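(* Assume conditions (A), (B), (C) and (D) below hold; in particular (C) holds with some $E\subset\mathbb{S}^{d-1}$ and $\kappa\ge 0$, and (D) holds with some bounded nonempty $T\subset(0,\infty)$. Then: (a) For every $t\in T$, $\theta\in E$ and $y\in\mathbb{R}^d$, the density $p_t$ of $P_t$ exists and $$\lim_{r\to\infty}\frac{p_t(r\theta-y)}{t\,\nu(r\theta)}=\begin{cases}1 & \text{if } \kappa=0,\\ e^{-t\widetilde\psi(\kappa\theta)+\kappa(\theta\cdot y)} & \text{if }\kappa>0.\end{cases}$$ (b) If for every compact set $D\subset\mathbb{R}^d$ the convergence $\lim_{r\to\infty}\nu(r\theta-y)/\nu(r\theta)=e^{\kappa(\theta\cdot y)}$ in (C) is uniform in $(\theta,y)\in E\times D$, then the convergence in (a) is uniform in $(t,\theta,y)$ on each set $T\times E\times B(0,\varrho)$, $\varrho>0$.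
   Context: Let $d\ge1$, $b\in\mathbb{R}^d$, $A$ a symmetric nonnegative definite $d\times d$ matrix and $\nu$ a Lévy measure on $\mathbb{R}^d\setminus\{0\}$ (i.e. $\int(1\wedge|y|^2)\nu(dy)<\infty$). Let $\psi(\xi)=-i\,\xi\cdot b+\xi\cdot A\xi+\int\big(1-e^{i\xi\cdot y}+i\xi\cdot y\,\mathbf 1_{B(0,1)}(y)\big)\nu(dy)$, and let $\{P_t\}_{t\ge0}$ be the convolution semigroup of probability measures on $\mathbb{R}^d$ with $\int e^{i\xi\cdot y}P_t(dy)=e^{-t\psi(\xi)}$; $p_t$ denotes the Lebesgue density of $P_t$. Let $\Phi(\xi)=\int\big(1-e^{i\xi\cdot y}+i\xi\cdot y\,\mathbf 1_{B(0,1)}(y)\big)\nu(dy)$, $\Psi(r)=\sup_{|\xi|\le r}\mathrm{Re}\,\Phi(\xi)$ for $r>0$, $\Psi(\infty)=\lim_{r\to\infty}\Psi(r)$, and $\Psi_-(s)=\sup\{r>0:\Psi(r)=s\}$ for $s\in(0,\Psi(\infty))$. $\mathbb{S}^{d-1}$ is the unit sphere, and for $E\subset\mathbb{S}^{d-1}$, $\Gamma_E=\{y\neq0: y/|y|\in E\}$. For $\xi$ with $\int_{|y|>1}e^{\xi\cdot y}\nu(dy)<\infty$ put $\widetilde\psi(\xi)=-\xi\cdot b-\xi\cdot A\xi+\int\big(1-e^{\xi\cdot y}+\xi\cdot y\,\mathbf 1_{B(0,1)}(y)\big)\nu(dy)$. Assumptions: (A) $A\equiv0$ or $\inf_{|\xi|=1}\xi\cdot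 A\xi>0$. (B) $\nu(dx)=\nu(x)dx$ and there are a nonincreasing $f:(0,\infty)\to(0,\infty)$ and $C_0>0$ with $\nu(x)\le C_0f(|x|)$ for $x\ne0$, $\liminf_{r\to0^+}\frac{\nu(\{|x|>r\})}{f(r)r^d}>0$, and $K(r):=\sup_{|x|>1}\frac{1}{f(|x|)}\int_{|x-y|>r,\,|y|>r}f(|x-y|)f(|y|)\,dy$ decreases to $0$ as $r\to\infty$. (C) $E\subset\mathbb{S}^{d-1}$ and $\kappa\ge0$ are such that $\lim_{r\to\infty}\nu(r\theta-y)/\nu(r\theta)=e^{\kappa(\theta\cdot y)}$ for all $y\in\mathbb{R}^d$, $\theta\in E$, and $C_1:=\inf_{x\in\Gamma_E}\nu(x)/f(|x|)>0$. (D) $T\subset(0,\infty)$ is nonempty and bounded and there is $C_2>0$ with $\int_{\mathbb{R}^d}e^{-t\,\mathrm{Re}\Phi(\xi)}|\xi|\,d\xi\le C_2\big(\Psi_-(1/t)\big)^{d+1}$ for $t\in T$. *)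

(* Defs.v *)
From mathcomp Require Import all_boot all_order all_algebra.
From mathcomp Require Import all_classical all_reals all_analysis.
Import Order.TTheory GRing.Theory Num.Theory.
Import numFieldNormedType.Exports.

Set Implicit Arguments.
Unset Strict Implicit.
Unset Printing Implicit Defensive.

Local Open Scope ring_scope.
Local Open Scope classical_set_scope.

(* Points of R^d are represented by d.-tuple R, which carries the library's
   product (= Borel) sigma-algebra. *)
Section Defs.
Context {R : realType} {d : nat}.
Local Notation V := (d.-tuple R).

Definition vzero : V := [tuple 0 | i < d].
Definition vadd (x y : V) : V := [tuple tnth x i + tnth y i | i < d].
Definition vsub (x y : V) : V := [tuple tnth x i - tnth y i | i < d].
Definition vscale (r : R) (x : V) : V := [tuple r * tnth x i | i < d].
Definition dotv (x y : V) : R := \sum_(i < d) tnth x i * tnth y i.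
Definition normv (x : V) : R := Num.sqrt (dotv x x).
Definition quadA (A : 'M[R]_d) (xi : V) : R :=
  \sum_(i < d) \sum_(j < d) tnth xi i * A i j * tnth xi j.

(* transfer to row vectors, which carry the library's (Euclidean-equivalent)
   topology; used for compactness and continuity *)
Definition rv_of (x : V) : 'rV[R]_d := \row_i tnth x i.
Definition tuple_of_rv (v : 'rV[R]_d) : V := [tuple v ord0 i | i < d].
Definition compactV (D : set V) : Prop := compact (rv_of @` D).
Definition continuousV (g : V -> R) : Prop :=
  continuous (fun v : 'rV[R]_d => g (tuple_of_rv v)).

(* leb is d-dimensional Lebesgue measure on the Borel sets of R^d: it gives
   every box its volume (this determines the measure uniquely). *)
Definition is_lebesgue (leb : {measure set V -> \bar R}) : Prop :=
  forall a b : V, (forall i, tnth a i <= tnth b i) ->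
    leb [set x | forall i, tnth a i < tnth x i <= tnth b i] =
      (\prod_(i < d) (tnth b i - tnth a i))%:E.

Definition levy_density (leb : {measure set V -> \bar R}) (nu : V -> R) : Prop :=
  [/\ measurable_fun setT nu, (forall x, 0 <= nu x) &
      (\int[leb]_x ((Order.min 1 (normv x ^+ 2)) * nu x)%:E < +oo)%E].

Definition indB1 (y : V) : R := if normv y < 1 then 1 else 0.

Definition RePhi (leb : {measure set V -> \bar R}) (nu : V -> R) (xi : V) : R :=
  Rintegral leb setT (fun y => (1 - cos (dotv xi y)) * nu y).
Definition ImPhi (leb : {measure set V -> \bar R}) (nu : V -> R) (xi : V) : R :=
  Rintegral leb setT (fun y => (- sin (dotv xi y) + dotv xi y * indB1 y) * nu y).

Definition Repsi (leb : {measure set V -> \bar R}) (A : 'M[R]_d) nu xi : R := quadA A xi + RePhi leb nu xi.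
Definition Impsi (leb : {measure set V -> \bar R}) (b : V) nu xi : R := - dotv xi b + ImPhi leb nu xi.

(* int e^{i xi.y} mu(dy) = e^{-t psi(xi)}, split into real and imaginary parts *)
Definition has_charfun (mu : probability V R) (t : R) (leb : {measure set V -> \bar R}) (b : V) (A : 'M[R]_d) nu :
  Prop := forall xi : V,
    Rintegral mu setT (fun y => cos (dotv xi y)) =
      expR (- (t * Repsi leb A nu xi)) * cos (t * Impsi leb b nu xi) /\
    Rintegral mu setT (fun y => sin (dotv xi y)) =
      - (expR (- (t * Repsi leb A nu xi)) * sin (t * Impsi leb b nu xi)).

Definition Psi (leb : {measure set V -> \bar R}) nu (r : R) : R :=
  sup [set RePhi leb nu xi | xi in [set xi | normv xi <= r]].
Definition Psi_inf (leb : {measure set V -> \bar R}) nu : \bar R :=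
  ereal_sup [set (Psi leb nu r)%:E | r in [set r : R | 0 < r]].
Definition Psi_minus (leb : {measure set V -> \bar R}) nu (s : R) : R :=
  sup [set r : R | 0 < r /\ Psi leb nu r = s].

Definition Kfun (leb : {measure set V -> \bar R}) (f : R -> R) (r : R) : \bar R :=
  ereal_sup [set (((f (normv x))^-1)%:E *
     \int[leb]_(y in [set y | (r < normv (vsub x y))%R /\ (r < normv y)%R])
        (f (normv (vsub x y)) * f (normv y))%:E)%E
   | x in [set x | 1 < normv x]].

Definition psitilde (leb : {measure set V -> \bar R}) (b : V) (A : 'M[R]_d) nu (xi : V) : R :=
  - dotv xi b - quadA A xi +
  Rintegral leb setT (fun y => (1 - expR (dotv xi y) + dotv xi y * indB1 y) * nu y).

Definition cont_density (leb : {measure set V -> \bar R}) (mu : probability V R) (p : V -> R) : Prop :=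
  [/\ measurable_fun setT p, (forall x, 0 <= p x),
      (forall B, measurable B -> (mu B = \int[leb]_(x in B) (p x)%:E)%E) &
      continuousV p].

Definition limit_val (leb : {measure set V -> \bar R}) (b : V) (A : 'M[R]_d) nu (kappa t : R) (theta y : V) : R :=
  if kappa == 0 then 1
  else expR (- (t * psitilde leb b A nu (vscale kappa theta)) + kappa * dotv theta y).

End Defs.

(* Main.v *)
(** The density is the Fourier integral of [exp (- t psi)].  Splitting the jumps
    at a size [h] leaves a part whose density has exponential moments, and the
    jumps larger than [h] enter through the exponential convolution series of
    their density.  With [h] of the order of [1 / Psi_- (1/t)], condition (D)
    gives [p_t <= t B f] far from the origin, and [t B exp (- l |x|)] with [l] as
    large as one likes for the density [q_t] of the part with jumps below a
    large cutoff [R].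

    Then [p_t = exp (- t |nu_R|) (q_t + q_t * (t nu_R) + ...)], [nu_R] being the
    restriction of [nu] to [|y| > R].  After division by [t nu (r theta)] the
    terms with two or more large jumps are controlled by [K], which is small for
    large [R], and only the term with one large jump survives.  Its limit is an
    exponential moment of [q_t] at [kappa theta], which produces
    [exp (- t psi~ (kappa theta) + kappa theta . y)]. *)
Require Import Defs.
From HB Require Import structures.
From mathcomp Require Import all_boot all_order all_algebra.
From mathcomp Require Import all_classical all_reals all_analysis.
From mathcomp Require Import measurable_realfun.
From mathcomp Require Import ring lra.
Import Order.TTheory GRing.Theory Num.Theory.
Import numFieldNormedType.Exports.
Set Implicit Arguments.
Unset Strict Implicit.
Unset Printing Implicit Defensive.
Local Open Scope ring_scope.
Local Open Scope classical_set_scope.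

(** The law with cut-off jumps is never built as a measure, so positivity of its Fourier integral
    and its exponential moments cannot be quoted. The predicate [good] carries them: it holds for
    the Gaussian weight and survives translation, compound Poisson jumps and limits. A
    characteristic function is kept as modulus [rho] and argument [th], and densities stay
    unnormalised: all have the same mass [Kd], which is (2 pi)^d and enters only through its
    positivity. Two obstacles shape the tail bounds. A jump that lands close to the origin may start
    just outside the controlled region, hence be short, and the jump density is singular at 0;
    letting the excluded radius grow by summable steps costs a power of n, which the factorials of
    the series absorb. And constants must not depend on t although the scale h does: exponential
    moments at rate l/h leave a spare factor exp(-1/h), which beats every power of 1/h, and h^2 <= C
    t then produces the factor t. Both conclusions come from one estimate over a set of triples (t,
    theta, y). *)

Notation RI mu u := (Rintegral mu setT u).
Notation Itg mu u := (integrable mu setT (EFin \o u)).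

(** * Real-valued integrals: linearity, domination, dominated convergence *)

Section real_integral.
Context d (T : measurableType d) (R : realType).
Variable mu : {measure set T -> \bar R}.
Implicit Types u v w : T -> R.

Lemma Itg_meas u : Itg mu u -> measurable_fun setT u.
Proof. by move=> /integrableP[/measurable_EFinP]. Qed.

Lemma Itg_dom u v : measurable_fun setT u -> (forall x, `|u x| <= v x) ->
  Itg mu v -> Itg mu u.
Proof.
move=> mu_ uv iv; apply: le_integrable iv => //; first exact/measurable_EFinP.
by move=> x _ /=; rewrite lee_fin (le_trans (uv x))// ler_norm.
Qed.

Lemma Itg0 : Itg mu (fun=> 0).
Proof. exact: integrable0. Qed.

Lemma ItgZ k u : Itg mu u -> Itg mu (fun x => k * u x).
Proof.
move=> iu; rewrite (_ : _ \o _ = (fun x => k%:E * (EFin \o u) x)%E).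
  exact: integrableZl.
by apply/funext => x /=; rewrite EFinM.
Qed.

Lemma ItgD u v : Itg mu u -> Itg mu v -> Itg mu (fun x => u x + v x).
Proof. by move=> iu iv; apply: eq_integrable (integrableD measurableT iu iv). Qed.

Lemma ItgN u : Itg mu u -> Itg mu (fun x => - u x).
Proof.
by move=> iu; apply: eq_integrable (ItgZ (-1) iu) => // x _ /=; rewrite mulN1r.
Qed.

Lemma ItgB u v : Itg mu u -> Itg mu v -> Itg mu (fun x => u x - v x).
Proof. by move=> iu iv; exact: ItgD iu (ItgN iv). Qed.

Lemma Itg_abs u : Itg mu u -> Itg mu (fun x => `|u x|).
Proof.
move=> iu; apply: eq_integrable (integrable_abse iu) => //.
Qed.

Lemma RID u v : Itg mu u -> Itg mu v ->
  RI mu (fun x => u x + v x) = RI mu u + RI mu v.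
Proof. by move=> iu iv; rewrite RintegralD. Qed.

Lemma RIB u v : Itg mu u -> Itg mu v ->
  RI mu (fun x => u x - v x) = RI mu u - RI mu v.
Proof. by move=> iu iv; rewrite RintegralB. Qed.

Lemma RIZ k u : Itg mu u -> RI mu (fun x => k * u x) = k * RI mu u.
Proof. by move=> iu; rewrite RintegralZl. Qed.

Lemma RI_ext u v : u =1 v -> RI mu u = RI mu v.
Proof. by move=> uv; congr (Rintegral _ _ _); exact/funext. Qed.

Lemma Itg_ext u v : u =1 v -> Itg mu u -> Itg mu v.
Proof. by move=> /funext ->. Qed.

Lemma RI0 : RI mu (fun=> 0) = 0.
Proof. by rewrite /Rintegral integral0. Qed.

Lemma RI_ge0 u : (forall x, 0 <= u x) -> 0 <= RI mu u.
Proof. by move=> u0; apply: Rintegral_ge0. Qed.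

Lemma RI_le u v : Itg mu u -> Itg mu v -> (forall x, u x <= v x) ->
  RI mu u <= RI mu v.
Proof. by move=> iu iv uv; apply: le_Rintegral. Qed.

Lemma RI_abs_le u v : measurable_fun setT u -> (forall x, `|u x| <= v x) ->
  Itg mu v -> `|RI mu u| <= RI mu v.
Proof.
move=> mu_ uv iv; have iu := Itg_dom mu_ uv iv.
apply: (le_trans (le_normr_Rintegral measurableT iu)).
by apply: RI_le => //; exact: Itg_abs.
Qed.

Lemma RI_E u : Itg mu u -> (\int[mu]_x (u x)%:E = (RI mu u)%:E)%E.
Proof. by move=> iu; rewrite fineK//; exact: integrable_fin_num. Qed.

Lemma Itg_of_E u : measurable_fun setT u -> (forall x, 0 <= u x) ->
  (\int[mu]_x (u x)%:E < +oo)%E -> Itg mu u.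
Proof.
move=> mu_ u0 uoo; apply/integrableP; split; first exact/measurable_EFinP.
by under eq_integral => x _ do rewrite gee0_abs ?lee_fin ?u0//.
Qed.

Lemma RI_le_of_E u (c : R) : measurable_fun setT u -> (forall x, 0 <= u x) ->
  (\int[mu]_x (u x)%:E <= c%:E)%E -> Itg mu u /\ RI mu u <= c.
Proof.
move=> mu_ u0 uc; have iu : Itg mu u.
  by apply: Itg_of_E => //; rewrite (le_lt_trans uc)// ltry.
by split => //; move: uc; rewrite RI_E// lee_fin.
Qed.

Lemma RI_dct (u_ : nat -> T -> R) u v :
  (forall n, measurable_fun setT (u_ n)) ->
  (forall n x, `|u_ n x| <= v x) -> Itg mu v ->
  (forall x, u_ n x @[n --> \oo] --> u x) ->
  Itg mu u /\ RI mu (u_ n) @[n --> \oo] --> RI mu u.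
Proof.
move=> mu_ uv iv cu.
have mu0 : measurable_fun setT u.
  by apply: (@measurable_fun_cvg _ _ _ setT u_) => // x _; exact: cu.
have := @dominated_convergence _ _ _ mu setT measurableT
  (fun n x => (u_ n x)%:E) (EFin \o u) (EFin \o v).
case => //.
- by move=> n; exact/measurable_EFinP.
- exact/measurable_EFinP.
- by apply: aeW => x _; apply/cvg_EFin; [exact: nearW|exact: cu].
- by apply: aeW => x n _ /=; rewrite lee_fin.
move=> iu _ cvg; split => //.
rewrite RI_E// in cvg; move/fine_cvg : cvg; exact.
Qed.

End real_integral.

(** * Fubini and Tonelli for real-valued integrands *)

Section fubini_real.
Context d1 d2 (T1 : measurableType d1) (T2 : measurableType d2) (R : realType).

(** Holds even where a slice diverges, because the integral is [fine] of a difference of two Tonelli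
    integrals, each measurable in x. *)
Lemma measurable_RI (m2 : {sigma_finite_measure set T2 -> \bar R})
  (F : T1 * T2 -> R) : measurable_fun setT F ->
  measurable_fun setT (fun x => RI m2 (fun y => F (x, y))).
Proof.
move=> mF; apply: measurableT_comp => //.
rewrite [X in measurable_fun _ X](_ : _ = (fun x =>
  \int[m2]_y ((EFin \o F)^\+ (x, y)) - \int[m2]_y ((EFin \o F)^\- (x, y)))%E).
  apply: emeasurable_funB.
  - apply: (@measurable_fun_fubini_tonelli_F _ _ _ _ _ m2 (EFin \o F)^\+)%E => //.
    by apply: measurable_funepos; exact/measurable_EFinP.
  - apply: (@measurable_fun_fubini_tonelli_F _ _ _ _ _ m2 (EFin \o F)^\-)%E => //.
    by apply: measurable_funeneg; exact/measurable_EFinP.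
apply/funext => x; rewrite [LHS]integralE.
by congr (_ - _)%E; apply: eq_integral => y _; rewrite ?funeposE ?funenegE.
Qed.


Variable m1 : {sigma_finite_measure set T1 -> \bar R}.
Variable m2 : {sigma_finite_measure set T2 -> \bar R}.

Lemma tonelli_real (F : T1 * T2 -> R) : measurable_fun setT F ->
  (forall z, 0 <= F z) ->
  (forall x, Itg m2 (fun y => F (x, y))) ->
  (forall y, Itg m1 (fun x => F (x, y))) ->
  Itg m2 (fun y => RI m1 (fun x => F (x, y))) ->
  Itg m1 (fun x => RI m2 (fun y => F (x, y))) /\
  RI m1 (fun x => RI m2 (fun y => F (x, y))) =
  RI m2 (fun y => RI m1 (fun x => F (x, y))).
Proof.
move=> mF F0 i2 i1 i21.
have E0 := @fubini_tonelli _ _ _ _ _ m1 m2 (EFin \o F).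
have E : (\int[m1]_x (RI m2 (fun y => F (x, y)))%:E =
   \int[m2]_y (RI m1 (fun x => F (x, y)))%:E)%E.
  under eq_integral => x _ do rewrite -RI_E//.
  under [RHS]eq_integral => x _ do rewrite -RI_E//.
  by apply: E0; [exact/measurable_EFinP|move=> z; rewrite lee_fin].
have h : Itg m1 (fun x => RI m2 (fun y => F (x, y))).
  apply: Itg_of_E; [exact: measurable_RI|by move=> x; exact: RI_ge0|].
  by rewrite E RI_E// ltry.
by split => //; move: E; rewrite !RI_E// => -[].
Qed.

Lemma fubini_real (F G : T1 * T2 -> R) : measurable_fun setT F ->
  measurable_fun setT G ->
  (forall z, `|F z| <= G z) ->
  (forall x, Itg m2 (fun y => G (x, y))) ->
  (forall y, Itg m1 (fun x => G (x, y))) ->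
  Itg m2 (fun y => RI m1 (fun x => G (x, y))) ->
  RI m1 (fun x => RI m2 (fun y => F (x, y))) =
  RI m2 (fun y => RI m1 (fun x => F (x, y))).
Proof.
move=> mF mG FG i2 i1 i21.
have G0 z : 0 <= G z by exact: le_trans (FG z).
have [j1 _] := tonelli_real mG G0 i2 i1 i21.
have iF2 x : Itg m2 (fun y => F (x, y)).
  by apply: Itg_dom (i2 x) => //; exact: measurableT_comp.
have iF1 y : Itg m1 (fun x => F (x, y)).
  by apply: Itg_dom (i1 y) => //; exact: measurableT_comp.
have prodI : (m1 \x m2)%E.-integrable setT (EFin \o F).
  apply/integrable12ltyP; first exact/measurable_EFinP.
  apply: (@le_lt_trans _ _ (\int[m1]_x (RI m2 (fun y => G (x, y)))%:E)%E).
    apply: ge0_le_integral => //.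
    - by move=> x _; exact: integral_ge0.
    - apply: (measurable_fun_fubini_tonelli_F (abse \o (EFin \o F))) => //.
        by apply: measurableT_comp => //; exact/measurable_EFinP.
      by move=> z; exact: abse_ge0.
    - by apply/measurable_EFinP; exact: measurable_RI.
    - move=> x _; rewrite -RI_E//; apply: ge0_le_integral => //.
      + by apply: measurableT_comp => //; apply/measurable_EFinP; exact: Itg_meas (iF2 x).
      + by apply/measurable_EFinP; exact: Itg_meas (i2 x).
      + by move=> y _ /=; rewrite lee_fin.
  by rewrite RI_E// ltry.
have /= E := Fubini prodI.
have {}E : (\int[m1]_x (RI m2 (fun y => F (x, y)))%:E =
   \int[m2]_y (RI m1 (fun x => F (x, y)))%:E)%E.
  under eq_integral => x _ do rewrite -RI_E//.
  by under [RHS]eq_integral => x _ do rewrite -RI_E//.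
by rewrite /Rintegral; congr fine; exact: E.
Qed.

(** A product majorant settles all integrability conditions at once; oscillating kernels such as
    m(y) rho(xi) cos((x - y).xi) have one. *)
Lemma fubini_prod_dom (F : T1 * T2 -> R) (a : T1 -> R) (b : T2 -> R) :
  measurable_fun setT F -> Itg m1 a -> Itg m2 b ->
  (forall x, 0 <= a x) ->
  (forall x y, `|F (x, y)| <= a x * b y) ->
  RI m1 (fun x => RI m2 (fun y => F (x, y))) =
  RI m2 (fun y => RI m1 (fun x => F (x, y))).
Proof.
move=> mF ia ib a0 Fab.
apply: (@fubini_real F (fun z => a z.1 * b z.2)) => //.
- apply: measurable_funM.
    exact: (measurableT_comp (Itg_meas ia) measurable_fst).
  exact: (measurableT_comp (Itg_meas ib) measurable_snd).
- by move=> [x y]; exact: Fab.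
- by move=> x /=; exact: ItgZ.
- move=> y; apply: (@Itg_ext _ _ _ _ (fun x => b y * a x)); last exact: ItgZ.
  by move=> x /=; rewrite mulrC.
- apply: (@Itg_ext _ _ _ _ (fun y => RI m1 a * b y)); last exact: ItgZ.
  by move=> y /=; rewrite mulrC -RIZ//; apply: RI_ext => x; rewrite mulrC.
Qed.

End fubini_real.

(** * Measurability of expressions in vectors, and a tactic for it *)

Section measurability.
Context d0 (T : measurableType d0) (R : realType) (d : nat).
Local Notation V := (d.-tuple R).
Implicit Types f g : T -> R.
Implicit Types F G : T -> V.

Lemma mf_cst (c : R) : measurable_fun setT (fun _ : T => c).
Proof. exact: measurable_cst. Qed.
Lemma mf_add f g : measurable_fun setT f -> measurable_fun setT g ->
  measurable_fun setT (fun x => f x + g x).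
Proof. exact: measurable_funD. Qed.
Lemma mf_opp f : measurable_fun setT f -> measurable_fun setT (fun x => - f x).
Proof. exact: measurable_funN. Qed.
Lemma mf_mul f g : measurable_fun setT f -> measurable_fun setT g ->
  measurable_fun setT (fun x => f x * g x).
Proof. exact: measurable_funM. Qed.
Lemma mf_pow f n : measurable_fun setT f ->
  measurable_fun setT (fun x => f x ^+ n).
Proof. exact: measurable_funX. Qed.
Lemma mf_abs f : measurable_fun setT f -> measurable_fun setT (fun x => `|f x|).
Proof. exact: measurableT_comp. Qed.
Lemma mf_exp f : measurable_fun setT f -> measurable_fun setT (fun x => expR (f x)).
Proof. by apply: measurableT_comp; exact: measurable_expR. Qed.
Lemma mf_cos f : measurable_fun setT f -> measurable_fun setT (fun x => cos (f x)).
Proof.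
apply: measurableT_comp; apply: continuous_measurable_fun; exact: continuous_cos.
Qed.
Lemma mf_sin f : measurable_fun setT f -> measurable_fun setT (fun x => sin (f x)).
Proof.
apply: measurableT_comp; apply: continuous_measurable_fun; exact: continuous_sin.
Qed.
Lemma mf_sqrt f : measurable_fun setT f ->
  measurable_fun setT (fun x => Num.sqrt (f x)).
Proof.
apply: measurableT_comp; apply: continuous_measurable_fun; exact: sqrt_continuous.
Qed.
Lemma mf_min f g : measurable_fun setT f -> measurable_fun setT g ->
  measurable_fun setT (fun x => Order.min (f x) (g x)).
Proof. exact: measurable_minr. Qed.
Lemma mf_sum (I : Type) (r : seq I) (f_ : I -> T -> R) :
  (forall i, measurable_fun setT (f_ i)) ->
  measurable_fun setT (fun x => \sum_(i <- r) f_ i x).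
Proof. by move=> mf; exact: measurable_sum. Qed.
Lemma mf_lt f g : measurable_fun setT f -> measurable_fun setT g ->
  measurable_fun setT (fun x => f x < g x).
Proof. exact: measurable_fun_ltr. Qed.
Lemma mf_le f g : measurable_fun setT f -> measurable_fun setT g ->
  measurable_fun setT (fun x => f x <= g x).
Proof. exact: measurable_fun_ler. Qed.
Lemma mf_and (p q : T -> bool) : measurable_fun setT p -> measurable_fun setT q ->
  measurable_fun setT (fun x => p x && q x).
Proof. exact: measurable_and. Qed.
Lemma mf_neg (p : T -> bool) : measurable_fun setT p ->
  measurable_fun setT (fun x => ~~ p x).
Proof. exact: measurable_neg. Qed.
Lemma mf_if (p : T -> bool) f g : measurable_fun setT p ->
  measurable_fun setT f -> measurable_fun setT g ->
  measurable_fun setT (fun x => if p x then f x else g x).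
Proof. exact: measurable_fun_ifT. Qed.
Lemma mf_ind (p : T -> bool) : measurable_fun setT p ->
  measurable_fun setT (fun x => (p x)%:R : R).
Proof.
move=> mp; rewrite (_ : (fun _ => _) = (fun x => if p x then 1 else 0 : R)).
  exact: mf_if.
by apply/funext => x; case: (p x).
Qed.
Lemma mf_tnth F i : measurable_fun setT F -> measurable_fun setT (fun x => tnth (F x) i).
Proof. by apply: (measurableT_comp (measurable_tnth _)). Qed.
Lemma mf_tuple (f_ : 'I_d -> T -> R) : (forall i, measurable_fun setT (f_ i)) ->
  measurable_fun setT (fun x => [tuple f_ i x | i < d] : V).
Proof.
move=> mf; apply/measurable_fun_tnthP => i.
rewrite (_ : _ \o _ = f_ i)//.
by apply/funext => x /=; rewrite tnth_mktuple.
Qed.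
Lemma mf_vadd F G : measurable_fun setT F -> measurable_fun setT G ->
  measurable_fun setT (fun x => vadd (F x) (G x)).
Proof. by move=> mF mG; apply: mf_tuple => i; apply: mf_add; exact: mf_tnth. Qed.
Lemma mf_vsub F G : measurable_fun setT F -> measurable_fun setT G ->
  measurable_fun setT (fun x => vsub (F x) (G x)).
Proof.
move=> mF mG; apply: mf_tuple => i; apply: mf_add; first exact: mf_tnth.
by apply: mf_opp; exact: mf_tnth.
Qed.
Lemma mf_vscale f F : measurable_fun setT f -> measurable_fun setT F ->
  measurable_fun setT (fun x => vscale (f x) (F x)).
Proof. by move=> mF mG; apply: mf_tuple => i; apply: mf_mul => //; exact: mf_tnth. Qed.
Lemma mf_dotv F G : measurable_fun setT F -> measurable_fun setT G ->
  measurable_fun setT (fun x => dotv (F x) (G x)).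
Proof. by move=> mF mG; apply: mf_sum => i; apply: mf_mul; exact: mf_tnth. Qed.
Lemma mf_normv F : measurable_fun setT F -> measurable_fun setT (fun x => normv (F x)).
Proof. by move=> mF; apply: mf_sqrt; exact: mf_dotv. Qed.
Lemma mf_quadA A F : measurable_fun setT F -> measurable_fun setT (fun x => quadA A (F x)).
Proof.
move=> mF; apply: mf_sum => i; apply: mf_sum => j.
apply: mf_mul; last exact: mf_tnth.
by apply: mf_mul; [exact: mf_tnth|exact: mf_cst].
Qed.
Lemma mf_vcst (c : V) : measurable_fun setT (fun _ : T => c).
Proof. exact: measurable_cst. Qed.
End measurability.

Lemma mf_indB1 d0 (T : measurableType d0) (R : realType) d (F : T -> d.-tuple R) :
  measurable_fun setT F -> measurable_fun setT (fun x => indB1 (F x)).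
Proof.
move=> mF; apply: mf_if; try exact: mf_cst.
by apply: mf_lt; [exact: mf_normv|exact: mf_cst].
Qed.

Lemma mf_comp2 d1 d2 d3 (T1 : measurableType d1) (T2 : measurableType d2)
  (T3 : measurableType d3) (g : T2 -> T3) (f : T1 -> T2) :
  measurable_fun setT g -> measurable_fun setT f ->
  measurable_fun setT (fun x => g (f x)).
Proof. exact: measurableT_comp. Qed.

(** The match in [mfun] is syntactic and only sees functions written as abstractions. *)
Ltac mfun_eta :=
  lazymatch goal with
  | |- measurable_fun _ (fun x => _) => idtac
  | |- measurable_fun ?D ?f => change (measurable_fun D (fun x => f x))
  | |- _ => idtac
  end.

Ltac mfun := mfun_eta; first
  [ assumption | exact: measurable_id | exact: measurable_fst
  | exact: measurable_snd | exact: measurable_cst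
  | lazymatch goal with
    | |- measurable_fun _ (fun x => _ + _) => apply: mf_add; mfun
    | |- measurable_fun _ (fun x => - _) => apply: mf_opp; mfun
    | |- measurable_fun _ (fun x => _ * _) => apply: mf_mul; mfun
    | |- measurable_fun _ (fun x => _ ^+ _) => apply: mf_pow; mfun
    | |- measurable_fun _ (fun x => `|_|) => apply: mf_abs; mfun
    | |- measurable_fun _ (fun x => expR _) => apply: mf_exp; mfun
    | |- measurable_fun _ (fun x => cos _) => apply: mf_cos; mfun
    | |- measurable_fun _ (fun x => sin _) => apply: mf_sin; mfun
    | |- measurable_fun _ (fun x => Order.min _ _) => apply: mf_min; mfun
    | |- measurable_fun _ (fun x => dotv _ _) => apply: mf_dotv; mfun
    | |- measurable_fun _ (fun x => normv _) => apply: mf_normv; mfun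
    | |- measurable_fun _ (fun x => quadA _ _) => apply: mf_quadA; mfun
    | |- measurable_fun _ (fun x => vadd _ _) => apply: mf_vadd; mfun
    | |- measurable_fun _ (fun x => vsub _ _) => apply: mf_vsub; mfun
    | |- measurable_fun _ (fun x => vscale _ _) => apply: mf_vscale; mfun
    | |- measurable_fun _ (fun x => indB1 _) => apply: mf_indB1; mfun
    | |- measurable_fun _ (fun x => tnth _ _) => apply: mf_tnth; mfun
    | |- measurable_fun _ (fun x => (nat_of_bool _)%:R) => apply: mf_ind; mfun
    | |- measurable_fun _ (fun x => _ < _) => apply: mf_lt; mfun
    | |- measurable_fun _ (fun x => _ <= _) => apply: mf_le; mfun
    | |- measurable_fun _ (fun x => _ && _) => apply: mf_and; mfun
    | |- measurable_fun _ (fun x => ~~ _) => apply: mf_neg; mfun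
    | |- measurable_fun _ (fun x => if _ then _ else _) => apply: mf_if; mfun
    | |- measurable_fun _ (fun x => \sum_(i <- _) _) => apply: mf_sum => ?; mfun
    | |- measurable_fun _ (fun x => fst _) => apply: (mf_comp2 measurable_fst); mfun
    | |- measurable_fun _ (fun x => snd _) => apply: (mf_comp2 measurable_snd); mfun
    | H : measurable_fun setT ?u |- measurable_fun _ (fun x => ?u _) =>
        apply: (mf_comp2 H); mfun
    end
  | idtac ].

(** * Euclidean geometry of tuples *)

Section vectors.
Context (R : realType) (d : nat).
Local Notation V := (d.-tuple R).
Implicit Types x y z : V.

Lemma tnth_vadd x y i : tnth (vadd x y) i = tnth x i + tnth y i.
Proof. by rewrite tnth_mktuple. Qed.
Lemma tnth_vsub x y i : tnth (vsub x y) i = tnth x i - tnth y i.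
Proof. by rewrite tnth_mktuple. Qed.
Lemma tnth_vscale k x i : tnth (vscale k x) i = k * tnth x i.
Proof. by rewrite tnth_mktuple. Qed.
Lemma tnth_vzero i : tnth (vzero : V) i = 0.
Proof. by rewrite tnth_mktuple. Qed.
Definition tnthE := (tnth_vadd, tnth_vsub, tnth_vscale, tnth_vzero).

Lemma dotvC x y : dotv x y = dotv y x.
Proof. by apply: eq_bigr => i _; rewrite mulrC. Qed.
Lemma dotvDr x y z : dotv x (vadd y z) = dotv x y + dotv x z.
Proof. by rewrite -big_split; apply: eq_bigr => i _; rewrite tnthE mulrDr. Qed.
Lemma dotvBr x y z : dotv x (vsub y z) = dotv x y - dotv x z.
Proof.
rewrite /dotv -sumrN -big_split; apply: eq_bigr => i _; by rewrite tnthE /= mulrBr.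
Qed.
Lemma dotvZr k x y : dotv x (vscale k y) = k * dotv x y.
Proof. by rewrite mulr_sumr; apply: eq_bigr => i _; rewrite tnthE mulrCA. Qed.
Lemma dotvDl x y z : dotv (vadd y z) x = dotv y x + dotv z x.
Proof. by rewrite dotvC dotvDr ![dotv x _]dotvC. Qed.
Lemma dotvBl x y z : dotv (vsub y z) x = dotv y x - dotv z x.
Proof. by rewrite dotvC dotvBr ![dotv x _]dotvC. Qed.
Lemma dotvZl k x y : dotv (vscale k y) x = k * dotv y x.
Proof. by rewrite dotvC dotvZr dotvC. Qed.
Lemma dotv0r x : dotv x vzero = 0.
Proof. by rewrite /dotv big1// => i _; rewrite tnthE mulr0. Qed.
Lemma dotv0l x : dotv vzero x = 0.
Proof. by rewrite dotvC dotv0r. Qed.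
Lemma dotv_ge0 x : 0 <= dotv x x.
Proof. by apply: sumr_ge0 => i _; rewrite -expr2 sqr_ge0. Qed.

Lemma normv_ge0 x : 0 <= normv x.
Proof. exact: sqrtr_ge0. Qed.
Lemma normv2 x : normv x ^+ 2 = dotv x x.
Proof. by rewrite sqr_sqrtr// dotv_ge0. Qed.
Lemma normvZ k x : normv (vscale k x) = `|k| * normv x.
Proof.
by rewrite /normv dotvZl dotvZr mulrA -expr2 sqrtrM ?sqr_ge0// sqrtr_sqr.
Qed.
Lemma normv0 : normv (vzero : V) = 0.
Proof. by rewrite /normv dotv0r sqrtr0. Qed.

Lemma cauchy_schwarz x y : `|dotv x y| <= normv x * normv y.
Proof.
rewrite -(@ler_pXn2r _ 2)// ?nnegrE ?mulr_ge0 ?normv_ge0//.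
rewrite exprMn !normv2 real_normK ?num_real//.
have [y0|y0] := eqVneq (dotv y y) 0.
  have yi i : tnth y i = 0.
    move/eqP: y0; rewrite psumr_eq0 => [/allP/(_ i)|j _].
      by rewrite mem_index_enum => /(_ isT)/eqP/eqP; rewrite mulf_eq0 orbb => /eqP.
    by rewrite -expr2 sqr_ge0.
  rewrite (_ : dotv x y = 0) ?expr0n ?y0 ?mulr0//.
  by rewrite /dotv big1// => i _; rewrite yi mulr0.
have yp : 0 < dotv y y by rewrite lt_neqAle eq_sym y0 dotv_ge0.
(* The square of the vector (y.y) x - (x.y) y equals y.y times the Cauchy-Schwarz defect. *)
have := dotv_ge0 (vsub (vscale (dotv y y) x) (vscale (dotv x y) y)).
rewrite !(dotvBl, dotvBr, dotvZl, dotvZr) (dotvC y x).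
set a := dotv x x; set b := dotv y y; set c := dotv x y => h.
have : 0 <= b * (a * b - c ^+ 2) by rewrite expr2; move: h; congr (_ <= _); ring.
by rewrite pmulr_rge0// subr_ge0.
Qed.

Lemma dotv_le x y : dotv x y <= normv x * normv y.
Proof. exact: le_trans (ler_norm _) (cauchy_schwarz _ _). Qed.

Lemma normvD x y : normv (vadd x y) <= normv x + normv y.
Proof.
rewrite -(@ler_pXn2r _ 2)// ?nnegrE ?addr_ge0 ?normv_ge0//.
rewrite sqrrD !normv2 !(dotvDl, dotvDr) (dotvC y x).
have := dotv_le x y; lra.
Qed.

Lemma vsubE x y : vsub x y = vadd x (vscale (-1) y).
Proof. by apply: eq_from_tnth => i; rewrite !tnthE mulN1r. Qed.
Lemma normvB x y : normv (vsub x y) <= normv x + normv y.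
Proof. by rewrite vsubE (le_trans (normvD _ _))// normvZ normrN1 mul1r. Qed.
Lemma normv_vsubC x y : normv (vsub x y) = normv (vsub y x).
Proof.
rewrite (_ : vsub x y = vscale (-1) (vsub y x)) ?normvZ ?normrN1 ?mul1r//.
by apply: eq_from_tnth => i; rewrite !tnthE; ring.
Qed.
Lemma normvB_ge x y : normv x - normv y <= normv (vsub x y).
Proof.
rewrite lerBlDr {1}(_ : x = vadd (vsub x y) y); first exact: normvD.
by apply: eq_from_tnth => i; rewrite !tnthE; ring.
Qed.
Lemma vsub_vsub x y : vsub x (vsub x y) = y.
Proof. by apply: eq_from_tnth => i; rewrite !tnthE; ring. Qed.
Lemma vsubA x y z : vsub (vsub x y) z = vsub x (vadd y z).
Proof. by apply: eq_from_tnth => i; rewrite !tnthE; ring. Qed.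

Lemma coord_le_normv x i : `|tnth x i| <= normv x.
Proof.
rewrite -(@ler_pXn2r _ 2)// ?nnegrE ?normv_ge0// normv2 real_normK ?num_real//.
rewrite /dotv (bigD1 i)//= -expr2 lerDl sumr_ge0// => j _.
by rewrite -expr2 sqr_ge0.
Qed.

Lemma normv_le_sum x : normv x <= \sum_(i < d) `|tnth x i|.
Proof.
have s0 : 0 <= \sum_(i < d) `|tnth x i| by apply: sumr_ge0.
rewrite -(@ler_pXn2r _ 2)// ?nnegrE ?normv_ge0// normv2 expr2 mulr_suml.
apply: ler_sum => i _; rewrite (le_trans (ler_norm _))// normrM.
by rewrite ler_wpM2l// (bigD1 i)//= lerDl sumr_ge0.
Qed.

Lemma normv_le_coord x (a : R) : (forall i, `|tnth x i| <= a) -> normv x <= d%:R * a.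
Proof.
move=> h; apply: (le_trans (normv_le_sum x)).
apply: (le_trans (ler_sum _ (fun i _ => h i))).
by rewrite sumr_const card_ord mulr_natl.
Qed.

Lemma exists_big_coord x : (0 < d)%N -> exists i, normv x <= d%:R * `|tnth x i|.
Proof.
move=> d0; have [i _ h] := @arg_maxP _ _ _ (Ordinal d0) xpredT (fun i => `|tnth x i|) isT.
by exists i; apply: normv_le_coord => j; exact: h.
Qed.

Lemma normv_eq0 x : normv x = 0 -> x = vzero.
Proof.
move=> h; apply: eq_from_tnth => i; rewrite tnthE; apply/eqP.
by rewrite -normr_le0 -h coord_le_normv.
Qed.

Lemma normv_gt0 x : x <> vzero -> 0 < normv x.
Proof. by move=> /eqP x0; rewrite lt_neqAle normv_ge0 andbT eq_sym; apply: contra x0 => /eqP/normv_eq0 ->. Qed.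

End vectors.

Section limits.
Context (R : realType).
Implicit Types (u v : nat -> R).

Lemma cvg_le u l c : u n @[n --> \oo] --> l -> (forall n, u n <= c) -> l <= c.
Proof.
move=> h uc; rewrite -(cvg_lim _ h)//; apply: limr_le; last exact: nearW.
by apply/cvg_ex; exists l.
Qed.

Lemma cvg_ge u l c : u n @[n --> \oo] --> l -> (forall n, c <= u n) -> c <= l.
Proof.
move=> h uc; rewrite -(cvg_lim _ h)//; apply: limr_ge; last exact: nearW.
by apply/cvg_ex; exists l.
Qed.

Lemma cvg_le2 u v l m : u n @[n --> \oo] --> l -> v n @[n --> \oo] --> m ->
  (forall n, u n <= v n) -> l <= m.
Proof.
move=> h k uv; rewrite -subr_ge0; apply: (@cvg_ge (fun n => v n - u n)).
  exact: cvgB.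
by move=> n; rewrite subr_ge0.
Qed.

Lemma cvg_uniq u (l m : R) : u n @[n --> \oo] --> l -> u n @[n --> \oo] --> m -> l = m.
Proof. by move=> h k; apply/eqP; rewrite eq_le (cvg_le2 h k)// (cvg_le2 k h). Qed.

End limits.

(** * Half-open boxes determine a measure *)

Section lebesgue_uniqueness.
Context (R : realType) (d : nat).
Local Notation V := (d.-tuple R).

Definition box (a b : V) : set V := [set x | forall i, tnth a i < tnth x i <= tnth b i].

Definition boxes : set (set V) := [set B | exists a b, B = box a b].

Lemma box_meas (a b : V) : measurable (box a b).
Proof.
rewrite (_ : box a b = \big[setI/setT]_(i < d) ((fun x : V => tnth x i) @^-1` `]tnth a i, tnth b i])).
  apply: bigsetI_measurable => i _; rewrite -[X in measurable X]setTI.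
  by apply: measurable_tnth => //; exact: measurable_itv.
apply/seteqP; split => x.
- move=> h; rewrite -bigcap_seq => i _ /=; rewrite in_itv /=; exact: h.
- rewrite -bigcap_seq => h i; have := h i; rewrite /= in_itv /=; apply.
  by rewrite mem_index_enum.
Qed.

Lemma setI_closed_boxes : setI_closed boxes.
Proof.
move=> _ _ [a [b ->]] [a' [b' ->]].
exists [tuple Num.max (tnth a i) (tnth a' i) | i < d],
       [tuple Num.min (tnth b i) (tnth b' i) | i < d].
apply/seteqP; split => x /=.
- by move=> [h h'] i; rewrite !tnth_mktuple gt_max le_min !andbA; move: (h i) (h' i) => /andP[-> ->] /andP[-> ->].
- by move=> h; split => i; have := h i; rewrite !tnth_mktuple gt_max le_min => /andP[/andP[h1 h2] /andP[h3 h4]]; apply/andP.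
Qed.

Definition cube (n : nat) : set V := box [tuple - n%:R | i < d] [tuple n%:R | i < d].

Lemma cube_cover : \bigcup_n cube n = setT.
Proof.
rewrite -subTset => x _.
have [n hn] : exists n : nat, normv x < n%:R.
  by exists (Num.bound (normv x)); rewrite archi_boundP// normv_ge0.
exists n => // i; rewrite !tnth_mktuple.
have := le_lt_trans (coord_le_normv x i) hn.
by rewrite ltr_norml => /andP[-> /ltW ->].
Qed.

(** An open half-space in coordinate i is the countable union of the boxes bounded below by x in
    direction i and by -n in the others. Coordinates are therefore measurable for the sigma-algebra
    of boxes, and so is the identity. *)
Lemma measurable_boxes : measurable = <<s boxes >>.
Proof.
rewrite eqEsubset; split; last first.
  apply: smallest_sub; first exact: sigma_algebra_measurable.
  by move=> _ [a [b ->]]; exact: box_meas.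
move=> A mA.
pose W := g_sigma_algebraType boxes.
have mid : measurable_fun (setT : set W) (fun x : W => (x : V)).
  apply/measurable_fun_tnthP => i.
  apply: (@measurability _ _ _ _ _ _ _ (RGenOInfty.measurableE R)).
  move=> _ [_ [x ->] <-]; rewrite setTI.
  rewrite (_ : _ @^-1` _ = \bigcup_n box [tuple if j == i then x else - n%:R | j < d]
     [tuple n%:R | j < d]).
    apply: bigcup_measurable => n _; apply: sub_sigma_algebra.
    by eexists; eexists; reflexivity.
  apply/seteqP; split => y /=.
  - rewrite in_itv/= andbT => xy.
    have [n hn] : exists n : nat, normv (y : V) < n%:R.
      by exists (Num.bound (normv (y : V))); rewrite archi_boundP// normv_ge0.
    exists n => // j; rewrite !tnth_mktuple.
    have := le_lt_trans (coord_le_normv (y : V) j) hn.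
    rewrite ltr_norml => /andP[h1 /ltW ->]; rewrite andbT.
    by case: eqVneq => [->|].
  - by move=> [n _ /(_ i)]; rewrite !tnth_mktuple eqxx in_itv/= andbT => /andP[].
by have := mid measurableT A mA; rewrite setTI.
Qed.

Lemma measure_box_unique (m1 m2 : {measure set V -> \bar R}) :
  (forall a b : V, (forall i, tnth a i <= tnth b i) -> m1 (box a b) = m2 (box a b)) ->
  (forall n, m1 (cube n) < +oo)%E ->
  forall A, measurable A -> m1 A = m2 A.
Proof.
move=> h hf; apply: (@measure_unique _ _ _ boxes cube) => //.
- exact: measurable_boxes.
- exact: setI_closed_boxes.
- by move=> n; eexists; eexists; reflexivity.
- exact: cube_cover.
move=> _ [a [b ->]].
have [ab|] := boolP [forall i, tnth a i <= tnth b i]; first exact/h/forallP.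
rewrite negb_forall => /existsP[i]; rewrite -ltNge => ba.
rewrite (_ : box a b = set0) ?measure0//.
rewrite -subset0 => x /(_ i) /andP[h1 h2].
by have := lt_trans ba (lt_le_trans h1 h2); rewrite ltxx.
Qed.

End lebesgue_uniqueness.

(** * Changes of variables and integrability of exponentials *)

Section lebesgue.
Context (R : realType) (d : nat).
Local Notation V := (d.-tuple R).

Lemma sigma_finite_lebesgue (leb : {measure set V -> \bar R}) : is_lebesgue leb ->
  sigma_finite setT leb.
Proof.
move=> H; exists (fun n => @cube R d n); first by rewrite cube_cover.
move=> n; split; first exact: box_meas.
rewrite /cube H ?ltry// => i; rewrite !tnth_mktuple.
by rewrite (@le_trans _ _ 0)// oppr_le0.
Qed.

(** Fubini asks for a sigma-finite structure while the theorem speaks of a bare measure; cubes of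
    finite volume provide it, on the same underlying measure. *)
Lemma exists_sigma_finite (leb : {measure set V -> \bar R}) : is_lebesgue leb ->
  exists leb' : {sigma_finite_measure set V -> \bar R}, leb = leb'.
Proof.
move=> /sigma_finite_lebesgue; case: leb => m c H.
pose sf := @Measure_isSigmaFinite.Build _ _ _ (Measure.Pack c) H.
by exists (HB.pack_for {sigma_finite_measure set V -> \bar R} m c sf).
Qed.

Variable leb : {sigma_finite_measure set V -> \bar R}.
Hypothesis Hleb : is_lebesgue leb.

Lemma leb_cube n : (leb (@cube R d n) < +oo)%E.
Proof.
rewrite /cube Hleb ?ltry// => i; rewrite !tnth_mktuple.
by rewrite (@le_trans _ _ 0)// oppr_le0.
Qed.

Section change_of_variables.
Variables (phi : V -> V) (k : R).
Hypothesis mphi : measurable_fun setT phi.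
Hypothesis k0 : 0 < k.
Hypothesis phi_box : forall a b : V, (forall i, tnth a i <= tnth b i) ->
  (leb (phi @^-1` (box a b)) = k%:E * leb (box a b))%E.

(** The image of Lebesgue measure under [phi] and k times Lebesgue measure agree on boxes, hence
    everywhere. *)
Lemma ge0_integral_phi (g : V -> \bar R) : measurable_fun setT g ->
  (forall x, 0 <= g x)%E -> (\int[leb]_x g (phi x) = k%:E * \int[leb]_x g x)%E.
Proof.
move=> mg g0.
pose kn : {nonneg R} := NngNum (ltW k0).
pose phim : {mfun V >-> V} := HB.pack phi (isMeasurableFun.Build _ _ _ _ _ mphi).
have E A : measurable A -> mscale kn leb A = pushforward leb phim A.
  apply: measure_box_unique => [a b ab|n].
    by rewrite /mscale/= /pushforward phi_box.
  by rewrite /mscale/= lte_mul_pinfty ?lee_fin ?ltW// leb_cube.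
rewrite -[LHS]/(\int[leb]_(x in phim @^-1` setT) (g \o phim) x)%E.
rewrite -(ge0_integral_pushforward mphi)//.
rewrite -(@eq_measure_integral _ _ _ _ _ (mscale kn leb)).
  by rewrite ge0_integral_mscale.
by move=> A mA _; exact: E.
Qed.

Lemma Itg_phi (u : V -> R) : Itg leb u -> Itg leb (fun x => u (phi x)).
Proof.
move=> iu; have mu := Itg_meas iu; apply/integrableP; split.
  by apply/measurable_EFinP; exact: measurableT_comp.
rewrite (@ge0_integral_phi (fun y => `|(EFin \o u) y|)%E)//.
  by rewrite lte_mul_pinfty ?lee_fin ?ltW//; case/integrableP: iu.
by apply: measurableT_comp => //; exact/measurable_EFinP.
Qed.

Lemma RI_phi (u : V -> R) : Itg leb u -> RI leb (fun x => u (phi x)) = k * RI leb u.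
Proof.
move=> iu; have mu := Itg_meas iu.
apply: EFin_inj; rewrite EFinM -!RI_E//; last exact: Itg_phi.
have iup : Itg leb (fun x => Num.max (u x) 0).
  apply: Itg_dom (Itg_abs iu) => [|x]; first by apply: measurable_maxr.
  by rewrite ger0_norm ?le_max ?lexx ?orbT// ge_max ler_norm normr_ge0.
have iun : Itg leb (fun x => Num.max (- u x) 0).
  apply: Itg_dom (Itg_abs iu) => [|x]; first by apply: measurable_maxr => //; exact: measurable_funN.
  by rewrite ger0_norm ?le_max ?lexx ?orbT// ge_max -normrN ler_norm normr_ge0.
have uE x : u x = Num.max (u x) 0 - Num.max (- u x) 0.
  have [h|h] := leP 0 (u x).
    by rewrite (max_idPr (_ : - u x <= 0)) ?subr0// oppr_le0.
  by rewrite (max_idPl (_ : 0 <= - u x)) ?sub0r ?opprK// oppr_ge0 ltW.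
have P (v : V -> R) : Itg leb v -> (forall x, 0 <= v x) ->
    RI leb (fun x => v (phi x)) = k * RI leb v.
  move=> iv v0; apply: EFin_inj; rewrite EFinM -!RI_E//; last exact: Itg_phi.
  rewrite (@ge0_integral_phi (fun y => (v y)%:E))//.
  by apply/measurable_EFinP; exact: Itg_meas iv.
rewrite !RI_E//; last exact: Itg_phi.
rewrite -EFinM; congr EFin.
rewrite (RI_ext leb (fun x => uE (phi x))) (RI_ext leb uE).
rewrite (RIB (Itg_phi iup) (Itg_phi iun)) RIB// mulrBr.
by rewrite (P _ iup) ?(P _ iun)// => x; rewrite le_max lexx orbT.
Qed.
End change_of_variables.

Lemma leb_ge_le_eq (A : set V) (P : R) : 0 <= P ->
  (forall e : R, 0 < e -> e < 1 -> (((1 - e) ^+ d * P)%:E <= leb A)%E) ->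
  (forall e : R, 0 < e -> e < 1 -> (leb A <= ((1 + e) ^+ d * P)%:E)%E) ->
  leb A = P%:E.
Proof.
move=> P0 h1 h2.
have e0 n : 0 < (n.+2%:R : R)^-1 by rewrite invr_gt0.
have e1 n : (n.+2%:R : R)^-1 < 1 by rewrite invf_lt1// ltr1n.
have fA : leb A \is a fin_num.
  by rewrite ge0_fin_numE// (le_lt_trans (h2 _ (e0 0%N) (e1 0%N)))// ltry.
have c0 : (n.+2%:R : R)^-1 @[n --> \oo] --> 0.
  have := @cvg_harmonic R; rewrite -(cvg_shiftS _) /harmonic; exact.
have c (s : R) : (1 + s * (n.+2%:R : R)^-1) ^+ d * P @[n --> \oo] --> P.
  rewrite -[X in _ --> X]mul1r; apply: cvgM; last exact: cvg_cst.
  rewrite (_ : nbhs (1 : R) = nbhs ((1 + s * 0) ^+ d : R)); last first.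
    by rewrite mulr0 addr0 expr1n.
  apply: (@cvg_comp _ _ _ _ (fun x => x ^+ d)); last exact: exprn_continuous.
  by apply: cvgD; [exact: cvg_cst|apply: cvgM => //; exact: cvg_cst].
rewrite -(fineK fA); congr EFin; apply/eqP; rewrite eq_le; apply/andP; split.
- apply: (cvg_ge (c 1)) => n.
  by rewrite mul1r -lee_fin fineK// h2.
- apply: (cvg_le (c (-1))) => n.
  by rewrite mulN1r -lee_fin fineK// h1.
Qed.


Lemma preimage_transl (c a b : V) : (vadd^~ c) @^-1` (box a b) = box (vsub a c) (vsub b c).
Proof.
by apply/seteqP; split => x /= h i; have := h i; rewrite !tnthE ltrBlDr lerBrDr.
Qed.

Lemma mvadd (c : V) : measurable_fun setT (vadd^~ c).
Proof. by apply: mf_vadd; [exact: measurable_id|exact: mf_vcst]. Qed.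

Lemma transl_box (c a b : V) : (forall i, tnth a i <= tnth b i) ->
  (leb ((vadd^~ c) @^-1` (box a b)) = 1%:E * leb (box a b))%E.
Proof.
move=> ab; rewrite preimage_transl mul1e Hleb; last by move=> i; rewrite !tnthE lerB.
rewrite Hleb//; congr EFin; apply: eq_bigr => i _; rewrite !tnthE; ring.
Qed.

Lemma Itg_transl c (u : V -> R) : Itg leb u -> Itg leb (fun x => u (vadd x c)).
Proof. exact: (Itg_phi (mvadd c) ltr01 (transl_box c)). Qed.

Lemma RI_transl c (u : V -> R) : Itg leb u -> RI leb (fun x => u (vadd x c)) = RI leb u.
Proof. by move=> iu; rewrite (RI_phi (mvadd c) ltr01 (transl_box c))// mul1r. Qed.

Lemma vsub_as_vadd (x c : V) : vsub x c = vadd x (vsub vzero c).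
Proof. by apply: eq_from_tnth => i; rewrite !tnthE; ring. Qed.

Lemma Itg_translB c (u : V -> R) : Itg leb u -> Itg leb (fun x => u (vsub x c)).
Proof.
move=> iu; apply: (Itg_ext _ (Itg_transl (vsub vzero c) iu)) => x.
by rewrite -vsub_as_vadd.
Qed.

Lemma RI_translB c (u : V -> R) : Itg leb u -> RI leb (fun x => u (vsub x c)) = RI leb u.
Proof.
move=> iu; rewrite -[RHS](RI_transl (vsub vzero c) iu).
by apply: RI_ext => x; rewrite -vsub_as_vadd.
Qed.

Lemma mvsub (c : V) : measurable_fun setT (vsub c).
Proof. by apply: mf_vsub; [exact: mf_vcst|exact: measurable_id]. Qed.

(** A reflection exchanges the open and the closed sides of a box, and only one of the two kinds has
    its volume prescribed. The other is squeezed between prescribed boxes whose sides are shrunk or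
    stretched by a factor 1 - e or 1 + e. *)
Lemma leb_cobox (a b : V) : (forall i, tnth a i <= tnth b i) ->
  measurable [set x : V | forall i, tnth a i <= tnth x i < tnth b i] ->
  leb [set x | forall i, tnth a i <= tnth x i < tnth b i] =
      (\prod_(i < d) (tnth b i - tnth a i))%:E.
Proof.
move=> ab mC; apply: leb_ge_le_eq.
- by apply: prodr_ge0 => i _; rewrite subr_ge0.
- move=> e e0 e1.
  pose b' : V := [tuple tnth a i + (1 - e) * (tnth b i - tnth a i) | i < d].
  have h : forall i, tnth a i <= tnth b' i.
    by move=> i; rewrite tnth_mktuple lerDl mulr_ge0// subr_ge0// ltW.
  rewrite (_ : ((1 - e) ^+ d * _)%:E = leb (box a b')).
    apply: le_measure; rewrite ?inE//; first exact: box_meas.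
    move=> x xB i; have /andP[h1] := xB i; rewrite tnth_mktuple => h2.
    have h3 : tnth a i < tnth b i.
      rewrite lt_neqAle ab andbT; apply/eqP => E; move: h2; rewrite E subrr mulr0 addr0.
      by rewrite leNgt -E h1.
    rewrite ltW//= (le_lt_trans h2)// -ltrBrDl gtr_pMl ?subr_gt0// gtrBl//.
  rewrite Hleb//; congr EFin; rewrite -[X in _ ^+ X]card_ord -prodr_const -big_split.
  by apply: eq_bigr => i _; rewrite tnth_mktuple addrAC subrr add0r.
- move=> e e0 e1.
  pose a' : V := [tuple tnth a i - e * (tnth b i - tnth a i) | i < d].
  have h : forall i, tnth a' i <= tnth b i.
    move=> i; rewrite tnth_mktuple (le_trans _ (ab i))// gerBl mulr_ge0// ?subr_ge0// ltW//.
  rewrite (_ : ((1 + e) ^+ d * _)%:E = leb (box a' b)).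
    apply: le_measure; rewrite ?inE//; first exact: box_meas.
    move=> x xB i; have /andP[h1 h2] := xB i; rewrite tnth_mktuple (ltW h2) andbT.
    rewrite (lt_le_trans _ h1)// gtrBl mulr_gt0// subr_gt0.
    exact: le_lt_trans h1 h2.
  rewrite Hleb//; congr EFin; rewrite -[X in _ ^+ X]card_ord -prodr_const -big_split.
  by apply: eq_bigr => i _; rewrite tnth_mktuple /=; ring.
Qed.

Lemma refl_box (c a b : V) : (forall i, tnth a i <= tnth b i) ->
  (leb ((vsub c) @^-1` (box a b)) = 1%:E * leb (box a b))%E.
Proof.
move=> ab; have E : (vsub c) @^-1` (box a b) = [set x | forall i,
    tnth (vsub c b) i <= tnth x i < tnth (vsub c a) i].
  apply/seteqP; split => x /= h i; have := h i; rewrite !tnthE => /andP[h1 h2].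
    by apply/andP; split; lra.
  by apply/andP; split; lra.
have mE : measurable ((vsub c) @^-1` (box a b)).
  by rewrite -[X in measurable X]setTI; apply: mvsub => //; exact: box_meas.
rewrite mul1e Hleb// E leb_cobox -?E//; last by move=> i; rewrite !tnthE lerB.
by congr EFin; apply: eq_bigr => i _; rewrite !tnthE; ring.
Qed.

Lemma Itg_refl c (u : V -> R) : Itg leb u -> Itg leb (fun x => u (vsub c x)).
Proof. exact: (Itg_phi (mvsub c) ltr01 (refl_box c)). Qed.

Lemma RI_refl c (u : V -> R) : Itg leb u -> RI leb (fun x => u (vsub c x)) = RI leb u.
Proof. by move=> iu; rewrite (RI_phi (mvsub c) ltr01 (refl_box c))// mul1r. Qed.

Lemma mvscale (s : R) : measurable_fun setT (vscale s : V -> V).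
Proof. by apply: mf_vscale; [exact: mf_cst|exact: measurable_id]. Qed.

Lemma scale_box (s : R) (a b : V) : 0 < s -> (forall i, tnth a i <= tnth b i) ->
  (leb ((vscale s) @^-1` (box a b)) = (s^-1 ^+ d)%:E * leb (box a b))%E.
Proof.
move=> s0 ab; rewrite (_ : _ @^-1` _ = box (vscale s^-1 a) (vscale s^-1 b)); last first.
  by apply/seteqP; split => x /= h i; have := h i; rewrite !tnthE ltr_pdivrMl// ler_pdivlMl.
rewrite !Hleb//; last by move=> i; rewrite !tnthE ler_pM2l// invr_gt0.
rewrite -EFinM; congr EFin; rewrite -[X in _ ^+ X]card_ord -prodr_const -big_split.
by apply: eq_bigr => i _; rewrite !tnthE /= -mulrBr.
Qed.

Lemma Itg_scale s (u : V -> R) : 0 < s -> Itg leb u -> Itg leb (fun x => u (vscale s x)).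
Proof.
move=> s0; apply: (Itg_phi (mvscale s) _ (fun a b => scale_box s0)).
by rewrite exprn_gt0// invr_gt0.
Qed.

Lemma RI_scale s (u : V -> R) : 0 < s -> Itg leb u ->
  RI leb (fun x => u (vscale s x)) = s^-1 ^+ d * RI leb u.
Proof.
move=> s0; apply: (RI_phi (mvscale s) _ (fun a b => scale_box s0)).
by rewrite exprn_gt0// invr_gt0.
Qed.

Lemma meas_normv_set (p : R -> bool) : measurable_fun setT p ->
  measurable [set x : V | p (normv x)].
Proof.
move=> mp; rewrite -[X in measurable X]setTI.
have := @mf_comp2 _ _ _ V R _ p (fun x => normv x) mp.
move=> /(_ _ measurableT [set true]); apply => //.
by apply: mf_normv; exact: measurable_id.
Qed.

Lemma leb_ball_le (n : nat) :
  (leb [set x : V | (normv x <= n%:R)%R] <= ((2 * n.+1%:R) ^+ d)%:E)%E.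
Proof.
rewrite (_ : ((2 * n.+1%:R) ^+ d)%:E = leb (@cube R d n.+1)).
  apply: le_measure; rewrite ?inE.
  - by apply: (@meas_normv_set (fun r => r <= n%:R)); apply: measurable_fun_ler.
  - exact: box_meas.
  - move=> x /= h i; rewrite !tnth_mktuple.
    have := le_lt_trans (le_trans (coord_le_normv x i) h) (_ : n%:R < n.+1%:R :> R).
    by rewrite ltr_nat => /(_ (ltnSn _)); rewrite ltr_norml => /andP[-> /ltW ->].
rewrite /cube Hleb; last by move=> i; rewrite !tnth_mktuple (@le_trans _ _ 0)// oppr_le0.
congr EFin; rewrite -[X in _ ^+ X]card_ord -prodr_const; apply: eq_bigr => i _.
by rewrite !tnth_mktuple opprK mulr2n mulrDl mul1r.
Qed.


Lemma exp_ge_pow (x : R) n : 0 <= x -> x ^+ n <= n`!%:R * expR x.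
Proof.
case: n => [|n] x0; first by rewrite expr0 fact0 mul1r -expR0 ler_expR.
have := expR_ge1Dxn n x0; rewrite -ler_pdivrMl ?ltr0n ?fact_gt0// mulrC.
by apply: le_trans; rewrite lerDr.
Qed.

(** Comparison with a sum over unit shells. The volume of the n-th ball is polynomial in n; half of
    the rate l absorbs it through [exp_ge_pow], and the other half leaves a geometric series of
    ratio exp(-l/2). *)
Lemma Itg_exp_norm (l : R) : 0 < l -> Itg leb (fun x : V => expR (- (l * normv x))).
Proof.
move=> l0; have mu : measurable_fun setT (fun x : V => expR (- (l * normv x))) by mfun.
apply: Itg_of_E => //.
have mB n : measurable [set x : V | normv x <= n%:R].
  by apply: (@meas_normv_set (fun r => r <= n%:R)); apply: measurable_fun_ler.
pose g n (x : V) : \bar R := (expR (- (l * n%:R)) * \1_[set x : V | normv x <= n.+1%:R] x)%:E.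
have mg n : measurable_fun setT (g n).
  by apply/measurable_EFinP; apply: measurable_funM => //; exact: measurable_indic.
have g0 n x : (0 <= g n x)%E by rewrite lee_fin mulr_ge0// expR_ge0.
apply: (@le_lt_trans _ _ (\int[leb]_x \sum_(0 <= n <oo) g n x)%E).
  apply: ge0_le_integral => //.
  - exact/measurable_EFinP.
  - by apply: ge0_emeasurable_sum.
  - move=> x _.
    have [n hn] : exists n : nat, n%:R <= normv x < n.+1%:R.
      exists (Num.truncn (normv x)).
      by rewrite truncn_le ?normv_ge0// truncnS_gt.
    case/andP: hn => n1 n2.
    apply: (@le_trans _ _ (g n x)).
      rewrite lee_fin indicE mem_set ?mulr1/=; last exact: ltW.
      by rewrite ler_expR lerN2 ler_pM2l.
    apply: (@le_trans _ _ (\sum_(0 <= i < n.+1) g i x)%E).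
      by rewrite big_nat_recr//= leeDr// sume_ge0.
    by apply: nneseries_lim_ge.
rewrite integral_nneseries//.
pose q := expR (- (l / 2)).
have q1 : `|q| < 1 by rewrite ger0_norm ?expR_ge0// -expR0 ltr_expR oppr_lt0 divr_gt0.
pose C : R := (4 / l) ^+ d * d`!%:R * expR l.
apply: (@le_lt_trans _ _ (C / (1 - q))%:E); last exact: ltry.
apply: lime_le; first by apply: is_cvg_nneseries => n _ _; apply: integral_ge0.
apply: nearW => N.
apply: (@le_trans _ _ (\sum_(0 <= n < N) (C * q ^+ n)%:E)%E); last first.
  rewrite sumEFin lee_fin.
  by apply: (@geometric_le_lim _ N C q) => //; rewrite ?mulr_ge0 ?exprn_ge0 ?divr_ge0 ?expR_ge0 ?ltW ?expR_gt0.
apply: lee_sum => n _; rewrite /g.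
under eq_integral do rewrite EFinM.
rewrite ge0_integralZl ?lee_fin ?expR_ge0//; last exact/measurable_EFinP/measurable_indic.
rewrite integral_indic// setIT.
apply: (@le_trans _ _ ((expR (- (l * n%:R)))%:E * ((2 * n.+2%:R) ^+ d)%:E)%E).
  by rewrite lee_wpmul2l ?lee_fin ?expR_ge0//; exact: leb_ball_le.
rewrite -EFinM lee_fin /C.
have h0 : 0 <= l / 2 * n.+2%:R by rewrite mulr_ge0// divr_ge0// ltW.
have h := exp_ge_pow d h0.
rewrite (_ : 2 * n.+2%:R = (4 / l) * (l / 2 * n.+2%:R)); last by field; rewrite gt_eqF.
have E : expR (- (l * n%:R)) * expR (l / 2 * n.+2%:R) = expR l * q ^+ n.
  by rewrite /q -expRM_natl -!expRD -addn2 natrD; congr expR; field.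
rewrite exprMn.
apply: (@le_trans _ _ (expR (- (l * n%:R)) * ((4 / l) ^+ d * (d`!%:R * expR (l / 2 * n.+2%:R))))).
  rewrite ler_wpM2l ?expR_ge0// ler_wpM2l//.
  by rewrite exprn_ge0// divr_ge0// ltW.
rewrite le_eqVlt; apply/orP; left; apply/eqP.
transitivity ((4 / l) ^+ d * d`!%:R * (expR (- (l * n%:R)) * expR (l / 2 * n.+2%:R))); first ring.
by rewrite E; ring.
Qed.

End lebesgue.

(** * Differentiation under the integral sign *)

Section deriv_under_integral.
Context (R : realType) d0 (T : measurableType d0) (mu : {measure set T -> \bar R}).

Lemma is_derive_RI (f df : R -> T -> R) (G : T -> R) (a : R) :
  (forall u, Itg mu (f u)) ->
  (forall u y, is_derive u (1 : R) (f^~ y) (df u y)) ->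
  Itg mu G -> (forall u y, `|u - a| < 1 -> `|df u y| <= G y) ->
  is_derive a (1 : R) (fun u => RI mu (f u)) (RI mu (df a)).
Proof.
move=> If Df IG bd.
have G0 y : 0 <= G y by apply: le_trans (bd a y _); rewrite ?subrr ?normr0.
have Ia : `]a - 1, a + 1[%classic a by rewrite /= in_itv/=; apply/andP; split; lra.
have dfE u y : partial1of2 f u y = df u y.
  by rewrite partial1of2E; have := Df u y => /@derive_val.
have D1 : forall x y, `]a - 1, a + 1[%classic x -> [set: T] y -> derivable (f ^~ y) x 1.
  by move=> x y _ _; have := Df x y => /@ex_derive.
have B1 : forall x y, `]a - 1, a + 1[%classic x -> [set: T] y ->
    `|partial1of2 f x y| <= G y.
  move=> x y; rewrite /= in_itv/= => /andP[h1 h2] _; rewrite dfE; apply: bd.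
  by rewrite ltr_norml; apply/andP; split; lra.
apply: DeriveDef.
  exact: (@derivable_under_integral _ _ _ mu f setT measurableT a _ _ Ia
    (fun x _ => If x) D1 G G0 IG B1).
rewrite -derive1E (@differentiation_under_integral _ _ _ mu f setT measurableT a _ _ Ia
    (fun x _ => If x) D1 G G0 IG B1).
by apply: RI_ext => y; rewrite dfE.
Qed.

End deriv_under_integral.

Lemma scale_R (R : realType) (a b : R) : a *: (b : R^o) = a * b.
Proof. by []. Qed.

(** * Gaussian integrals and their Fourier transform *)

Section gaussian.
Context (R : realType) (d : nat).
Local Notation V := (d.-tuple R).
Variable leb : {sigma_finite_measure set V -> \bar R}.
Hypothesis Hleb : is_lebesgue leb.

(** Read in the frequency variable, this is the characteristic function of a centred Gaussian of
    variance s; read in the space variable, its shape has variance 1/s. *)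
Definition gam (s : R) (x : V) : R := expR (- (s * dotv x x / 2)).

Lemma gam_ge0 (s : R) x : 0 <= gam s x. Proof. exact: expR_ge0. Qed.
Lemma gam_le1 (s : R) x : 0 <= s -> gam s x <= 1.
Proof.
by move=> s0; rewrite -expR0 ler_expR oppr_le0 divr_ge0// mulr_ge0// dotv_ge0.
Qed.

Lemma mgam (s : R) : measurable_fun setT (gam s).
Proof. rewrite /gam; mfun. Qed.

Lemma gam_le_exp (s k : R) (x : V) : 0 < s ->
  gam s x <= expR (k ^+ 2 / (2 * s)) * expR (- (k * normv x)).
Proof.
move=> s0; rewrite -expRD ler_expR -normv2; set a := normv x.
rewrite -subr_ge0 (_ : _ - _ = (s / 2) * (a - k / s) ^+ 2); last by field; rewrite gt_eqF.
by rewrite mulr_ge0 ?sqr_ge0// divr_ge0// ltW.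
Qed.

Lemma poly_exp (x : V) : 1 + normv x <= expR (normv x).
Proof. exact: expR_ge1Dx. Qed.

Lemma Itg_poly_exp (C : R) : Itg leb (fun x : V => C * (1 + normv x) * expR (- (2 * normv x))).
Proof.
apply: (@Itg_dom _ _ _ _ _ (fun x => `|C| * expR (- (1 * normv x)))).
- mfun.
- move=> x; rewrite !normrM -mulrA ler_wpM2l//.
  rewrite (@ger0_norm _ (1 + _)) ?addr_ge0 ?normv_ge0// ger0_norm ?expR_ge0//.
  apply: (@le_trans _ _ (expR (normv x) * expR (- (2 * normv x)))).
    by rewrite ler_wpM2r ?expR_ge0 ?poly_exp.
  by rewrite -expRD ler_expR; lra.
- by apply: ItgZ; exact: Itg_exp_norm.
Qed.

Lemma Itg_gam_poly (s C : R) : 0 < s -> Itg leb (fun x => C * (1 + normv x) * gam s x).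
Proof.
move=> s0; apply: (@Itg_dom _ _ _ _ _
  (fun x => (`|C| * expR (2 ^+ 2 / (2 * s))) * (1 + normv x) * expR (- (2 * normv x)))).
- by have mg := mgam s; mfun.
- move=> x; rewrite !normrM (@ger0_norm _ (1 + _)) ?addr_ge0 ?normv_ge0// (ger0_norm (gam_ge0 s x)).
  rewrite [X in _ <= X](_ : _ = `|C| * (1 + normv x) * (expR (2 ^+ 2 / (2 * s)) * expR (- (2 * normv x)))).
    by rewrite ler_wpM2l ?mulr_ge0 ?addr_ge0 ?normv_ge0 ?normr_ge0//; exact: gam_le_exp.
  by rewrite [RHS]mulrA; congr (_ * _); exact: mulrAC.
- exact: Itg_poly_exp.
Qed.

Lemma Itg_gam (s : R) : 0 < s -> Itg leb (gam s).
Proof.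
move=> s0; apply: Itg_dom (Itg_gam_poly 1 s0); first exact: mgam.
move=> x; rewrite mul1r ger0_norm ?gam_ge0//.
by rewrite ler_peMl ?gam_ge0// lerDl normv_ge0.
Qed.

(** By translation invariance the integral of v(xi + tau x) does not depend on tau, and its
    derivative at tau = 0 is the integral of the statement. This takes the place of an integration
    by parts in d dimensions. *)
Lemma gauss_ibp (s u : R) (x : V) : 0 < s ->
  RI leb (fun xi => gam s xi * (- (s * dotv x xi) * sin (u * dotv x xi) +
     u * dotv x x * cos (u * dotv x xi))) = 0.
Proof.
move=> s0.
pose v xi := gam s xi * sin (u * dotv x xi).
have iv : Itg leb v.
  apply: Itg_dom (Itg_gam s0); first by have mg := mgam s; rewrite /v; mfun.
  by move=> xi; rewrite normrM ger0_norm ?gam_ge0// ler_piMr ?gam_ge0// ler_norml sin_le1 sin_geN1.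
pose f (tau : R) xi := v (vadd xi (vscale tau x)).
pose df (tau : R) xi := gam s (vadd xi (vscale tau x)) *
  (- (s * (dotv x xi + tau * dotv x x)) * sin (u * (dotv x xi + tau * dotv x x)) +
   u * dotv x x * cos (u * (dotv x xi + tau * dotv x x))).
pose C := (s * (normv x + dotv x x) + `|u| * dotv x x) *
   expR (2 ^+ 2 / (2 * s)) * expR (2 * normv x).
have fE tau xi : f tau xi = expR (- (s * (dotv xi xi + 2 * tau * dotv x xi + tau ^+ 2 * dotv x x) / 2)) *
    sin (u * (dotv x xi + tau * dotv x x)).
  rewrite /f /v /gam !(dotvDl, dotvDr, dotvZl, dotvZr) (dotvC xi x).
  by congr (expR _ * sin _); ring.
have gE tau xi : gam s (vadd xi (vscale tau x)) = expR (- (s * (dotv xi xi + 2 * tau * dotv x xi + tau ^+ 2 * dotv x x) / 2)).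
  by rewrite /gam !(dotvDl, dotvDr, dotvZl, dotvZr) (dotvC xi x); congr expR; ring.
have D : is_derive (0 : R) (1 : R) (fun tau => RI leb (f tau)) (RI leb (df 0)).
  apply: (@is_derive_RI R _ _ leb f df
    (fun xi => C * (1 + normv xi) * expR (- (2 * normv xi))) 0).
  - by move=> tau; exact: Itg_transl.
  - move=> tau xi; rewrite (_ : f^~ xi = (fun t => expR (- (s * (dotv xi xi +
      2 * t * dotv x xi + t ^+ 2 * dotv x x) / 2)) * sin (u * (dotv x xi + t * dotv x x)))).
      rewrite /df gE; apply: is_derive_eq.
      by rewrite !scale_R; field.
    by apply/funext => t; exact: fE.
  - exact: Itg_poly_exp.
  - move=> tau xi; rewrite subr0 => tau1.
    rewrite /df normrM ger0_norm ?gam_ge0//.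
    have nx := normv_ge0 x; have nxi := normv_ge0 xi; have xx := dotv_ge0 x.
    (* For |tau| < 1 the shift by tau x costs at most the factor exp(2 |x|), so one majorant serves
       all these tau. *)
    have h1 : gam s (vadd xi (vscale tau x)) <=
       expR (2 ^+ 2 / (2 * s)) * (expR (2 * normv x) * expR (- (2 * normv xi))).
      apply: (le_trans (gam_le_exp 2 _ s0)); rewrite ler_wpM2l ?expR_ge0//.
      rewrite -expRD ler_expR.
      have := normvB_ge xi (vscale (- tau) x).
      rewrite (_ : vsub xi (vscale (- tau) x) = vadd xi (vscale tau x)).
        rewrite normvZ normrN.
        have : `|tau| * normv x <= 1 * normv x by rewrite ler_wpM2r// ltW.
        lra.
      by apply: eq_from_tnth => i; rewrite !tnthE; ring.
    have h2 : `|dotv x xi + tau * dotv x x| <= (normv x + dotv x x) * (1 + normv xi).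
      apply: (le_trans (ler_normD _ _)); rewrite normrM (ger0_norm xx).
      have := cauchy_schwarz x xi.
      have : `|tau| * dotv x x <= 1 * dotv x x by rewrite ler_wpM2r// ltW.
      have := mulr_ge0 xx nxi; have := mulr_ge0 nx nxi.
      rewrite mulrDl !mulrDr; lra.
    set w := dotv x xi + tau * dotv x x in h2 *.
    have h3 : `|- (s * w) * sin (u * w) + u * dotv x x * cos (u * w)| <=
        (s * (normv x + dotv x x) + `|u| * dotv x x) * (1 + normv xi).
      apply: (le_trans (ler_normD _ _)); rewrite !normrM normrN normrM (gtr0_norm s0) (ger0_norm xx).
      rewrite mulrDl; apply: lerD.
        apply: (@le_trans _ _ (s * `|w| * 1)).
          by rewrite ler_wpM2l ?mulr_ge0 ?(ltW s0)// ler_norml sin_le1 sin_geN1.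
        by rewrite mulr1 -mulrA ler_pM2l.
      apply: ler_pM => //; rewrite ?mulr_ge0//.
      by apply: (@le_trans _ _ 1); rewrite ?lerDl// ler_norml cos_le1 cos_geN1.
    rewrite (_ : C * _ * _ = (expR (2 ^+ 2 / (2 * s)) * (expR (2 * normv x) * expR (- (2 * normv xi)))) *
      ((s * (normv x + dotv x x) + `|u| * dotv x x) * (1 + normv xi))); last by rewrite /C; ring.
    by apply: ler_pM => //; exact: gam_ge0.
have E0 : (fun tau => RI leb (f tau)) = cst (RI leb v).
  by apply/funext => tau; rewrite /f RI_transl.
rewrite E0 in D.
have := @derive_val _ _ _ _ _ _ _ D; rewrite derive_cst => /esym.
rewrite /df => <-; apply: RI_ext => xi; rewrite mul0r addr0.
by congr (gam s _ * _); apply: eq_from_tnth => i; rewrite !tnthE mul0r addr0.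
Qed.

(** With k = |x|^2 / s, the integral G(u) of gam s xi cos(u x.xi) satisfies G' = - u k G by
    [gauss_ibp], so G(u) exp(k u^2 / 2) is constant; compare u = 1 with u = 0. *)
Lemma gauss_ft (s : R) (x : V) : 0 < s ->
  RI leb (fun xi => gam s xi * cos (dotv x xi)) = RI leb (gam s) * gam s^-1 x.
Proof.
move=> s0; pose k := dotv x x / s.
pose G (u : R) := RI leb (fun xi => gam s xi * cos (u * dotv x xi)).
pose S (u : R) := RI leb (fun xi => gam s xi * (dotv x xi * sin (u * dotv x xi))).
have mg := mgam s.
have iC u : Itg leb (fun xi => gam s xi * cos (u * dotv x xi)).
  apply: Itg_dom (Itg_gam s0); first by mfun.
  by move=> xi; rewrite normrM ger0_norm ?gam_ge0// ler_piMr ?gam_ge0// ler_norml cos_le1 cos_geN1.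
have bS u xi : `|gam s xi * (dotv x xi * sin (u * dotv x xi))| <= normv x * (1 + normv xi) * gam s xi.
  rewrite mulrC !normrM (ger0_norm (gam_ge0 _ _)) ler_wpM2r ?gam_ge0//.
  apply: (@le_trans _ _ (normv x * normv xi * 1)).
    by apply: ler_pM => //; [exact: cauchy_schwarz|rewrite ler_norml sin_le1 sin_geN1].
  by rewrite mulr1 ler_wpM2l ?normv_ge0// lerDr.
have iS u : Itg leb (fun xi => gam s xi * (dotv x xi * sin (u * dotv x xi))).
  by apply: Itg_dom (bS u) (Itg_gam_poly _ s0); mfun.
have SE u : S u = u * k * G u.
  have := @gauss_ibp s u x s0.
  rewrite (RI_ext leb (_ : _ =1 (fun xi => u * dotv x x * (gam s xi * cos (u * dotv x xi)) -
     s * (gam s xi * (dotv x xi * sin (u * dotv x xi)))))); last by move=> xi; ring.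
  rewrite RIB ?RIZ//; try exact: ItgZ.
  rewrite -/(G u) -/(S u) => /eqP; rewrite subr_eq0 => /eqP h.
  by apply: (mulfI (lt0r_neq0 s0)); rewrite -h /k; field; exact: lt0r_neq0.
have DG u : is_derive u (1 : R) G (- S u).
  rewrite /S -mulN1r -RIZ//.
  apply: (@is_derive_RI R _ _ leb (fun u xi => gam s xi * cos (u * dotv x xi))
    (fun u xi => -1 * (gam s xi * (dotv x xi * sin (u * dotv x xi)))) (fun xi => normv x * (1 + normv xi) * gam s xi)) => //.
  - move=> v xi; apply: is_derive_eq.
    by rewrite /GRing.scale/= !(mulr1, mulr0, addr0, add0r); ring.
  - exact: Itg_gam_poly.
  - by move=> v xi _; rewrite mulN1r normrN; exact: bS.
have DH u : is_derive u (1 : R) (fun u => G u * expR (k * u ^+ 2 / 2)) 0.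
  by apply: is_derive_eq; rewrite SE !scale_R; field.
have := @is_derive_0_is_cst _ _ 1 0 DH.
rewrite /G expr1n mulr1 expr0n/= mulr0 mul0r expR0 mulr1.
rewrite (RI_ext leb (_ : _ =1 (fun xi => gam s xi * cos (dotv x xi)))); last by move=> xi; rewrite mul1r.
rewrite [X in _ = X](RI_ext leb (_ : _ =1 gam s)); last by move=> xi; rewrite mul0r cos0 mulr1.
move=> <-; rewrite -mulrA -expRD /k (_ : _ + _ = 0) ?expR0 ?mulr1//.
by field; exact: lt0r_neq0.
Qed.

Lemma gam_scale (s : R) (x : V) : 0 < s -> gam s x = gam 1 (vscale (Num.sqrt s) x).
Proof.
move=> s0; rewrite /gam dotvZl dotvZr (mulrA (Num.sqrt s)) -expr2 sqr_sqrtr ?(ltW s0)//.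
by congr expR; rewrite mul1r.
Qed.

Lemma RI_gam_scale (s : R) : 0 < s -> RI leb (gam s) = (Num.sqrt s)^-1 ^+ d * RI leb (gam 1).
Proof.
move=> s0; have r0 : 0 < Num.sqrt s by rewrite sqrtr_gt0.
rewrite -(RI_scale Hleb r0 (Itg_gam ltr01)).
by apply: RI_ext => x; exact: gam_scale.
Qed.

(** The constant (2 pi)^d of Fourier inversion, since [gam 1] integrates to (2 pi)^(d/2). It is kept
    symbolic. *)
Definition Kd : R := RI leb (gam 1) ^+ 2.

Lemma RI_gam_inv (s : R) : 0 < s -> RI leb (gam s) * RI leb (gam s^-1) = Kd.
Proof.
move=> s0; have s1 : 0 < s^-1 by rewrite invr_gt0.
rewrite (RI_gam_scale s0) (RI_gam_scale s1) sqrtrV ?(ltW s0)// invrK /Kd.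
have r0 : Num.sqrt s != 0 by rewrite gt_eqF// sqrtr_gt0.
by rewrite mulrACA -exprMn mulVf// expr1n mul1r expr2.
Qed.

Lemma RI_gam_gt0 (s : R) : 0 < s -> 0 < RI leb (gam s).
Proof.
move=> s0; pose B := box (vzero : V) [tuple 1 | i < d].
have mB : measurable B by exact: box_meas.
have LB : leb B = 1%:E.
  rewrite Hleb => [|i]; last by rewrite tnthE tnth_mktuple.
  by congr EFin; apply: big1 => i _; rewrite tnthE tnth_mktuple subr0.
have iB : Itg leb (\1_B : V -> R).
  apply: Itg_of_E => //.
  rewrite integral_indic// setIT; apply: (@le_lt_trans _ _ 1%E); last exact: ltry.
  by rewrite -LB.
have RB : RI leb (\1_B : V -> R) = 1.
  by apply: EFin_inj; rewrite -RI_E// integral_indic// setIT; exact: LB.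
pose m := expR (- (s * (d%:R ^+ 2) / 2)).
apply: (@lt_le_trans _ _ m); first exact: expR_gt0.
rewrite -[m]mulr1 -RB -RIZ//; apply: RI_le; [exact: ItgZ|exact: Itg_gam|move=> x].
rewrite indicE; case: (boolP (x \in B)) => xB; last by rewrite mulr0 gam_ge0.
rewrite mulr1 ler_expR lerN2 ler_pM2r ?invr_gt0// ler_pM2l// -normv2.
rewrite ler_pXn2r ?nnegrE ?normv_ge0// -[X in _ <= X]mulr1.
apply: normv_le_coord => i; have := set_mem xB => /(_ i).
by rewrite tnthE tnth_mktuple => /andP[h1 h2]; rewrite ger0_norm// ltW.
Qed.

Lemma Kd_gt0 : 0 < Kd. Proof. by rewrite exprn_gt0// RI_gam_gt0. Qed.

(* translation invariance completes the square *)
Lemma gauss_mgf (s : R) (a : V) : 0 < s ->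
  Itg leb (fun x => expR (dotv a x) * gam s x) /\
  RI leb (fun x => expR (dotv a x) * gam s x) = expR (dotv a a / (2 * s)) * RI leb (gam s).
Proof.
move=> s0.
have E x : expR (dotv a x) * gam s x = expR (dotv a a / (2 * s)) * gam s (vsub x (vscale s^-1 a)).
  rewrite /gam -!expRD; congr expR; rewrite !(dotvBl, dotvBr, dotvZl, dotvZr) (dotvC x a).
  by field; rewrite gt_eqF.
have i1 : Itg leb (fun x => gam s (vsub x (vscale s^-1 a))).
  exact: (Itg_translB Hleb _ (Itg_gam s0)).
split; first by apply: (Itg_ext (fun x => esym (E x))); exact: ItgZ.
by rewrite (RI_ext leb E) (RIZ _ i1) (RI_translB Hleb _ (Itg_gam s0)).
Qed.

End gaussian.

(** * The exponential series of a complex number, in real coordinates *)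

Section complex_exponential.
Context (R : realType).
Implicit Types (c s u : R).

(** Real and imaginary part of (c + i s)^n. *)
Fixpoint cpow c s n : R * R :=
  if n is n'.+1 then let p := cpow c s n' in (c * p.1 - s * p.2, s * p.1 + c * p.2)
  else (1, 0).

Lemma cpow_bound c s n : `|(cpow c s n).1| + `|(cpow c s n).2| <= (`|c| + `|s|) ^+ n.
Proof.
elim: n => [|n IH]; first by rewrite /= normr1 normr0 addr0 expr0.
rewrite exprS /=; set p := cpow c s n in IH *.
apply: (@le_trans _ _ ((`|c| + `|s|) * (`|p.1| + `|p.2|))); last first.
  by rewrite ler_wpM2l// addr_ge0.
have := ler_normB (c * p.1) (s * p.2); have := ler_normD (s * p.1) (c * p.2).
rewrite !normrM; lra.
Qed.

(** With f n a part of z^n this is the same part of the Taylor polynomial of exp(u z);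
    differentiating in u shifts f. *)
Definition esum_ (f : nat -> R) N u : R := \sum_(n < N) f n * u ^+ n / n`!%:R.

Lemma is_derive_esum f N u :
  is_derive u (1 : R) (esum_ f N.+1) (esum_ (fun n => f n.+1) N u).
Proof.
elim: N => [|N IH].
  rewrite /esum_ big_ord0 (_ : (fun _ => _) = cst (f 0%N)); first exact: is_derive_cst.
  by apply/funext => v; rewrite big_ord_recr big_ord0/= add0r expr0 mulr1 fact0 divr1.
rewrite (_ : esum_ f N.+2 = (fun v => esum_ f N.+1 v + f N.+1 / N.+1`!%:R * v ^+ N.+1)); last first.
  by apply/funext => v; rewrite /esum_ big_ord_recr/= mulrAC.
rewrite (_ : esum_ (fun n => f n.+1) N.+1 u =
  esum_ (fun n => f n.+1) N u + f N.+1 * u ^+ N / N`!%:R); last by rewrite /esum_ big_ord_recr.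
set k := f N.+1 / N.+1`!%:R.
have -> : f N.+1 * u ^+ N / N`!%:R = k * (N.+1%:R * u ^+ N).
  rewrite /k factS natrM; field.
  by rewrite !(pnatr_eq0, nat1r) -lt0n fact_gt0.
have D1 : is_derive u (1 : R) (fun v : R => v ^+ N.+1) (N.+1%:R * u ^+ N).
  have := @is_deriveX R R (fun v => v) N.+1 u 1 1 (is_derive_id _ _).
  rewrite (_ : (fun v : R => v ^+ N.+1) = (fun v : R => v) ^+ N.+1).
    by rewrite scale_R mulr1.
  by apply/funext => v; rewrite exprfctE.
have D2 : is_derive u (1 : R) (fun v : R => k * v ^+ N.+1) (k * (N.+1%:R * u ^+ N)).
  exact: is_deriveZ.
exact: (is_deriveD IH D2).
Qed.

Lemma esum_lin f g c s N u :
  esum_ (fun n => c * f n + s * g n) N u = c * esum_ f N u + s * esum_ g N u.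
Proof.
rewrite /esum_ !mulr_sumr -big_split; apply: eq_bigr => i _ /=; ring.
Qed.

Lemma mvt_bound (f df : R -> R) (e : R) :
  (forall u, is_derive u (1 : R) f (df u)) ->
  (forall u, 0 <= u <= 1 -> `|df u| <= e) -> `|f 1 - f 0| <= e.
Proof.
move=> D b.
have cf : {within `[0, 1], continuous f}.
  by apply: derivable_within_continuous => x _; have := D x => /@ex_derive.
have [c + ->] := @MVT_segment R f df 0 1 ler01 (fun x _ => D x) cf.
by rewrite in_itv/= subr0 mulr1; exact: b.
Qed.

Lemma cvg_pow_fact (x : R) : x ^+ n / n`!%:R @[n --> \oo] --> 0.
Proof.
have := cvg_series_cvg_0 (is_cvg_series_exp_coeff x).
by rewrite /exp_coeff; apply: cvg_trans; apply: near_eq_cvg; near=> n.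
Unshelve. all: by end_near. Qed.

Section fixed.
Variables (c s : R).
Let r n := (cpow c s n).1.
Let i n := (cpow c s n).2.
Let k : R := `|c| + `|s|.

Lemma esumS_r N u : esum_ (fun n => r n.+1) N u = c * esum_ r N u - s * esum_ i N u.
Proof. by rewrite -mulNr -esum_lin; apply: eq_bigr => j _; rewrite mulNr. Qed.
Lemma esumS_i N u : esum_ (fun n => i n.+1) N u = s * esum_ r N u + c * esum_ i N u.
Proof. by rewrite -esum_lin. Qed.

Lemma esum_recr f N u : esum_ f N.+1 u = esum_ f N u + f N * u ^+ N / N`!%:R.
Proof. by rewrite /esum_ big_ord_recr. Qed.

Let bd N := 2 * expR k * k * (k ^+ N / N`!%:R).

Lemma trig_bound (a b p q u : R) : `|a| <= 1 -> `|b| <= 1 -> `|a * p + b * q| <= `|p| + `|q|.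
Proof.
move=> ha hb; apply: (le_trans (ler_normD _ _)); rewrite !normrM.
by apply: lerD; rewrite -[X in _ <= X]mul1r ler_wpM2r.
Qed.

Lemma esum_step_bound N u (a b : R) : 0 <= u <= 1 -> `|a| <= 1 -> `|b| <= 1 ->
  `|a * (r N * u ^+ N / N`!%:R) + b * (i N * u ^+ N / N`!%:R)| <= k ^+ N / N`!%:R.
Proof.
move=> /andP[u0 u1] ha hb.
apply: (le_trans (trig_bound _ _ u ha hb)).
have un : `|u ^+ N| <= 1 by rewrite normrX ger0_norm// exprn_ile1.
rewrite !normrM -!mulrDl; rewrite normfV (ger0_norm (ler0n _ _)).
rewrite ler_wpM2r ?invr_ge0//; apply: le_trans (cpow_bound c s N).
by rewrite -[X in _ <= X]mulr1 ler_wpM2l// addr_ge0.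
Qed.

(** Put z = c + i s and let S(u) be the Taylor polynomial of exp(u z) of degree N. The expressions
    are the real part, minus 1, and the imaginary part of exp(-z) S(1). The derivative of exp(-u z)
    S(u) collapses to - z exp(-u z) (u z)^N / N!, and the mean value theorem compares u = 1 with the
    value 1 at u = 0. *)
Lemma rot_bounds N :
  `|expR (- c) * (cos s * esum_ r N.+1 1 + sin s * esum_ i N.+1 1) - 1| <= bd N /\
  `|expR (- c) * (cos s * esum_ i N.+1 1 - sin s * esum_ r N.+1 1)| <= bd N.
Proof.
pose W u := expR (- (u * c)) * (cos (u * s) * esum_ r N.+1 u + sin (u * s) * esum_ i N.+1 u).
pose Z u := expR (- (u * c)) * (cos (u * s) * esum_ i N.+1 u - sin (u * s) * esum_ r N.+1 u).
pose dr u := r N * u ^+ N / N`!%:R.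
pose di u := i N * u ^+ N / N`!%:R.
have e0 f : esum_ f N.+1 0 = f 0%N.
  rewrite /esum_ big_ord_recl/= expr0 mulr1 fact0 divr1 big1 ?addr0// => j _.
  by rewrite /= exprS mul0r mulr0 mul0r.
have Dr u := is_derive_esum r N u.
have Di u := is_derive_esum i N u.
have DW u : is_derive u (1 : R) W (expR (- (u * c)) *
   (- c * (cos (u * s) * dr u + sin (u * s) * di u) +
    s * (- sin (u * s) * dr u + cos (u * s) * di u))).
  apply: is_derive_eq; rewrite !scale_R esumS_r esumS_i !esum_recr -/(dr u) -/(di u); ring.
have DZ u : is_derive u (1 : R) Z (expR (- (u * c)) *
   (- c * (- sin (u * s) * dr u + cos (u * s) * di u) +
    - s * (cos (u * s) * dr u + sin (u * s) * di u))).
  apply: is_derive_eq; rewrite !scale_R esumS_r esumS_i !esum_recr -/(dr u) -/(di u); ring.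
have B (a1 a2 u p q : R) : 0 <= u <= 1 -> `|a1| + `|a2| <= k ->
   `|p| <= k ^+ N / N`!%:R -> `|q| <= k ^+ N / N`!%:R ->
   `|expR (- (u * c)) * (a1 * p + a2 * q)| <= bd N.
  move=> /andP[u0 u1] ha hp hq; rewrite normrM ger0_norm ?expR_ge0//.
  have ek : expR (- (u * c)) <= expR k.
    rewrite ler_expR (le_trans (ler_norm _))// normrN normrM ger0_norm//.
    rewrite (@le_trans _ _ (1 * `|c|))// ?ler_wpM2r// mul1r /k lerDl//.
  have kn0 : 0 <= k ^+ N / N`!%:R by exact: le_trans hp.
  rewrite /bd (_ : 2 * expR k * k * _ = expR k * (2 * (k * (k ^+ N / N`!%:R)))); last ring.
  apply: ler_pM; rewrite ?expR_ge0//.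
  apply: (le_trans (ler_normD _ _)); rewrite !normrM.
  have h1 : `|a1| * `|p| <= `|a1| * (k ^+ N / N`!%:R) by rewrite ler_wpM2l.
  have h2 : `|a2| * `|q| <= `|a2| * (k ^+ N / N`!%:R) by rewrite ler_wpM2l.
  have h3 : (`|a1| + `|a2|) * (k ^+ N / N`!%:R) <= k * (k ^+ N / N`!%:R) by rewrite ler_wpM2r.
  have k0 : 0 <= k by rewrite addr_ge0.
  have := mulr_ge0 k0 kn0; lra.
have c1 v : `|cos v| <= 1 :> R by rewrite ler_norml cos_le1 cos_geN1.
have s1 v : `|sin v| <= 1 :> R by rewrite ler_norml sin_le1 sin_geN1.
have sN1 v : `|- sin v| <= 1 :> R by rewrite normrN.
split.
- have := @mvt_bound W _ (bd N) DW.
  rewrite /W !mul1r !mul0r oppr0 expR0 cos0 sin0 !e0 /= !(mul1r, mul0r, addr0); apply.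
  move=> u u01; apply: B => //; rewrite ?normrN//; exact: esum_step_bound.
- have := @mvt_bound Z _ (bd N) DZ.
  rewrite /Z !mul1r !mul0r oppr0 expR0 cos0 sin0 !e0 /= !(mul1r, mul0r, subr0); apply.
  move=> u u01; apply: B => //; rewrite ?normrN//; exact: esum_step_bound.
Qed.

Lemma cvg_bd : bd n @[n --> \oo] --> 0.
Proof.
rewrite (_ : nbhs (0 : R) = nbhs (2 * expR k * k * 0)); last by rewrite mulr0.
apply: cvgM; [exact: cvg_cst|exact: cvg_pow_fact].
Qed.

Lemma cexp_series :
  esum_ r N 1 @[N --> \oo] --> expR c * cos s /\
  esum_ i N 1 @[N --> \oo] --> expR c * sin s.
Proof.
pose W N := expR (- c) * (cos s * esum_ r N.+1 1 + sin s * esum_ i N.+1 1).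
pose Z N := expR (- c) * (cos s * esum_ i N.+1 1 - sin s * esum_ r N.+1 1).
have cW : W N @[N --> \oo] --> (1 : R).
  apply/subr_cvg0; apply: norm_cvg0.
  apply: (@squeeze_cvgr _ _ _ _ (cst 0) bd) => //; [|exact: cvg_cst|exact: cvg_bd].
  by apply: nearW => N; rewrite /= normr_ge0/=; case: (rot_bounds N).
have cZ : Z N @[N --> \oo] --> (0 : R).
  apply: norm_cvg0.
  apply: (@squeeze_cvgr _ _ _ _ (cst 0) bd) => //; [|exact: cvg_cst|exact: cvg_bd].
  by apply: nearW => N; rewrite /= normr_ge0/=; case: (rot_bounds N).
have ec : expR c * expR (- c) = 1 by rewrite -expRD subrr expR0.
have cs := cos2Dsin2 s.
split; rewrite -(cvg_shiftS _).
- have -> : (fun n => esum_ r n.+1 1) = (fun n => expR c * (cos s * W n - sin s * Z n)).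
    apply/funext => n; rewrite /W /Z.
    transitivity ((expR c * expR (- c)) * (cos s ^+ 2 + sin s ^+ 2) * esum_ r n.+1 1).
      by rewrite ec cs !mul1r.
    ring.
  rewrite (_ : expR c * cos s = expR c * (cos s * 1 - sin s * 0)); last ring.
  by apply: cvgM; [exact: cvg_cst|apply: cvgB; apply: cvgM => //; exact: cvg_cst].
- have -> : (fun n => esum_ i n.+1 1) = (fun n => expR c * (sin s * W n + cos s * Z n)).
    apply/funext => n; rewrite /W /Z.
    transitivity ((expR c * expR (- c)) * (cos s ^+ 2 + sin s ^+ 2) * esum_ i n.+1 1).
      by rewrite ec cs !mul1r.
    ring.
  rewrite (_ : expR c * sin s = expR c * (sin s * 1 + cos s * 0)); last ring.
  by apply: cvgM; [exact: cvg_cst|apply: cvgD; apply: cvgM => //; exact: cvg_cst].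
Qed.

End fixed.
End complex_exponential.

(** * Fourier inversion integrals and exponential convolution series *)

Section fourier_synthesis.
Context (R : realType) (d : nat).
Local Notation V := (d.-tuple R).
Variable leb : {sigma_finite_measure set V -> \bar R}.

(** Cartesian form of [U], with a + i b = rho exp(i th); convolution acts linearly on the pair (a,
    b). *)
Definition UU (a b : V -> R) (x : V) : R :=
  RI leb (fun xi => a xi * cos (dotv x xi) + b xi * sin (dotv x xi)).

(** Real part of the inversion integral of the characteristic function rho exp(i th), without the
    factor 1 / (2 pi)^d. *)
Definition U (rho th : V -> R) (x : V) : R :=
  RI leb (fun xi => rho xi * cos (dotv x xi - th xi)).

(** Convolution of u with the measure m lam. The reference measure is a parameter because the
    Gaussian part uses Dirac masses and the jump part Lebesgue measure. *)
Definition vconv (lam : {sigma_finite_measure set V -> \bar R}) (m u : V -> R) (x : V) : R :=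
  RI lam (fun y => m y * u (vsub x y)).

Lemma U_UU (rho th : V -> R) (x : V) :
  U rho th x = UU (fun xi => rho xi * cos (th xi)) (fun xi => rho xi * sin (th xi)) x.
Proof. by apply: RI_ext => xi; rewrite cosB; ring. Qed.

Lemma normcos (v : R) : `|cos v| <= 1. Proof. by rewrite ler_norml cos_le1 cos_geN1. Qed.
Lemma normsin (v : R) : `|sin v| <= 1. Proof. by rewrite ler_norml sin_le1 sin_geN1. Qed.

Lemma UU_integrand_le (a b : V -> R) (x xi : V) :
  `|a xi * cos (dotv x xi) + b xi * sin (dotv x xi)| <= `|a xi| + `|b xi|.
Proof.
apply: (le_trans (ler_normD _ _)); rewrite !normrM.
by apply: lerD; rewrite -[X in _ <= X]mulr1 ler_wpM2l// ?normcos ?normsin.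
Qed.

Lemma Itg_UU (a b : V -> R) (x : V) : Itg leb a -> Itg leb b ->
  Itg leb (fun xi => a xi * cos (dotv x xi) + b xi * sin (dotv x xi)).
Proof.
move=> ia ib; have ma := Itg_meas ia; have mb := Itg_meas ib.
apply: (Itg_dom _ (UU_integrand_le a b x)); first by mfun.
by apply: ItgD; exact: Itg_abs.
Qed.

Lemma measurable_U (rho th : V -> R) : measurable_fun setT rho -> measurable_fun setT th ->
  measurable_fun setT (U rho th).
Proof.
move=> ma mb.
apply: (measurable_RI leb (F := fun z : V * V => rho z.2 * cos (dotv z.1 z.2 - th z.2))).
mfun.
Qed.

Section conv_exp.
Variables (lam : {sigma_finite_measure set V -> \bar R}) (m : V -> R).
Hypothesis m0 : forall y, 0 <= m y.
Hypothesis im : Itg lam m.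
Let mm : measurable_fun setT m := Itg_meas im.

Definition fcos xi := RI lam (fun y => m y * cos (dotv xi y)).
Definition fsin xi := RI lam (fun y => m y * sin (dotv xi y)).

Lemma Itg_fcos xi : Itg lam (fun y => m y * cos (dotv xi y)).
Proof.
apply: (Itg_dom _ _ im); first by mfun.
by move=> y; rewrite normrM (ger0_norm (m0 y)) -[X in _ <= X]mulr1 ler_wpM2l// normcos.
Qed.
Lemma Itg_fsin xi : Itg lam (fun y => m y * sin (dotv xi y)).
Proof.
apply: (Itg_dom _ _ im); first by mfun.
by move=> y; rewrite normrM (ger0_norm (m0 y)) -[X in _ <= X]mulr1 ler_wpM2l// normsin.
Qed.
Lemma mfcos : measurable_fun setT fcos.
Proof. by apply: (measurable_RI lam (F := fun z : V * V => m z.2 * cos (dotv z.1 z.2))); mfun. Qed.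
Lemma mfsin : measurable_fun setT fsin.
Proof. by apply: (measurable_RI lam (F := fun z : V * V => m z.2 * sin (dotv z.1 z.2))); mfun. Qed.
Lemma fcos_le xi : `|fcos xi| <= RI lam m.
Proof.
apply: RI_abs_le => //; first by mfun.
by move=> y; rewrite normrM (ger0_norm (m0 y)) -[X in _ <= X]mulr1 ler_wpM2l// normcos.
Qed.
Lemma fsin_le xi : `|fsin xi| <= RI lam m.
Proof.
apply: RI_abs_le => //; first by mfun.
by move=> y; rewrite normrM (ger0_norm (m0 y)) -[X in _ <= X]mulr1 ler_wpM2l// normsin.
Qed.

(** The new pair is the complex product of a + i b with the Fourier transform fcos + i fsin of m. *)
Lemma conv_UU (a b : V -> R) (x : V) : Itg leb a -> Itg leb b ->
  vconv lam m (UU a b) x = UU (fun xi => a xi * fcos xi - b xi * fsin xi)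
    (fun xi => a xi * fsin xi + b xi * fcos xi) x.
Proof.
move=> ia ib; have ma := Itg_meas ia; have mb := Itg_meas ib.
pose F (z : V * V) := m z.1 * (a z.2 * cos (dotv (vsub x z.1) z.2) + b z.2 * sin (dotv (vsub x z.1) z.2)).
rewrite /vconv; transitivity (RI lam (fun y => RI leb (fun xi => F (y, xi)))).
  by apply: RI_ext => y; rewrite /F /= RIZ//; exact: Itg_UU.
rewrite (@fubini_prod_dom _ _ _ _ _ lam leb F m (fun xi => `|a xi| + `|b xi|)) => //.
- rewrite /UU; apply: RI_ext => xi; rewrite /F /=.
  rewrite (RI_ext lam (_ : _ =1 (fun y =>
     (a xi * cos (dotv x xi) + b xi * sin (dotv x xi)) * (m y * cos (dotv xi y)) +
     (a xi * sin (dotv x xi) - b xi * cos (dotv x xi)) * (m y * sin (dotv xi y))))).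
    rewrite RID ?RIZ; [|exact: Itg_fsin|exact: Itg_fcos|exact: ItgZ (Itg_fcos _)|exact: ItgZ (Itg_fsin _)].
    by rewrite -/(fcos xi) -/(fsin xi); ring.
  by move=> y; rewrite dotvBl cosB sinB (dotvC y xi); ring.
- by rewrite /F; mfun.
- by apply: ItgD; exact: Itg_abs.
- move=> y xi; rewrite /F /= normrM (ger0_norm (m0 y)) ler_wpM2l//; exact: UU_integrand_le.
Qed.

Let r n xi := (cpow (fcos xi) (fsin xi) n).1.
Let i n xi := (cpow (fcos xi) (fsin xi) n).2.
Let M := RI lam m.

Lemma M_ge0 : 0 <= RI lam m. Proof. exact: RI_ge0. Qed.

Lemma ri_le n xi : `|r n xi| + `|i n xi| <= (2 * M) ^+ n.
Proof.
apply: (le_trans (cpow_bound _ _ _)); apply: lerXn2r; rewrite ?nnegrE ?addr_ge0//.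
  by rewrite mulr_ge0// M_ge0.
by rewrite mulr2n mulrDl mul1r lerD// ?fcos_le ?fsin_le.
Qed.

Lemma mri n : measurable_fun setT (r n) /\ measurable_fun setT (i n).
Proof.
have mc := mfcos; have ms := mfsin.
elim: n => [|n [mr mi]]; first by split; exact: measurable_cst.
by split; rewrite /r /i /=; apply: mf_add; (try apply: mf_opp); apply: mf_mul.
Qed.

Lemma Itg_mul_bd (a g : V -> R) (C : R) : Itg leb a -> measurable_fun setT g ->
  (forall xi, `|g xi| <= C) -> Itg leb (fun xi => a xi * g xi).
Proof.
move=> ia mg gC; have ma := Itg_meas ia.
apply: (@Itg_dom _ _ _ _ _ (fun xi => C * `|a xi|)); first by mfun.
  by move=> xi; rewrite normrM mulrC ler_wpM2r.
by apply: ItgZ; exact: Itg_abs.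
Qed.

Lemma Itg_ri (a : V -> R) n : Itg leb a -> Itg leb (fun xi => a xi * r n xi) /\ Itg leb (fun xi => a xi * i n xi).
Proof.
move=> ia; have [mr mi] := mri n; split.
- apply: (Itg_mul_bd ia mr) => xi; apply: le_trans (ri_le n xi); by rewrite lerDl.
- apply: (Itg_mul_bd ia mi) => xi; apply: le_trans (ri_le n xi); by rewrite lerDr.
Qed.

Lemma iter_conv_UU (a b : V -> R) n : Itg leb a -> Itg leb b ->
  iter n (vconv lam m) (UU a b) = UU (fun xi => a xi * r n xi - b xi * i n xi)
    (fun xi => a xi * i n xi + b xi * r n xi).
Proof.
move=> ia ib; elim: n => [|n IH].
  by apply/funext => x /=; apply: RI_ext => xi; rewrite /r /i /=; ring.
rewrite iterS IH; apply/funext => x; rewrite conv_UU.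
- by apply: RI_ext => xi; rewrite /r /i /=; ring.
- by apply: ItgB; [case: (Itg_ri n ia)|case: (Itg_ri n ib)].
- by apply: ItgD; [case: (Itg_ri n ia)|case: (Itg_ri n ib)].
Qed.

Lemma sum_pow_fact_le (x : R) N : 0 <= x -> \sum_(n < N) x ^+ n / n`!%:R <= expR x.
Proof.
move=> x0; have h := is_cvg_series_exp_coeff x.
have := nondecreasing_cvgn_le (_ : nondecreasing_seq (series (exp_coeff x))) h N.
rewrite -/(expR x) /series/= big_mkord; apply.
apply: nondecreasing_series => n _ _; exact: exp_coeff_ge0.
Qed.

(** The n-th iterate multiplies a + i b by the n-th complex power of the transform, so a partial sum
    is the inversion integral of a Taylor polynomial of the exponential. As |fcos| + |fsin| <= 2 M,
    all these polynomials are bounded by exp(2 M) and dominated convergence applies. *)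
Lemma conv_exp_UU (a b : V -> R) (x : V) : Itg leb a -> Itg leb b ->
  \sum_(n < N) iter n (vconv lam m) (UU a b) x / n`!%:R @[N --> \oo] -->
  UU (fun xi => expR (fcos xi) * (a xi * cos (fsin xi) - b xi * sin (fsin xi)))
     (fun xi => expR (fcos xi) * (a xi * sin (fsin xi) + b xi * cos (fsin xi))) x.
Proof.
move=> ia ib; have ma := Itg_meas ia; have mb := Itg_meas ib.
pose er N xi := esum_ (fun n => r n xi) N 1.
pose ei N xi := esum_ (fun n => i n xi) N 1.
pose G N xi := (a xi * er N xi - b xi * ei N xi) * cos (dotv x xi) +
  (a xi * ei N xi + b xi * er N xi) * sin (dotv x xi).
have mer N : measurable_fun setT (er N).
  apply: mf_sum => n; have [mr _] := mri n; mfun.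
have mei N : measurable_fun setT (ei N).
  apply: mf_sum => n; have [_ mi] := mri n; mfun.
have er_le N xi : `|er N xi| <= expR (2 * M).
  apply: (le_trans (ler_norm_sum _ _ _)).
  apply: le_trans (sum_pow_fact_le N _); last by rewrite mulr_ge0// M_ge0.
  apply: ler_sum => n _; rewrite expr1n mulr1 normrM normfV (ger0_norm (ler0n _ _)).
  rewrite ler_wpM2r ?invr_ge0//; apply: le_trans (ri_le n xi); by rewrite lerDl.
have ei_le N xi : `|ei N xi| <= expR (2 * M).
  apply: (le_trans (ler_norm_sum _ _ _)).
  apply: le_trans (sum_pow_fact_le N _); last by rewrite mulr_ge0// M_ge0.
  apply: ler_sum => n _; rewrite expr1n mulr1 normrM normfV (ger0_norm (ler0n _ _)).
  rewrite ler_wpM2r ?invr_ge0//; apply: le_trans (ri_le n xi); by rewrite lerDr.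
have E N : \sum_(n < N) iter n (vconv lam m) (UU a b) x / n`!%:R = RI leb (G N).
  elim: N => [|N IH].
    rewrite big_ord0 (RI_ext leb (_ : _ =1 (fun=> 0))) ?RI0// => xi.
    by rewrite /G /er /ei /esum_ !big_ord0; ring.
  rewrite big_ord_recr/= IH iter_conv_UU// /UU mulrC -RIZ; last first.
    apply: Itg_UU.
      by apply: ItgB; [case: (Itg_ri N ia)|case: (Itg_ri N ib)].
    by apply: ItgD; [case: (Itg_ri N ia)|case: (Itg_ri N ib)].
  rewrite -RID.
  - by apply: RI_ext => xi; rewrite /G /er /ei !esum_recr expr1n; ring.
  - apply: Itg_UU.
      by apply: ItgB; [exact: (Itg_mul_bd ia (mer N) (er_le N))|exact: (Itg_mul_bd ib (mei N) (ei_le N))].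
    by apply: ItgD; [exact: (Itg_mul_bd ia (mei N) (ei_le N))|exact: (Itg_mul_bd ib (mer N) (er_le N))].
  - apply: ItgZ; apply: Itg_UU.
      by apply: ItgB; [case: (Itg_ri N ia)|case: (Itg_ri N ib)].
    by apply: ItgD; [case: (Itg_ri N ia)|case: (Itg_ri N ib)].
rewrite (_ : (fun N => \sum_(n < N) _) = (fun N => RI leb (G N))); last exact/funext.
have := @RI_dct _ _ _ leb G (fun xi => expR (fcos xi) * (a xi * cos (fsin xi) - b xi * sin (fsin xi)) * cos (dotv x xi)
  + expR (fcos xi) * (a xi * sin (fsin xi) + b xi * cos (fsin xi)) * sin (dotv x xi))
  (fun xi => 2 * expR (2 * M) * (`|a xi| + `|b xi|)).
case => //.
- by move=> N; have := mer N; have := mei N; rewrite /G => m1 m2; mfun.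
- move=> N xi; apply: (le_trans (UU_integrand_le (fun xi => a xi * er N xi - b xi * ei N xi) (fun xi => a xi * ei N xi + b xi * er N xi) x xi)).
  have := ler_normB (a xi * er N xi) (b xi * ei N xi).
  have := ler_normD (a xi * ei N xi) (b xi * er N xi).
  rewrite !normrM.
  have h1 := ler_wpM2l (normr_ge0 (a xi)) (er_le N xi).
  have h2 := ler_wpM2l (normr_ge0 (a xi)) (ei_le N xi).
  have h3 := ler_wpM2l (normr_ge0 (b xi)) (er_le N xi).
  have h4 := ler_wpM2l (normr_ge0 (b xi)) (ei_le N xi).
  lra.
- by apply: ItgZ; apply: ItgD; exact: Itg_abs.
- move=> xi; have [cr ci] := cexp_series (fcos xi) (fsin xi).
  rewrite (_ : expR (fcos xi) * (a xi * cos (fsin xi) - b xi * sin (fsin xi)) =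
    a xi * (expR (fcos xi) * cos (fsin xi)) - b xi * (expR (fcos xi) * sin (fsin xi))); last ring.
  rewrite (_ : expR (fcos xi) * (a xi * sin (fsin xi) + b xi * cos (fsin xi)) =
    a xi * (expR (fcos xi) * sin (fsin xi)) + b xi * (expR (fcos xi) * cos (fsin xi))); last ring.
  apply: cvgD; (apply: cvgM; last exact: cvg_cst).
    by apply: cvgB; apply: cvgM => //; exact: cvg_cst.
  by apply: cvgD; apply: cvgM => //; exact: cvg_cst.
Qed.

(* adding compound Poisson jumps of intensity m multiplies the characteristic
   function by exp(int (e^{i xi.y} - 1) m) *)
Lemma conv_exp (rho th : V -> R) (x : V) : Itg leb rho -> measurable_fun setT th ->
  \sum_(n < N) iter n (vconv lam m) (U rho th) x / n`!%:R @[N --> \oo] -->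
  expR (RI lam m) * U (fun xi => rho xi * expR (- RI lam (fun y => m y * (1 - cos (dotv xi y)))))
     (fun xi => th xi + RI lam (fun y => m y * sin (dotv xi y))) x.
Proof.
move=> ir mth; have mr := Itg_meas ir.
pose a xi := rho xi * cos (th xi); pose b xi := rho xi * sin (th xi).
have ia : Itg leb a by apply: (Itg_mul_bd ir _ (fun xi => normcos (th xi))); mfun.
have ib : Itg leb b by apply: (Itg_mul_bd ir _ (fun xi => normsin (th xi))); mfun.
have -> : U rho th = UU a b by apply/funext => y; exact: U_UU.
have := @conv_exp_UU a b x ia ib.
set L := UU _ _ x; set L' := expR _ * _; suff -> : L' = L by [].
rewrite /L /L' /U /UU -RIZ.
  apply: RI_ext => xi.
  have -> : RI lam (fun y => m y * (1 - cos (dotv xi y))) = RI lam m - fcos xi.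
    rewrite -RIB//; last exact: Itg_fcos.
    by apply: RI_ext => y; ring.
  have -> : - (RI lam m - fcos xi) = - RI lam m + fcos xi by ring.
  rewrite expRD -/(fsin xi).
  have e1 : expR (RI lam m) * expR (- RI lam m) = 1 by rewrite -expRD subrr expR0.
  rewrite /a /b opprD addrA cosB cosB sinB.
  transitivity ((expR (RI lam m) * expR (- RI lam m)) * (expR (fcos xi) *
   ((rho xi * cos (th xi) * cos (fsin xi) - rho xi * sin (th xi) * sin (fsin xi)) * cos (dotv x xi) +
     (rho xi * cos (th xi) * sin (fsin xi) + rho xi * sin (th xi) * cos (fsin xi)) * sin (dotv x xi)))).
    ring.
  by rewrite e1; ring.
have mc := mfcos; have ms := mfsin.
have mc1 : measurable_fun setT (fun xi => RI lam (fun y => m y * (1 - cos (dotv xi y)))).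
  by apply: (measurable_RI lam (F := fun z : V * V => m z.2 * (1 - cos (dotv z.1 z.2)))); mfun.
apply: (@Itg_dom _ _ _ _ _ (fun xi => `|rho xi|)).
- by apply: mf_mul; [apply: mf_mul => //; apply: mf_exp; exact: mf_opp|apply: mf_cos; apply: mf_add; [mfun|apply: mf_opp; exact: mf_add]].
- move=> xi; rewrite !normrM -mulrA -[X in _ <= X]mulr1 ler_wpM2l//.
  rewrite -[X in _ <= X]mulr1; apply: ler_pM => //; last exact: normcos.
  rewrite ger0_norm ?expR_ge0// -expR0 ler_expR oppr_le0; apply: RI_ge0 => y.
  by rewrite mulr_ge0// subr_ge0 cos_le1.
- exact: Itg_abs.
Qed.

End conv_exp.
End fourier_synthesis.

Lemma RI_mct (R : realType) d0 (T : measurableType d0) (mu : {measure set T -> \bar R})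
  (u_ : nat -> T -> R) (u : T -> R) (c : R) :
  (forall n, Itg mu (u_ n)) -> (forall n x, 0 <= u_ n x) ->
  (forall x n m, (n <= m)%N -> u_ n x <= u_ m x) ->
  (forall x, u_ n x @[n --> \oo] --> u x) ->
  RI mu (u_ n) @[n --> \oo] --> c ->
  Itg mu u /\ RI mu u = c.
Proof.
move=> iu u0 nd cu cc.
have mu_ n := Itg_meas (iu n).
have mu0 : measurable_fun setT u.
  by apply: (@measurable_fun_cvg _ _ _ setT u_) => // x _; exact: cu.
have u0' x : 0 <= u x by apply: (cvg_ge (cu x)) => n.
have E := @cvg_monotone_convergence _ _ _ mu setT measurableT (fun n x => (u_ n x)%:E).
have {}E : (\int[mu]_x (u_ n x)%:E)%E @[n --> \oo] --> (\int[mu]_x (u x)%:E)%E.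
  have -> : (fun x => (u x)%:E) = (fun x => limn (fun n => (u_ n x)%:E)).
    apply/funext => x; apply/esym/cvg_lim => //.
    by apply/cvg_EFin; [exact: nearW|exact: cu].
  apply: E.
  - by move=> n; exact/measurable_EFinP.
  - by move=> n x _; rewrite lee_fin.
  - by move=> x _ n m nm; rewrite lee_fin nd.
have E2 : (\int[mu]_x (u_ n x)%:E)%E @[n --> \oo] --> c%:E.
  rewrite (_ : (fun n => _) = (fun n => (RI mu (u_ n))%:E)).
    by apply/cvg_EFin; [exact: nearW|exact: cc].
  by apply/funext => n; rewrite RI_E.
have E3 : (\int[mu]_x (u x)%:E)%E = c%:E by apply: cvg_unique E E2; exact: ereal_hausdorff.
have iu0 : Itg mu u by apply: Itg_of_E => //; rewrite E3 ltry.
by split => //; move: E3; rewrite RI_E// => -[].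
Qed.

(** * From exponential moments to pointwise bounds, and limits of moments *)

Section nonneg_kernels.
Context (R : realType) (d : nat).
Local Notation V := (d.-tuple R).
Variable leb : {sigma_finite_measure set V -> \bar R}.
Hypothesis Hleb : is_lebesgue leb.

(** Since exp(a.x) = exp(a.y) exp(a.(x - y)), Tonelli and translation invariance factor the
    exponential moment of a convolution. *)
Lemma conv_mgf (lam : {sigma_finite_measure set V -> \bar R}) (m u : V -> R) (C : R) (a : V) :
  (forall y, 0 <= m y) -> Itg lam m -> Itg lam (fun y => m y * expR (dotv a y)) ->
  (forall x, 0 <= u x <= C) -> measurable_fun setT u ->
  Itg leb (fun x => expR (dotv a x) * u x) ->
  [/\ forall x, 0 <= vconv lam m u x <= RI lam m * C,
      measurable_fun setT (vconv lam m u),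
      Itg leb (fun x => expR (dotv a x) * vconv lam m u x) &
      RI leb (fun x => expR (dotv a x) * vconv lam m u x) =
      RI lam (fun y => m y * expR (dotv a y)) * RI leb (fun x => expR (dotv a x) * u x)].
Proof.
move=> m0 im ima uC mu iu.
have mm := Itg_meas im.
have u0 x : 0 <= u x by case/andP: (uC x).
have u1 x : u x <= C by case/andP: (uC x).
have imu x : Itg lam (fun y => m y * u (vsub x y)).
  apply: (@Itg_dom _ _ _ _ _ (fun y => C * m y)); [by mfun| |exact: ItgZ].
  by move=> y; rewrite normrM !ger0_norm// mulrC ler_wpM2r.
have mc : measurable_fun setT (vconv lam m u).
  by apply: (measurable_RI lam (F := fun z : V * V => m z.2 * u (vsub z.1 z.2))); mfun.
pose F (z : V * V) := expR (dotv a z.1) * (m z.2 * u (vsub z.1 z.2)).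
have mF : measurable_fun setT F by rewrite /F; mfun.
have FE (y x : V) : F (x, y) = (m y * expR (dotv a y)) * (expR (dotv a (vsub x y)) * u (vsub x y)).
  rewrite /F /= dotvBr expRD expRN; field; exact: lt0r_neq0 (expR_gt0 _).
have i1 y : Itg leb (fun x => F (x, y)).
  apply: (Itg_ext (fun x => esym (FE y x))); apply: ItgZ.
  exact: (Itg_translB Hleb y iu).
have R1 y : RI leb (fun x => F (x, y)) = RI leb (fun x => expR (dotv a x) * u x) * (m y * expR (dotv a y)).
  rewrite (RI_ext leb (FE y)) RIZ; last exact: (Itg_translB Hleb y iu).
  by rewrite (RI_translB Hleb y iu) mulrC.
have [I1 E1] : Itg leb (fun x => RI lam (fun y => F (x, y))) /\
   RI leb (fun x => RI lam (fun y => F (x, y))) = RI lam (fun y => RI leb (fun x => F (x, y))).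
  apply: tonelli_real => //.
  - by move=> [x y]; rewrite /F /= !mulr_ge0// expR_ge0.
  - by move=> x; rewrite /F /=; exact: (ItgZ _ (imu x)).
  - by apply: (Itg_ext (fun y => esym (R1 y))); apply: ItgZ.
have E2 x : RI lam (fun y => F (x, y)) = expR (dotv a x) * vconv lam m u x.
  by rewrite /F /= RIZ.
split => //.
- move=> x; apply/andP; split; first by apply: RI_ge0 => y; rewrite mulr_ge0.
  rewrite mulrC -RIZ//; apply: RI_le => //; first exact: ItgZ.
  by move=> y; rewrite mulrC ler_wpM2r.
- exact: (Itg_ext E2).
- rewrite -(RI_ext leb E2) E1 (RI_ext lam R1) RIZ//; exact: mulrC.
Qed.

Definition unitv (i : 'I_d) : V := [tuple (j == i)%:R | j < d].

Lemma dotv_unitv i (x : V) : dotv (unitv i) x = tnth x i.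
Proof.
rewrite /dotv (bigD1 i)//= tnth_mktuple eqxx mul1r big1 ?addr0// => j /negbTE ji.
by rewrite tnth_mktuple ji mul0r.
Qed.

Lemma normv_unitv i : normv (unitv i) = 1.
Proof. by rewrite /normv dotv_unitv tnth_mktuple eqxx sqrtr1. Qed.

Lemma leb_box_centered (x : V) (r : R) : 0 <= r ->
  leb (box (vsub x [tuple r | i < d]) (vadd x [tuple r | i < d])) = ((2 * r) ^+ d)%:E.
Proof.
move=> r0; rewrite Hleb => [|i]; last by rewrite !tnthE tnth_mktuple; lra.
congr EFin; rewrite -[X in _ ^+ X]card_ord -prodr_const; apply: eq_bigr => i _.
by rewrite !tnthE tnth_mktuple; ring.
Qed.

Lemma Itg_indic_box (a b : V) : Itg leb (\1_(box a b) : V -> R) /\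
  RI leb (\1_(box a b) : V -> R) = fine (leb (box a b)).
Proof.
have mB : measurable (box a b) by exact: box_meas.
have fB : (leb (box a b) < +oo)%E.
  have [ab|] := boolP [forall i, tnth a i <= tnth b i].
    by rewrite Hleb ?ltry//; exact/forallP.
  rewrite negb_forall => /existsP[i]; rewrite -ltNge => ba.
  rewrite (_ : box a b = set0) ?measure0//.
  rewrite -subset0 => x /(_ i) /andP[h1 h2].
  by have := lt_trans ba (lt_le_trans h1 h2); rewrite ltxx.
have iB : Itg leb (\1_(box a b) : V -> R).
  by apply: Itg_of_E => //; rewrite integral_indic// setIT.
by split => //; rewrite /Rintegral integral_indic// setIT.
Qed.

(* A Lipschitz density that is large at x is large on a neighbourhood of x, so
   its exponential moments control its values. *)
Lemma pointwise_bound (m : V -> R) (L B Lam : R) (x : V) : (0 < d)%N ->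
  0 < L -> 0 <= Lam -> (forall y, 0 <= m y <= 2 * L) ->
  (forall y z, `|m y - m z| <= L * normv (vsub y z)) ->
  (forall a : V, normv a = Lam -> Itg leb (fun y => expR (dotv a y) * m y) /\
      RI leb (fun y => expR (dotv a y) * m y) <= B) ->
  m x ^+ d.+1 <= 2 * B * (d%:R * L) ^+ d * expR (- (Lam * (normv x / d%:R - 1))).
Proof.
move=> d0 L0 Lam0 mL lip mgf.
have dp : 0 < d%:R :> R by rewrite ltr0n.
have [i hi] := exists_big_coord x d0.
(* The vector a points along the largest coordinate of x with its sign, so that a.x >= Lam |x| /
   d. *)
pose sg : R := if 0 <= tnth x i then 1 else -1.
have sgx : sg * tnth x i = `|tnth x i|.
  by rewrite /sg; case: ifPn => h; [rewrite mul1r ger0_norm|rewrite mulN1r ltr0_norm// ltNge].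
have sgn : `|sg| = 1 by rewrite /sg; case: ifP; rewrite ?normrN normr1.
pose a := vscale (Lam * sg) (unitv i).
have na : normv a = Lam by rewrite normvZ normv_unitv mulr1 normrM sgn mulr1 ger0_norm.
have [Ia Ba] := mgf a na.
set A := m x; have /andP[A0 A2] := mL x; rewrite -/A in A0 A2.
(* Within distance r of x the Lipschitz bound keeps m above A / 2; the cube of half-width r / d lies
   in that ball. *)
pose r := A / (2 * L).
have r0 : 0 <= r by rewrite divr_ge0// mulr_ge0// ltW.
have r1 : r <= 1 by rewrite ler_pdivrMr ?mul1r// mulr_gt0.
have rd0 : 0 <= r / d%:R by rewrite divr_ge0// ltW.
pose Q := box (vsub x [tuple r / d%:R | i < d]) (vadd x [tuple r / d%:R | i < d]).
have [iQ RQ] := Itg_indic_box (vsub x [tuple r / d%:R | i < d]) (vadd x [tuple r / d%:R | i < d]).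
rewrite -/Q leb_box_centered//= in iQ RQ.
have low : expR (Lam * (`|tnth x i| - 1)) * (A / 2) * (2 * (r / d%:R)) ^+ d <= B.
  apply: le_trans Ba; rewrite -RQ -RIZ//; apply: RI_le => //; first exact: ItgZ.
  move=> y; rewrite indicE; case: (boolP (y \in Q)) => yQ; last first.
    by rewrite mulr0 mulr_ge0 ?expR_ge0//; case/andP: (mL y).
  rewrite mulr1; have /= {}yQ := set_mem yQ.
  have cy j : `|tnth (vsub x y) j| <= r / d%:R.
    have := yQ j; rewrite !tnthE !tnth_mktuple => /andP[h1 h2].
    by rewrite ler_norml; apply/andP; split; lra.
  have nxy : normv (vsub x y) <= r.
    apply: (le_trans (normv_le_coord cy)); rewrite mulrC divfK//; exact: lt0r_neq0.
  apply: ler_pM; rewrite ?expR_ge0 ?divr_ge0//.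
    rewrite ler_expR dotvZl dotv_unitv -mulrA ler_wpM2l//.
    have : `|tnth x i - tnth y i| <= 1.
      rewrite -tnth_vsub; apply: (le_trans (coord_le_normv _ _)); exact: le_trans r1.
    rewrite -sgx => h; have : `|sg * (tnth x i - tnth y i)| <= 1 by rewrite normrM sgn mul1r.
    by move/(le_trans (ler_norm _)); lra.
  have := lip x y => h.
  have h2 : L * normv (vsub x y) <= A / 2.
    apply: (@le_trans _ _ (L * r)); first by rewrite ler_pM2l.
    by rewrite /r le_eqVlt; apply/orP; left; apply/eqP; field; exact: lt0r_neq0.
  have := le_trans (ler_norm _) (le_trans h h2); rewrite -/A; lra.
have E : A ^+ d.+1 = (A / 2) * (2 * (r / d%:R)) ^+ d * (2 * (d%:R * L) ^+ d).
  rewrite /r exprS.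
  have -> : A = 2 * (A / (2 * L) / d%:R) * (d%:R * L).
    by field; rewrite !lt0r_neq0.
  rewrite [in LHS]exprMn; set X := (2 * (A / (2 * L) / d%:R)).
  have -> : 2 * (X * (d%:R * L) / (2 * L) / d%:R) = X by field; rewrite !lt0r_neq0.
  by field.
have e1 : expR (Lam * (`|tnth x i| - 1)) * expR (- (Lam * (`|tnth x i| - 1))) = 1.
  by rewrite -expRD subrr expR0.
have P0 : 0 <= 2 * (d%:R * L) ^+ d by rewrite mulr_ge0// exprn_ge0// mulr_ge0// ltW.
have B0 : 0 <= B.
  by apply: le_trans low; rewrite !mulr_ge0 ?expR_ge0// exprn_ge0// mulr_ge0.
apply: (@le_trans _ _ (2 * B * (d%:R * L) ^+ d * expR (- (Lam * (`|tnth x i| - 1))))).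
  have h := ler_wpM2r (mulr_ge0 P0 (expR_ge0 (- (Lam * (`|tnth x i| - 1))))) low.
  apply: (@le_trans _ _ (B * (2 * (d%:R * L) ^+ d * expR (- (Lam * (`|tnth x i| - 1)))))); last first.
    by rewrite le_eqVlt; apply/orP; left; apply/eqP; ring.
  apply: le_trans h; rewrite E [X in _ <= X](_ : _ =
    (expR (Lam * (`|tnth x i| - 1)) * expR (- (Lam * (`|tnth x i| - 1)))) *
    (A / 2 * (2 * (r / d%:R)) ^+ d * (2 * (d%:R * L) ^+ d))); last ring.
  by rewrite e1 mul1r.
rewrite ler_wpM2l//; first by rewrite !mulr_ge0// exprn_ge0// mulr_ge0// ltW.
rewrite ler_expR lerN2 ler_wpM2l// lerB// ler_pdivrMr// mulrC; exact: hi.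
Qed.

(** [pointwise_bound] divides the rate by d and controls the power d + 1 of m; moments of rate l d
    (d + 1) therefore leave decay at rate l. *)
Lemma pointwise_exp_bound (m : V -> R) (L B l : R) : (0 < d)%N ->
  0 < L -> 0 <= l -> 0 <= B -> (forall y, 0 <= m y <= 2 * L) ->
  (forall y z, `|m y - m z| <= L * normv (vsub y z)) ->
  (forall a : V, normv a = l * (d * d.+1)%:R -> Itg leb (fun y => expR (dotv a y) * m y) /\
      RI leb (fun y => expR (dotv a y) * m y) <= B) ->
  forall x, m x <= (1 + 2 * B * (d%:R * L) ^+ d * expR (l * (d * d.+1)%:R)) * expR (- (l * normv x)).
Proof.
move=> d0 L0 l0 B0 mL lip mgf x.
have dp : 0 < d%:R :> R by rewrite ltr0n.
have := @pointwise_bound m L B _ x d0 L0 _ mL lip mgf.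
rewrite mulr_ge0// => /(_ isT) h.
set Y := 2 * B * (d%:R * L) ^+ d * expR (l * (d * d.+1)%:R).
have Y0 : 0 <= Y by rewrite !mulr_ge0 ?expR_ge0// exprn_ge0// mulr_ge0// ltW.
rewrite -(@ler_pXn2r _ d.+1)// ?nnegrE ?mulr_ge0 ?expR_ge0 ?addr_ge0//; last by case/andP: (mL x).
apply: (le_trans h); rewrite [X in _ <= X]exprMn -expRM_natl.
have -> : 2 * B * (d%:R * L) ^+ d * expR (- (l * (d * d.+1)%:R * (normv x / d%:R - 1))) =
   Y * expR (d.+1%:R * - (l * normv x)).
  rewrite /Y -[RHS]mulrA -expRD; congr (_ * expR _); rewrite natrM; field.
  exact: lt0r_neq0.
rewrite ler_wpM2r ?expR_ge0//.
(* Y <= (1 + Y)^(d+1), so 1 + Y stands in for the root of order d + 1. *)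
have Y1 : 1 <= 1 + Y by rewrite lerDl.
apply: (@le_trans _ _ (1 + Y)); first by rewrite lerDr.
by rewrite exprS ler_peMr ?exprn_ege1// (le_trans ler01).
Qed.

(** Pointwise convergence alone does not carry exponential moments to the limit. Bounded moments at
    the larger rate (|a| + 1) d (d + 1) give a bound by a multiple of exp(-(|a| + 1)|x|) common to
    all N, and then exp(a.x) m is dominated by a multiple of exp(-|x|). *)
Lemma limit_mgf (m_ : nat -> V -> R) (m : V -> R) (L K : R) (La_ : nat -> V -> R) (La : V -> R) :
  (0 < d)%N -> 0 < L -> 0 <= K ->
  (forall N, measurable_fun setT (m_ N)) ->
  (forall N y, 0 <= m_ N y <= 2 * L) ->
  (forall N y z, `|m_ N y - m_ N z| <= L * normv (vsub y z)) ->
  (forall N a, Itg leb (fun x => expR (dotv a x) * m_ N x) /\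
     RI leb (fun x => expR (dotv a x) * m_ N x) = K * expR (La_ N a)) ->
  (forall l : R, exists B : R, forall N a, normv a = l -> La_ N a <= B) ->
  (forall x, m_ N x @[N --> \oo] --> m x) ->
  (forall a, La_ N a @[N --> \oo] --> La a) ->
  (forall x, 0 <= m x) /\
  (forall a, Itg leb (fun x => expR (dotv a x) * m x) /\
     RI leb (fun x => expR (dotv a x) * m x) = K * expR (La a)).
Proof.
move=> d0 L0 K0 mm mL lip mgf bd cm cLa.
split => [x|a]; first by apply: (cvg_ge (cm x)) => n; case/andP: (mL n x).
have [B hB] := bd ((normv a + 1) * (d * d.+1)%:R).
pose C := 1 + 2 * (K * expR B) * (d%:R * L) ^+ d * expR ((normv a + 1) * (d * d.+1)%:R).
have dom N x : m_ N x <= C * expR (- ((normv a + 1) * normv x)).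
  apply: pointwise_exp_bound => //.
  - by rewrite addr_ge0// normv_ge0.
  - by rewrite mulr_ge0// expR_ge0.
  - move=> b hb; have [I1 ->] := mgf N b; split => //.
    by rewrite ler_wpM2l// ler_expR hB.
have [||||I1 c1] := @RI_dct _ _ _ leb (fun N x => expR (dotv a x) * m_ N x)
  (fun x => expR (dotv a x) * m x) (fun x => C * expR (- (1 * normv x))).
- by move=> N; have := mm N => mN; mfun.
- move=> N x; have /andP[h0 _] := mL N x.
  rewrite ger0_norm ?mulr_ge0 ?expR_ge0//.
  apply: (le_trans (ler_wpM2l (expR_ge0 _) (dom N x))).
  rewrite mulrCA ler_wpM2l//.
    by rewrite addr_ge0// !mulr_ge0 ?expR_ge0// exprn_ge0// mulr_ge0// ltW.
  by rewrite -expRD ler_expR; have := dotv_le a x; lra.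
- by apply: ItgZ; exact: Itg_exp_norm.
- by move=> x; apply: cvgM; [exact: cvg_cst|exact: cm].
split => //; apply: (cvg_uniq c1).
rewrite (_ : (fun N => _) = (fun N => K * expR (La_ N a))).
  apply: cvgM; first exact: cvg_cst.
  by apply: (@cvg_comp _ _ _ _ expR); [exact: cLa|exact: continuous_expR].
by apply/funext => N; case: (mgf N a).
Qed.

End nonneg_kernels.

Lemma cos_lip (R : realType) (a b : R) : `|cos a - cos b| <= `|a - b|.
Proof.
have D u : is_derive u (1 : R) (fun u : R => cos (b + u * (a - b))) (- sin (b + u * (a - b)) * (a - b)).
  by apply: is_derive_eq; rewrite !scale_R; ring.
have := @mvt_bound R _ _ `|a - b| D.
rewrite mul1r mul0r addr0 (_ : b + (a - b) = a); last ring.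
apply => u _; rewrite normrM normrN -[X in _ <= X]mul1r ler_wpM2r//; exact: normsin.
Qed.

(** * Characteristic functions with positive inversion and exponential moments *)

Section good.
Context (R : realType) (d : nat).
Local Notation V := (d.-tuple R).
Variable leb : {sigma_finite_measure set V -> \bar R}.
Hypothesis Hleb : is_lebesgue leb.
Hypothesis d0 : (0 < d)%N.

Lemma Itg_U (rho th : V -> R) (x : V) : Itg leb rho -> measurable_fun setT th ->
  Itg leb (fun xi => rho xi * cos (dotv x xi - th xi)).
Proof.
move=> ir mth; have mr := Itg_meas ir.
by apply: (Itg_mul_bd ir _ (fun xi => normcos (dotv x xi - th xi))); mfun.
Qed.

Lemma U_abs (rho th : V -> R) (x : V) : Itg leb rho -> (forall xi, 0 <= rho xi) ->
  measurable_fun setT th -> `|U leb rho th x| <= RI leb rho.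
Proof.
move=> ir r0 mth; have mr := Itg_meas ir; apply: RI_abs_le => //; first by mfun.
by move=> xi; rewrite normrM (ger0_norm (r0 xi)) -[X in _ <= X]mulr1 ler_wpM2l// normcos.
Qed.

Lemma U_lip (rho th : V -> R) (x y : V) : Itg leb rho -> (forall xi, 0 <= rho xi) ->
  measurable_fun setT th -> Itg leb (fun xi => rho xi * normv xi) ->
  `|U leb rho th x - U leb rho th y| <= RI leb (fun xi => rho xi * normv xi) * normv (vsub x y).
Proof.
move=> ir r0 mth irn; have mr := Itg_meas ir.
rewrite /U -RIB; try exact: Itg_U.
rewrite mulrC -RIZ//; apply: RI_abs_le; [by mfun| |exact: ItgZ].
move=> xi; rewrite -mulrBr normrM (ger0_norm (r0 xi)) mulrCA ler_wpM2l//.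
apply: (le_trans (cos_lip _ _)).
have -> : dotv x xi - th xi - (dotv y xi - th xi) = dotv (vsub x y) xi by rewrite dotvBl; ring.
exact: cauchy_schwarz.
Qed.

(** Expresses, without a measure, that rho exp(i th) is the characteristic function of a law with
    Laplace transform exp(La). Multiplication by [gam s] adds an independent Gaussian of variance s,
    which makes the inversion integral converge and contributes the term s a.a / 2. *)
Record good (rho th La : V -> R) : Prop := Good {
  good_meas : measurable_fun setT rho ;
  good_ge0 : forall xi, 0 <= rho xi ;
  good_le1 : forall xi, rho xi <= 1 ;
  good_th : measurable_fun setT th ;
  good_pos : forall s : R, 0 < s -> forall x, 0 <= U leb (fun xi => rho xi * gam s xi) th x ;
  good_mgf : forall s : R, 0 < s -> forall a,
    Itg leb (fun x => expR (dotv a x) * U leb (fun xi => rho xi * gam s xi) th x) /\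
    RI leb (fun x => expR (dotv a x) * U leb (fun xi => rho xi * gam s xi) th x) =
    Kd leb * expR (La a + s * dotv a a / 2) }.

Lemma Itg_rho_gam (rho : V -> R) (s : R) : 0 < s -> measurable_fun setT rho ->
  (forall xi, 0 <= rho xi) -> (forall xi, rho xi <= 1) ->
  Itg leb (fun xi => rho xi * gam s xi).
Proof.
move=> s0 mr r0 r1; have mg := @mgam R d s.
apply: Itg_dom (Itg_gam Hleb s0); first by mfun.
by move=> xi; rewrite ger0_norm ?mulr_ge0 ?gam_ge0// ler_piMl ?gam_ge0.
Qed.

Lemma good_ext (rho th La rho' th' La' : V -> R) : rho =1 rho' -> th =1 th' -> La =1 La' ->
  good rho th La -> good rho' th' La'.
Proof. by move=> /funext -> /funext -> /funext ->. Qed.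

Lemma good_gauss : good (fun=> 1) (fun=> 0) (fun=> 0).
Proof.
have UE (s : R) : 0 < s -> U leb (fun xi : V => 1 * gam s xi) (fun=> 0) =
     (fun x => RI leb (gam s) * gam s^-1 x).
  move=> s0; apply/funext => x; rewrite -(gauss_ft Hleb x s0).
  by apply: RI_ext => xi; rewrite mul1r subr0.
split => //.
- by move=> s s0 x; rewrite UE// mulr_ge0 ?gam_ge0// RI_ge0// => xi; exact: gam_ge0.
- move=> s s0 a; rewrite UE//.
  have s1 : 0 < s^-1 by rewrite invr_gt0.
  have [I1 E1] := gauss_mgf Hleb a s1.
  have E (x : V) : RI leb (gam s) * (expR (dotv a x) * gam s^-1 x) =
    expR (dotv a x) * (RI leb (gam s) * gam s^-1 x) by ring.
  split; first by apply: (Itg_ext E); exact: ItgZ.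
  rewrite -(RI_ext leb E) RIZ// E1 add0r -(RI_gam_inv Hleb s0) (_ : dotv a a / (2 * s^-1) = s * dotv a a / 2).
    ring.
  by field; exact: lt0r_neq0.
Qed.

Lemma good_drift (rho th La : V -> R) (c : V) : good rho th La ->
  good rho (fun xi => th xi + dotv c xi) (fun a => La a + dotv a c).
Proof.
move=> G; have mth := good_th G.
have UE (s : R) : U leb (fun xi => rho xi * gam s xi) (fun xi => th xi + dotv c xi) =
   (fun x => U leb (fun xi => rho xi * gam s xi) th (vsub x c)).
  apply/funext => x; apply: RI_ext => xi; rewrite dotvBl; congr (_ * cos _); ring.
split; [exact: good_meas G|exact: good_ge0 G|exact: good_le1 G|by mfun| |].
- by move=> s s0 x; rewrite UE; exact: (good_pos G).
- move=> s s0 a; rewrite UE; have [I1 E1] := good_mgf G s0 a.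
  set u := U leb _ th in I1 E1 *.
  have E (x : V) : expR (dotv a c) * (expR (dotv a (vsub x c)) * u (vsub x c)) =
      expR (dotv a x) * u (vsub x c).
    by rewrite mulrA -expRD dotvBr; congr (expR _ * _); ring.
  have I2 := Itg_translB Hleb c I1.
  split; first by apply: (Itg_ext E); exact: ItgZ.
  rewrite -(RI_ext leb E) (RIZ _ I2) (RI_translB Hleb c I1) E1 mulrCA -expRD.
  by congr (_ * expR _); ring.
Qed.

(** Up to the factor exp(M), M the total mass of m, the new inversion integral is a convolution
    series with nonnegative terms. That gives its sign, and monotone convergence sums its
    exponential moments. *)
Lemma good_cp (lam : {sigma_finite_measure set V -> \bar R}) (m : V -> R) (rho th La : V -> R) :
  (forall y, 0 <= m y) -> Itg lam m -> (forall a, Itg lam (fun y => m y * expR (dotv a y))) ->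
  good rho th La ->
  good (fun xi => rho xi * expR (- RI lam (fun y => m y * (1 - cos (dotv xi y)))))
       (fun xi => th xi + RI lam (fun y => m y * sin (dotv xi y)))
       (fun a => La a + RI lam (fun y => m y * (expR (dotv a y) - 1))).
Proof.
move=> m0 im ima G; have mth := good_th G; have mr := good_meas G.
have mm := Itg_meas im.
have mc1 : measurable_fun setT (fun xi => RI lam (fun y => m y * (1 - cos (dotv xi y)))).
  by apply: (measurable_RI lam (F := fun z : V * V => m z.2 * (1 - cos (dotv z.1 z.2)))); mfun.
have ms1 : measurable_fun setT (fun xi => RI lam (fun y => m y * sin (dotv xi y))).
  by apply: (measurable_RI lam (F := fun z : V * V => m z.2 * sin (dotv z.1 z.2))); mfun.
have e1 xi : expR (- RI lam (fun y => m y * (1 - cos (dotv xi y)))) <= 1.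
  rewrite -expR0 ler_expR oppr_le0; apply: RI_ge0 => y.
  by rewrite mulr_ge0// subr_ge0 cos_le1.
pose M := RI lam m.
pose u (s : R) := U leb (fun xi => rho xi * gam s xi) th.
pose u' (s : R) := U leb (fun xi => rho xi * expR (- RI lam (fun y => m y * (1 - cos (dotv xi y)))) * gam s xi)
   (fun xi => th xi + RI lam (fun y => m y * sin (dotv xi y))).
pose q (s : R) n := iter n (vconv lam m) (u s).
have irg (s : R) : 0 < s -> Itg leb (fun xi => rho xi * gam s xi).
  by move=> s0; apply: Itg_rho_gam => //; [exact: good_ge0 G|exact: good_le1 G].
have cvg (s : R) x : 0 < s -> \sum_(n < N) q s n x / n`!%:R @[N --> \oo] --> expR M * u' s x.
  move=> s0; have <- : U leb (fun xi => rho xi * gam s xi *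
      expR (- RI lam (fun y => m y * (1 - cos (dotv xi y)))))
      (fun xi => th xi + RI lam (fun y => m y * sin (dotv xi y))) x = u' s x.
    by apply: RI_ext => xi; rewrite (mulrAC (rho xi)).
  exact: (@conv_exp R d leb lam m m0 im _ th x (irg s s0) mth).
have mg s := @mgam R d s.
have qn (s : R) a n : 0 < s -> [/\ exists C, forall x, 0 <= q s n x <= C,
   measurable_fun setT (q s n),
   Itg leb (fun x => expR (dotv a x) * q s n x) &
   RI leb (fun x => expR (dotv a x) * q s n x) = (RI lam (fun y => m y * expR (dotv a y))) ^+ n *
     (Kd leb * expR (La a + s * dotv a a / 2))].
  move=> s0; elim: n => [|n [[C hC] mq Iq Eq]].
    have [I1 E1] := good_mgf G s0 a; split => //.
    - exists (RI leb (fun xi => rho xi * gam s xi)) => x; rewrite (good_pos G s0)/=.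
      apply: (le_trans (ler_norm _)); apply: U_abs => //; first exact: irg.
      by move=> xi; apply: mulr_ge0; [exact: (good_ge0 G)|exact: gam_ge0].
    - by apply: measurable_U => //; have := mg s => mgs; mfun.
    - by rewrite expr0 mul1r E1.
  have [h1 h2 h3 h4] := conv_mgf Hleb m0 im (ima a) hC mq Iq.
  split => //; first by exists (RI lam m * C).
  by rewrite /q iterS h4 Eq exprS mulrA.
have q0 (s : R) n x : 0 < s -> 0 <= q s n x.
  by move=> s0; have [[C hC] _ _ _] := qn s vzero n s0; case/andP: (hC x).
have e0 : expR M * expR (- M) = 1 by rewrite -expRD subrr expR0.
split.
- by apply: mf_mul => //; apply: mf_exp; exact: mf_opp.
- by move=> xi; apply: mulr_ge0; [exact: (good_ge0 G)|exact: expR_ge0].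
- by move=> xi; apply: mulr_ile1; [exact: (good_ge0 G)|exact: expR_ge0|exact: (good_le1 G)|].
- exact: mf_add.
- move=> s s0 x; rewrite -/(u' s x) -(pmulr_rge0 _ (expR_gt0 M)).
  apply: (cvg_ge (cvg s x s0)) => N; apply: sumr_ge0 => n _.
  by rewrite mulr_ge0 ?invr_ge0// q0.
- move=> s s0 a; rewrite -/(u' s).
  pose Ma := RI lam (fun y => m y * expR (dotv a y)).
  pose K := Kd leb * expR (La a + s * dotv a a / 2).
  pose S N x := expR (- M) * \sum_(n < N) (n`!%:R)^-1 * (expR (dotv a x) * q s n x).
  have IS N : Itg leb (fun x => \sum_(n < N) (n`!%:R)^-1 * (expR (dotv a x) * q s n x)) /\
    RI leb (fun x => \sum_(n < N) (n`!%:R)^-1 * (expR (dotv a x) * q s n x)) =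
    K * \sum_(n < N) Ma ^+ n / n`!%:R.
    elim: N => [|N [IH1 IH2]].
      split; first by apply: (Itg_ext (u := fun=> 0)) => [x|]; [rewrite big_ord0|exact: Itg0].
      by rewrite big_ord0 mulr0 (RI_ext leb (v := fun=> 0)) ?RI0// => x; rewrite big_ord0.
    have [_ _ Iq Eq] := qn s a N s0.
    have E x : \sum_(n < N) (n`!%:R)^-1 * (expR (dotv a x) * q s n x) + (N`!%:R)^-1 * (expR (dotv a x) * q s N x)
      = \sum_(n < N.+1) (n`!%:R)^-1 * (expR (dotv a x) * q s n x) by rewrite [RHS]big_ord_recr.
    split; first by apply: (Itg_ext E); apply: ItgD => //; exact: ItgZ.
    rewrite -(RI_ext leb E) RID//; last exact: ItgZ.
    rewrite IH2 (RIZ _ Iq) Eq big_ord_recr/= mulrDr -/Ma -/K; congr (_ + _); ring.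
  have [|||||I1 E1] := @RI_mct R _ _ leb S (fun x => expR (dotv a x) * u' s x) (expR (- M) * (K * expR Ma)).
  + by move=> N; apply: ItgZ; case: (IS N).
  + move=> N x; rewrite mulr_ge0 ?expR_ge0// sumr_ge0// => n _.
    by rewrite mulr_ge0 ?invr_ge0// mulr_ge0 ?expR_ge0// q0.
  + move=> x n1 n2 n12; rewrite /S ler_wpM2l ?expR_ge0//.
    rewrite -(subnKC n12) big_split_ord/= lerDl sumr_ge0// => n _.
    by rewrite mulr_ge0 ?invr_ge0// mulr_ge0 ?expR_ge0// q0.
  + move=> x.
    have -> : expR (dotv a x) * u' s x = (expR (- M) * expR (dotv a x)) * (expR M * u' s x).
      transitivity ((expR M * expR (- M)) * (expR (dotv a x) * u' s x)); last ring.
      by rewrite e0 mul1r.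
    rewrite (_ : S ^~ x = (fun N => (expR (- M) * expR (dotv a x)) * \sum_(n < N) q s n x / n`!%:R)).
      by apply: cvgM; [exact: cvg_cst|exact: cvg].
    apply/funext => N; rewrite /S -mulrA; congr (_ * _); rewrite mulr_sumr.
    by apply: eq_bigr => n _; ring.
  + rewrite (_ : (fun N => RI leb (S N)) = (fun N => expR (- M) * (K * \sum_(n < N) Ma ^+ n / n`!%:R))).
      apply: cvgM; first exact: cvg_cst.
      apply: cvgM; first exact: cvg_cst.
      have h : series (exp_coeff Ma) n @[n --> \oo] --> expR Ma := is_cvg_series_exp_coeff Ma.
      rewrite (_ : (fun N => \sum_(n < N) _) = series (exp_coeff Ma)); first exact: h.
      by apply/funext => N; rewrite /series/= big_mkord.
    by apply/funext => N; have [h1 h2] := IS N; rewrite /S RIZ// h2.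
  split => //; rewrite E1 /K.
  have -> : RI lam (fun y => m y * (expR (dotv a y) - 1)) = Ma - M.
    by rewrite -RIB//; apply: RI_ext => y; ring.
  have -> : La a + (Ma - M) + s * dotv a a / 2 = (La a + s * dotv a a / 2) + Ma - M by ring.
  by rewrite !expRD; ring.
Qed.

(** Damping supplies a height and a Lipschitz constant common to all N, so [limit_mgf] applies as
    soon as the Laplace exponents are bounded on spheres uniformly in N. *)
Lemma good_lim (rho_ th_ La_ : nat -> V -> R) (rho th La : V -> R) :
  (forall N, good (rho_ N) (th_ N) (La_ N)) ->
  (forall l : R, exists B : R, forall N a, normv a = l -> La_ N a <= B) ->
  (forall xi, rho_ N xi @[N --> \oo] --> rho xi) ->
  (forall xi, th_ N xi @[N --> \oo] --> th xi) ->
  (forall a, La_ N a @[N --> \oo] --> La a) ->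
  good rho th La.
Proof.
move=> G bd cr ct cL.
have mr : measurable_fun setT rho.
  by apply: (@measurable_fun_cvg _ _ _ setT rho_) => [N|x _]; [exact: good_meas (G N)|exact: cr].
have mt : measurable_fun setT th.
  by apply: (@measurable_fun_cvg _ _ _ setT th_) => [N|x _]; [exact: good_th (G N)|exact: ct].
have r0 xi : 0 <= rho xi by apply: (cvg_ge (cr xi)) => N; exact: good_ge0 (G N) xi.
have r1 xi : rho xi <= 1 by apply: (cvg_le (cr xi)) => N; exact: good_le1 (G N) xi.
have key (s : R) : 0 < s -> (forall x, 0 <= U leb (fun xi => rho xi * gam s xi) th x) /\
  (forall a, Itg leb (fun x => expR (dotv a x) * U leb (fun xi => rho xi * gam s xi) th x) /\
    RI leb (fun x => expR (dotv a x) * U leb (fun xi => rho xi * gam s xi) th x) =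
    Kd leb * expR (La a + s * dotv a a / 2)).
  move=> s0; have mg := @mgam R d s.
  have iL := Itg_gam_poly Hleb 1 s0.
  have igam := Itg_gam Hleb s0.
  pose L := RI leb (fun x : V => 1 * (1 + normv x) * gam s x).
  have irg N : Itg leb (fun xi => rho_ N xi * gam s xi).
    apply: Itg_rho_gam => //; [exact: good_meas (G N)|exact: good_ge0 (G N)|exact: good_le1 (G N)].
  have rg0 N xi : 0 <= rho_ N xi * gam s xi by rewrite mulr_ge0 ?gam_ge0//; exact: good_ge0 (G N) _.
  have rg1 N xi : rho_ N xi * gam s xi <= gam s xi.
    by rewrite ler_piMl ?gam_ge0//; exact: good_le1 (G N) _.
  have gL xi : gam s xi <= 1 * (1 + normv xi) * gam s xi.
    by rewrite mul1r ler_peMl ?gam_ge0// lerDl normv_ge0.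
  have igL : RI leb (gam s) <= L by apply: RI_le.
  have L0 : 0 < L by apply: lt_le_trans igL; exact: RI_gam_gt0.
  have irgn N : Itg leb (fun xi => rho_ N xi * gam s xi * normv xi).
    apply: Itg_dom iL; first by have := good_meas (G N) => mN; mfun.
    move=> xi; rewrite (ger0_norm (mulr_ge0 (rg0 N xi) (normv_ge0 xi))) mul1r mulrC ler_pM ?normv_ge0//.
    by rewrite lerDr.
  apply: (@limit_mgf R d leb Hleb (fun N => U leb (fun xi => rho_ N xi * gam s xi) (th_ N)) _ L (Kd leb)
    (fun N a => La_ N a + s * dotv a a / 2)) => //.
  - exact: ltW (Kd_gt0 Hleb).
  - move=> N; have mN := good_meas (G N); have mT := good_th (G N).
    by apply: measurable_U => //; mfun.
  - move=> N y; rewrite (good_pos (G N))//=.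
    apply: (le_trans (ler_norm _)).
    apply: (le_trans (U_abs _ (irg N) (rg0 N) (good_th (G N)))).
    apply: (@le_trans _ _ L); last by rewrite ler_peMl// ?ler1n// ltW.
    by apply: le_trans igL; exact: RI_le.
  - move=> N y z; apply: (le_trans (U_lip _ _ (irg N) (rg0 N) (good_th (G N)) (irgn N))).
    rewrite ler_wpM2r ?normv_ge0//; apply: RI_le => // xi.
    by rewrite mul1r mulrC ler_pM ?normv_ge0// lerDr.
  - by move=> N a; exact: good_mgf (G N) s s0 a.
  - move=> l; have [B hB] := bd l; exists (B + s * l ^+ 2 / 2) => N a al.
    by rewrite lerD ?hB// -normv2 al.
  - move=> x; rewrite /U.
    have [||||I1 c1] := @RI_dct _ _ _ leb (fun N xi => rho_ N xi * gam s xi * cos (dotv x xi - th_ N xi))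
      (fun xi => rho xi * gam s xi * cos (dotv x xi - th xi)) (gam s).
    + by move=> N; have mN := good_meas (G N); have mT := good_th (G N); mfun.
    + move=> N xi; rewrite normrM (ger0_norm (rg0 N xi)) -[X in _ <= X]mulr1.
      by apply: ler_pM => //; exact: normcos.
    + exact: igam.
    + move=> xi; apply: cvgM; first by apply: cvgM; [exact: cr|exact: cvg_cst].
      apply: (@cvg_comp _ _ _ _ cos); last exact: continuous_cos.
      by apply: cvgB; [exact: cvg_cst|exact: ct].
    exact: c1.
  - by move=> a; apply: cvgD; [exact: cL|exact: cvg_cst].
by split => // s s0; have [h1 h2] := key s s0.
Qed.

(** The damping is removed along s = 1/(n+1): integrability of rho and rho |xi| now provides the
    height and the Lipschitz constant uniformly in s. *)
Lemma good_integrable (rho th La : V -> R) : good rho th La ->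
  (forall l : R, exists B : R, forall a, normv a = l -> La a <= B) ->
  Itg leb rho -> Itg leb (fun xi => rho xi * normv xi) ->
  (forall x, 0 <= U leb rho th x) /\
  (forall a, Itg leb (fun x => expR (dotv a x) * U leb rho th x) /\
     RI leb (fun x => expR (dotv a x) * U leb rho th x) = Kd leb * expR (La a)).
Proof.
move=> G bd ir irn; have mr := good_meas G; have mt := good_th G; have r0 := good_ge0 G.
pose s (n : nat) : R := n.+1%:R^-1.
have s0 n : 0 < s n by rewrite invr_gt0.
have s1 n : s n <= 1 by rewrite invf_le1// ler1n.
have cs : s n @[n --> \oo] --> 0 by exact: cvg_harmonic.
pose L := 1 + RI leb rho + RI leb (fun xi => rho xi * normv xi).
have p1 : 0 <= RI leb rho by exact: RI_ge0.
have p2 : 0 <= RI leb (fun xi => rho xi * normv xi).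
  by apply: RI_ge0 => xi; rewrite mulr_ge0 ?normv_ge0.
have rg0 N xi : 0 <= rho xi * gam (s N) xi by rewrite mulr_ge0 ?gam_ge0.
have rg1 N xi : rho xi * gam (s N) xi <= rho xi.
  by rewrite ler_piMr// gam_le1// ltW.
have irg N : Itg leb (fun xi => rho xi * gam (s N) xi).
  by apply: Itg_rho_gam => //; exact: good_le1 G.
have irgn N : Itg leb (fun xi => rho xi * gam (s N) xi * normv xi).
  apply: Itg_dom irn; first by have := @mgam R d (s N) => mg; mfun.
  by move=> xi; rewrite (ger0_norm (mulr_ge0 (rg0 N xi) (normv_ge0 xi))) ler_wpM2r ?normv_ge0.
apply: (@limit_mgf R d leb Hleb (fun N => U leb (fun xi => rho xi * gam (s N) xi) th) _ L (Kd leb)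
    (fun N a => La a + s N * dotv a a / 2)) => //.
- by rewrite /L -addrA ltr_pwDl ?addr_ge0.
- exact: ltW (Kd_gt0 Hleb).
- by move=> N; apply: measurable_U => //; have := @mgam R d (s N) => mg; mfun.
- move=> N y; rewrite (good_pos G)//=.
  apply: (le_trans (ler_norm _)).
  apply: (le_trans (U_abs _ (irg N) (rg0 N) mt)).
  have : RI leb (fun xi => rho xi * gam (s N) xi) <= RI leb rho by exact: RI_le.
  rewrite /L; lra.
- move=> N y z; apply: (le_trans (U_lip _ _ (irg N) (rg0 N) mt (irgn N))).
  rewrite ler_wpM2r ?normv_ge0//.
  have : RI leb (fun xi => rho xi * gam (s N) xi * normv xi) <= RI leb (fun xi => rho xi * normv xi).
    by apply: RI_le => // xi; rewrite ler_wpM2r ?normv_ge0.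
  rewrite /L; lra.
- by move=> N a; exact: good_mgf G _ (s0 N) a.
- move=> l; have [B hB] := bd l; exists (B + l ^+ 2 / 2) => N a al.
  rewrite lerD ?hB// -normv2 al ler_pM2r ?invr_gt0//.
  by rewrite ler_piMl// sqr_ge0.
- move=> x; rewrite /U.
  have [||||I1 c1] := @RI_dct _ _ _ leb (fun N xi => rho xi * gam (s N) xi * cos (dotv x xi - th xi))
      (fun xi => rho xi * cos (dotv x xi - th xi)) rho.
  + by move=> N; have := @mgam R d (s N) => mg; mfun.
  + move=> N xi; rewrite normrM (ger0_norm (rg0 N xi)) -[X in _ <= X]mulr1.
    by apply: ler_pM => //; exact: normcos.
  + exact: ir.
  + move=> xi; apply: cvgM; last exact: cvg_cst.
    rewrite -[X in _ --> X]mulr1; apply: cvgM; first exact: cvg_cst.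
    have h : gam (s n) xi @[n --> \oo] --> expR (- (0 * dotv xi xi / 2)).
      apply: (@cvg_comp _ _ _ _ expR); last exact: continuous_expR.
      apply: cvgN; apply: cvgM; last exact: cvg_cst.
      by apply: cvgM => //; exact: cvg_cst.
    by rewrite !mul0r oppr0 expR0 in h.
  exact: c1.
- move=> a; rewrite (_ : nbhs (La a) = nbhs (La a + 0 * dotv a a / 2)); last by rewrite !mul0r addr0.
  apply: cvgD; first exact: cvg_cst.
  by apply: cvgM; [apply: cvgM => //; exact: cvg_cst|exact: cvg_cst].
Qed.

End good.

(** * Taylor remainders and scaled limits *)

Section taylor.
Context (R : realType).
Implicit Types z u : R.

Lemma sin_abs_le z : `|sin z| <= `|z|.
Proof.
have D u : is_derive u (1 : R) (fun u : R => sin (u * z)) (cos (u * z) * z).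
  by apply: is_derive_eq; rewrite !scale_R; ring.
have := @mvt_bound R _ _ `|z| D; rewrite mul1r mul0r sin0 subr0; apply => u _.
by rewrite normrM -[X in _ <= X]mul1r ler_wpM2r// normcos.
Qed.

Lemma one_sub_cos_le z : 0 <= 1 - cos z <= z ^+ 2 / 2.
Proof.
rewrite subr_ge0 cos_le1/=.
have -> : cos z = 1 - 2 * sin (z / 2) ^+ 2.
  have := cosD (z / 2) (z / 2); rewrite -splitr => ->.
  have := cos2Dsin2 (z / 2); lra.
have : sin (z / 2) ^+ 2 <= (z / 2) ^+ 2.
  by rewrite -(@real_normK _ (sin _)) ?num_real// -(@real_normK _ (z / 2)) ?num_real// lerXn2r ?nnegrE// sin_abs_le.
rewrite exprMn; lra.
Qed.

Lemma norm_pow_le (u z : R) n : 0 <= u <= 1 -> `|u * z| ^+ n <= `|z| ^+ n.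
Proof.
move=> /andP[u0 u1]; apply: lerXn2r; rewrite ?nnegrE//.
by rewrite normrM (ger0_norm u0) ler_piMl.
Qed.

(** Evaluated at u z, a remainder has as derivative in u, up to sign, z times the preceding
    remainder; the mean value theorem on [0, 1] gains one power. The next bounds arise in the same
    way. *)
Lemma sin_sub_id_le z : `|sin z - z| <= `|z| ^+ 3.
Proof.
have D u : is_derive u (1 : R) (fun u : R => sin (u * z) - u * z) (z * (cos (u * z) - 1)).
  by apply: is_derive_eq; rewrite !scale_R; ring.
have := @mvt_bound R _ _ (`|z| ^+ 3) D.
rewrite !mul1r !mul0r sin0 !subr0; apply => u u01.
rewrite normrM exprS ler_wpM2l//; apply: le_trans (norm_pow_le _ 2 u01).
rewrite real_normK ?num_real// distrC; have /andP[h0 h1] := one_sub_cos_le (u * z).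
by rewrite ger0_norm//; have := sqr_ge0 (u * z); lra.
Qed.

Lemma one_sub_cos_sub_le z : `|1 - cos z - z ^+ 2 / 2| <= `|z| ^+ 4.
Proof.
have D u : is_derive u (1 : R) (fun u : R => 1 - cos (u * z) - (u * z) ^+ 2 / 2) (z * (sin (u * z) - u * z)).
  by apply: is_derive_eq; rewrite !scale_R; field.
have := @mvt_bound R _ _ (`|z| ^+ 4) D.
rewrite !mul1r !mul0r cos0 expr0n/= mul0r subrr !subr0; apply => u u01.
rewrite normrM exprS ler_wpM2l//; apply: le_trans (norm_pow_le _ 3 u01).
exact: sin_sub_id_le.
Qed.

Lemma exp_norm_le (u z : R) : 0 <= u <= 1 -> expR (u * z) <= expR `|z|.
Proof.
move=> /andP[u0 u1]; rewrite ler_expR (le_trans (ler_norm _))// normrM (ger0_norm u0).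
by rewrite ler_piMl.
Qed.

Lemma exp_abs_le (u z : R) : 0 <= u <= 1 -> expR `|u * z| <= expR `|z|.
Proof. by move=> u01; rewrite ler_expR; have := norm_pow_le z 1 u01; rewrite !expr1. Qed.

Lemma exp_sub1_le z : `|expR z - 1| <= `|z| * expR `|z|.
Proof.
have D u : is_derive u (1 : R) (fun u : R => expR (u * z)) (z * expR (u * z)).
  by apply: is_derive_eq; rewrite !scale_R; ring.
have := @mvt_bound R _ _ (`|z| * expR `|z|) D.
rewrite !mul1r !mul0r expR0; apply => u u01.
by rewrite normrM ler_wpM2l// ger0_norm ?expR_ge0// exp_norm_le.
Qed.

Lemma exp_sub2_le z : `|expR z - 1 - z| <= `|z| ^+ 2 * expR `|z|.
Proof.
have D u : is_derive u (1 : R) (fun u : R => expR (u * z) - 1 - u * z) (z * (expR (u * z) - 1)).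
  by apply: is_derive_eq; rewrite !scale_R; ring.
have := @mvt_bound R _ _ (`|z| ^+ 2 * expR `|z|) D.
rewrite !mul1r !mul0r expR0 subrr !subr0; apply => u u01.
rewrite normrM exprS -mulrA ler_wpM2l//; apply: (le_trans (exp_sub1_le _)).
apply: ler_pM; rewrite ?expR_ge0//; first exact: (norm_pow_le z 1 u01).
exact: exp_abs_le.
Qed.

Lemma exp_sub3_le z : `|expR z - 1 - z - z ^+ 2 / 2| <= `|z| ^+ 3 * expR `|z|.
Proof.
have D u : is_derive u (1 : R) (fun u : R => expR (u * z) - 1 - u * z - (u * z) ^+ 2 / 2) (z * (expR (u * z) - 1 - u * z)).
  by apply: is_derive_eq; rewrite !scale_R; field.
have := @mvt_bound R _ _ (`|z| ^+ 3 * expR `|z|) D.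
rewrite !mul1r !mul0r expR0 expr0n/= mul0r subrr !subr0; apply => u u01.
rewrite normrM exprS -mulrA ler_wpM2l//; apply: (le_trans (exp_sub2_le _)).
apply: ler_pM; rewrite ?exprn_ge0 ?expR_ge0//; first exact: norm_pow_le.
exact: exp_abs_le.
Qed.

Lemma cvg_bounded_by (u v : nat -> R) (l : R) : (forall n, `|u n - l| <= v n) ->
  v n @[n --> \oo] --> 0 -> u n @[n --> \oo] --> l.
Proof.
move=> h c; apply/subr_cvg0; apply: norm_cvg0.
apply: (@squeeze_cvgr _ _ _ _ (cst 0) v) => //; last exact: cvg_cst.
by apply: nearW => n; rewrite /= normr_ge0/=.
Qed.

Lemma cvg_cdivN (c : R) : c / n.+1%:R @[n --> \oo] --> 0.
Proof.
rewrite (_ : nbhs (0 : R) = nbhs (c * 0)); last by rewrite mulr0.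
by apply: cvgM; [exact: cvg_cst|exact: cvg_harmonic].
Qed.

Lemma scaled_le (f : R -> R) (z c : R) k n : (2 < k)%N ->
  `|f (z / n.+1%:R)| <= `|z / n.+1%:R| ^+ k * c -> 0 <= c ->
  `|n.+1%:R ^+ 2 * f (z / n.+1%:R)| <= `|z| ^+ k * c / n.+1%:R.
Proof.
move=> k2 h c0; have n0 : (0 : R) < n.+1%:R by [].
rewrite normrM (ger0_norm (exprn_ge0 _ (ltW n0))).
apply: (le_trans (ler_wpM2l (exprn_ge0 2 (ltW n0)) h)).
rewrite normrM normfV (ger0_norm (ltW n0)) exprMn -(subnKC k2) !exprD exprVn.
set N := n.+1%:R : R; set m := (k - 3)%N.
have -> : N ^+ 2 * (`|z| ^+ 3 * `|z| ^+ m * (N ^- 3 * N^-1 ^+ m) * c) =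
   `|z| ^+ 3 * `|z| ^+ m * c / N * N^-1 ^+ m.
  field; exact: lt0r_neq0.
rewrite ler_piMr//.
  by rewrite divr_ge0// !mulr_ge0// exprn_ge0.
by rewrite exprn_ile1// ?invr_ge0// invf_le1// ler1n.
Qed.

Lemma cvg_scaled_cos z : n.+1%:R ^+ 2 * (1 - cos (z / n.+1%:R)) @[n --> \oo] --> z ^+ 2 / 2.
Proof.
apply: (@cvg_bounded_by _ (fun n => `|z| ^+ 4 * 1 / n.+1%:R)); last exact: cvg_cdivN.
move=> n; have := @scaled_le (fun z => 1 - cos z - z ^+ 2 / 2) z 1 4 n isT.
rewrite [X in _ <= X -> _]mulr1 => /(_ (one_sub_cos_sub_le _) ler01); apply: le_trans.
rewrite le_eqVlt; apply/orP; left; apply/eqP; congr `|_|; field.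
by rewrite gt_eqF.
Qed.

Lemma cvg_scaled_sin z : n.+1%:R ^+ 2 * (sin (z / n.+1%:R) - z / n.+1%:R) @[n --> \oo] --> 0.
Proof.
apply: (@cvg_bounded_by _ (fun n => `|z| ^+ 3 * 1 / n.+1%:R)); last exact: cvg_cdivN.
move=> n; rewrite subr0; apply: (@scaled_le (fun z => sin z - z) z 1 3 n isT) => //.
by rewrite mulr1; exact: sin_sub_id_le.
Qed.

Lemma exp_abs_div z n : expR `|z / n.+1%:R| <= expR `|z|.
Proof.
rewrite mulrC; apply: exp_abs_le; rewrite invr_ge0 ler0n/=.
by rewrite invf_le1// ler1n.
Qed.

Lemma cvg_scaled_exp z :
  n.+1%:R ^+ 2 * (expR (z / n.+1%:R) - 1 - z / n.+1%:R) @[n --> \oo] --> z ^+ 2 / 2.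
Proof.
apply: (@cvg_bounded_by _ (fun n => `|z| ^+ 3 * expR `|z| / n.+1%:R)); last exact: cvg_cdivN.
move=> n; have := @scaled_le (fun z => expR z - 1 - z - z ^+ 2 / 2) z (expR `|z|) 3 n isT.
move=> /(_ _ (expR_ge0 _)) h; apply: (le_trans _ (h _)).
  rewrite le_eqVlt; apply/orP; left; apply/eqP; congr `|_|; field.
  by rewrite gt_eqF.
apply: (le_trans (exp_sub3_le _)); rewrite ler_wpM2l ?exprn_ge0//.
exact: exp_abs_div.
Qed.

Lemma scaled_exp_le z n :
  n.+1%:R ^+ 2 * (expR (z / n.+1%:R) - 1 - z / n.+1%:R) <= `|z| ^+ 2 * expR `|z|.
Proof.
have n0 : (0 : R) < n.+1%:R by [].
apply: (@le_trans _ _ (n.+1%:R ^+ 2 * (`|z / n.+1%:R| ^+ 2 * expR `|z|))).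
  rewrite ler_pM2l ?exprn_gt0//; apply: (le_trans (ler_norm _)); apply: (le_trans (exp_sub2_le _)).
  by rewrite ler_wpM2l ?exprn_ge0// exp_abs_div.
rewrite le_eqVlt; apply/orP; left; apply/eqP.
rewrite normrM normfV (ger0_norm (ltW n0)) exprMn exprVn; field; exact: lt0r_neq0.
Qed.

End taylor.

(** * Nonnegative quadratic forms as sums of squares *)

Section sum_of_squares.
Context (R : realType) (d : nat).
Local Notation V := (d.-tuple R).

Definition mulv (A : 'M[R]_d) (x : V) : V := [tuple \sum_(j < d) A i j * tnth x j | i < d].

Lemma quadA_mulv A x : quadA A x = dotv x (mulv A x).
Proof.
apply: eq_bigr => i _; rewrite tnth_mktuple mulr_sumr; apply: eq_bigr => j _; ring.
Qed.

Lemma mulvDZ A x c y : mulv A (vadd x (vscale c y)) = vadd (mulv A x) (vscale c (mulv A y)).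
Proof.
apply: eq_from_tnth => i; rewrite !tnthE !tnth_mktuple mulr_sumr -big_split.
by apply: eq_bigr => j _; rewrite !tnthE /=; ring.
Qed.

Lemma dotv_mulv_sym A x y : A^T = A -> dotv x (mulv A y) = dotv y (mulv A x).
Proof.
move=> sA; rewrite /dotv.
transitivity (\sum_i \sum_j tnth x i * A i j * tnth y j).
  by apply: eq_bigr => i _; rewrite tnth_mktuple mulr_sumr; apply: eq_bigr => j _; ring.
rewrite exchange_big; apply: eq_bigr => j _; rewrite tnth_mktuple mulr_sumr.
by apply: eq_bigr => i _; rewrite -{1}sA mxE; ring.
Qed.

Lemma quadA_shift A x c i : A^T = A ->
  quadA A (vadd x (vscale c (unitv R i))) = quadA A x + 2 * c * tnth (mulv A x) i + c ^+ 2 * A i i.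
Proof.
move=> sA; rewrite !quadA_mulv mulvDZ !(dotvDl, dotvDr, dotvZl, dotvZr) !dotv_unitv.
rewrite (dotv_mulv_sym x (unitv R i) sA) dotv_unitv.
have -> : tnth (mulv A (unitv R i)) i = A i i.
  rewrite tnth_mktuple (bigD1 i)//= tnth_mktuple eqxx mulr1 big1 ?addr0// => j /negbTE ji.
  by rewrite tnth_mktuple ji mulr0.
ring.
Qed.

(** Elimination from the last row upwards, by induction on the number of leading rows that may be
    nonzero. A positive pivot splits off one square and leaves the Schur complement, again
    nonnegative; a zero pivot has a zero row. *)
Lemma psd_sum_of_squares (A : 'M[R]_d) : A^T = A -> (forall x, 0 <= quadA A x) ->
  exists s : seq V, forall x, quadA A x = \sum_(v <- s) dotv v x ^+ 2.
Proof.
move=> sA pA.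
have [n zA] : exists n : nat, forall i j : 'I_d, (n <= i)%N -> A i j = 0.
  by exists d => i j; rewrite leqNgt ltn_ord.
elim: n A sA pA zA => [|n IH] A sA pA zA.
  exists [::] => x; rewrite big_nil /quadA big1// => i _; rewrite big1// => j _.
  by rewrite zA// mulr0 mul0r.
have [nd|dn] := ltnP n d; last first.
  apply: IH => // i j ni; apply: zA; rewrite ltn_neqAle ni andbT.
  by apply: contraTneq (ltn_ord i) => <-; rewrite -leqNgt.
pose k : 'I_d := Ordinal nd.
have sAE i j : A i j = A j i by rewrite -{1}sA mxE.
have Akk : 0 <= A k k.
  have := pA (vadd vzero (vscale 1 (unitv R k))); rewrite quadA_shift// expr1n mul1r mulr1.
  rewrite {1}/quadA big1 ?add0r => [|i _]; last by rewrite big1// => j _; rewrite tnthE !mul0r.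
  rewrite tnth_mktuple big1 ?mulr0 ?add0r// => j _; by rewrite tnthE mulr0.
have mk j : tnth (mulv A (unitv R j)) k = A k j.
  rewrite tnth_mktuple (bigD1 j)//= tnth_mktuple eqxx mulr1 big1 ?addr0// => i /negbTE ij.
  by rewrite tnth_mktuple ij mulr0.
have rowS (i j : 'I_d) : (n <= i)%N -> i != k -> A i j = 0.
  move=> ni ik; apply: zA; rewrite ltn_neqAle ni andbT; apply: contra ik => /eqP E.
  by apply/eqP/val_inj; rewrite /= -E.
have [a0|a0] := eqVneq (A k k) 0.
  have row0 j : A k j = 0.
    apply/eqP; apply: contraT => akj.
    (* With a zero pivot and A k j nonzero, this c would give the form the value -1. *)
    pose c := - (quadA A (unitv R j) + 1) / (2 * A k j).
    have := pA (vadd (unitv R j) (vscale c (unitv R k))); rewrite quadA_shift// a0 mulr0 addr0 mk.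
    have -> : 2 * c * A k j = - (quadA A (unitv R j) + 1) by rewrite /c; field.
    lra.
  apply: IH => // i j ni; have [->|ik] := eqVneq i k; first exact: row0.
  exact: rowS.
have ap : 0 < A k k by rewrite lt_neqAle eq_sym a0.
pose A' : 'M[R]_d := \matrix_(i, j) (A i j - A i k * A k j / A k k).
have qA' x : quadA A' x = quadA A x - tnth (mulv A x) k ^+ 2 / A k k.
  rewrite !quadA_mulv.
  have -> : mulv A' x = vadd (mulv A x) (vscale (- (tnth (mulv A x) k / A k k)) [tuple A i k | i < d]).
    apply: eq_from_tnth => i; rewrite !tnthE !tnth_mktuple.
    transitivity (\sum_j (A i j * tnth x j - A i k * (A k j * tnth x j) / A k k)).
      by apply: eq_bigr => j _; rewrite mxE; field.
    rewrite big_split/=; congr (_ + _); rewrite sumrN -mulr_suml -mulr_sumr.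
    by set S := \sum_j _; field.
  rewrite dotvDr dotvZr; congr (_ + _).
  have -> : dotv x [tuple A i k | i < d] = tnth (mulv A x) k.
    by rewrite tnth_mktuple; apply: eq_bigr => j _; rewrite tnth_mktuple (sAE j) mulrC.
  by field.
have [|||s hs] := IH A'.
- by apply/matrixP => i j; rewrite !mxE (sAE j i) (sAE j k) (sAE k i); ring.
- move=> x; rewrite qA'.
  (* This shift minimises the form along the k-th axis, and the minimum is the Schur complement at
     x. *)
  have := pA (vadd x (vscale (- (tnth (mulv A x) k / A k k)) (unitv R k))).
  by rewrite quadA_shift//; congr (_ <= _); field.
- move=> i j ni; rewrite mxE; have [->|ik] := eqVneq i k; first by field.
  by rewrite !(rowS i)// mul0r mul0r subr0.
exists (vscale (Num.sqrt (A k k))^-1 [tuple A k i | i < d] :: s) => x.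
rewrite big_cons -hs qA' dotvZl exprMn exprVn sqr_sqrtr ?ltW//.
have -> : dotv [tuple A k i | i < d] x = tnth (mulv A x) k.
  by rewrite tnth_mktuple; apply: eq_bigr => j _; rewrite tnth_mktuple.
by field.
Qed.

End sum_of_squares.

(** * The Gaussian component as a limit of compound Poisson laws *)

Section gaussian_part.
Context (R : realType) (d : nat).
Local Notation V := (d.-tuple R).
Variable leb : {sigma_finite_measure set V -> \bar R}.
Hypothesis Hleb : is_lebesgue leb.
Hypothesis d0 : (0 < d)%N.

Lemma RI_dirac (v : V) (u : V -> R) : measurable_fun setT u ->
  Itg (\d_v : {measure set V -> \bar R}) u /\ RI (\d_v : {measure set V -> \bar R}) u = u v.
Proof.
move=> mu; have mE : measurable_fun setT (EFin \o u) by exact/measurable_EFinP.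
have E (g : V -> \bar R) : measurable_fun setT g -> (\int[(\d_v : {measure set V -> \bar R})]_x g x = g v)%E.
  by move=> mg; rewrite integral_dirac// diracT mul1e.
split.
  apply/integrableP; split => //.
  by rewrite (E (fun x => `|(EFin \o u) x|%E)) ?ltry//; exact: measurableT_comp.
by rewrite /Rintegral (E (EFin \o u)).
Qed.

(** The factor exp(-t (v.xi)^2) is the limit of compound Poisson laws that jump by v/N at rate 2 t
    N^2, recentred by the drift - 2 t N v. The jump measure is a weighted Dirac mass. *)
Lemma good_gauss_dir (rho th La : V -> R) (v : V) (t : R) : 0 <= t ->
  (forall l : R, exists B : R, forall a, normv a = l -> La a <= B) ->
  good leb rho th La ->
  good leb (fun xi => rho xi * expR (- (t * dotv v xi ^+ 2))) th (fun a => La a + t * dotv v a ^+ 2).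
Proof.
move=> t0 bd G.
pose N (n : nat) : R := n.+1%:R.
pose w n := vscale (N n)^-1 v.
pose m n : V -> R := fun=> 2 * t * N n ^+ 2.
have m0 n y : 0 <= m n y by rewrite /m !mulr_ge0// exprn_ge0.
pose lam n : {sigma_finite_measure set V -> \bar R} := \d_(w n).
have step n := good_drift Hleb (vscale (- (2 * t * N n)) v)
  (good_cp Hleb (lam := lam n) (m := m n) (m0 n)
     (proj1 (@RI_dirac (w n) (m n) ltac:(rewrite /m; mfun)))
     (fun a => proj1 (@RI_dirac (w n) (fun y => m n y * expR (dotv a y)) ltac:(rewrite /m; mfun))) G).
have dw n xi : dotv xi (w n) = dotv v xi / N n by rewrite dotvZr dotvC mulrC.
have e1 n xi : RI (lam n) (fun y => m n y * (1 - cos (dotv xi y))) =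
    2 * t * (N n ^+ 2 * (1 - cos (dotv v xi / N n))).
  rewrite (proj2 (@RI_dirac (w n) (fun y => m n y * (1 - cos (dotv xi y))) _)); last by rewrite /m; mfun.
  by rewrite dw /m mulrA.
have e2 n xi : RI (lam n) (fun y => m n y * sin (dotv xi y)) + dotv (vscale (- (2 * t * N n)) v) xi =
    2 * t * (N n ^+ 2 * (sin (dotv v xi / N n) - dotv v xi / N n)).
  rewrite (proj2 (@RI_dirac (w n) (fun y => m n y * sin (dotv xi y)) _)); last by rewrite /m; mfun.
  rewrite dw /m dotvZl; field; exact: lt0r_neq0.
have e3 n a : RI (lam n) (fun y => m n y * (expR (dotv a y) - 1)) + dotv a (vscale (- (2 * t * N n)) v) =
    2 * t * (N n ^+ 2 * (expR (dotv v a / N n) - 1 - dotv v a / N n)).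
  rewrite (proj2 (@RI_dirac (w n) (fun y => m n y * (expR (dotv a y) - 1)) _)); last by rewrite /m; mfun.
  rewrite dw /m dotvZr (dotvC a v); field; exact: lt0r_neq0.
have {step} := good_lim Hleb d0 step; apply.
- move=> l; have [B hB] := bd l.
  exists (B + 2 * t * ((normv v * l) ^+ 2 * expR (normv v * l))) => n a al.
  rewrite -addrA e3 lerD ?hB// ler_wpM2l ?mulr_ge0//.
  apply: (le_trans (scaled_exp_le _ _)).
  have h : `|dotv v a| <= normv v * l by rewrite -al cauchy_schwarz.
  by apply: ler_pM; rewrite ?exprn_ge0 ?expR_ge0 ?ler_expR//; apply: lerXn2r; rewrite ?nnegrE// (le_trans _ h).
- move=> xi; apply: cvgM; first exact: cvg_cst.
  apply: (@cvg_comp _ _ _ _ expR); last exact: continuous_expR.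
  apply: cvgN; rewrite (_ : (fun n => _) = (fun n => 2 * t * (N n ^+ 2 * (1 - cos (dotv v xi / N n))))).
    have -> : t * dotv v xi ^+ 2 = 2 * t * (dotv v xi ^+ 2 / 2) by field.
    by apply: cvgM; [exact: cvg_cst|exact: cvg_scaled_cos].
  by apply/funext => n; rewrite e1.
- move=> xi; rewrite (_ : (fun n => _) = (fun n => th xi + 2 * t * (N n ^+ 2 * (sin (dotv v xi / N n) - dotv v xi / N n)))).
    have -> : nbhs (th xi) = nbhs (th xi + 2 * t * 0) by rewrite mulr0 addr0.
    apply: cvgD; first exact: cvg_cst.
    by apply: cvgM; [exact: cvg_cst|exact: cvg_scaled_sin].
  by apply/funext => n; rewrite -addrA e2.
- move=> a; rewrite (_ : (fun n => _) = (fun n => La a + 2 * t * (N n ^+ 2 * (expR (dotv v a / N n) - 1 - dotv v a / N n)))).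
    have -> : t * dotv v a ^+ 2 = 2 * t * (dotv v a ^+ 2 / 2) by field.
    apply: cvgD; first exact: cvg_cst.
    by apply: cvgM; [exact: cvg_cst|exact: cvg_scaled_exp].
  by apply/funext => n; rewrite -addrA e3.
Qed.

Lemma good_quadA (A : 'M[R]_d) (t : R) : 0 <= t -> A^T = A -> (forall x, 0 <= quadA A x) ->
  good leb (fun xi => expR (- (t * quadA A xi))) (fun=> 0) (fun a => t * quadA A a).
Proof.
move=> t0 sA pA; have [s hs] := psd_sum_of_squares sA pA.
suff H : good leb (fun xi => expR (- (t * \sum_(v <- s) dotv v xi ^+ 2))) (fun=> 0)
    (fun a => t * \sum_(v <- s) dotv v a ^+ 2).
  by apply: good_ext H => // xi; rewrite hs.
elim: s {hs} => [|v s IH].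
  apply: good_ext (good_gauss Hleb) => //= xi; rewrite big_nil mulr0 ?oppr0 ?expR0//.
have bd (l : R) : exists B : R, forall a, normv a = l -> t * \sum_(v <- s) dotv v a ^+ 2 <= B.
  exists (t * \sum_(v <- s) (normv v * l) ^+ 2) => a al.
  rewrite ler_wpM2l// ler_sum// => w _; rewrite -(@real_normK _ (dotv w a)) ?num_real//.
  have h : `|dotv w a| <= normv w * l by rewrite -al cauchy_schwarz.
  by apply: lerXn2r; rewrite ?nnegrE// (le_trans _ h).
apply: good_ext (good_gauss_dir v t0 bd IH) => //.
- by move=> xi; rewrite big_cons -expRD; congr expR; ring.
- by move=> a; rewrite big_cons; ring.
Qed.

End gaussian_part.

(** * The Levy-Khintchine exponent with bounded jumps *)

Section levy.
Context (R : realType) (d : nat).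
Local Notation V := (d.-tuple R).
Variable leb : {sigma_finite_measure set V -> \bar R}.
Hypothesis Hleb : is_lebesgue leb.
Hypothesis d0 : (0 < d)%N.
Variables (b : V) (A : 'M[R]_d) (nu : V -> R).
Hypothesis sA : A^T = A.
Hypothesis pA : forall x, 0 <= quadA A x.
Hypothesis Hnu : levy_density leb nu.

Definition min2 (y : V) : R := Order.min 1 (normv y ^+ 2).

Lemma mnu : measurable_fun setT nu. Proof. by case: Hnu. Qed.
Lemma nu_ge0 y : 0 <= nu y. Proof. by case: Hnu. Qed.

Lemma min2_ge0 y : 0 <= min2 y.
Proof. by rewrite /min2 le_min ler01 exprn_ge0// normv_ge0. Qed.

Lemma min2_lt1 y : normv y < 1 -> min2 y = normv y ^+ 2.
Proof.
move=> h; rewrite /min2 min_r// exprn_ile1 ?normv_ge0// ltW//.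
Qed.

Lemma min2_ge1 y : 1 <= normv y -> min2 y = 1.
Proof. by move=> h; rewrite /min2 min_l// exprn_ege1. Qed.

Lemma Itg_min2nu : Itg leb (fun y => min2 y * nu y).
Proof.
have mn := mnu; case: Hnu => _ n0 f; apply: Itg_of_E => //; first by rewrite /min2; mfun.
by move=> y; rewrite mulr_ge0 ?min2_ge0.
Qed.

Definition Cnu := RI leb (fun y => min2 y * nu y).

Lemma Cnu_ge0 : 0 <= Cnu.
Proof. by apply: RI_ge0 => y; rewrite mulr_ge0 ?min2_ge0 ?nu_ge0. Qed.

Lemma Itg_levy (F : V -> R) (C : R) : measurable_fun setT F -> (forall y, `|F y| <= C * min2 y) ->
  Itg leb (fun y => F y * nu y) /\ `|RI leb (fun y => F y * nu y)| <= C * Cnu.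
Proof.
move=> mF FC; have mn := mnu.
have h y : `|F y * nu y| <= C * (min2 y * nu y).
  by rewrite normrM (ger0_norm (nu_ge0 y)) mulrA ler_wpM2r ?nu_ge0.
have iC : Itg leb (fun y => C * (min2 y * nu y)) by apply: ItgZ; exact: Itg_min2nu.
split; first by apply: Itg_dom h iC; mfun.
rewrite /Cnu -RIZ; last exact: Itg_min2nu.
by apply: RI_abs_le => //; mfun.
Qed.

Definition far (n : nat) (y : V) : R := ((n.+1%:R^-1 < normv y)%R : bool)%:R.

Lemma mfar n : measurable_fun setT (far n).
Proof. rewrite /far; mfun. Qed.

Lemma far_le n y : 0 <= far n y <= 1. Proof. by rewrite /far; case: (_ < _); rewrite ?lexx ?ler01. Qed.

Lemma cvg_far (F : V -> R) y : F vzero = 0 -> far n y * F y @[n --> \oo] --> F y.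
Proof.
move=> F0; have [->|/normv_gt0 y0] := pselect (y = vzero).
  rewrite F0 (_ : (fun n => _) = (fun=> 0)); first exact: cvg_cst.
  by apply/funext => n; rewrite mulr0.
have c0 := @cvg_harmonic R.
apply: (@cvg_near_cst _ _ _ _ _ _).
have [N _ hN] := cvgr0_norm_lt (fun n => n.+1%:R^-1 : R) c0 _ y0.
exists N => // n /hN /=; rewrite ger0_norm ?invr_ge0// => h.
by rewrite /far h mul1r.
Qed.

Lemma levy_dct (F : V -> R) (C : R) : measurable_fun setT F -> (forall y, `|F y| <= C * min2 y) ->
  RI leb (fun y => far n y * (F y * nu y)) @[n --> \oo] --> RI leb (fun y => F y * nu y).
Proof.
move=> mF FC; have mn := mnu.
have [iF _] := Itg_levy mF FC.
have F0 : F vzero = 0.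
  apply/eqP; rewrite -normr_le0; apply: (le_trans (FC _)).
  by rewrite /min2 normv0 expr0n/= min_r// mulr0.
have [||||_] // := @RI_dct _ _ _ leb (fun n y => far n y * (F y * nu y)) (fun y => F y * nu y)
   (fun y => `|F y * nu y|).
- by move=> n; have mf := mfar n; mfun.
- move=> n y; rewrite normrM ler_piMl//; case/andP: (far_le n y) => h1 h2; by rewrite ger0_norm.
- exact: Itg_abs.
- by move=> y; apply: (@cvg_far (fun y => F y * nu y)); rewrite F0 mul0r.
Qed.

Section cutoff.
Variable r : R.
Hypothesis r0 : 0 < r.

Definition inb (y : V) : R := ((normv y <= r)%R : bool)%:R.

Lemma minb : measurable_fun setT inb. Proof. rewrite /inb; mfun. Qed.
Lemma inb_le y : 0 <= inb y <= 1. Proof. by rewrite /inb; case: (normv y <= r); rewrite ?lexx ?ler01. Qed.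

(** With jumps of size at most r the characteristic function at time t is exp(-t aR + i t bR), and
    its Laplace exponent is t LR. The compensator keeps the unit ball whatever r is, so that
    exponents for different r differ only by uncompensated jumps. *)
Definition aR (xi : V) : R := quadA A xi + RI leb (fun y => inb y * (1 - cos (dotv xi y)) * nu y).
Definition bR (xi : V) : R :=
  dotv xi b + RI leb (fun y => (inb y * sin (dotv xi y) - dotv xi y * indB1 y) * nu y).
Definition LR (a : V) : R := dotv a b + quadA A a +
  RI leb (fun y => (inb y * (expR (dotv a y) - 1) - dotv a y * indB1 y) * nu y).

Lemma indB1E (y : V) : indB1 y = ((normv y < 1)%R : bool)%:R :> R.
Proof. by rewrite /indB1; case: (_ < _). Qed.

Lemma cos_dom xi y : `|inb y * (1 - cos (dotv xi y))| <= (2 + normv xi ^+ 2) * min2 y.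
Proof.
have /andP[h0 h1] := one_sub_cos_le (dotv xi y).
have nx := normv_ge0 xi; have ny := normv_ge0 y.
apply: (@le_trans _ _ (1 - cos (dotv xi y))).
  rewrite ger0_norm ?mulr_ge0//.
  by rewrite ler_piMl//; case/andP: (inb_le y).
have [y1|y1] := ltP (normv y) 1.
  rewrite (min2_lt1 y1); apply: (le_trans h1).
  have : dotv xi y ^+ 2 <= normv xi ^+ 2 * normv y ^+ 2.
    rewrite -exprMn -(@real_normK _ (dotv xi y)) ?num_real//.
    by apply: lerXn2r; rewrite ?nnegrE ?mulr_ge0// cauchy_schwarz.
  have := sqr_ge0 (normv y); have := mulr_ge0 (sqr_ge0 (normv xi)) (sqr_ge0 (normv y)).
  rewrite mulrDl; lra.
rewrite (min2_ge1 y1) mulr1; have := cos_geN1 (dotv xi y); have := sqr_ge0 (normv xi); lra.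
Qed.

(** For r < |y| < 1 the jump is cut off but its compensator stays; there this brings the linear term
    below a multiple of 1 /\ |y|^2. *)
Lemma small_y_sq (y : V) (c : R) : 0 <= c -> ~~ (normv y <= r) -> c * normv y <= c / r * normv y ^+ 2.
Proof.
move=> c0; rewrite -ltNge => ry.
rewrite -mulrA ler_wpM2l// mulrC expr2 -mulrA ler_peMr ?normv_ge0//.
by rewrite ler_pdivlMr// mul1r ltW.
Qed.

Lemma sin_dom xi y : `|inb y * sin (dotv xi y) - dotv xi y * indB1 y| <=
  (1 + normv xi ^+ 3 + normv xi / r) * min2 y.
Proof.
have nx := normv_ge0 xi; have ny := normv_ge0 y.
have p1 : 0 <= normv xi ^+ 3 by exact: exprn_ge0.
have p2 : 0 <= normv xi / r by rewrite divr_ge0// ltW.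
have cs := cauchy_schwarz xi y.
rewrite indB1E; have [y1|y1] := ltP (normv y) 1; last first.
  rewrite mulr0 subr0 min2_ge1// mulr1; apply: (@le_trans _ _ 1); last by lra.
  rewrite normrM -[X in _ <= X]mulr1; apply: ler_pM => //; last exact: normsin.
  by case/andP: (inb_le y) => h1 h2; rewrite ger0_norm.
rewrite mulr1 min2_lt1//; have y2 := sqr_ge0 (normv y).
have yy : normv y ^+ 3 <= normv y ^+ 2 by rewrite exprS ler_piMl// ltW.
rewrite /inb; case: (boolP (normv y <= r)) => yr.
  rewrite mul1r; apply: (le_trans (sin_sub_id_le _)).
  apply: (@le_trans _ _ ((normv xi * normv y) ^+ 3)).
    by apply: lerXn2r; rewrite ?nnegrE ?mulr_ge0.
  rewrite exprMn; have := ler_wpM2l p1 yy; have := mulr_ge0 p2 y2; rewrite !mulrDl; lra.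
rewrite mul0r sub0r normrN; apply: (le_trans cs); apply: (le_trans (small_y_sq nx yr)).
have := mulr_ge0 p1 y2; rewrite !mulrDl; lra.
Qed.

Definition Cexp (l : R) : R := 1 + l ^+ 2 * expR l + l / r + expR (l * r).

Lemma exp_dom a y : `|inb y * (expR (dotv a y) - 1) - dotv a y * indB1 y| <= Cexp (normv a) * min2 y.
Proof.
have nx := normv_ge0 a; have ny := normv_ge0 y.
have p1 : 0 <= normv a ^+ 2 * expR (normv a) by rewrite mulr_ge0 ?expR_ge0// exprn_ge0.
have p2 : 0 <= normv a / r by rewrite divr_ge0// ltW.
have p3 := expR_ge0 (normv a * r).
have cs := cauchy_schwarz a y.
rewrite indB1E /Cexp; have [y1|y1] := ltP (normv y) 1; last first.
  rewrite mulr0 subr0 min2_ge1// mulr1 /inb; case: (boolP (normv y <= r)) => yr; last first.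
    by rewrite mul0r normr0; lra.
  rewrite mul1r; apply: (le_trans (ler_normB _ _)); rewrite normr1 ger0_norm ?expR_ge0//.
  have : expR (dotv a y) <= expR (normv a * r).
    by rewrite ler_expR (le_trans (dotv_le _ _))// ler_wpM2l.
  lra.
rewrite mulr1 min2_lt1//; have y2 := sqr_ge0 (normv y).
rewrite /inb; case: (boolP (normv y <= r)) => yr.
  rewrite mul1r; apply: (le_trans (exp_sub2_le _)).
  have : `|dotv a y| ^+ 2 * expR `|dotv a y| <= (normv a ^+ 2 * normv y ^+ 2) * expR (normv a).
    rewrite -exprMn; apply: ler_pM; rewrite ?exprn_ge0 ?expR_ge0//.
      by apply: lerXn2r; rewrite ?nnegrE ?mulr_ge0.
    by rewrite ler_expR (le_trans cs)// ler_piMr// ltW.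
  have := mulr_ge0 p2 y2; have := mulr_ge0 p3 y2; rewrite !mulrDl; lra.
rewrite mul0r sub0r normrN; apply: (le_trans cs); apply: (le_trans (small_y_sq nx yr)).
have := mulr_ge0 p1 y2; have := mulr_ge0 p3 y2; rewrite !mulrDl; lra.
Qed.

Lemma LR_bound (l : R) : exists B : R, forall a, normv a = l -> LR a <= B.
Proof.
have [s hs] := psd_sum_of_squares sA pA.
exists (l * normv b + \sum_(v <- s) (normv v * l) ^+ 2 + Cexp l * Cnu) => a al.
have mb := minb.
have [_ h] := @Itg_levy (fun y => inb y * (expR (dotv a y) - 1) - dotv a y * indB1 y)
  (Cexp (normv a)) ltac:(mfun) (exp_dom a).
rewrite al in h; apply: lerD; last exact: le_trans (ler_norm _) h.
apply: lerD; first by rewrite -al dotv_le.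
rewrite hs ler_sum// => w _; rewrite -(@real_normK _ (dotv w a)) ?num_real//.
have hw : `|dotv w a| <= normv w * l by rewrite -al cauchy_schwarz.
by apply: lerXn2r; rewrite ?nnegrE// (le_trans _ hw).
Qed.

Lemma normv_exp_le (a y : V) : normv y <= r -> expR (dotv a y) <= expR (normv a * r).
Proof. by move=> yr; rewrite ler_expR (le_trans (dotv_le _ _))// ler_wpM2l ?normv_ge0. Qed.

Lemma far_min2 n y : far n y <= n.+1%:R ^+ 2 * min2 y.
Proof.
rewrite /far; case: (boolP (_ < _)) => [h|_]; last by rewrite mulr_ge0 ?min2_ge0// exprn_ge0.
have [y1|y1] := ltP (normv y) 1.
  rewrite min2_lt1// -exprMn exprn_ege1// -[X in X <= _](@mulfV _ n.+1%:R)// ler_pM2l// ltW//.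
by rewrite min2_ge1// mulr1 exprn_ege1// ler1n.
Qed.

(** Jumps between 1/(n+1) and r have finite intensity and, being bounded, all exponential moments:
    they form a compound Poisson part. Their compensator is a drift, and n tends to infinity by
    [good_lim], with 1 /\ |y|^2 as majorant of the compensated integrands. *)
Lemma good_cutoff (t : R) : 0 <= t ->
  good leb (fun xi => expR (- (t * aR xi))) (fun xi => t * bR xi) (fun a => t * LR a).
Proof.
move=> t0; have mn := mnu; have mb := minb.
have G0 := good_quadA Hleb d0 t0 sA pA.
pose m n (y : V) := t * (far n y * (inb y * nu y)).
have m0 n y : 0 <= m n y.
  by rewrite /m !mulr_ge0 ?nu_ge0//.
have farI n (F : V -> R) (C : R) : measurable_fun setT F -> (forall y, `|F y| <= C) ->
    Itg leb (fun y => far n y * (F y * nu y)).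
  move=> mF FC; have mf := mfar n.
  have C0 : 0 <= C by apply: le_trans (FC vzero).
  have [|h _] := @Itg_levy (fun y => far n y * F y) (C * n.+1%:R ^+ 2) ltac:(mfun) _.
    move=> y; rewrite normrM mulrC -mulrA; apply: ler_pM => //.
    by case/andP: (far_le n y) => h1 _; rewrite ger0_norm// far_min2.
  by apply: (Itg_ext _ h) => y; rewrite mulrA.
have im n : Itg leb (m n).
  apply: ItgZ; apply: (@farI n inb 1) => // y.
  by case/andP: (inb_le y) => h1 h2; rewrite ger0_norm.
have ima n a : Itg leb (fun y => m n y * expR (dotv a y)).
  have h : Itg leb (fun y => far n y * (inb y * expR (dotv a y) * nu y)).
    apply: (@farI n _ (expR (normv a * r))); first by mfun.
    move=> y; rewrite /inb; case: (boolP (normv y <= r)) => yr; last by rewrite mul0r normr0 expR_ge0.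
    by rewrite mul1r ger0_norm ?expR_ge0// normv_exp_le.
  by apply: (Itg_ext _ (ItgZ t h)) => y; rewrite /m; ring.
have idr n i : Itg leb (fun y => far n y * (tnth y i * indB1 y * nu y)).
  apply: (@farI n _ 1); first by mfun.
  move=> y; rewrite indB1E; have [y1|y1] := ltP (normv y) 1; last by rewrite mulr0 normr0.
  by rewrite mulr1 (le_trans (coord_le_normv _ _))// ltW.
(* The drift b corrected by the compensator of those jumps of the unit ball that are longer than
   1/(n+1). *)
pose c n : V := [tuple t * (tnth b i - RI leb (fun y => far n y * (tnth y i * indB1 y * nu y))) | i < d].
have dotc n a : Itg leb (fun y => far n y * (dotv a y * indB1 y * nu y)) /\
   dotv a (c n) = t * (dotv a b - RI leb (fun y => far n y * (dotv a y * indB1 y * nu y))).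
  have S (s : seq 'I_d) : Itg leb (fun y => \sum_(i <- s) tnth a i * (far n y * (tnth y i * indB1 y * nu y))) /\
     RI leb (fun y => \sum_(i <- s) tnth a i * (far n y * (tnth y i * indB1 y * nu y))) =
     \sum_(i <- s) tnth a i * RI leb (fun y => far n y * (tnth y i * indB1 y * nu y)).
    elim: s => [|i s [I1 E1]].
      split; first by apply: (Itg_ext (u := fun=> 0)) => [x|]; [rewrite big_nil|exact: Itg0].
      by rewrite big_nil (RI_ext leb (v := fun=> 0)) ?RI0// => x; rewrite big_nil.
    have E y : tnth a i * (far n y * (tnth y i * indB1 y * nu y)) +
       \sum_(j <- s) tnth a j * (far n y * (tnth y j * indB1 y * nu y)) =
       \sum_(j <- i :: s) tnth a j * (far n y * (tnth y j * indB1 y * nu y)) by rewrite [RHS]big_cons.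
    split; first by apply: (Itg_ext E); apply: ItgD => //; exact: ItgZ.
    rewrite -(RI_ext leb E) RID//; last exact: ItgZ.
    by rewrite (RIZ _ (idr n i)) E1 big_cons.
  have [I1 E1] := S (index_enum 'I_d).
  have E y : \sum_(i < d) tnth a i * (far n y * (tnth y i * indB1 y * nu y)) =
      far n y * (dotv a y * indB1 y * nu y).
    rewrite /dotv !mulr_suml mulr_sumr; apply: eq_bigr => i _; ring.
  split; first exact: (Itg_ext E).
  rewrite -(RI_ext leb E) E1 /dotv -sumrN -big_split mulr_sumr; apply: eq_bigr => i _.
  by rewrite tnth_mktuple /=; ring.
have step n := good_drift Hleb (c n) (good_cp Hleb (lam := leb) (m := m n) (m0 n) (im n) (ima n) G0).
have isin n xi : Itg leb (fun y => m n y * sin (dotv xi y)).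
  by apply: (@Itg_fsin _ _ leb (m n)).
have e1 n xi : RI leb (fun y => m n y * (1 - cos (dotv xi y))) =
   t * RI leb (fun y => far n y * (inb y * (1 - cos (dotv xi y)) * nu y)).
  rewrite -RIZ; first by apply: RI_ext => y; rewrite /m; ring.
  apply: (@farI n _ 2); first by mfun.
  move=> y; rewrite normrM -[X in _ <= X]mul1r; apply: ler_pM => //.
    by case/andP: (inb_le y) => h1 h2; rewrite ger0_norm.
  have := cos_geN1 (dotv xi y); have := cos_le1 (dotv xi y) => h1 h2; rewrite ger0_norm; lra.
have e2 n xi : RI leb (fun y => m n y * sin (dotv xi y)) + dotv (c n) xi =
   t * (dotv xi b + RI leb (fun y => far n y * ((inb y * sin (dotv xi y) - dotv xi y * indB1 y) * nu y))).
  have [I1 E1] := dotc n xi; rewrite (dotvC (c n)) E1.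
  have I2 : Itg leb (fun y => far n y * (inb y * sin (dotv xi y) * nu y)).
    apply: (@farI n _ 1); first by mfun.
    move=> y; rewrite normrM -[X in _ <= X]mul1r; apply: ler_pM => //; last exact: normsin.
    by case/andP: (inb_le y) => h1 h2; rewrite ger0_norm.
  rewrite (RI_ext leb (_ : _ =1 (fun y => t * (far n y * (inb y * sin (dotv xi y) * nu y))))); last first.
    by move=> y; rewrite /m; ring.
  have E3 : RI leb (fun y => far n y * ((inb y * sin (dotv xi y) - dotv xi y * indB1 y) * nu y)) =
      RI leb (fun y => far n y * (inb y * sin (dotv xi y) * nu y)) - RI leb (fun y => far n y * (dotv xi y * indB1 y * nu y)).
    by rewrite -RIB//; apply: RI_ext => y; ring.
  by rewrite (RIZ _ I2) E3; ring.
have e3 n a : RI leb (fun y => m n y * (expR (dotv a y) - 1)) + dotv a (c n) =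
   t * (dotv a b + RI leb (fun y => far n y * ((inb y * (expR (dotv a y) - 1) - dotv a y * indB1 y) * nu y))).
  have [I1 E1] := dotc n a; rewrite E1.
  have I2 : Itg leb (fun y => far n y * (inb y * (expR (dotv a y) - 1) * nu y)).
    apply: (@farI n _ (expR (normv a * r) + 1)); first by mfun.
    move=> y; rewrite /inb; case: (boolP (normv y <= r)) => yr; last by rewrite mul0r normr0 addr_ge0 ?expR_ge0.
    rewrite mul1r (le_trans (ler_normB _ _))// normr1 lerD2r ger0_norm ?expR_ge0//.
    exact: normv_exp_le.
  rewrite (RI_ext leb (_ : _ =1 (fun y => t * (far n y * (inb y * (expR (dotv a y) - 1) * nu y))))); last first.
    by move=> y; rewrite /m; ring.
  have E3 : RI leb (fun y => far n y * ((inb y * (expR (dotv a y) - 1) - dotv a y * indB1 y) * nu y)) =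
      RI leb (fun y => far n y * (inb y * (expR (dotv a y) - 1) * nu y)) - RI leb (fun y => far n y * (dotv a y * indB1 y * nu y)).
    by rewrite -RIB//; apply: RI_ext => y; ring.
  by rewrite (RIZ _ I2) E3; ring.
have mdx xi : measurable_fun setT (fun y : V => inb y * (expR (dotv xi y) - 1) - dotv xi y * indB1 y) by mfun.
have bdn n a : RI leb (fun y => far n y * ((inb y * (expR (dotv a y) - 1) - dotv a y * indB1 y) * nu y))
   <= Cexp (normv a) * Cnu.
  have mf := mfar n.
  have [|_ h] := @Itg_levy (fun y => far n y * (inb y * (expR (dotv a y) - 1) - dotv a y * indB1 y)) (Cexp (normv a)) ltac:(mfun) _.
    move=> y; apply: le_trans (exp_dom a y); rewrite normrM ler_piMl//.
    by case/andP: (far_le n y) => h1 h2; rewrite ger0_norm.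
  apply: le_trans (ler_norm _) _; rewrite (RI_ext leb (_ : _ =1 (fun y => far n y * (inb y * (expR (dotv a y) - 1) - dotv a y * indB1 y) * nu y))); first exact: h.
  by move=> y; rewrite mulrA.
have := good_lim Hleb d0 step; apply.
- move=> l; have [s hs] := psd_sum_of_squares sA pA.
  exists (t * (l * normv b + \sum_(v <- s) (normv v * l) ^+ 2 + Cexp l * Cnu)) => n a al.
  rewrite -addrA e3 -mulrDr ler_wpM2l// addrCA addrA; apply: lerD; last by rewrite -al bdn.
  apply: lerD; first by rewrite -al dotv_le.
  rewrite hs ler_sum// => w _; rewrite -(@real_normK _ (dotv w a)) ?num_real//.
  have hw : `|dotv w a| <= normv w * l by rewrite -al cauchy_schwarz.
  by apply: lerXn2r; rewrite ?nnegrE// (le_trans _ hw).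
- move=> xi; rewrite /aR mulrDr opprD expRD; apply: cvgM; first exact: cvg_cst.
  apply: (@cvg_comp _ _ _ _ expR); last exact: continuous_expR.
  apply: cvgN; rewrite (_ : (fun n => _) = (fun n => t * RI leb (fun y => far n y * (inb y * (1 - cos (dotv xi y)) * nu y)))).
    apply: cvgM; first exact: cvg_cst.
    by apply: (levy_dct _ (cos_dom xi)); mfun.
  by apply/funext => n; rewrite e1.
- move=> xi; rewrite (_ : (fun n => _) = (fun n => t * (dotv xi b + RI leb (fun y => far n y * ((inb y * sin (dotv xi y) - dotv xi y * indB1 y) * nu y))))).
    apply: cvgM; first exact: cvg_cst.
    apply: cvgD; first exact: cvg_cst.
    by apply: (levy_dct _ (sin_dom xi)); mfun.
  by apply/funext => n; rewrite add0r e2.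
- move=> a; rewrite (_ : (fun n => _) = (fun n => t * (dotv a b + quadA A a + RI leb (fun y => far n y * ((inb y * (expR (dotv a y) - 1) - dotv a y * indB1 y) * nu y))))).
    apply: cvgM; first exact: cvg_cst.
    apply: cvgD; first exact: cvg_cst.
    by apply: (levy_dct _ (exp_dom a)).
  by apply/funext => n; rewrite -addrA e3; ring.
Qed.

End cutoff.
End levy.

(** * Bounds and masses of iterated convolutions *)

Section conv_iterates.
Context (R : realType) (d : nat).
Local Notation V := (d.-tuple R).
Variable leb : {sigma_finite_measure set V -> \bar R}.
Hypothesis Hleb : is_lebesgue leb.
Variables (m u : V -> R) (C : R).
Hypothesis m0 : forall y, 0 <= m y.
Hypothesis im : Itg leb m.
Hypothesis u0 : forall x, 0 <= u x <= C.
Hypothesis iu : Itg leb u.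

Lemma vconv_mass (w : V -> R) (D : R) : (forall x, 0 <= w x <= D) -> Itg leb w ->
  [/\ forall x, 0 <= vconv leb m w x <= RI leb m * D, measurable_fun setT (vconv leb m w),
      Itg leb (vconv leb m w) & RI leb (vconv leb m w) = RI leb m * RI leb w].
Proof.
move=> w0 iw; have mw := Itg_meas iw.
have E (v : V -> R) : (fun y => expR (dotv vzero y) * v y) =1 v by move=> y; rewrite dotv0l expR0 mul1r.
have E' (v : V -> R) : (fun y => v y * expR (dotv vzero y)) =1 v by move=> y; rewrite dotv0l expR0 mulr1.
have [||h1 h2 h3 h4] := @conv_mgf _ _ _ Hleb leb m w D vzero m0 im _ w0 mw _.
- by rewrite (funext (E' m)).
- by rewrite (funext (E w)).
by move: h3 h4; rewrite !(funext (E _)) (funext (E' _)).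
Qed.

Lemma iter_vconv_mass n :
  [/\ forall x, 0 <= iter n (vconv leb m) u x <= RI leb m ^+ n * C,
      Itg leb (iter n (vconv leb m) u) & RI leb (iter n (vconv leb m) u) = RI leb m ^+ n * RI leb u].
Proof.
elim: n => [|n [h1 h2 h3]]; first by split => // [x|]; rewrite /= expr0 mul1r.
have [k1 k2 k3 k4] := vconv_mass h1 h2.
by split=> //=; [move=> x; rewrite exprS -mulrA|rewrite k4 h3 exprS mulrA].
Qed.

Lemma iter_vconv_ge0 n x : 0 <= iter n (vconv leb m) u x.
Proof. by have [h _ _] := iter_vconv_mass n; case/andP: (h x). Qed.

Lemma vconv_series_mass (l : V -> R) :
  (forall x, \sum_(n < N) iter n (vconv leb m) u x / n`!%:R @[N --> \oo] --> l x) ->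
  Itg leb l /\ RI leb l = expR (RI leb m) * RI leb u.
Proof.
move=> hl.
have f0 n : 0 <= (n`!%:R : R)^-1 by rewrite invr_ge0.
have S N : Itg leb (fun x => \sum_(n < N) iter n (vconv leb m) u x / n`!%:R) /\
    RI leb (fun x => \sum_(n < N) iter n (vconv leb m) u x / n`!%:R) =
    (\sum_(n < N) RI leb m ^+ n / n`!%:R) * RI leb u.
  elim: N => [|N [I E]].
    split; first by apply: (Itg_ext (u := fun=> 0)) => [x|]; [rewrite big_ord0|exact: Itg0].
    by rewrite big_ord0 mul0r (RI_ext leb (v := fun=> 0)) ?RI0// => x; rewrite big_ord0.
  have [k1 k2 k3] := iter_vconv_mass N.
  have iN : Itg leb (fun x => N`!%:R^-1 * iter N (vconv leb m) u x) by exact: ItgZ.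
  have e x : \sum_(n < N) iter n (vconv leb m) u x / n`!%:R + N`!%:R^-1 * iter N (vconv leb m) u x =
     \sum_(n < N.+1) iter n (vconv leb m) u x / n`!%:R by rewrite big_ord_recr/= [_^-1 * _]mulrC.
  split; first by apply: (Itg_ext e); exact: ItgD.
  by rewrite -(RI_ext leb e) RID// RIZ// k3 E big_ord_recr/=; ring.
apply: (@RI_mct _ _ _ leb (fun N x => \sum_(n < N) iter n (vconv leb m) u x / n`!%:R)) => //.
- by move=> N; have [] := S N.
- by move=> N x; apply: sumr_ge0 => n _; rewrite mulr_ge0// iter_vconv_ge0.
- move=> x N M NM.
  rewrite -(big_mkord xpredT (fun n => iter n (vconv leb m) u x / n`!%:R)).
  rewrite -(big_mkord xpredT (fun n => iter n (vconv leb m) u x / n`!%:R)).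
  rewrite [X in _ <= X](@big_cat_nat _ _ _ N)//= lerDl sumr_ge0// => n _.
  by rewrite mulr_ge0// iter_vconv_ge0.
rewrite (_ : (fun N => _) = (fun N => (\sum_(n < N) RI leb m ^+ n / n`!%:R) * RI leb u)).
  apply: cvgM; last exact: cvg_cst.
  have := @is_cvg_series_exp_coeff R (RI leb m); rewrite /expR => h.
  rewrite (_ : (fun N : nat => _) = series (exp_coeff (RI leb m))); first exact: h.
  by apply/funext => N; rewrite /series /= big_mkord; apply: eq_bigr.
by apply/funext => N; have [] := S N.
Qed.

End conv_iterates.

(** * Convolution series relating different cutoffs *)

Section cutoff_relations.
Context (R : realType) (d : nat).
Local Notation V := (d.-tuple R).
Variable leb : {sigma_finite_measure set V -> \bar R}.
Hypothesis Hleb : is_lebesgue leb.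
Hypothesis d0 : (0 < d)%N.
Variables (b : V) (A : 'M[R]_d) (nu : V -> R).
Hypothesis sA : A^T = A.
Hypothesis pA : forall x, 0 <= quadA A x.
Hypothesis Hnu : levy_density leb nu.

Definition outb (r : R) (y : V) : R := ((r < normv y)%R : bool)%:R.

Lemma moutb r : measurable_fun setT (outb r). Proof. rewrite /outb; mfun. Qed.
Lemma outb_le r y : 0 <= outb r y <= 1. Proof. by rewrite /outb; case: (r < _); rewrite ?lexx ?ler01. Qed.
Lemma outb_inb r (y : V) : inb r y + outb r y = 1.
Proof. by rewrite /inb /outb ltNge; case: (_ <= r); rewrite ?addr0 ?add0r. Qed.

Lemma outb_min2 r y : 0 < r -> outb r y <= (1 + r ^- 2) * min2 y.
Proof.
move=> r0; rewrite /outb; case: (boolP (r < normv y)) => [h|_]; last first.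
  by rewrite mulr_ge0 ?min2_ge0// addr_ge0// invr_ge0 exprn_ge0// ltW.
have r2 : 0 < r ^+ 2 by rewrite exprn_gt0.
have [y1|y1] := ltP (normv y) 1; last first.
  by rewrite min2_ge1// mulr1 lerDl invr_ge0 ltW.
rewrite min2_lt1// mulrDl mul1r -[true%:R]/(1 : R); have := sqr_ge0 (normv y).
have : 1 <= r ^- 2 * normv y ^+ 2; last by lra.
rewrite mulrC ler_pdivlMr// mul1r; apply: lerXn2r; rewrite ?nnegrE ?normv_ge0// ltW//.
Qed.

Lemma Itg_out (r : R) (F : V -> R) (C : R) : 0 < r -> measurable_fun setT F ->
  (forall y, `|F y| <= C) -> Itg leb (fun y => outb r y * F y * nu y).
Proof.
move=> r0 mF FC; have mo := moutb r.
have [|h _] := @Itg_levy _ _ leb nu Hnu (fun y => outb r y * F y) ((1 + r ^- 2) * C) ltac:(mfun) _ => //.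
move=> y; rewrite normrM mulrAC; apply: ler_pM => //.
by case/andP: (outb_le r y) => h _; rewrite ger0_norm// outb_min2.
Qed.

Lemma Itg_outnu (r : R) : 0 < r -> Itg leb (fun y => outb r y * nu y).
Proof.
move=> r0; apply: (@Itg_ext _ _ _ _ (fun y => outb r y * 1 * nu y)); first by move=> y; rewrite mulr1.
by apply: (@Itg_out r (fun=> 1) 1) => // y; rewrite normr1.
Qed.

Section general_cutoff.
Variables (h : R) (X : V -> R).
Hypothesis h0 : 0 < h.
Hypothesis mX : measurable_fun setT X.
Hypothesis X01 : forall y, 0 <= X y <= 1.
Hypothesis X1 : forall y, normv y <= h -> X y = 1.

(** A weight X equal to 1 on |y| <= h covers both applications: X = 1 is the full exponent and X =
    [inb s] the exponent cut at s >= h. *)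
Definition aX (xi : V) : R := quadA A xi + RI leb (fun y => X y * (1 - cos (dotv xi y)) * nu y).
Definition bX (xi : V) : R :=
  dotv xi b + RI leb (fun y => (X y * sin (dotv xi y) - dotv xi y * indB1 y) * nu y).
Definition mX_ (t : R) (y : V) : R := t * (outb h y * X y * nu y).

Let Xabs y : `|X y| <= 1. Proof. by case/andP: (X01 y) => h1 h2; rewrite ger0_norm. Qed.

Lemma cutoffX y : X y = inb h y + outb h y * X y.
Proof.
rewrite /inb /outb; have [yh|yh] := leP (normv y) h; first by rewrite X1// mul0r addr0.
by rewrite mul1r add0r.
Qed.

Lemma Itg_outX (F : V -> R) (C : R) : measurable_fun setT F ->
  (forall y, `|F y| <= C) -> Itg leb (fun y => outb h y * X y * nu y * F y).
Proof.
move=> mF FC; apply: (@Itg_ext _ _ _ _ (fun y => outb h y * (X y * F y) * nu y)); first by move=> y; ring.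
apply: (@Itg_out h _ C) => //; first by mfun.
by move=> y; rewrite normrM -[C]mul1r ler_pM.
Qed.

Lemma ImX_ t : Itg leb (mX_ t).
Proof.
apply: ItgZ; apply: (@Itg_ext _ _ _ _ (fun y => outb h y * X y * nu y * 1)); first by move=> y; rewrite mulr1.
by apply: (@Itg_outX (fun=> 1) 1) => // y; rewrite normr1.
Qed.

Lemma mX_ge0 t y : 0 <= t -> 0 <= mX_ t y.
Proof.
by move=> t0; rewrite /mX_ !mulr_ge0 ?(nu_ge0 Hnu)//; case/andP: (X01 y).
Qed.

Lemma abs_1cos (s : R) : `|1 - cos s| <= 2.
Proof. have := cos_geN1 s; have := cos_le1 s => h1 h2; rewrite ger0_norm; lra. Qed.

Lemma aX_split xi : aX xi = aR leb A nu h xi + RI leb (fun y => outb h y * X y * nu y * (1 - cos (dotv xi y))).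
Proof.
have mb := minb (d := d) h; rewrite /aX /aR -addrA; congr (_ + _).
rewrite -RID.
- by apply: RI_ext => y; rewrite {1}cutoffX; ring.
- apply: (proj1 (Itg_levy Hnu _ (cos_dom h xi))); mfun.
- by apply: (@Itg_outX _ 2) => [|y]; [mfun|exact: abs_1cos].
Qed.

Lemma bX_split xi : bX xi = bR leb b nu h xi + RI leb (fun y => outb h y * X y * nu y * sin (dotv xi y)).
Proof.
have mb := minb (d := d) h; rewrite /bX /bR -addrA; congr (_ + _).
rewrite -RID.
- by apply: RI_ext => y; rewrite {1}cutoffX; ring.
- apply: (proj1 (Itg_levy Hnu _ (sin_dom h0 xi))); mfun.
- by apply: (@Itg_outX _ 1) => [|y]; [mfun|exact: normsin].
Qed.

Lemma aX_le xi : aX xi <= aR leb A nu h xi + 2 * RI leb (fun y => outb h y * nu y).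
Proof.
rewrite aX_split lerD2l -RIZ; last exact: Itg_outnu.
apply: RI_le; first by apply: (@Itg_outX _ 2) => [|y]; [mfun|exact: abs_1cos].
  by apply: ItgZ; exact: Itg_outnu.
move=> y; have := abs_1cos (dotv xi y); have [_ q] := andP (X01 y).
have p0 : 0 <= outb h y * nu y by rewrite mulr_ge0 ?(nu_ge0 Hnu)//; case/andP: (outb_le h y).
move=> k; rewrite [X in X <= _](_ : _ = outb h y * nu y * (X y * (1 - cos (dotv xi y)))); last by ring.
rewrite [2 * _]mulrC ler_wpM2l//.
apply: (le_trans (ler_norm _)); rewrite normrM -[2]mul1r ler_pM//.
Qed.

Lemma aX_ge0 xi : 0 <= aX xi.
Proof.
rewrite addr_ge0// RI_ge0// => y; rewrite !mulr_ge0 ?(nu_ge0 Hnu)// ?subr_ge0 ?cos_le1//; by case/andP: (X01 y).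
Qed.

Lemma meas_aX : measurable_fun setT aX.
Proof.
have mn := mnu Hnu; rewrite /aX.
have h1 := @measurable_RI _ _ _ _ _ leb (fun z : V * V => X z.2 * (1 - cos (dotv z.1 z.2)) * nu z.2).
by apply: mf_add; [mfun|apply: h1; have := mf_comp2 mX measurable_snd; have := mf_comp2 mn measurable_snd;
  rewrite /=; move=> *; mfun].
Qed.

Lemma meas_bX : measurable_fun setT bX.
Proof.
have mn := mnu Hnu; rewrite /bX.
have h1 := @measurable_RI _ _ _ _ _ leb (fun z : V * V => (X z.2 * sin (dotv z.1 z.2) - dotv z.1 z.2 * indB1 z.2) * nu z.2).
by apply: mf_add; [mfun|apply: h1; have := mf_comp2 mX measurable_snd; have := mf_comp2 mn measurable_snd;
  rewrite /=; move=> *; mfun].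
Qed.

(** Going from the cutoff h to the weight X adds finitely many jumps longer than h, which is a
    compound Poisson step with density [mX_]. *)
Lemma series_X (t : R) x : 0 <= t ->
  Itg leb (fun xi => expR (- (t * aR leb A nu h xi))) ->
  \sum_(n < N) iter n (vconv leb (mX_ t))
     (U leb (fun xi => expR (- (t * aR leb A nu h xi))) (fun xi => t * bR leb b nu h xi)) x / n`!%:R
  @[N --> \oo] --> expR (RI leb (mX_ t)) * U leb (fun xi => expR (- (t * aX xi))) (fun xi => t * bX xi) x.
Proof.
move=> t0 ir; have G := good_cutoff Hleb d0 b sA pA Hnu h0 t0.
have := @conv_exp _ _ leb leb (mX_ t) (fun y => mX_ge0 y t0) (ImX_ t) _ _ x ir (good_th G).
have E1 xi : expR (- (t * aR leb A nu h xi)) * expR (- RI leb (fun y => mX_ t y * (1 - cos (dotv xi y)))) =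
   expR (- (t * aX xi)).
  rewrite -expRD aX_split (mulrDr t (aR leb A nu h xi)) opprD -[in RHS]RIZ; last by apply: (@Itg_outX _ 2) => [|y]; [mfun|exact: abs_1cos].
  by congr (expR (_ - _)); apply: RI_ext => y; rewrite /mX_; ring.
have E2 xi : t * bR leb b nu h xi + RI leb (fun y => mX_ t y * sin (dotv xi y)) = t * bX xi.
  rewrite bX_split (mulrDr t (bR leb b nu h xi)) -[in RHS]RIZ; last by apply: (@Itg_outX _ 1) => [|y]; [mfun|exact: normsin].
  by congr (_ + _); apply: RI_ext => y; rewrite /mX_; ring.
by rewrite (funext E1) (funext E2).
Qed.

End general_cutoff.

Definition rhoR (t r : R) (xi : V) : R := expR (- (t * aR leb A nu r xi)).
Definition thR (t r : R) (xi : V) : R := t * bR leb b nu r xi.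
Definition UR (t r : R) : V -> R := U leb (rhoR t r) (thR t r).
Definition rhoF (t : R) (xi : V) : R := expR (- (t * Repsi leb A nu xi)).
Definition thF (t : R) (xi : V) : R := - (t * Impsi leb b nu xi).
Definition UF (t : R) : V -> R := U leb (rhoF t) (thF t).

Let one : V -> R := fun=> 1.

Lemma Repsi_aX xi : Repsi leb A nu xi = aX one xi.
Proof. by congr (_ + _); apply: RI_ext => y; rewrite mul1r. Qed.

Lemma Impsi_bX xi : - Impsi leb b nu xi = bX one xi.
Proof.
rewrite /Impsi opprD opprK /bX; congr (_ + _).
rewrite /ImPhi -mulN1r -RIZ.
  by apply: RI_ext => y; rewrite /one; ring.
apply: (proj1 (Itg_levy (C := 1 + normv xi ^+ 3 + normv xi / 1 + 1) Hnu _ _)); first by mfun.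
move=> y; have := sin_dom ltr01 xi y.
have m2 := min2_ge0 y.
have E : `|- sin (dotv xi y) + dotv xi y * indB1 y| <= `|inb 1 y * sin (dotv xi y) - dotv xi y * indB1 y| + min2 y.
  rewrite /inb; have [y1|y1] := leP (normv y) 1.
    by rewrite mul1r -normrN opprD opprK lerDl.
  by rewrite (min2_ge1 (ltW y1)) /indB1 ltNge (ltW y1)/= !mulr0 addr0 mul0r subr0 normr0 add0r normrN normsin.
move=> h; apply: (le_trans E); rewrite [X in _ <= X]mulrDl mul1r lerD2r; exact: h.
Qed.

Section fixed_time.
Variable t : R.
Hypothesis t0 : 0 <= t.
Hypothesis irF : Itg leb (fun xi => rhoF t xi * normv xi).

(** In the unit ball rho <= 1 <= exp(1 - |xi|), outside it rho <= rho |xi|. *)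
Lemma Itg_of_moment (rho : V -> R) : measurable_fun setT rho -> (forall xi, 0 <= rho xi <= 1) ->
  Itg leb (fun xi => rho xi * normv xi) ->
  Itg leb rho /\ RI leb rho <= RI leb (fun xi : V => expR (1 - normv xi)) + RI leb (fun xi => rho xi * normv xi).
Proof.
move=> mr r01 ir.
have ie : Itg leb (fun xi : V => expR (1 - normv xi)).
  apply: (@Itg_ext _ _ _ _ (fun xi : V => expR 1 * expR (- (1 * normv xi)))).
    by move=> xi; rewrite -expRD mul1r.
  by apply: ItgZ; exact: Itg_exp_norm.
have is_ : Itg leb (fun xi : V => expR (1 - normv xi) + rho xi * normv xi) by exact: ItgD.
have le xi : rho xi <= expR (1 - normv xi) + rho xi * normv xi.
  have /andP[r0 r1] := r01 xi; have [x1|x1] := leP (normv xi) 1.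
    have : 1 <= expR (1 - normv xi) by rewrite -[X in X <= _]expR0 ler_expR subr_ge0.
    have := mulr_ge0 r0 (normv_ge0 xi); lra.
  have := expR_ge0 (1 - normv xi); have := ler_wpM2l r0 (ltW x1); rewrite mulr1; lra.
have i1 : Itg leb rho.
  apply: Itg_dom is_ => // xi; rewrite ger0_norm//; by case/andP: (r01 xi).
by split=> //; rewrite -RID//; apply: RI_le.
Qed.

Lemma mrhoF : measurable_fun setT (rhoF t).
Proof.
have m1 := @meas_aX one (measurable_cst _); rewrite /rhoF (funext Repsi_aX); mfun.
Qed.
Lemma mthF : measurable_fun setT (thF t).
Proof.
have m1 := @meas_bX one (measurable_cst _).
rewrite (_ : thF t = (fun xi => t * bX one xi)); first by mfun.
by apply/funext => xi; rewrite -Impsi_bX mulrN.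
Qed.

Let one01 (y : V) : 0 <= one y <= 1. Proof. by rewrite /one ler01 lexx. Qed.

Lemma rhoF01 xi : 0 <= rhoF t xi <= 1.
Proof. by rewrite expR_ge0 -expR0 ler_expR oppr_le0 mulr_ge0// Repsi_aX aX_ge0. Qed.

Lemma Itg_rhoF : Itg leb (rhoF t) /\
  RI leb (rhoF t) <= RI leb (fun xi : V => expR (1 - normv xi)) + RI leb (fun xi => rhoF t xi * normv xi).
Proof. exact: Itg_of_moment mrhoF rhoF01 irF. Qed.

Section cut.
Variable r : R.
Hypothesis r0 : 0 < r.
Let G := good_cutoff Hleb d0 b sA pA Hnu r0 t0.

(** As 1 - cos <= 2, removing the jumps beyond r lowers the real exponent by at most twice their
    mass. *)
Lemma rhoR_le xi : rhoR t r xi <= expR (2 * (t * RI leb (fun y => outb r y * nu y))) * rhoF t xi.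
Proof.
rewrite -expRD ler_expR Repsi_aX.
have := ler_wpM2l t0 (aX_le r0 (measurable_cst _) one01 (fun _ _ => erefl) xi).
rewrite mulrDr; lra.
Qed.

Lemma Itg_rhoR : Itg leb (rhoR t r) /\ Itg leb (fun xi => rhoR t r xi * normv xi) /\
  RI leb (rhoR t r) <= expR (2 * (t * RI leb (fun y => outb r y * nu y))) * RI leb (rhoF t) /\
  RI leb (fun xi => rhoR t r xi * normv xi) <=
    expR (2 * (t * RI leb (fun y => outb r y * nu y))) * RI leb (fun xi => rhoF t xi * normv xi).
Proof.
set c := expR (2 * _); have [iF _] := Itg_rhoF.
have mr : measurable_fun setT (rhoR t r) := good_meas G.
have i1 : Itg leb (rhoR t r).
  by apply: Itg_dom (ItgZ c iF) => // xi; rewrite ger0_norm ?expR_ge0// rhoR_le.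
have le xi : rhoR t r xi * normv xi <= c * (rhoF t xi * normv xi).
  by rewrite mulrA ler_wpM2r ?normv_ge0// rhoR_le.
have i2 : Itg leb (fun xi => rhoR t r xi * normv xi).
  apply: Itg_dom (ItgZ c irF); first by mfun.
  by move=> xi; rewrite ger0_norm ?mulr_ge0 ?expR_ge0 ?normv_ge0//; exact: le.
split => //; split => //; split.
- by rewrite -(RIZ c iF); apply: RI_le => //; [exact: ItgZ|exact: rhoR_le].
- by rewrite -(RIZ c irF); exact: (RI_le i2 (ItgZ c irF) le).
Qed.

Lemma UR_mgf : (forall x, 0 <= UR t r x) /\
  (forall a, Itg leb (fun x => expR (dotv a x) * UR t r x) /\
     RI leb (fun x => expR (dotv a x) * UR t r x) = Kd leb * expR (t * LR leb b A nu r a)).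
Proof.
have [i1 [i2 _]] := Itg_rhoR; apply: (good_integrable Hleb d0 G) => //.
move=> l; have [B hB] := LR_bound b sA pA Hnu r0 l.
by exists (t * B) => a /hB; exact: ler_wpM2l.
Qed.

Lemma UR_ge0 x : 0 <= UR t r x. Proof. by case: UR_mgf. Qed.

Lemma mUR : measurable_fun setT (UR t r).
Proof. apply: measurable_U; [exact: (good_meas G)|exact: (good_th G)]. Qed.

Lemma UR_mass : Itg leb (UR t r) /\ RI leb (UR t r) = Kd leb.
Proof.
have [_ /(_ vzero)] := UR_mgf.
have E : (fun x => expR (dotv vzero x) * UR t r x) = UR t r.
  by apply/funext => x; rewrite dotv0l expR0 mul1r.
rewrite E => -[i ->]; split => //; rewrite /LR dotv0l (_ : quadA A vzero = 0); last first.
  by rewrite /quadA big1// => i' _; rewrite big1// => j _; rewrite tnthE !mul0r.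
rewrite (RI_ext leb (v := fun=> 0)) ?RI0 ?addr0 ?mulr0 ?expR0 ?mulr1//.
by move=> y; rewrite dotv0l expR0 subrr mulr0 !mul0r subr0 mul0r.
Qed.

Lemma UR_le x : 0 <= UR t r x <= RI leb (rhoR t r).
Proof.
have [i1 _] := Itg_rhoR; rewrite UR_ge0/=; apply: (le_trans (ler_norm _)).
by apply: U_abs => // [xi|]; [exact: expR_ge0|exact: (good_th G)].
Qed.

Lemma UF_series x :
  \sum_(n < N) iter n (vconv leb (mX_ r one t)) (UR t r) x / n`!%:R @[N --> \oo] -->
  expR (RI leb (mX_ r one t)) * UF t x.
Proof.
have [i1 _] := Itg_rhoR.
have := @series_X r one r0 (measurable_cst _) one01 (fun _ _ => erefl) t x t0 i1.
rewrite /UF (_ : rhoF t = (fun xi => expR (- (t * aX one xi)))); last by apply/funext => xi; rewrite -Repsi_aX.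
rewrite (_ : thF t = (fun xi => t * bX one xi)); last by apply/funext => xi; rewrite -Impsi_bX mulrN.
by [].
Qed.

Lemma UR_series (s : R) x : r <= s ->
  \sum_(n < N) iter n (vconv leb (mX_ r (inb s) t)) (UR t r) x / n`!%:R @[N --> \oo] -->
  expR (RI leb (mX_ r (inb s) t)) * UR t s x.
Proof.
move=> rs; have [i1 _] := Itg_rhoR.
apply: (@series_X r (inb s) r0 (minb s) (inb_le s) _ t x t0 i1) => y yr.
by rewrite /inb (le_trans yr rs).
Qed.

(** The full law may lack exponential moments, so [good] does not cover it; positivity and mass are
    read off the convolution series over a cutoff density. *)
Lemma UF_mass : (forall x, 0 <= UF t x) /\ Itg leb (UF t) /\ RI leb (UF t) = Kd leb.
Proof.
have [i1 e1] := UR_mass.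
have i2 := @ImX_ r one r0 (measurable_cst _) one01 t.
have p2 y := @mX_ge0 r one one01 t y t0.
have E0 x : 0 <= expR (RI leb (mX_ r one t)) * UF t x.
  apply: (cvg_ge (@UF_series x)) => N; apply: sumr_ge0 => n _; rewrite mulr_ge0 ?invr_ge0//.
  exact: (iter_vconv_ge0 Hleb p2 i2 UR_le i1).
split; first by move=> x; move: (E0 x); rewrite pmulr_rge0 ?expR_gt0.
have [i3 e3] := vconv_series_mass Hleb p2 i2 UR_le i1 (@UF_series).
have e0 : expR (RI leb (mX_ r one t)) != 0 by rewrite lt0r_neq0 ?expR_gt0.
have i4 : Itg leb (UF t).
  by apply: (Itg_ext _ (ItgZ (expR (RI leb (mX_ r one t)))^-1 i3)) => x; rewrite mulKf.
split; first exact: i4.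
by apply: (mulfI e0); rewrite -(RIZ _ i4) e3 e1.
Qed.

End cut.
End fixed_time.
End cutoff_relations.

(** * Piecewise linear cutoffs *)

Section clip.
Context (R : realType).

(** Truncation of s to [0, 1], in a form whose continuity and measurability are those of the
    absolute value. *)
Definition clip (s : R) : R := (1 + `|s| - `|s - 1|) / 2.

Lemma clip_le0 s : s <= 0 -> clip s = 0.
Proof. by move=> h; rewrite /clip ler0_norm// ler0_norm; [field|lra]. Qed.
Lemma clip_ge1 s : 1 <= s -> clip s = 1.
Proof. by move=> h; rewrite /clip ger0_norm ?ger0_norm; [field|lra|lra]. Qed.
Lemma clip_mid s : 0 <= s <= 1 -> clip s = s.
Proof. by move=> /andP[h1 h2]; rewrite /clip ger0_norm// ler0_norm; [field|lra]. Qed.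
Lemma clip01 s : 0 <= clip s <= 1.
Proof.
have [h|h] := leP s 0; first by rewrite clip_le0// lexx ler01.
have [k|k] := leP 1 s; first by rewrite clip_ge1// lexx ler01.
by rewrite clip_mid !ltW.
Qed.
Lemma clip_mono s r : s <= r -> clip s <= clip r.
Proof.
move=> sr; have [h|h] := leP s 0; first by rewrite (clip_le0 h); case/andP: (clip01 r).
have [k|k] := leP 1 r; first by rewrite (clip_ge1 k); case/andP: (clip01 s).
by rewrite !clip_mid// !ltW//; lra.
Qed.
Lemma cvg_clip (u : nat -> R) l : u n @[n --> \oo] --> l -> clip (u n) @[n --> \oo] --> clip l.
Proof.
move=> h; apply: cvgM; last exact: cvg_cst.
apply: cvgB; first by apply: cvgD; [exact: cvg_cst|exact: cvg_norm].
by apply: cvg_norm; apply: cvgB => //; exact: cvg_cst.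
Qed.

Lemma cvg_bigsum (I : Type) (s : seq I) (u : nat -> I -> R) (l : I -> R) :
  (forall i, u n i @[n --> \oo] --> l i) ->
  \sum_(i <- s) u n i @[n --> \oo] --> \sum_(i <- s) l i.
Proof.
move=> h; elim: s => [|i s IH].
  rewrite big_nil (_ : (fun n => _) = (fun=> 0)); first exact: cvg_cst.
  by apply/funext => n; rewrite big_nil.
rewrite big_cons (_ : (fun n => _) = (fun n => u n i + \sum_(j <- s) u n j)); first exact: cvgD.
by apply/funext => n; rewrite big_cons.
Qed.

Lemma cvg_steep_clip (s : R) : clip (n.+1%:R * s) @[n --> \oo] --> (((0 < s)%R : bool)%:R : R).
Proof.
apply: (@cvg_near_cst _ _ _ _ _ _).
have [s0|s0] := ltP 0 s; last by exists 0%N => // n _; rewrite /= clip_le0// mulr_ge0_le0.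
have [N _ hN] := cvgr0_norm_lt (fun n => n.+1%:R^-1 : R) (@cvg_harmonic R) _ s0.
exists N => // n /hN /=; rewrite ger0_norm ?invr_ge0// => h.
by rewrite clip_ge1// mulrC -ler_pdivrMr// mul1r ltW.
Qed.

End clip.

(** * Fourier inversion for a probability with integrable characteristic function *)

Section density_of_charfun.
Context (R : realType) (d : nat).
Local Notation V := (d.-tuple R).
Variable leb : {sigma_finite_measure set V -> \bar R}.
Hypothesis Hleb : is_lebesgue leb.
Hypothesis d0 : (0 < d)%N.
Variable P : probability V R.
Variables (rho th : V -> R).
Hypothesis mth : measurable_fun setT th.
Hypothesis rho0 : forall xi, 0 <= rho xi.
Hypothesis irho : Itg leb rho.
Hypothesis Pcos : forall xi, RI P (fun y => cos (dotv xi y)) = rho xi * cos (th xi).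
Hypothesis Psin : forall xi, RI P (fun y => sin (dotv xi y)) = rho xi * sin (th xi).

Let Psf : {sigma_finite_measure set V -> \bar R} := P.

Lemma Itg_prob (F : V -> R) (c : R) : measurable_fun setT F -> (forall y, `|F y| <= c) -> Itg P F.
Proof.
move=> mF Fc; apply: (@Itg_dom _ _ _ P F (fun=> c)) => //.
apply/integrableP; split; first exact/measurable_EFinP.
rewrite (eq_integral (cst (`|c|%:E)))//.
by rewrite integral_cst// -ge0_fin_numE ?mule_ge0// fin_numM// fin_num_measure.
Qed.

Let mrho : measurable_fun setT rho := Itg_meas irho.

(** Damping by [gam s] in frequency is convolution of P with a Gaussian of variance s in space;
    Fubini and [gauss_ft] make this exact. *)
Lemma mollify (s : R) x : 0 < s ->
  U leb (fun xi => rho xi * gam s xi) th x = RI leb (gam s) * RI P (fun y => gam s^-1 (vsub x y)).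
Proof.
move=> s0; have mg := @mgam R d s; have mg' := @mgam R d s^-1.
have E xi : rho xi * gam s xi * cos (dotv x xi - th xi) =
    RI Psf (fun y => gam s xi * cos (dotv (vsub x y) xi)).
  have ic : Itg P (fun y => cos (dotv xi y)) by apply: (@Itg_prob _ 1) => [|y]; [mfun|exact: normcos].
  have is_ : Itg P (fun y => sin (dotv xi y)) by apply: (@Itg_prob _ 1) => [|y]; [mfun|exact: normsin].
  have e y : gam s xi * cos (dotv x xi) * cos (dotv xi y) + gam s xi * sin (dotv x xi) * sin (dotv xi y)
     = gam s xi * cos (dotv (vsub x y) xi).
    by rewrite dotvBl cosB (dotvC y xi); ring.
  rewrite -(RI_ext P e) RID; [|exact: ItgZ|exact: ItgZ].
  by rewrite (RIZ _ ic) (RIZ _ is_) Pcos Psin cosB; ring.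
rewrite /U (RI_ext leb E).
rewrite (@fubini_prod_dom _ _ _ _ _ leb Psf (fun z => gam s z.1 * cos (dotv (vsub x z.2) z.1)) (gam s) (fun=> 1)).
- rewrite -(RIZ (RI leb (gam s))); last first.
    apply: (@Itg_prob _ 1) => [|y]; first by have := mf_comp2 mg' (mf_vsub (mf_vcst x) (@measurable_id _ _ setT)).
    by rewrite ger0_norm ?gam_ge0// gam_le1// invr_ge0 ltW.
  by apply: RI_ext => y /=; rewrite gauss_ft.
- have := mf_comp2 mg measurable_fst; rewrite /= => h; mfun.
- exact: Itg_gam.
- by apply: (@Itg_prob _ 1) => // y; rewrite normr1.
- exact: gam_ge0.
- by move=> xi y; rewrite normrM (ger0_norm (gam_ge0 _ _)) ler_wpM2l ?gam_ge0 ?normcos.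
Qed.

Lemma gam_unscale (s : R) (v : V) : 0 < s -> gam 1 v = gam s^-1 (vscale (Num.sqrt s) v).
Proof.
move=> s0; rewrite /gam dotvZl dotvZr (mulrA (Num.sqrt s)) -expr2 sqr_sqrtr ?(ltW s0)//.
by rewrite mulrA mulVf ?lt0r_neq0.
Qed.

(** The substitution x = y + sqrt(s) v moves the parameter s into the argument of the test function,
    where s can tend to 0. *)
Lemma mollified_test (G : V -> R) (c s : R) : 0 < s -> measurable_fun setT G ->
  (forall x, `|G x| <= c) -> Itg leb G ->
  RI leb (fun x => G x * U leb (fun xi => rho xi * gam s xi) th x) =
  RI leb (gam 1) * RI P (fun y => RI leb (fun v => G (vadd y (vscale (Num.sqrt s) v)) * gam 1 v)).
Proof.
move=> s0 mG Gc iG; have mg' := @mgam R d s^-1.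
have si0 : 0 < s^-1 by rewrite invr_gt0.
have q0 : 0 < Num.sqrt s by rewrite sqrtr_gt0.
rewrite (RI_ext leb (_ : _ =1 (fun x => RI Psf (fun y => G x * RI leb (gam s) * gam s^-1 (vsub x y))))); last first.
  move=> x; rewrite mollify// (RIZ (mu := P)); first by rewrite mulrA.
  apply: (@Itg_prob _ 1) => [|y]; first by have := mf_comp2 mg' (mf_vsub (mf_vcst x) (@measurable_id _ _ setT)).
  by rewrite ger0_norm ?gam_ge0// gam_le1// ltW.
have g0 : 0 <= RI leb (gam s) by apply: RI_ge0 => v; exact: gam_ge0.
rewrite (@fubini_prod_dom _ _ _ _ _ leb Psf (fun z => G z.1 * RI leb (gam s) * gam s^-1 (vsub z.1 z.2))
   (fun x => `|G x|) (fun=> RI leb (gam s))).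
- have e y : RI leb (fun x => G x * RI leb (gam s) * gam s^-1 (vsub x y)) =
     RI leb (gam 1) * RI leb (fun v => G (vadd y (vscale (Num.sqrt s) v)) * gam 1 v).
    have i1 : Itg leb (fun w => G (vadd y w) * gam s^-1 w).
      apply: (@Itg_dom _ _ _ _ _ (fun w => c * gam s^-1 w)).
      - have := mf_comp2 mG (mf_vadd (mf_vcst y) (@measurable_id _ _ setT)); rewrite /= => h; mfun.
      - by move=> w; rewrite normrM (ger0_norm (gam_ge0 _ _)) ler_wpM2r ?gam_ge0.
      - by apply: ItgZ; exact: Itg_gam.
    have E1 : RI leb (fun x => G x * gam s^-1 (vsub x y)) = RI leb (fun w => G (vadd y w) * gam s^-1 w).
      rewrite -(RI_translB Hleb y i1); apply: RI_ext => x; congr (G _ * _).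
      by apply: eq_from_tnth => i; rewrite !tnthE; ring.
    have E2 : RI leb (fun v => G (vadd y (vscale (Num.sqrt s) v)) * gam 1 v) =
        (Num.sqrt s)^-1 ^+ d * RI leb (fun w => G (vadd y w) * gam s^-1 w).
      rewrite -(RI_scale Hleb q0 i1); apply: RI_ext => v; congr (_ * _).
      exact: gam_unscale.
    have i2 : Itg leb (fun x => G x * gam s^-1 (vsub x y)).
      apply: (@Itg_ext _ _ _ _ (fun x => (fun w => G (vadd y w) * gam s^-1 w) (vsub x y))).
        by move=> x; congr (G _ * _); apply: eq_from_tnth => i; rewrite !tnthE; ring.
      exact: (Itg_translB Hleb y i1).
    rewrite (RI_ext leb (_ : _ =1 (fun x => RI leb (gam s) * (G x * gam s^-1 (vsub x y))))); last by move=> x; ring.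
    rewrite (RIZ _ i2) E1 E2 (RI_gam_scale Hleb s0); ring.
  have iJ : Itg P (fun y => RI leb (fun v => G (vadd y (vscale (Num.sqrt s) v)) * gam 1 v)); last first.
    by rewrite (RI_ext P e) (RIZ _ iJ).
  apply: (@Itg_prob _ (RI leb (fun v => c * gam 1 v))).
    apply: (@measurable_RI _ _ _ _ _ leb (fun z => G (vadd z.1 (vscale (Num.sqrt s) z.2)) * gam 1 z.2)).
    have h1 := mf_comp2 (@mgam R d 1) (measurable_snd (T1 := V) (T2 := V)).
    have h2 := mf_comp2 mG (mf_vadd (measurable_fst (T1 := V) (T2 := V)) (mf_vscale (mf_cst (Num.sqrt s)) measurable_snd)).
    exact: mf_mul h2 h1.
  move=> y; apply: RI_abs_le.
  - have := mf_comp2 mG (mf_vadd (mf_vcst y) (mf_vscale (mf_cst (Num.sqrt s)) (@measurable_id _ _ setT))) => h2.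
    exact: mf_mul h2 (mgam 1).
  - by move=> v; rewrite normrM (ger0_norm (gam_ge0 _ _)) ler_wpM2r ?gam_ge0.
  - by apply: ItgZ; apply: Itg_gam.
- have h1 := mf_comp2 mG (measurable_fst (T1 := V) (T2 := V)).
  have h2 := mf_comp2 mg' (mf_vsub (measurable_fst (T1 := V) (T2 := V)) measurable_snd).
  by apply: mf_mul h2; apply: mf_mul => //; exact: mf_cst.
- exact: Itg_abs.
- by apply: (@Itg_prob _ (RI leb (gam s))) => // y; rewrite ger0_norm.
- by [].
- move=> x y; rewrite !normrM -mulrA ler_wpM2l// (ger0_norm g0) (ger0_norm (gam_ge0 _ _)).
  by rewrite ler_piMr// gam_le1// ltW.
Qed.

Lemma charfun_test (G : V -> R) (c : R) : measurable_fun setT G -> (forall x, `|G x| <= c) -> Itg leb G ->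
  (forall y v, G (vadd y (vscale n.+1%:R^-1 v)) @[n --> \oo] --> G y) ->
  RI leb (fun x => G x * U leb rho th x) = Kd leb * RI P G.
Proof.
move=> mG Gc iG Gcont.
(* Squared so that sqrt (s n) = 1/(n+1), the step in the continuity hypothesis on G. *)
pose s (n : nat) : R := n.+1%:R^-1 ^+ 2.
have s0 n : 0 < s n by rewrite exprn_gt0.
have sq n : Num.sqrt (s n) = n.+1%:R^-1 by rewrite sqrtr_sqr ger0_norm.
have cs : s n @[n --> \oo] --> (0 : R).
  rewrite -[X in _ --> X](mulr0 (0 : R)) /s; apply: cvgM; exact: cvg_harmonic.
have cU x : U leb (fun xi => rho xi * gam (s n) xi) th x @[n --> \oo] --> U leb rho th x.
  have [||||_ h] // := @RI_dct _ _ _ leb (fun n xi => rho xi * gam (s n) xi * cos (dotv x xi - th xi))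
    (fun xi => rho xi * cos (dotv x xi - th xi)) rho.
  - by move=> n; have mg := @mgam R d (s n); mfun.
  - move=> n xi; rewrite -mulrA normrM ger0_norm// ler_piMr// normrM -[1]mulr1 ler_pM ?normcos//.
    by rewrite ger0_norm ?gam_ge0// gam_le1// ltW.
  - move=> xi; apply: cvgM; last exact: cvg_cst.
    rewrite -[X in _ --> X]mulr1; apply: cvgM; first exact: cvg_cst.
    rewrite -[X in _ --> X]expR0; apply: (@cvg_comp _ _ _ _ expR); last exact: continuous_expR.
    have -> : (0 : R) = - (0 * dotv xi xi / 2) by rewrite !mul0r oppr0.
    apply: cvgN; apply: cvgM; last exact: cvg_cst.
    by apply: cvgM => //; exact: cvg_cst.
have L1 : RI leb (fun x => G x * U leb (fun xi => rho xi * gam (s n) xi) th x) @[n --> \oo] -->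
    RI leb (fun x => G x * U leb rho th x).
  have [||||_ h] // := @RI_dct _ _ _ leb (fun n x => G x * U leb (fun xi => rho xi * gam (s n) xi) th x)
    (fun x => G x * U leb rho th x) (fun x => RI leb rho * `|G x|).
  - move=> n; have mg := @mgam R d (s n); have mU := @measurable_U _ _ leb (fun xi => rho xi * gam (s n) xi) th ltac:(mfun) mth.
    by apply: mf_mul.
  - move=> n x; rewrite normrM mulrC ler_wpM2r//.
    have mg := @mgam R d (s n).
    apply: RI_abs_le => //; first by mfun.
    move=> xi; rewrite -mulrA normrM ger0_norm// ler_piMr// normrM -[1]mulr1 ler_pM ?normcos//.
    by rewrite ger0_norm ?gam_ge0// gam_le1// ltW.
  - by apply: ItgZ; exact: Itg_abs.
  - by move=> x; apply: cvgM => //; exact: cvg_cst.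
have c0 : 0 <= c := le_trans (normr_ge0 _) (Gc vzero).
have mGv n : measurable_fun setT (fun z : V * V => G (vadd z.1 (vscale (Num.sqrt (s n)) z.2)) * gam 1 z.2).
  have h1 := mf_comp2 (@mgam R d 1) (measurable_snd (T1 := V) (T2 := V)).
  have h2 := mf_comp2 mG (mf_vadd (measurable_fst (T1 := V) (T2 := V)) (mf_vscale (mf_cst (Num.sqrt (s n))) measurable_snd)).
  exact: mf_mul h2 h1.
have mGy n y : measurable_fun setT (fun v : V => G (vadd y (vscale (Num.sqrt (s n)) v)) * gam 1 v).
  have := mf_comp2 mG (mf_vadd (mf_vcst y) (mf_vscale (mf_cst (Num.sqrt (s n))) (@measurable_id _ _ setT))) => h2.
  exact: mf_mul h2 (mgam 1).
have bd n y v : `|G (vadd y (vscale (Num.sqrt (s n)) v)) * gam 1 v| <= c * gam 1 v.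
  by rewrite normrM (ger0_norm (gam_ge0 _ _)) ler_wpM2r ?gam_ge0.
have icg : Itg leb (fun v : V => c * gam 1 v) by apply: ItgZ; exact: Itg_gam.
have L2 y : RI leb (fun v => G (vadd y (vscale (Num.sqrt (s n)) v)) * gam 1 v) @[n --> \oo] --> G y * RI leb (gam 1).
  have [||||_ h] // := @RI_dct _ _ _ leb (fun n v => G (vadd y (vscale (Num.sqrt (s n)) v)) * gam 1 v)
    (fun v => G y * gam 1 v) (fun v => c * gam 1 v).
  - move=> v; apply: cvgM; last exact: cvg_cst.
    rewrite (_ : (fun n => _) = (fun n => G (vadd y (vscale n.+1%:R^-1 v)))); first exact: Gcont.
    by apply/funext => n; rewrite sq.
  by rewrite -RIZ//; apply: Itg_gam.
have L3 : RI P (fun y => RI leb (fun v => G (vadd y (vscale (Num.sqrt (s n)) v)) * gam 1 v)) @[n --> \oo] -->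
    RI P (fun y => G y * RI leb (gam 1)).
  have [||||_ h] // := @RI_dct _ _ _ P (fun n y => RI leb (fun v => G (vadd y (vscale (Num.sqrt (s n)) v)) * gam 1 v))
    (fun y => G y * RI leb (gam 1)) (fun=> RI leb (fun v => c * gam 1 v)).
  - by move=> n; exact: (@measurable_RI _ _ _ _ _ leb _ (mGv n)).
  - by move=> n y; apply: RI_abs_le.
  - by apply: (@Itg_prob _ `|RI leb (fun v => c * gam 1 v)|).
have L4 : RI leb (fun x => G x * U leb (fun xi => rho xi * gam (s n) xi) th x) @[n --> \oo] -->
    RI leb (gam 1) * RI P (fun y => G y * RI leb (gam 1)).
  rewrite (_ : (fun n => _) = (fun n => RI leb (gam 1) *
    RI P (fun y => RI leb (fun v => G (vadd y (vscale (Num.sqrt (s n)) v)) * gam 1 v)))); last first.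
    by apply/funext => n; rewrite (mollified_test (s0 _) mG Gc iG).
  by apply: cvgM => //; exact: cvg_cst.
rewrite (cvg_uniq L1 L4) /Kd expr2 -mulrA; congr (_ * _).
rewrite -RIZ; last exact: Itg_prob Gc.
by apply: RI_ext => y; rewrite mulrC.
Qed.

Lemma charfun_box (a b : V) : (forall i, tnth a i <= tnth b i) ->
  Itg leb (U leb rho th) -> (forall x, 0 <= U leb rho th x) ->
  RI leb (fun x => \1_(box a b) x * U leb rho th x) = Kd leb * RI P (\1_(box a b) : V -> R).
Proof.
move=> ab iU U0.
(* A difference of two steep ramps. A ramp vanishes at its foot, so the limit is the indicator of
   the interval open at a_i and closed at b_i. *)
pose w (n : nat) (i : 'I_d) (x : V) : R := clip (n.+1%:R * (tnth x i - tnth a i)) - clip (n.+1%:R * (tnth x i - tnth b i)).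
(* A sum of d numbers of [0, 1] lowered by d - 1 is at most 0 once one of them vanishes, and is 1
   when all are 1; it replaces their product. *)
pose G n (x : V) : R := clip (\sum_(i < d) w n i x - (d%:R - 1)).
have w01 n i x : 0 <= w n i x <= 1.
  rewrite /w subr_ge0 clip_mono ?ler_wpM2l ?lerB//=.
  have /andP[h1 h2] := clip01 (n.+1%:R * (tnth x i - tnth a i)).
  by have /andP[h3 h4] := clip01 (n.+1%:R * (tnth x i - tnth b i)); lra.
have mc (F : V -> R) : measurable_fun setT F -> measurable_fun setT (fun x => clip (F x)).
  by move=> mF; rewrite /clip; mfun.
have mG n : measurable_fun setT (G n).
  refine (mc _ _); apply: mf_add; last exact: mf_cst.
  by apply: mf_sum => i; apply: mf_add; [|apply: mf_opp]; refine (mc _ _); mfun.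
have G01 n x : 0 <= G n x <= 1 by exact: clip01.
have Gb n x : `|G n x| <= 1 by case/andP: (G01 n x) => h1 h2; rewrite ger0_norm.
have sum_le (v : 'I_d -> R) i0 : (forall i, v i <= 1) -> v i0 <= 0 -> \sum_(i < d) v i - (d%:R - 1) <= 0.
  move=> v1 v0; rewrite (bigD1 i0)//=.
  have : \sum_(i < d | i != i0) v i <= \sum_(i < d | i != i0) 1 by apply: ler_sum => i _.
  have : \sum_(i < d) (1 : R) = 1 + \sum_(i < d | i != i0) 1 by rewrite (bigD1 i0).
  rewrite sumr_const card_ord; lra.
have Gz n x : ~ box a (vadd b [tuple 1 | i < d]) x -> G n x = 0.
  move=> /existsNP[i]; rewrite tnthE tnth_mktuple => /negP.
  rewrite negb_and -leNgt -ltNge => h; apply: clip_le0; apply: (sum_le (fun i => w n i x) i).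
    by move=> j; case/andP: (w01 n j x).
  case/orP: h => h; rewrite /w.
    rewrite clip_le0 ?sub0r ?oppr_le0; first by case/andP: (clip01 (n.+1%:R * (tnth x i - tnth b i))).
    by rewrite mulr_ge0_le0// subr_le0.
  have n1 : (1 : R) <= n.+1%:R by rewrite ler1n.
  have k1 : 1 <= n.+1%:R * (tnth x i - tnth b i).
    have e : 1 <= tnth x i - tnth b i by lra.
    by have := ler_pM ler01 ler01 n1 e; rewrite mulr1.
  have k2 : 1 <= n.+1%:R * (tnth x i - tnth a i).
    by apply: (le_trans k1); rewrite ler_wpM2l// lerB.
  by rewrite !clip_ge1// subrr.
have iG n : Itg leb (G n).
  have [iB _] := Itg_indic_box Hleb a (vadd b [tuple 1 | i < d]).
  apply: Itg_dom iB => // x; rewrite indicE.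
  by case: (boolP (x \in _)) => [_|/negP h]; [exact: Gb|rewrite Gz ?normr0// => /mem_set].
have Gcont n y v : G n (vadd y (vscale k.+1%:R^-1 v)) @[k --> \oo] --> G n y.
  apply: cvg_clip; apply: cvgB; last exact: cvg_cst.
  apply: (cvg_bigsum (u := fun k i => w n i (vadd y (vscale k.+1%:R^-1 v)))) => i.
  have cv : tnth (vadd y (vscale k.+1%:R^-1 v)) i @[k --> \oo] --> tnth y i.
    rewrite (_ : (fun k => _) = (fun k => tnth y i + k.+1%:R^-1 * tnth v i)); last first.
      by apply/funext => k; rewrite !tnthE.
    have -> : nbhs (tnth y i) = nbhs (tnth y i + 0 * tnth v i) by rewrite mul0r addr0.
    by apply: cvgD; [exact: cvg_cst|apply: cvgM; [exact: cvg_harmonic|exact: cvg_cst]].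
  by apply: cvgB; apply: cvg_clip; apply: cvgM; try exact: cvg_cst; apply: cvgB => //; exact: cvg_cst.
have Glim x : G n x @[n --> \oo] --> (\1_(box a b) x : R).
  pose l i : R := (((0 < tnth x i - tnth a i)%R : bool)%:R) - (((0 < tnth x i - tnth b i)%R : bool)%:R).
  have -> : \1_(box a b) x = clip (\sum_(i < d) l i - (d%:R - 1)) :> R.
    rewrite indicE; case: (boolP (x \in _)) => [/set_mem h|/negP h].
      rewrite (eq_bigr (fun=> 1)); first by rewrite sumr_const card_ord clip_ge1//; lra.
      move=> i _; case/andP: (h i) => h1 h2; rewrite /l !subr_gt0 h1 ltNge h2/= subr0//.
    have /existsNP[i /negP hi] : ~ box a b x by move=> h'; apply: h; exact: mem_set.
    have l1 j : l j <= 1.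
      by rewrite /l; case: (0 < tnth x j - tnth a j); case: (0 < tnth x j - tnth b j) => /=; lra.
    rewrite clip_le0//; apply: (sum_le l i) => //.
    move: hi; rewrite /l negb_and -leNgt -ltNge !subr_gt0 => /orP[hi|hi].
      by rewrite ltNge hi/= sub0r oppr_le0.
    by rewrite hi (le_lt_trans (ab i) hi) subrr.
  apply: cvg_clip; apply: cvgB; last exact: cvg_cst.
  apply: (cvg_bigsum (u := fun n i => w n i x)) => i.
  by apply: cvgB; exact: cvg_steep_clip.
have T n := charfun_test (mG n) (Gb n) (iG n) (Gcont n).
have L1 : RI leb (fun x => G n x * U leb rho th x) @[n --> \oo] --> RI leb (fun x => \1_(box a b) x * U leb rho th x).
  have mU := Itg_meas iU.
  have [||||_ h] // := @RI_dct _ _ _ leb (fun n x => G n x * U leb rho th x)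
    (fun x => \1_(box a b) x * U leb rho th x) (U leb rho th).
  - by move=> n; exact: mf_mul.
  - by move=> n x; rewrite normrM (ger0_norm (U0 x)) ler_piMl.
  - by move=> x; apply: cvgM => //; exact: cvg_cst.
have L2 : RI P (G n) @[n --> \oo] --> RI P (\1_(box a b) : V -> R).
  have [||||_ h] // := @RI_dct _ _ _ P G (\1_(box a b)) (fun=> 1).
  by apply: (@Itg_prob _ 1) => // y; rewrite normr1.
apply: (cvg_uniq L1); rewrite (_ : (fun n => _) = (fun n => Kd leb * RI P (G n))); last exact/funext.
by apply: cvgM => //; exact: cvg_cst.
Qed.

End density_of_charfun.

(** * The measure with a given density *)

Section density_measure.
Context (R : realType) (d : nat).
Local Notation V := (d.-tuple R).
Variable leb : {measure set V -> \bar R}.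
Variable p : V -> R.
Hypothesis mp : measurable_fun setT p.
Hypothesis p0 : forall x, 0 <= p x.

(** The two proofs are arguments so that the measure structure can be attached to the term
    [dens mp p0]. *)
Definition dens (_ : measurable_fun setT p) (_ : forall x, 0 <= p x) (B : set V) : \bar R :=
  (\int[leb]_(x in B) (p x)%:E)%E.

Let dens0 : dens mp p0 set0 = 0%E.
Proof. by rewrite /dens integral_set0. Qed.
Let dens_ge0 B : (0 <= dens mp p0 B)%E.
Proof. by apply: integral_ge0 => x _; rewrite lee_fin. Qed.
Let dens_sigma : semi_sigma_additive (dens mp p0).
Proof.
move=> /= F mF tF mUF; rewrite /dens; apply: cvg_toP.
  apply: ereal_nondecreasing_is_cvgn => m n mn.
  apply: lee_sum_nneg_natr => // k _ _; apply: integral_ge0 => /= x Fkx.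
  by rewrite lee_fin.
rewrite ge0_integral_bigcup//=.
- by apply/measurable_funTS/measurableT_comp.
- by move=> x _; rewrite lee_fin.
Qed.
HB.instance Definition _ := isMeasure.Build _ _ _ (dens mp p0) dens0 dens_ge0 dens_sigma.

End density_measure.

(** * Existence and uniqueness of the continuous density *)

Section density.
Context (R : realType) (d : nat).
Local Notation V := (d.-tuple R).
Variable leb : {sigma_finite_measure set V -> \bar R}.
Hypothesis Hleb : is_lebesgue leb.
Hypothesis d0 : (0 < d)%N.
Variable P : probability V R.

(** Agreement on half-open boxes decides the equality of the two measures; continuity is the
    Lipschitz bound of [U], whose constant is the integral of rho |xi|. *)
Lemma density_of_charfun (rho th : V -> R) :
  measurable_fun setT th -> (forall xi, 0 <= rho xi) -> Itg leb rho ->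
  Itg leb (fun xi => rho xi * normv xi) ->
  (forall xi, RI P (fun y => cos (dotv xi y)) = rho xi * cos (th xi)) ->
  (forall xi, RI P (fun y => sin (dotv xi y)) = rho xi * sin (th xi)) ->
  Itg leb (U leb rho th) -> (forall x, 0 <= U leb rho th x) ->
  cont_density leb P (fun x => U leb rho th x / Kd leb).
Proof.
move=> mth r0 ir irn Pc Ps iU U0; have mU := Itg_meas iU.
have K0 := Kd_gt0 Hleb.
have mp : measurable_fun setT (fun x => U leb rho th x / Kd leb) by mfun.
have p0 x : 0 <= U leb rho th x / Kd leb by rewrite divr_ge0// ltW.
split=> //.
- move=> B mB; have := @measure_box_unique _ _ P (dens leb mp p0) _ _ B mB; apply.
  + move=> a b ab; have mbx := @box_meas R d a b.
    have T := charfun_box Hleb mth r0 ir Pc Ps ab iU U0.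
    have e1 : RI P (\1_(box a b) : V -> R) = fine (P (box a b)).
      by rewrite /Rintegral integral_indic// setIT.
    have e2 x : \1_(box a b) x * U leb rho th x = Kd leb * (\1_(box a b) x * (U leb rho th x / Kd leb)).
      by field; exact: lt0r_neq0.
    have ip : Itg leb (fun x => \1_(box a b) x * (U leb rho th x / Kd leb)).
      apply: (@Itg_dom _ _ _ _ _ (fun x => (Kd leb)^-1 * U leb rho th x)); last exact: ItgZ.
        by apply: mf_mul => //; exact: measurable_indic.
      move=> x; rewrite normrM mulrC (ger0_norm (p0 x)) [X in _ <= X]mulrC ler_piMr//.
      by rewrite indicE; case: (_ \in _); rewrite ?normr1 ?normr0.
    have e3 : RI leb (fun x => \1_(box a b) x * (U leb rho th x / Kd leb)) = fine (P (box a b)).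
      by move: T; rewrite (RI_ext leb e2) (RIZ _ ip) e1 => /(mulfI (lt0r_neq0 K0)).
    rewrite -[LHS]fineK ?fin_num_measure// -e3 -RI_E//= /dens [RHS]integral_mkcond.
    apply: eq_integral => x _; rewrite patchE indicE; case: (x \in _); by rewrite ?mul1r ?mul0r.
  + by move=> n; rewrite (le_lt_trans (probability_le1 _ _)) ?ltry//; exact: box_meas.
- move=> v; pose L := RI leb (fun xi => rho xi * normv xi) / Kd leb.
  have L0 : 0 <= L by rewrite divr_ge0 ?(ltW K0)//; apply: RI_ge0 => xi; rewrite mulr_ge0 ?normv_ge0.
  have FF : Filter (nbhs v) := @nbhs_filter _ v.
  apply/(@cvgrPdist_lt _ _ _ (nbhs v) FF) => e e0.
  (* Balls of row vectors refer to the maximum norm, and the factor d passes to the Euclidean norm;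
     L + 1 is positive even when L = 0. *)
  have D0 : 0 < d%:R * (L + 1) by rewrite mulr_gt0 ?ltr0n//; lra.
  have : nbhs v (ball v (e / (d%:R * (L + 1)))) by apply: nbhsx_ballx; rewrite divr_gt0.
  apply: filterS => u /= vu.
  rewrite -mulrBl normrM (gtr0_norm (_ : 0 < (Kd leb)^-1)) ?invr_gt0//.
  have h1 := U_lip (tuple_of_rv v) (tuple_of_rv u) ir r0 mth irn.
  have h2 : normv (vsub (tuple_of_rv v) (tuple_of_rv u)) <= d%:R * (e / (d%:R * (L + 1))).
    apply: normv_le_coord => i; rewrite !tnthE !tnth_mktuple.
    by case: vu => _ /(_ ord0 i) /ltW.
  rewrite ltr_pdivrMr//; apply: (le_lt_trans h1).
  have -> : RI leb (fun xi => rho xi * normv xi) = L * Kd leb by rewrite /L divfK// lt0r_neq0.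
  rewrite mulrAC ltr_pM2r//; apply: (le_lt_trans (ler_wpM2l L0 h2)).
  rewrite [X in X < _](_ : _ = L / (L + 1) * e); last first.
    have dn : d%:R != 0 :> R by rewrite pnatr_eq0 -lt0n.
    have Ln : L + 1 != 0 by rewrite lt0r_neq0//; lra.
    by field; rewrite ?dn ?Ln.
  by rewrite mulrAC ltr_pdivrMr; [rewrite mulrDr mulr1; lra|lra].
Qed.

(** The asymptotics concern values at points, so equality is needed everywhere. If p > q at x, then
    by continuity p exceeds q by a third of the gap on a small cube, against the equality of the two
    integrals. *)
Lemma cont_density_unique (p q : V -> R) : cont_density leb P p -> cont_density leb P q -> p = q.
Proof.
suff H (p' q' : V -> R) : cont_density leb P p' -> cont_density leb P q' -> forall x, p' x <= q' x.
  by move=> hp hq; apply/funext => x; apply/eqP; rewrite eq_le !H.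
move=> [mp p0 hp cp] [mq q0 hq cq] x; rewrite leNgt; apply/negP => pq.
pose e := (p' x - q' x) / 3.
have e0 : 0 < e by rewrite divr_gt0// subr_gt0.
have rvK : tuple_of_rv (rv_of x) = x by apply: eq_from_tnth => i; rewrite tnth_mktuple mxE.
have FF : Filter (nbhs (rv_of x)) := @nbhs_filter _ (rv_of x).
have := cp (rv_of x); rewrite /continuous_at rvK => /(@cvgrPdist_lt _ _ _ (nbhs (rv_of x)) FF)/(_ e e0).
have := cq (rv_of x); rewrite /continuous_at rvK => /(@cvgrPdist_lt _ _ _ (nbhs (rv_of x)) FF)/(_ e e0) => H1 H2.
have [r /= r0 hr] : nbhs_ball (rv_of x) [set u | `|q' x - q' (tuple_of_rv u)| < e /\ `|p' x - p' (tuple_of_rv u)| < e].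
  by rewrite nbhs_ballE; exact: filterI H1 H2.
pose k := r / 2.
have k0 : 0 < k by rewrite divr_gt0.
pose B := box (vsub x [tuple k | i < d]) (vadd x [tuple k | i < d]).
have mB : measurable B by exact: box_meas.
have inB y : B y -> p' x - e <= p' y /\ q' y <= q' x + e.
  move=> By; have rvy : tuple_of_rv (rv_of y) = y by apply: eq_from_tnth => i; rewrite tnth_mktuple mxE.
  have : ball (rv_of x) r (rv_of y).
    split=> // i j; rewrite !mxE /ball /=.
    have := By j; rewrite !tnthE tnth_mktuple => /andP[h1 h2].
    rewrite ltr_norml; apply/andP; split; rewrite /k in h1 h2; lra.
  move=> /hr /=; rewrite rvy => -[h2 h1]; split.
    by have := ler_norm (p' x - p' y); lra.
  by have := ler_norm (- (q' x - q' y)); rewrite normrN; lra.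
have vB : leb B = ((2 * k) ^+ d)%:E by apply: leb_box_centered => //; exact: ltW.
have P1 : ((p' x - e)%:E * leb B <= P B)%E.
  rewrite hp// -integral_cst//; apply: ge0_le_integral => //;
    try by [apply/measurable_funTS/measurableT_comp|move=> y _; rewrite lee_fin].
  - by move=> y _; rewrite lee_fin /e; have := q0 x; lra.
  - by move=> y /inB[h _]; rewrite lee_fin.
have P2 : (P B <= (q' x + e)%:E * leb B)%E.
  rewrite hq// -integral_cst//; apply: ge0_le_integral => //;
    try by [apply/measurable_funTS/measurableT_comp|move=> y _; rewrite lee_fin].
  by move=> y /inB[_ h]; rewrite lee_fin.
have := le_trans P1 P2; rewrite vB -!EFinM lee_fin ler_pM2r ?exprn_gt0 ?mulr_gt0//.
rewrite /e; lra.
Qed.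

End density.

(** * Inequalities for cosines and exponentials *)

Section trigonometry.
Context (R : realType).
Implicit Types z : R.

Lemma sin_natmul_le z n : `|sin (n%:R * z)| <= n%:R * `|sin z|.
Proof.
elim: n => [|n IH]; first by rewrite !mul0r sin0 normr0.
rewrite -natr1 !mulrDl !mul1r sinD (le_trans (ler_normD _ _))// lerD// normrM.
  by apply: le_trans IH; rewrite ler_piMr// normcos.
by rewrite ler_piMl// normcos.
Qed.

Lemma one_sub_cos_half z : 1 - cos z = 2 * sin (z / 2) ^+ 2.
Proof.
have -> : cos z = cos (z / 2 + z / 2) by congr cos; field.
rewrite cosD; have := cos2Dsin2 (z / 2); rewrite !expr2; lra.
Qed.

(** From 1 - cos z = 2 sin(z/2)^2 and |sin(n z)| <= n |sin z|. Integrated against nu, it limits the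
    symbol to quadratic growth. *)
Lemma one_sub_cos_natmul_le z n : 1 - cos (n%:R * z) <= n%:R ^+ 2 * (1 - cos z).
Proof.
rewrite (one_sub_cos_half (n%:R * z)) (one_sub_cos_half z) [X in _ <= X]mulrCA ler_wpM2l// -exprMn.
rewrite -(@real_normK _ (sin _)) ?num_real// -(@real_normK _ (_ * sin _)) ?num_real//.
apply: lerXn2r; rewrite ?nnegrE// -mulrA normrM (ger0_norm (ler0n _ _)).
exact: sin_natmul_le.
Qed.

Lemma one_sub_expN_ge (x : R) : 0 <= x -> Order.min 1 (2 * x) / 4 <= 1 - expR (- x).
Proof.
move=> x0; have h : 1 - (1 + x)^-1 <= 1 - expR (- x).
  rewrite lerD2l lerN2 expRN lef_pV2 ?posrE ?expR_gt0//; last by lra.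
  exact: expR_ge1Dx.
apply: le_trans h; have -> : 1 - (1 + x)^-1 = x / (1 + x) by field; rewrite lt0r_neq0//; lra.
rewrite ler_pdivlMr; last by lra.
have [k|k] := leP (2 * x) 1; last by lra.
have : x * x <= x by rewrite ler_piMr//; lra.
have := mulr_ge0 x0 x0; lra.
Qed.

Lemma one_sub_expN_le (x : R) : 0 <= x -> 0 <= 1 - expR (- x) <= Order.min 1 x.
Proof.
move=> x0; rewrite subr_ge0 -[X in _ <= X]expR0 ler_expR oppr_le0 x0/= le_min.
have := expR_ge0 (- x); have := expR_ge1Dx (- x); move=> h1 h2; apply/andP; split; lra.
Qed.

Lemma divide_bound (q p c1 c2 : R) : 0 < c1 -> 0 <= p ->
  c1 / 4 * q <= c2 * p -> q <= (4 / c1 * c2 + 1) * p.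
Proof.
move=> c10 p0 B; have -> : q = 4 / c1 * (c1 / 4 * q) by field; exact: lt0r_neq0.
apply: (@le_trans _ _ (4 / c1 * (c2 * p))).
  by rewrite ler_wpM2l// divr_ge0// ltW.
rewrite mulrDl mulrA mul1r; lra.
Qed.

Lemma quarter_le (c m g n : R) : 0 <= c -> 0 <= n -> m / 4 <= g -> c / 4 * (m * n) <= c * (g * n).
Proof.
move=> c0 n0 mg; rewrite (_ : c / 4 * (m * n) = c * (m / 4 * n)); last by ring.
by rewrite ler_wpM2l// ler_wpM2r.
Qed.

End trigonometry.

(** * Growth of the symbol and the length scale of a time *)

Section symbol_scale.
Context (R : realType) (d : nat).
Local Notation V := (d.-tuple R).
Variable leb : {sigma_finite_measure set V -> \bar R}.
Hypothesis Hleb : is_lebesgue leb.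
Hypothesis d0 : (0 < d)%N.
Variables (A : 'M[R]_d) (nu : V -> R).
Hypothesis sA : A^T = A.
Hypothesis pA : forall x, 0 <= quadA A x.
Hypothesis Hnu : levy_density leb nu.

Lemma one_sub_cos_min2 (xi y : V) : `|1 - cos (dotv xi y)| <= (2 + normv xi ^+ 2) * min2 y.
Proof.
have /andP[h0 h1] := one_sub_cos_le (dotv xi y); rewrite ger0_norm//.
have [y1|y1] := ltP (normv y) 1.
  have := cos_dom 1 xi y; rewrite /inb (ltW y1) mul1r ger0_norm//.
rewrite (min2_ge1 y1) mulr1; have := cos_geN1 (dotv xi y); have := sqr_ge0 (normv xi); lra.
Qed.

Lemma Itg_RePhi xi : Itg leb (fun y => (1 - cos (dotv xi y)) * nu y).
Proof. by apply: (proj1 (Itg_levy Hnu _ (one_sub_cos_min2 xi))); mfun. Qed.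

Lemma RePhi_ge0 xi : 0 <= RePhi leb nu xi.
Proof.
by apply: RI_ge0 => y; rewrite mulr_ge0 ?(nu_ge0 Hnu)// subr_ge0 cos_le1.
Qed.

Lemma RePhi_le xi : RePhi leb nu xi <= (2 + normv xi ^+ 2) * Cnu leb nu.
Proof.
have [|_ h] := Itg_levy Hnu _ (one_sub_cos_min2 xi); first by mfun.
exact: le_trans (ler_norm _) h.
Qed.

Lemma mRePhi : measurable_fun setT (RePhi leb nu).
Proof.
have mn := mnu Hnu.
apply: (@measurable_RI _ _ _ _ _ leb (fun z : V * V => (1 - cos (dotv z.1 z.2)) * nu z.2)).
by have := mf_comp2 mn (measurable_snd (T1 := V) (T2 := V)) => h; apply: mf_mul h; mfun.
Qed.

Lemma RePhi_natmul xi n : RePhi leb nu (vscale n%:R xi) <= n%:R ^+ 2 * RePhi leb nu xi.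
Proof.
rewrite /RePhi -(RIZ _ (Itg_RePhi xi)); apply: RI_le; [exact: Itg_RePhi|by apply: ItgZ; exact: Itg_RePhi|].
by move=> y; rewrite mulrA ler_wpM2r ?(nu_ge0 Hnu)// dotvZl one_sub_cos_natmul_le.
Qed.

Lemma RePhi_Psi xi r : normv xi <= r -> RePhi leb nu xi <= Psi leb nu r.
Proof.
move=> xr; apply: ub_le_sup; last by exists xi.
exists ((2 + r ^+ 2) * Cnu leb nu) => _ [z /= zr <-]; apply: (le_trans (RePhi_le z)).
rewrite ler_wpM2r ?Cnu_ge0// lerD2l; apply: lerXn2r; rewrite ?nnegrE ?normv_ge0//.
exact: le_trans (normv_ge0 _) zr.
Qed.

Lemma Psi_le (r : R) : 0 <= r -> Psi leb nu r <= (2 + r ^+ 2) * Cnu leb nu.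
Proof.
move=> r0; apply: ge_sup; first by exists (RePhi leb nu vzero); exists vzero => //=; rewrite normv0.
move=> _ [z /= zr <-]; apply: (le_trans (RePhi_le z)).
rewrite ler_wpM2r ?Cnu_ge0// lerD2l; apply: lerXn2r; rewrite ?nnegrE ?normv_ge0//.
Qed.

Lemma Psi_ge0 (r : R) : 0 <= r -> 0 <= Psi leb nu r.
Proof. by move=> r0; apply: le_trans (RePhi_ge0 vzero) (RePhi_Psi _); rewrite normv0. Qed.

(** Write xi as n times a vector of length at most r, n being the first integer above |xi| / r. *)
Lemma RePhi_growth xi (r : R) : 0 < r -> RePhi leb nu xi <= (normv xi / r + 1) ^+ 2 * Psi leb nu r.
Proof.
move=> r0; have q0 : 0 <= normv xi / r by rewrite divr_ge0 ?normv_ge0// ltW.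
pose n := (Num.truncn (normv xi / r)).+1.
have [h1 h2] := andP (truncn_itv q0).
have n0 : n%:R != 0 :> R by rewrite pnatr_eq0.
have -> : xi = vscale n%:R (vscale n%:R^-1 xi).
  by apply: eq_from_tnth => i; rewrite !tnthE mulVKf.
apply: (le_trans (RePhi_natmul _ _)).
have e : normv (vscale n%:R (vscale n%:R^-1 xi)) = normv xi.
  by congr normv; apply: eq_from_tnth => i; rewrite !tnthE mulVKf.
rewrite e; apply: ler_pM; rewrite ?exprn_ge0 ?RePhi_ge0//.
  apply: lerXn2r; rewrite ?nnegrE ?addr_ge0// /n -natr1 lerD2r//.
apply: RePhi_Psi; rewrite normvZ ger0_norm ?invr_ge0// mulrC ler_pdivrMr ?ltr0n//.
by move/ltW: h2; rewrite ler_pdivrMr// mulrC.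
Qed.

Definition minh (h : R) (y : V) : R := Order.min 1 (normv y ^+ 2 / h ^+ 2).

Lemma minh_ge0 h y : 0 <= minh h y.
Proof. by rewrite /minh le_min ler01 divr_ge0 ?sqr_ge0. Qed.

Lemma minh_min2 h y : 0 < h -> minh h y <= (1 + h ^- 2) * min2 y.
Proof.
move=> h0; have h2 : 0 <= h ^- 2 by rewrite invr_ge0 sqr_ge0.
have [y1|y1] := ltP (normv y) 1; rewrite /minh.
  by rewrite min2_lt1// ge_min mulrDl mul1r [h ^- 2 * _]mulrC lerDr sqr_ge0 orbT.
by rewrite (min2_ge1 y1) mulr1 ge_min lerDl h2.
Qed.

Lemma mminh h : measurable_fun setT (minh h).
Proof. rewrite /minh; mfun. Qed.

Lemma Itg_minh (h : R) : 0 < h -> Itg leb (fun y => minh h y * nu y).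
Proof.
move=> h0; have mm := mminh h.
have [|i _] // := @Itg_levy _ _ leb nu Hnu (minh h) (1 + h ^- 2) mm.
by move=> y; rewrite ger0_norm ?minh_ge0// minh_min2.
Qed.

Lemma Itg_gam_quad : Itg leb (fun xi : V => gam 1 xi * (normv xi + 1) ^+ 2).
Proof.
have mg := @mgam R d 1.
apply: (@Itg_dom _ _ _ _ _ (fun xi : V => 2 * expR 3 * expR (- (1 * normv xi)))); first by mfun.
- move=> xi; have n0 := normv_ge0 xi; have n1 : 0 <= normv xi + 1 by lra.
  rewrite ger0_norm ?mulr_ge0 ?gam_ge0 ?exprn_ge0//.
  have e1 := exp_ge_pow 2 n1.
  have e2 := @gam_le_exp R d 1 2 xi ltr01.
  apply: (le_trans (ler_pM (gam_ge0 _ _) (exprn_ge0 2 n1) e2 e1)).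
  have f2 : 2`!%:R = 2 :> R by [].
  rewrite f2 mulrCA -mulrA ler_wpM2l// -!expRD ler_expR expr2; lra.
- by apply: ItgZ; exact: Itg_exp_norm.
Qed.

(* Averaging Re Phi against a Gaussian turns 1 - cos into 1 - e^{-|y|^2/2}, which controls 1 /\ |y|^2. *)
Lemma minh_Psi : exists C : R, 0 < C /\
  forall h : R, 0 < h -> RI leb (fun y => minh h y * nu y) <= C * Psi leb nu h^-1.
Proof.
have mn := mnu Hnu; have mg := @mgam R d 1.
pose c1 := RI leb (gam 1); have c10 : 0 < c1 := RI_gam_gt0 Hleb ltr01.
pose c2 := RI leb (fun xi : V => gam 1 xi * (normv xi + 1) ^+ 2).
have c20 : 0 <= c2 by apply: RI_ge0 => xi; rewrite mulr_ge0 ?gam_ge0// exprn_ge0// addr_ge0 ?normv_ge0.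
exists (4 / c1 * c2 + 1); split.
  by rewrite ltr_wpDl// mulr_ge0// divr_ge0// ltW.
move=> h h0; have hi0 : 0 < h^-1 by rewrite invr_gt0.
pose F (z : V * V) := gam 1 z.1 * ((1 - cos (dotv z.1 (vscale h^-1 z.2))) * nu z.2).
have mF : measurable_fun setT F.
  have h1 := mf_comp2 mg (measurable_fst (T1 := V) (T2 := V)).
  have h2 := mf_comp2 mn (measurable_snd (T1 := V) (T2 := V)).
  apply: mf_mul h1 _; apply: mf_mul _ h2; mfun.
have F0 z : 0 <= F z by rewrite /F !mulr_ge0 ?gam_ge0 ?(nu_ge0 Hnu)// subr_ge0 cos_le1.
have cE (xi y : V) : dotv xi (vscale h^-1 y) = dotv (vscale h^-1 xi) y by rewrite dotvZr dotvZl.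
have I1 xi : Itg leb (fun y => F (xi, y)).
  rewrite /F /=; apply: ItgZ; apply: Itg_ext (Itg_RePhi (vscale h^-1 xi)) => y /=; by rewrite cE.
have i0 (y : V) : Itg leb (fun xi : V => gam 1 xi * (1 - cos (dotv y xi))).
  apply: (@Itg_dom _ _ _ _ _ (fun xi : V => 2 * gam 1 xi)); first by mfun.
    by move=> xi; rewrite normrM mulrC (ger0_norm (gam_ge0 _ _)) ler_wpM2r ?gam_ge0 ?abs_1cos.
  by apply: ItgZ; exact: Itg_gam.
have I2 y : Itg leb (fun xi => F (xi, y)).
  apply: (Itg_ext _ (ItgZ (nu y) (i0 (vscale h^-1 y)))) => xi; rewrite /F /= (dotvC xi); ring.
have E y : RI leb (fun xi => F (xi, y)) = c1 * ((1 - gam 1 (vscale h^-1 y)) * nu y).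
  rewrite (RI_ext leb (_ : _ =1 (fun xi => nu y * (gam 1 xi * (1 - cos (dotv (vscale h^-1 y) xi)))))); last first.
    by move=> xi; rewrite /F /= (dotvC xi); ring.
  rewrite (RIZ _ (i0 _)) (RI_ext leb (_ : _ =1 (fun xi => gam 1 xi - gam 1 xi * cos (dotv (vscale h^-1 y) xi)))); last first.
    by move=> xi; ring.
  rewrite RIB; last 2 first.
  - exact: Itg_gam.
  - apply: (@Itg_dom _ _ _ _ _ (gam 1)); [mfun| |exact: Itg_gam].
    by move=> xi; rewrite normrM (ger0_norm (gam_ge0 _ _)) ler_piMr ?gam_ge0// normcos.
  by rewrite gauss_ft// invr1 -/c1; ring.
clearbody c1.
have x0 (y : V) : 0 <= 1 * dotv (vscale h^-1 y) (vscale h^-1 y) / 2 by rewrite mul1r divr_ge0// dotv_ge0.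
have xE (y : V) : 2 * (1 * dotv (vscale h^-1 y) (vscale h^-1 y) / 2) = normv y ^+ 2 / h ^+ 2.
  by rewrite dotvZl dotvZr -normv2; field; exact: lt0r_neq0.
have low y : minh h y / 4 <= 1 - gam 1 (vscale h^-1 y).
  by have := one_sub_expN_ge (x0 y); rewrite xE.
have up (y : V) : `|1 - gam 1 (vscale h^-1 y)| <= (1 + h ^- 2) * min2 y.
  have /andP[k1 k2] := one_sub_expN_le (x0 y).
  rewrite ger0_norm//; apply: le_trans k2 _; apply: le_trans (minh_min2 y h0).
  rewrite /minh -xE; apply: le_min2 => //; have := x0 y; lra.
have mgv : measurable_fun setT (fun y : V => gam 1 (vscale h^-1 y)).
  by apply: mf_comp2 mg _; mfun.
have [|i3 _] := Itg_levy Hnu _ up; first by mfun.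
have I3 : Itg leb (fun y => RI leb (fun xi => F (xi, y))).
  by apply: (Itg_ext (fun y => esym (E y))); exact: ItgZ.
have [I4 T] := @tonelli_real _ _ _ _ _ leb leb F mF F0 I1 I2 I3.
have inner xi : RI leb (fun y => F (xi, y)) = gam 1 xi * RePhi leb nu (vscale h^-1 xi).
  rewrite /F /= RIZ; last by apply: Itg_ext (Itg_RePhi (vscale h^-1 xi)) => y /=; rewrite cE.
  by congr (_ * _); apply: RI_ext => y; rewrite cE.
have P0 : 0 <= Psi leb nu h^-1 by apply: Psi_ge0; exact: ltW.
have B1 : RI leb (fun xi => RI leb (fun y => F (xi, y))) <= c2 * Psi leb nu h^-1.
  rewrite mulrC -(RIZ _ Itg_gam_quad); apply: (RI_le I4 (ItgZ _ Itg_gam_quad)).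
  move=> xi; rewrite inner mulrCA ler_wpM2l ?gam_ge0// mulrC.
  have := RePhi_growth (vscale h^-1 xi) hi0; rewrite normvZ (ger0_norm (ltW hi0)).
  rewrite (_ : h^-1 * normv xi / h^-1 = normv xi) //; by field; exact: lt0r_neq0.
clearbody c2.
have B2 : c1 / 4 * RI leb (fun y => minh h y * nu y) <= RI leb (fun y => RI leb (fun xi => F (xi, y))).
  rewrite -(RIZ _ (Itg_minh h0)); apply: (RI_le (ItgZ _ (Itg_minh h0)) I3).
  by move=> y; rewrite E; exact: (quarter_le (ltW c10) (nu_ge0 Hnu y) (low y)).
rewrite -T in B2; exact: (divide_bound c10 P0 (le_trans B2 B1)).
Qed.

Lemma quadA_scale (k : R) (x : V) : quadA A (vscale k x) = k ^+ 2 * quadA A x.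
Proof.
have [s hs] := psd_sum_of_squares sA pA; rewrite !hs mulr_sumr.
by apply: eq_bigr => v _; rewrite dotvZr exprMn.
Qed.

Lemma quadA_le : exists C : R, 0 <= C /\ forall x : V, quadA A x <= C * normv x ^+ 2.
Proof.
have [s hs] := psd_sum_of_squares sA pA.
exists (\sum_(v <- s) normv v ^+ 2); split; first by apply: sumr_ge0 => v _; exact: sqr_ge0.
move=> x; rewrite hs mulr_suml; apply: ler_sum => v _.
rewrite -exprMn -(@real_normK _ (dotv v x)) ?num_real//.
by apply: lerXn2r; rewrite ?nnegrE ?mulr_ge0 ?normv_ge0// cauchy_schwarz.
Qed.

(** Says that h is a length scale for time t. The first moment of the characteristic function will
    bound height and slope of the density by powers of 1/h; the next two conditions keep the jump
    part and the Gaussian part of order 1 at that scale; the last one converts spare powers of h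
    into a factor t. *)
Definition intensity (t h C : R) : Prop :=
  [/\ 0 < h <= 1, RI leb (fun xi => rhoF leb A nu t xi * normv xi) <= C * h^-1 ^+ d.+1,
      t * RI leb (fun y => minh h y * nu y) <= C,
      (forall a, t * quadA A a <= C * (h ^+ 2 * normv a ^+ 2)) & h ^+ 2 <= C * t].

Variables (T : set R) (M C2 : R).
Hypothesis T0 : forall t, T t -> 0 < t.
Hypothesis TM : forall t, T t -> t <= M.
Hypothesis C20 : 0 < C2.
Hypothesis TD : forall t, T t ->
   (\int[leb]_xi (expR (- (t * RePhi leb nu xi)) * normv xi)%:E <= (C2 * Psi_minus leb nu t^-1 ^+ d.+1)%:E)%E.

Lemma TD_real t : T t -> Itg leb (fun xi => expR (- (t * RePhi leb nu xi)) * normv xi) /\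
  RI leb (fun xi => expR (- (t * RePhi leb nu xi)) * normv xi) <= C2 * Psi_minus leb nu t^-1 ^+ d.+1.
Proof.
move=> Tt; apply: RI_le_of_E; last exact: TD.
  by have m := mRePhi; mfun.
by move=> xi; rewrite mulr_ge0 ?expR_ge0 ?normv_ge0.
Qed.

Lemma rhoF_le t xi : T t -> rhoF leb A nu t xi <= expR (- (t * RePhi leb nu xi)).
Proof.
by move=> /T0 t0; rewrite ler_expR lerN2 ler_wpM2l ?(ltW t0)// /Repsi lerDr.
Qed.

Lemma Itg_rhoF_normv t : T t -> Itg leb (fun xi => rhoF leb A nu t xi * normv xi) /\
  RI leb (fun xi => rhoF leb A nu t xi * normv xi) <=
  RI leb (fun xi => expR (- (t * RePhi leb nu xi)) * normv xi).
Proof.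
move=> Tt; have [i1 _] := TD_real Tt.
have mr := @mrhoF _ _ leb A nu Hnu t.
have i2 : Itg leb (fun xi => rhoF leb A nu t xi * normv xi).
  apply: Itg_dom i1; first by mfun.
  move=> xi; rewrite ger0_norm ?mulr_ge0 ?expR_ge0 ?normv_ge0//.
  by rewrite ler_wpM2r ?normv_ge0// rhoF_le.
split=> //; apply: RI_le => // xi; by rewrite ler_wpM2r ?normv_ge0// rhoF_le.
Qed.

Lemma RePhi_integral_gt0 t : T t -> 0 < RI leb (fun xi => expR (- (t * RePhi leb nu xi)) * normv xi).
Proof.
move=> Tt; have [i1 _] := TD_real Tt; have t0 := T0 Tt.
pose x0 : V := [tuple 2 | i < d].
pose B := box (vsub x0 [tuple 1 | i < d]) (vadd x0 [tuple 1 | i < d]).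
pose c := expR (- (t * ((2 + (d%:R * 3) ^+ 2) * Cnu leb nu))).
have [iB eB] := Itg_indic_box Hleb (vsub x0 [tuple 1 | i < d]) (vadd x0 [tuple 1 | i < d]).
rewrite leb_box_centered//= in eB.
apply: (@lt_le_trans _ _ (c * RI leb (\1_B : V -> R))).
  by rewrite mulr_gt0 ?expR_gt0// eB exprn_gt0// mulr_gt0.
rewrite -(RIZ _ iB); apply: RI_le => //; first exact: ItgZ.
move=> xi; rewrite indicE; case: (boolP (xi \in _)) => [/set_mem h|_]; last first.
  by rewrite mulr0 mulr_ge0 ?expR_ge0 ?normv_ge0.
have hc i : 1 < tnth xi i <= 3.
  by have := h i; rewrite !tnthE !tnth_mktuple => /andP[k1 k2]; apply/andP; split; lra.
have n1 : 1 <= normv xi.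
  have /andP[k1 _] := hc (Ordinal d0); apply: le_trans (coord_le_normv xi (Ordinal d0)).
  by rewrite ger0_norm; lra.
have n2 : normv xi <= d%:R * 3.
  by apply: normv_le_coord => i; have /andP[k1 k2] := hc i; rewrite ger0_norm//; lra.
apply: ler_pM => //; rewrite ?expR_ge0//.
rewrite ler_expR lerN2 ler_wpM2l ?(ltW t0)//; apply: (le_trans (RePhi_le xi)).
rewrite ler_wpM2r ?Cnu_ge0// lerD2l; apply: lerXn2r; rewrite ?nnegrE ?normv_ge0// mulr_ge0//.
Qed.

(** [sup] has the value 0 on a set without supremum, and then (D) would make a positive integral
    vanish. So the level 1/t is attained, at radii arbitrarily close to the supremum; half of it
    suffices. *)
Lemma Psi_minus_witness t : T t -> exists r : R, [/\ 0 < r, Psi leb nu r = t^-1 & Psi_minus leb nu t^-1 <= 2 * r].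
Proof.
move=> Tt; have [_ h] := TD_real Tt; have h0 := lt_le_trans (RePhi_integral_gt0 Tt) h.
set S := [set r : R | 0 < r /\ Psi leb nu r = t^-1].
have hs : has_sup S.
  apply: contrapT => /sup_out e; move: h0; rewrite /Psi_minus -/S e expr0n/= mulr0 ltxx.
  by [].
have [[r0 [r00 r0S]] ub] := hs.
have p0 : 0 < sup S by apply: (lt_le_trans r00); apply: ub_le_sup.
have [|r [rp rS] hr] := @sup_adherent _ S (sup S / 2) _ hs; first by rewrite divr_gt0.
by exists r; split=> //; rewrite /Psi_minus -/S; lra.
Qed.

(** The scale is h = min(1, 1/r) with Psi(r) = 1/t and r comparable to Psi_- (1/t). Then t Psi(1/h)
    is bounded and [minh_Psi] controls the jumps; the quadratic bound on Psi gives 1 <= t (2 + r^2)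
    Cnu, whence h^2 <= C t. *)
Lemma exists_scale_jump : (forall x, quadA A x = 0) ->
  exists C : R, 0 < C /\ forall t, T t -> exists h, intensity t h C.
Proof.
move=> A0; have [c [c0 hc]] := minh_Psi.
pose K := 1 + M * Psi leb nu 1 + (C2 * 2 ^+ d.+1 + c + c * (M * Psi leb nu 1)) + 4 * Cnu leb nu.
have [[t' Tt']|nT] := pselect (exists t, T t); last first.
  by exists 1; split=> // t Tt; exfalso; apply: nT; exists t.
have M0 : 0 <= M := le_trans (ltW (T0 Tt')) (TM Tt').
have P1 : 0 <= Psi leb nu 1 := Psi_ge0 ler01.
have MP := mulr_ge0 M0 P1; have cn := Cnu_ge0 Hnu.
have q1 : 0 <= C2 * 2 ^+ d.+1 by rewrite mulr_ge0 ?exprn_ge0// ltW.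
have q2 := mulr_ge0 (ltW c0) MP.
exists K; split; first by rewrite /K; lra.
move=> t Tt; have t0 := T0 Tt; have [r [r0 Pr Pm]] := Psi_minus_witness Tt.
pose h := Order.min 1 r^-1; exists h.
have ri0 : 0 < r^-1 by rewrite invr_gt0.
have h0 : 0 < h by rewrite lt_min ltr01.
have h1 : h <= 1 by rewrite ge_min lexx.
have hr : h * r <= 1 by rewrite -ler_pdivlMr// div1r ge_min lexx orbT.
(* Either h = 1, and t Psi(1) is bounded because T is, or 1/h = r and t Psi(r) = 1. *)
have tP : t * Psi leb nu h^-1 <= 1 + M * Psi leb nu 1.
  rewrite /h; have [k|k] := leP 1 r^-1.
    rewrite invr1; have : t * Psi leb nu 1 <= M * Psi leb nu 1 by rewrite ler_wpM2r// TM.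
    lra.
  by rewrite invrK Pr mulfV ?lt0r_neq0//; lra.
split.
- by rewrite h0 h1.
- have [_ i1] := Itg_rhoF_normv Tt; have [_ i2] := TD_real Tt.
  apply: (le_trans i1); apply: (le_trans i2).
  apply: (@le_trans _ _ (C2 * 2 ^+ d.+1 * h^-1 ^+ d.+1)); last first.
    by rewrite ler_wpM2r ?exprn_ge0 ?invr_ge0 ?(ltW h0)// /K; lra.
  rewrite -mulrA ler_wpM2l ?(ltW C20)// -exprMn; apply: lerXn2r.
  + rewrite nnegrE leNgt; apply/negP => neg.
    have := lt_le_trans (RePhi_integral_gt0 Tt) i2; rewrite pmulr_rgt0// => pos.
    have [[r' [r'0 r'P]] ub] : has_sup [set r : R | 0 < r /\ Psi leb nu r = t^-1].
      by apply: contrapT => /sup_out e; move: neg; rewrite /Psi_minus e ltxx.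
    by have := ub_le_sup ub (conj r'0 r'P) => /(lt_le_trans r'0)/ltW; rewrite leNgt neg.
  + by rewrite nnegrE mulr_ge0// invr_ge0 ltW.
  + apply: (le_trans Pm); rewrite ler_wpM2l//.
    by rewrite -[r](mulfK (lt0r_neq0 h0)) -[X in _ <= X]mul1r ler_wpM2r ?invr_ge0 ?(ltW h0)// mulrC.
- apply: (@le_trans _ _ (c * (t * Psi leb nu h^-1))).
    by rewrite mulrCA ler_wpM2l ?(ltW t0)// hc.
  apply: (le_trans (ler_wpM2l (ltW c0) tP)); rewrite mulrDr mulr1 /K; lra.
- have K0 : 0 <= K by rewrite /K; lra.
  by move=> a; rewrite A0 mulr0 mulr_ge0// mulr_ge0 ?sqr_ge0.
- have PL := Psi_le (ltW r0); rewrite Pr in PL.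
  have e1 : 1 <= t * ((2 + r ^+ 2) * Cnu leb nu).
    by have := ler_wpM2l (ltW t0) PL; rewrite mulfV ?lt0r_neq0.
  have hh : h ^+ 2 <= 1 by rewrite exprn_ile1// ltW.
  have hr2 : h ^+ 2 * r ^+ 2 <= 1 by rewrite -exprMn exprn_ile1// mulr_ge0// ltW.
  have e2 : h ^+ 2 * (2 + r ^+ 2) <= 3 by rewrite mulrDr; lra.
  apply: (@le_trans _ _ (h ^+ 2 * (t * ((2 + r ^+ 2) * Cnu leb nu)))); first by rewrite ler_peMr// sqr_ge0.
  rewrite (_ : _ * _ = (h ^+ 2 * (2 + r ^+ 2)) * (t * Cnu leb nu)); last by ring.
  have tc : 0 <= t * Cnu leb nu by rewrite mulr_ge0// ltW.
  apply: (le_trans (ler_wpM2r tc e2)); rewrite mulrCA mulrC ler_wpM2r ?(ltW t0)// /K; lra.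
Qed.

(** A nondegenerate Gaussian part imposes the diffusive scale h = min(1, sqrt t); boundedness of T
    makes t and h^2 comparable. *)
Lemma exists_scale_gauss (c : R) : 0 < c -> (forall xi, normv xi = 1 -> c <= quadA A xi) ->
  exists C : R, 0 < C /\ forall t, T t -> exists h, intensity t h C.
Proof.
move=> c0 hA; have [CA [CA0 hCA]] := quadA_le.
have low x : c * normv x ^+ 2 <= quadA A x.
  have [->|/normv_gt0 x0] := pselect (x = vzero); first by rewrite normv0 expr0n/= mulr0.
  have nx : normv (vscale (normv x)^-1 x) = 1 by rewrite normvZ ger0_norm ?invr_ge0 ?mulVf ?lt0r_neq0// ltW.
  have := hA _ nx; rewrite quadA_scale exprVn [_^-1 * _]mulrC ler_pdivlMr ?exprn_gt0//.
pose u (xi : V) : R := expR (- (c * normv xi ^+ 2)) * normv xi.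
have iu : Itg leb u.
  have c2 : 0 < 2 * c by rewrite mulr_gt0.
  apply: Itg_dom (Itg_gam_poly Hleb 1 c2); first by rewrite /u; mfun.
  move=> xi; have n0 := normv_ge0 xi.
  rewrite /u ger0_norm ?mulr_ge0 ?expR_ge0// mul1r mulrC /gam.
  rewrite (_ : 2 * c * dotv xi xi / 2 = c * normv xi ^+ 2); last by rewrite normv2; field.
  by rewrite ler_wpM2r ?expR_ge0// lerDr.
have u0 : 0 <= RI leb u by apply: RI_ge0 => xi; rewrite mulr_ge0 ?expR_ge0 ?normv_ge0.
have [[t' Tt']|nT] := pselect (exists t, T t); last first.
  by exists 1; split=> // t Tt; exfalso; apply: nT; exists t.
have M0 : 0 <= M := le_trans (ltW (T0 Tt')) (TM Tt').
have cn := Cnu_ge0 Hnu.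
have q1 : 0 <= (1 + M) * Cnu leb nu by rewrite mulr_ge0//; lra.
have q2 : 0 <= (1 + M) * CA by rewrite mulr_ge0//; lra.
exists (1 + RI leb u + 2 * ((1 + M) * Cnu leb nu) + (1 + M) * CA); split; first by lra.
move=> t Tt; have t0 := T0 Tt; have tM := TM Tt.
pose h := Order.min 1 (Num.sqrt t); exists h.
have st0 : 0 < Num.sqrt t by rewrite sqrtr_gt0.
have h0 : 0 < h by rewrite lt_min ltr01.
have h1 : h <= 1 by rewrite ge_min lexx.
have h2 : h ^+ 2 <= 1 by rewrite exprn_ile1// ltW.
have h20 : 0 < h ^+ 2 by rewrite exprn_gt0.
have ht : h ^+ 2 <= t.
  rewrite -[X in _ <= X]sqr_sqrtr ?(ltW t0)//; apply: lerXn2r; rewrite ?nnegrE ?(ltW h0) ?(ltW st0)//.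
  by rewrite ge_min lexx orbT.
have th : t <= (1 + M) * h ^+ 2.
  rewrite /h; have [k|k] := leP 1 (Num.sqrt t); first by rewrite expr1n mulr1; lra.
  by rewrite sqr_sqrtr ?(ltW t0)// mulrDl mul1r lerDl mulr_ge0// ltW.
split.
- by rewrite h0 h1.
- have [i1 _] := Itg_rhoF_normv Tt.
  have i2 : Itg leb (fun xi => h^-1 * u (vscale h xi)) by apply: ItgZ; exact: Itg_scale.
  apply: (@le_trans _ _ (RI leb (fun xi => h^-1 * u (vscale h xi)))).
    apply: RI_le => // xi; rewrite /u normvZ (ger0_norm (ltW h0)).
    rewrite [X in _ <= X](_ : _ = expR (- (c * (h * normv xi) ^+ 2)) * normv xi); last by field; exact: lt0r_neq0.
    rewrite ler_wpM2r ?normv_ge0// ler_expR lerN2.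
    apply: (@le_trans _ _ (t * quadA A xi)); last first.
      by rewrite ler_wpM2l ?(ltW t0)// /Repsi lerDl RePhi_ge0.
    apply: (@le_trans _ _ (t * (c * normv xi ^+ 2))); last by rewrite ler_wpM2l ?(ltW t0).
    by rewrite exprMn mulrCA ler_wpM2r// mulr_ge0 ?sqr_ge0// ltW.
  rewrite RIZ; last exact: Itg_scale.
  rewrite (RI_scale Hleb h0 iu) [h^-1 * _]mulrA -exprS [X in X <= _]mulrC ler_wpM2r ?exprn_ge0 ?invr_ge0 ?(ltW h0)//; lra.
- have [|_ b1] := Itg_levy Hnu (mminh h) (C := 1 + h ^- 2).
    by move=> y; rewrite ger0_norm ?minh_ge0// minh_min2.
  have b2 := ler_wpM2l (ltW t0) (le_trans (ler_norm _) b1).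
  apply: (le_trans b2); rewrite [X in X <= _]mulrA.
  have b3 : t * (1 + h ^- 2) <= 2 * (1 + M).
    have hi : 0 <= 1 + h ^- 2 by rewrite addr_ge0// invr_ge0 ltW.
    apply: (le_trans (ler_wpM2r hi th)); rewrite -mulrA mulrC ler_wpM2r//; first by lra.
    rewrite mulrDr mulr1 mulfV ?lt0r_neq0//; lra.
  apply: (le_trans (ler_wpM2r cn b3)); lra.
- move=> a; have n2 := sqr_ge0 (normv a).
  apply: (@le_trans _ _ (t * (CA * normv a ^+ 2))); first by rewrite ler_wpM2l ?(ltW t0).
  have z0 : 0 <= CA * normv a ^+ 2 by rewrite mulr_ge0.
  apply: (le_trans (ler_wpM2r z0 th)).
  rewrite [X in X <= _](_ : _ = (1 + M) * CA * (h ^+ 2 * normv a ^+ 2)); last by ring.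
  rewrite ler_wpM2r; [lra|by rewrite mulr_ge0// ltW|lra].
- by apply: (le_trans ht); rewrite ler_peMl ?(ltW t0)//; lra.
Qed.

End symbol_scale.

(** * Fatou's lemma for real-valued integrals *)

Section fatou_real.
Context (R : realType) (d0 : measure_display) (T : measurableType d0) (mu : {measure set T -> \bar R}).

Lemma RI_fatou (u_ : nat -> T -> R) (u : T -> R) (c : R) :
  (forall n, Itg mu (u_ n)) -> (forall n x, 0 <= u_ n x) -> (forall n, RI mu (u_ n) <= c) ->
  (forall x, u_ n x @[n --> \oo] --> u x) -> Itg mu u /\ RI mu u <= c.
Proof.
move=> iu u0 uc cu.
have mu_ n : measurable_fun setT (u_ n) by apply: Itg_meas (iu n).
have mu1 : measurable_fun setT u by apply: (measurable_fun_cvg mu_) => x _; exact: cu.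
apply: RI_le_of_E => //; first by move=> x; apply: (cvg_ge (cu x)) => n.
have -> : (\int[mu]_x (u x)%:E = \int[mu]_x limn_einf (fun n => (u_ n x)%:E))%E.
  apply: eq_integral => x _; rewrite is_cvg_limn_einfE; last first.
    by apply/cvg_ex; exists (u x)%:E; apply: cvg_EFin (cu x); exact: nearW.
  apply/esym/cvg_lim => //; apply: cvg_EFin (cu x); exact: nearW.
have F := @fatou _ _ _ mu setT measurableT (fun n x => (u_ n x)%:E)
   (fun n => proj2 (measurable_EFinP _ _) (mu_ n)) (fun n x _ => u0 n x).
apply: (le_trans F); rewrite limn_einf_lim; apply: lime_le.
  exact: is_cvg_einfs.
apply: nearW => n; apply: (@le_trans _ _ (\int[mu]_x (u_ n x)%:E)%E).
  by apply: ereal_inf_lbound; exists n => //=.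
by rewrite RI_E// lee_fin.
Qed.

End fatou_real.

(** * Regularity of the profile f forced by the condition on K *)

Section jump_profile.
Context (R : realType) (d : nat).
Local Notation V := (d.-tuple R).
Variable leb : {sigma_finite_measure set V -> \bar R}.
Hypothesis Hleb : is_lebesgue leb.
Hypothesis d0 : (0 < d)%N.
Variables (nu : V -> R) (f : R -> R).
Hypothesis Hnu : levy_density leb nu.
Hypothesis f0 : forall r, 0 < r -> 0 < f r.
Hypothesis fd : forall r s, 0 < r -> r <= s -> f s <= f r.
Hypothesis f_low : exists c : R, exists delta : R, 0 < c /\ 0 < delta /\
     forall r, 0 < r -> r < delta ->
       ((c * f r * r ^+ d)%:E <= \int[leb]_(x in [set x | (r < normv x)%R]) (nu x)%:E)%E.
Hypothesis K0 : Kfun leb f r @[r --> +oo] --> (0%R)%:E.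

(** Monotonicity is known on positive radii only. The function exp(-f), extended by 0, is monotone
    on the whole line, and f is recovered from its logarithm. *)
Lemma mfn : measurable_fun setT (fun y : V => f (normv y)).
Proof.
pose g (r : R) := if 0 < r then expR (- f r) else 0.
have mg : measurable_fun setT g.
  apply: nondecreasing_measurable => // r s rs; rewrite /g.
  have [r0|r0] := ltP 0 r; last by case: (0 < s); rewrite ?expR_ge0.
  by rewrite (lt_le_trans r0 rs) ler_expR lerN2 fd.
rewrite (_ : (fun y => _) = (fun y : V => if 0 < normv y then - ln (g (normv y)) else f 0)).
  apply: mf_if; [mfun| |exact: mf_cst].
  have mgn : measurable_fun setT (fun y : V => g (normv y)) by apply: (mf_comp2 mg); mfun.
  apply: mf_opp; exact: (measurableT_comp (@measurable_ln R) mgn).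
apply/funext => y; rewrite /g; case: (ltP 0 (normv y)) => h; first by rewrite expRK opprK.
by congr f; apply/eqP; rewrite eq_le h normv_ge0.
Qed.

Lemma K_eventually_le (e : R) : 0 < e -> exists r1 : R, forall r, r1 < r -> (Kfun leb f r <= e%:E)%E.
Proof.
move=> e0; have : nbhs (0%:E : \bar R) [set x | (x < e%:E)%E].
  by apply: open_nbhs_nbhs; split; [exact: open_ereal_lt_ereal|rewrite /= lte_fin].
by move=> /K0 [r1 [_ h]]; exists r1 => r /h /=; exact: ltW.
Qed.

Lemma Kfun_real (r k : R) (x : V) : 0 < r -> (Kfun leb f r <= k%:E)%E -> 1 < normv x ->
  Itg leb (fun y => outb r (vsub x y) * outb r y * (f (normv (vsub x y)) * f (normv y))) /\
  RI leb (fun y => outb r (vsub x y) * outb r y * (f (normv (vsub x y)) * f (normv y))) <= k * f (normv x).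
Proof.
move=> r0 Kk x1; have fx : 0 < f (normv x) by apply: f0; exact: lt_trans x1.
have mf := mfn; have mo := @moutb R d r.
have mxy : measurable_fun setT (fun y : V => vsub x y) by mfun.
have mf2 := mf_comp2 mf mxy; have mo2 := mf_comp2 mo mxy.
apply: RI_le_of_E; first by mfun.
  move=> y; rewrite /outb; have [h|h] := ltP r (normv (vsub x y)); last by rewrite !mul0r.
  have [h'|h'] := ltP r (normv y); last by rewrite mulr0 !mul0r.
  by rewrite !mul1r mulr_ge0// ltW// f0// (lt_trans r0).
set S := [set y : V | (r < normv (vsub x y))%R /\ (r < normv y)%R].
have -> : (\int[leb]_y (outb r (vsub x y) * outb r y * (f (normv (vsub x y)) * f (normv y)))%:E =
   \int[leb]_(y in S) (f (normv (vsub x y)) * f (normv y))%:E)%E.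
  rewrite [RHS]integral_mkcond; apply: eq_integral => y _; rewrite patchE /outb.
  case: (boolP (y \in S)) => [/set_mem[h1 h2]|/negP h]; first by rewrite h1 h2 !mul1r.
  have [h1|h1] := ltP r (normv (vsub x y)); last by rewrite !mul0r.
  have [h2|h2] := ltP r (normv y); last by rewrite mulr0 !mul0r.
  by exfalso; apply: h; apply/mem_set.
have : ((f (normv x))^-1%:E * \int[leb]_(y in S) (f (normv (vsub x y)) * f (normv y))%:E <= k%:E)%E.
  by apply: le_trans Kk; apply: ereal_sup_ubound; exists x.
by rewrite muleC lee_pdivrMr// -EFinM.
Qed.

(** By (B), c f(s) s^d is at most the mass of |x| > s for small s, and a Levy measure bounds this
    mass by a multiple of s^-2. *)
Lemma f_small : exists C : R, 0 < C /\ forall r : R, 0 < r -> r <= 1 -> f r <= C * r^-1 ^+ (d + 2).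
Proof.
have [c [dl [c0 [dl0 h]]]] := f_low; have mn := mnu Hnu.
(* Multiplying r by e brings it into the range where the lower bound of (B) is available, at the
   cost of a constant. *)
pose e : R := Order.min (dl / 2) 1.
have e0 : 0 < e by rewrite lt_min ltr01 andbT divr_gt0.
have e1 : e <= 1 by rewrite ge_min lexx orbT.
have ed : e < dl by apply: (@le_lt_trans _ _ (dl / 2)); [rewrite ge_min lexx|lra].
have cn := Cnu_ge0 Hnu.
exists (c^-1 * (2 * (Cnu leb nu + 1)) * e^-1 ^+ (d + 2)); split.
  by rewrite !mulr_gt0 ?invr_gt0 ?exprn_gt0 ?invr_gt0//; lra.
move=> r r0 r1; pose s := r * e.
have s0 : 0 < s by rewrite mulr_gt0.
have sr : s <= r by rewrite ler_piMr// ltW.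
have s1 : s <= 1 := le_trans sr r1.
have sd : s < dl by apply: le_lt_trans ed; rewrite ler_piMl// ltW.
have io := Itg_outnu Hnu s0.
have E : (\int[leb]_(x in [set x | (s < normv x)%R]) (nu x)%:E = (RI leb (fun y => outb s y * nu y))%:E)%E.
  rewrite -(RI_E io) [LHS]integral_mkcond; apply: eq_integral => y _; rewrite patchE /outb.
  case: (boolP (y \in _)) => [/set_mem/= ->|/negP hy]; first by rewrite mul1r.
  by have [h1|h1] := ltP s (normv y); [exfalso; apply: hy; apply/mem_set|rewrite mul0r].
have k1 := h s s0 sd; rewrite E lee_fin in k1.
have si0 : 0 < s ^- 2 by rewrite invr_gt0 exprn_gt0.
have k2 : RI leb (fun y => outb s y * nu y) <= 2 * s ^- 2 * Cnu leb nu.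
  rewrite /Cnu -(RIZ _ (Itg_min2nu Hnu)); apply: (RI_le io (ItgZ _ (Itg_min2nu Hnu))) => y.
  rewrite mulrA ler_wpM2r ?(nu_ge0 Hnu)//; apply: (le_trans (outb_min2 y s0)).
  rewrite ler_wpM2r ?min2_ge0//; have : 1 <= s ^- 2; last by lra.
  by rewrite invf_ge1 ?exprn_gt0// exprn_ile1// ltW.
have k3 : f s <= c^-1 * (2 * s ^- 2 * Cnu leb nu) * s^-1 ^+ d.
  have sd0 : 0 < s ^+ d by rewrite exprn_gt0.
  have -> : f s = c^-1 * (c * f s * s ^+ d) * s^-1 ^+ d.
    by rewrite exprVn; field; rewrite ?lt0r_neq0.
  rewrite ler_wpM2r ?exprn_ge0 ?invr_ge0 ?(ltW s0)// ler_wpM2l ?invr_ge0 ?(ltW c0)//.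
  exact: le_trans k1 k2.
apply: (le_trans (fd s0 sr)); apply: (le_trans k3).
have -> : c^-1 * (2 * (Cnu leb nu + 1)) * e^-1 ^+ (d + 2) * r^-1 ^+ (d + 2) =
    c^-1 * (2 * s ^- 2 * (Cnu leb nu + 1)) * s^-1 ^+ d.
  have es : e^-1 ^+ (d + 2) * r^-1 ^+ (d + 2) = s ^- 2 * s^-1 ^+ d.
    by rewrite -exprMn -invfM exprD mulrC -exprVn /s (mulrC e).
  by rewrite -mulrA es; ring.
rewrite ler_wpM2r ?exprn_ge0 ?invr_ge0 ?(ltW s0)// ler_wpM2l ?invr_ge0 ?(ltW c0)//.
by rewrite ler_wpM2l ?mulr_ge0 ?(ltW si0)//; lra.
Qed.

(* One convolution step: a ball of unit size around the point at distance r + 2 from x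
   contributes f(r + 3) f(|x| - r - 1) to the integral defining K. *)
Lemma f_step : exists a s0 C : R, [/\ 1 <= a, a + 1 <= s0, 1 <= C & forall s, s0 <= s -> f (s - a) <= C * f s].
Proof.
have [r1 h1] := K_eventually_le ltr01.
pose r := Order.max r1 0 + 1.
have rr1 : r1 < r by rewrite /r; (have : r1 <= Order.max r1 0 by rewrite le_max lexx); lra.
have r0 : 0 < r by rewrite /r; (have : 0 <= Order.max r1 0 by rewrite le_max lexx orbT); lra.
have fr3 : 0 < f (r + 3) by apply: f0; lra.
(* Side of a cube contained in the unit ball, its half-width being 1/d. *)
pose w : R := 2 * d%:R^-1.
have dR : 0 < d%:R :> R by rewrite ltr0n.
have w0 : 0 < w ^+ d by rewrite exprn_gt0// mulr_gt0// invr_gt0.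
exists (r + 1), (2 * r + 5), (1 + (f (r + 3) * w ^+ d)^-1); split; try lra.
  by rewrite lerDl invr_ge0 mulr_ge0// ltW.
move=> s hs; have s0 : 0 < s by lra.
pose i0 := Ordinal d0.
pose x : V := vscale s (unitv R i0).
have nx : normv x = s by rewrite normvZ normv_unitv mulr1 ger0_norm// ltW.
have [|iK hK] := @Kfun_real r 1 x r0 (h1 _ rr1); first by rewrite nx; lra.
rewrite nx mul1r in hK.
pose c : V := vscale (s - r - 2) (unitv R i0).
have nc : normv c = s - r - 2 by rewrite normvZ normv_unitv mulr1 ger0_norm//; lra.
have nxc : normv (vsub x c) = r + 2.
  rewrite (_ : vsub x c = vscale (r + 2) (unitv R i0)); first by rewrite normvZ normv_unitv mulr1 ger0_norm//; lra.
  by apply: eq_from_tnth => i; rewrite !tnthE; ring.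
clearbody c.
have [iB eB] := Itg_indic_box Hleb (vsub c [tuple d%:R^-1 | i < d]) (vadd c [tuple d%:R^-1 | i < d]).
rewrite leb_box_centered ?invr_ge0//= in eB.
set B := box _ _ in iB eB.
have inB y : B y -> normv (vsub y c) <= 1.
  move=> By; rewrite -[X in _ <= X](mulfV (lt0r_neq0 dR)); apply: normv_le_coord => i.
  have := By i; rewrite !tnthE tnth_mktuple => /andP[k1 k2]; rewrite ?tnthE ler_norml; apply/andP; split; lra.
have q1 : f (r + 3) * f (s - (r + 1)) * w ^+ d <= f s.
  apply: le_trans hK; rewrite /w -eB -(RIZ _ iB); apply: (RI_le (ItgZ _ iB) iK) => y.
  rewrite indicE; case: (boolP (y \in B)) => [/set_mem/inB yB|_]; last first.
    rewrite mulr0 /outb; have [h|h] := ltP r (normv (vsub x y)); last by rewrite !mul0r.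
    have [h'|h'] := ltP r (normv y); last by rewrite mulr0 !mul0r.
    by rewrite !mul1r mulr_ge0// ltW// f0// (lt_trans r0).
  have y1 : normv y <= s - (r + 1).
    by have := normvB_ge y c; rewrite nc; lra.
  have y2 : s - r - 3 <= normv y.
    by have := normvB_ge c y; rewrite normv_vsubC nc; lra.
  have e : vsub (vsub x c) (vsub y c) = vsub x y by apply: eq_from_tnth => i; rewrite !tnthE; ring.
  have z1 : normv (vsub x y) <= r + 3.
    by have := normvB (vsub x c) (vsub y c); rewrite e nxc; lra.
  have z2 : r + 1 <= normv (vsub x y).
    by have := normvB_ge (vsub x c) (vsub y c); rewrite e nxc; lra.
  have t1 : r < normv (vsub x y) by lra.
  have t2 : r < normv y by lra.
  rewrite mulr1 /outb t1 t2 !mul1r; apply: ler_pM; try exact: ltW.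
  - by apply: ltW; apply: f0; lra.
  - by apply: fd => //; lra.
  - by apply: fd => //; lra.
have Z0 : 0 < f (r + 3) * w ^+ d by rewrite mulr_gt0.
have fs0 : 0 < f s by apply: f0.
rewrite mulrDl mul1r; apply: (@le_trans _ _ ((f (r + 3) * w ^+ d)^-1 * f s)); last by rewrite lerDr ltW.
by rewrite mulrC ler_pdivlMr// mulrCA mulrA.
Qed.

(** Iterating [f_step] over about s - r steps of length a >= 1 yields exponential slowness with L =
    ln C. The constant D covers the bounded range below s0, on which [f_step] is silent. *)
Lemma f_slow : exists C L : R, [/\ 1 <= C, 0 <= L &
  forall r s : R, 1 <= r -> r <= s -> f r <= C * expR (L * (s - r)) * f s].
Proof.
have [a [s0 [C [a1 as0 C1 h]]]] := f_step.
have s00 : 0 < s0 by lra.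
pose D := Order.max 1 (f 1 / f s0).
have D1 : 1 <= D by rewrite /D le_max lexx.
have fD s : 1 <= s -> s <= s0 -> f 1 <= D * f s.
  move=> s1 ss0; have fs : 0 < f s0 := f0 s00.
  apply: (@le_trans _ _ (D * f s0)); last by rewrite ler_wpM2l ?fd//; lra.
  by rewrite -ler_pdivrMr// /D le_max lexx orbT.
have C0 : 0 < C by lra.
have D0 : 0 < D by lra.
have it k : forall r s, 1 <= r -> r <= s -> s <= r + k%:R * a -> f r <= D * C ^+ k * f s.
  elim: k => [|k IH] r s r1 rs sk.
    have -> : s = r by rewrite mul0r addr0 in sk; apply/eqP; rewrite eq_le sk rs.
    by rewrite expr0 mulr1 ler_peMl// ltW// f0//; lra.
  have fs : 0 <= f s by apply: ltW; apply: f0; lra.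
  have Ck1 : 1 <= C ^+ k by rewrite exprn_ege1.
  have CS1 : 1 <= C ^+ k.+1 by rewrite exprn_ege1.
  have [ss|ss] := leP s s0.
    apply: (@le_trans _ _ (D * f s)).
      by apply: (@le_trans _ _ (f 1)); [apply: fd => //; lra|apply: fD => //; lra].
    by rewrite -mulrA ler_wpM2l ?(ltW D0)// ler_peMl.
  have hs := h s (ltW ss).
  have [rs'|rs'] := leP r (s - a).
    have sk' : s - a <= r + k%:R * a by move: sk; rewrite -natr1 mulrDl mul1r; lra.
    apply: (le_trans (IH r (s - a) r1 rs' sk')).
    by rewrite exprSr mulrA -[X in _ <= X]mulrA ler_wpM2l// mulr_ge0 ?exprn_ge0// ltW.
  apply: (@le_trans _ _ (f (s - a))); first by apply: fd; lra.
  apply: (le_trans hs); rewrite exprSr mulrA ler_wpM2r// ler_peMl ?(ltW C0)//.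
  exact: mulr_ege1.
exists (D * C), (ln C); split.
- exact: mulr_ege1.
- by rewrite ln_ge0.
move=> r s r1 rs; pose k := (Num.truncn (s - r)).+1.
have sr0 : 0 <= s - r by lra.
have [t1 t2] := andP (truncn_itv sr0).
have fs : 0 <= f s by apply: ltW; apply: f0; lra.
apply: (le_trans (it k r s r1 rs _)).
  have : (s - r) * 1 <= k%:R * a by apply: ler_pM => //; exact: ltW.
  lra.
rewrite ler_wpM2r// -mulrA ler_wpM2l ?(ltW D0)// /k exprS ler_wpM2l ?(ltW C0)//.
rewrite mulrC -{1}(lnK (C0 : C \is Num.pos)) -expRM_natl ler_expR ler_wpM2r// ln_ge0//.
Qed.

(** The two forms of slowness in use: moving the argument by w costs at most exp(L |w|), and
    exponentials of rate at least L lie below a multiple of f. *)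
Lemma f_shift : exists C L : R, [/\ 1 <= C, 0 <= L &
  (forall x w : V, x <> vzero -> 1 <= normv (vsub x w) -> f (normv (vsub x w)) <= C * expR (L * normv w) * f (normv x)) /\
  (forall s : R, 1 <= s -> expR (- (L * s)) <= C * f s)].
Proof.
have [C [L [C1 L0 h]]] := f_slow.
have f1 : 0 < f 1 := f0 ltr01.
have m1 : 1 <= 1 + (f 1)^-1 by rewrite lerDl invr_ge0 ltW.
have Cm : C <= C * (1 + (f 1)^-1) by rewrite ler_peMr//; lra.
exists (C * (1 + (f 1)^-1)), L; split => //; first exact: le_trans C1 Cm.
split=> [x w /normv_gt0 x0 xw|s s1].
  have fx := f0 x0.
  apply: (@le_trans _ _ (C * expR (L * normv w) * f (normv x))); last first.
    by rewrite ler_wpM2r ?(ltW fx)// ler_wpM2r ?expR_ge0.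
  have [k|k] := leP (normv x) (normv (vsub x w)).
    apply: (le_trans (fd x0 k)); rewrite ler_peMl ?(ltW fx)//.
    by apply: mulr_ege1 => //; rewrite -expR0 ler_expR mulr_ge0// normv_ge0.
  apply: (le_trans (h _ _ xw (ltW k))); rewrite ler_wpM2r ?(ltW fx)// ler_wpM2l//; first by lra.
  by rewrite ler_expR ler_wpM2l//; have := normvB_ge x w; lra.
have := h 1 s (lexx _) s1; have fs : 0 < f s by apply: f0; lra.
move=> k; have : expR (- (L * s)) * f 1 <= C * f s.
  apply: (le_trans (ler_wpM2l (expR_ge0 _) k)).
  rewrite [X in X <= _](_ : _ = expR (- (L * s)) * expR (L * (s - 1)) * (C * f s)); last by ring.
  rewrite -expRD ler_piMl ?mulr_ge0 ?(ltW fs)//; first by lra.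
  by rewrite -[X in _ <= X]expR0 ler_expR; lra.
rewrite -ler_pdivlMr// => /le_trans; apply.
by rewrite mulrAC ler_wpM2r ?(ltW fs)// ler_wpM2l//; lra.
Qed.

End jump_profile.

(** * Tail of an exponential convolution series relative to a profile g *)

Section iterate_bound.
Context (R : realType) (d : nat).
Local Notation V := (d.-tuple R).
Variable leb : {sigma_finite_measure set V -> \bar R}.
Hypothesis Hleb : is_lebesgue leb.
Variables (m u g : V -> R) (D : R).
Hypothesis m0 : forall y, 0 <= m y.
Hypothesis im : Itg leb m.
Hypothesis u0 : forall x, 0 <= u x <= D.
Hypothesis iu : Itg leb u.
Variables (t B0 K Cl Q rh : R) (k : nat).
Hypothesis t0 : 0 <= t.
Hypothesis B00 : 0 <= B0.
Hypothesis Cl0 : 0 <= Cl.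
Hypothesis K1 : 1 <= K.
Hypothesis mK : RI leb m <= K.
Hypothesis uQ : RI leb u <= Q.
Hypothesis g0 : forall x, rh < normv x -> 0 <= g x.
Hypothesis H0 : forall x, rh < normv x -> u x <= t * B0 * g x.
Hypothesis HK : forall x, rh < normv x ->
  Itg leb (fun z => m z * (outb rh (vsub x z) * g (vsub x z))) /\
  RI leb (fun z => m z * (outb rh (vsub x z) * g (vsub x z))) <= K * g x.
Hypothesis HL : forall x z (dl : R), rh < normv x -> 0 < dl -> dl <= 1 -> dl <= normv z ->
  normv (vsub x z) <= rh + 1 -> m z <= t * Cl * dl^-1 ^+ k * g x.

(** J is the growth per convolution: K from one step of the profile, e from the powers of n lost to
    short jumps, and 2 for the two terms of the recursion. E is the constant of the short-jump
    term. *)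
Let J : R := 2 * (K * expR 1).
Let E : R := Cl * Q * ((2 * k)`!%:R * expR 2).

(* The radius grows from rh to rh + 1 by steps 1/((n+1)(n+2)), so a jump that brings x
   inside the previous radius has at least that size. *)
Lemma iterate_bound n x : rh + 1 - n.+1%:R^-1 < normv x ->
  iter n (vconv leb m) u x <= t * (J ^+ n * (B0 + E)) * g x.
Proof.
have Q0 : 0 <= Q by apply: le_trans uQ; apply: RI_ge0 => y; case/andP: (u0 y).
have E0 : 0 <= E by rewrite /E !mulr_ge0 ?expR_ge0.
have BE : 0 <= B0 + E by rewrite addr_ge0.
have e1 : 1 <= expR 1 :> R by rewrite -[X in X <= _]expR0 ler_expR.
have k1 := K1; have K0 : 0 <= K by lra.
have KJ : K + 1 <= J.
  have := ler_wpM2l K0 e1; rewrite mulr1 /J; lra.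
have Ke1 : 1 <= K * expR 1 by exact: mulr_ege1.
have J0 : 0 <= J by lra.
elim: n x => [|n IH] x.
  rewrite invr1 addrK expr0 mul1r => hx; apply: (le_trans (H0 hx)).
  by rewrite ler_wpM2r ?g0// ler_wpM2l// lerDl.
move=> hx.
have nn : n.+2%:R^-1 <= n.+1%:R^-1 :> R by rewrite lef_pV2 ?posrE// ler_nat.
have n1 : n.+1%:R^-1 <= 1 :> R by rewrite invf_le1// ler1n.
have n20 : 0 < n.+2%:R^-1 :> R by rewrite invr_gt0.
have [p pE] : exists p : R, p = n.+2%:R^-1 by exists n.+2%:R^-1.
have [p1 p1E] : exists p : R, p = n.+1%:R^-1 by exists n.+1%:R^-1.
rewrite -pE -?p1E in hx nn n1 n20 IH.
have hrx : rh < normv x by lra.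
have gx := g0 hrx.
pose dl : R := p1 - p.
have dlE : dl = (n.+1%:R * n.+2%:R)^-1.
  rewrite /dl pE p1E -[n.+2%:R]natr1; field.
  have n0 : 0 <= n%:R :> R by [].
  by rewrite !lt0r_neq0//; lra.
have dl0 : 0 < dl by rewrite dlE invr_gt0 mulr_gt0.
have dl1 : dl <= 1 by rewrite /dl; lra.
have [hb hi he] := iter_vconv_mass Hleb m0 im u0 iu n.
have [iK bK] := HK hrx.
have q0 y : 0 <= iter n (vconv leb m) u y by case/andP: (hb y).
set q := iter n (vconv leb m) u in hb hi he q0 IH *.
have irf : Itg leb (fun z => q (vsub x z)) := Itg_refl Hleb x hi.
have mq : measurable_fun setT q := Itg_meas hi.
have mm : measurable_fun setT m := Itg_meas im.
pose c1 := t * (J ^+ n * (B0 + E)); pose c2 := t * Cl * dl^-1 ^+ k * g x.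
have c10 : 0 <= c1 by rewrite !mulr_ge0// exprn_ge0.
have c20 : 0 <= c2 by rewrite !mulr_ge0// exprn_ge0// invr_ge0 ltW.
have pw z : m z * q (vsub x z) <= c1 * (m z * (outb rh (vsub x z) * g (vsub x z))) + c2 * q (vsub x z).
  have gz : 0 <= outb rh (vsub x z) * g (vsub x z).
    by rewrite /outb; case: (ltP rh (normv (vsub x z))) => hz; [rewrite mul1r g0|rewrite mul0r].
  have [hz|hz] := ltP (rh + 1 - p1) (normv (vsub x z)).
    have hz' : rh < normv (vsub x z) by lra.
    rewrite /outb hz' mul1r; apply: (@le_trans _ _ (c1 * (m z * g (vsub x z)))); last first.
      by rewrite lerDl mulr_ge0.
    by rewrite mulrCA ler_wpM2l// IH.
  have mz : m z <= c2.
    apply: HL => //; last by lra.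
    have := normvB_ge x (vsub x z); rewrite vsub_vsub /dl; lra.
  apply: (@le_trans _ _ (c2 * q (vsub x z))); first by rewrite ler_wpM2r.
  by rewrite lerDr mulr_ge0// mulr_ge0.
have ic1 := ItgZ c1 iK; have ic2 := ItgZ c2 irf.
have step : vconv leb m q x <= c1 * (K * g x) + c2 * (K ^+ n * Q).
  apply: (@le_trans _ _ (RI leb (fun z => c1 * (m z * (outb rh (vsub x z) * g (vsub x z))) + c2 * q (vsub x z)))).
    have mqx : measurable_fun setT (fun z => q (vsub x z)) := Itg_meas irf.
    apply: RI_le; [|exact: ItgD|exact: pw].
    apply: Itg_dom (ItgD ic1 ic2); first by mfun.
    by move=> z; rewrite ger0_norm ?pw// mulr_ge0.
  rewrite (RID ic1 ic2) (RIZ c1 iK) (RIZ c2 irf) lerD//; first by rewrite ler_wpM2l.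
  rewrite ler_wpM2l// (RI_refl Hleb x hi) he; apply: ler_pM => //.
  - by rewrite exprn_ge0// RI_ge0.
  - by apply: RI_ge0 => y; case/andP: (u0 y).
  - by apply: lerXn2r; rewrite ?nnegrE// RI_ge0.
(* Here 1/dl = (n+1)(n+2) <= (n+2)^2, and a power of n + 2 is at most a factorial times exp(n +
   2). *)
have dlk : dl^-1 ^+ k <= (2 * k)`!%:R * expR 2 * expR 1 ^+ n.
  have p0 : 0 <= n.+2%:R :> R by [].
  apply: (@le_trans _ _ (n.+2%:R ^+ (2 * k))).
    rewrite mulnC exprM exprAC dlE invrK; apply: lerXn2r; rewrite ?nnegrE ?exprn_ge0 ?mulr_ge0//.
    by rewrite expr2 ler_wpM2r// ler_nat.
  apply: (le_trans (exp_ge_pow (2 * k) p0)).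
  rewrite -mulrA ler_wpM2l// -expRM_natl -expRD ler_expR mulr1 -(addn2 n) natrD; lra.
rewrite -/q /= -/(vconv leb m q) in step *.
apply: (le_trans step).
have b2 : c2 * (K ^+ n * Q) <= t * g x * (E * (K * expR 1) ^+ n).
  rewrite /c2 (_ : _ * _ = t * g x * (Cl * Q * K ^+ n * dl^-1 ^+ k)); last by ring.
  rewrite ler_wpM2l ?mulr_ge0//.
  rewrite [X in _ <= X](_ : _ = Cl * Q * K ^+ n * ((2 * k)`!%:R * expR 2 * expR 1 ^+ n)); last first.
    by rewrite /E exprMn; ring.
  by rewrite ler_wpM2l// !mulr_ge0// exprn_ge0.
have b3 : E * (K * expR 1) ^+ n <= (B0 + E) * J ^+ n.
  have Ke0 : 0 <= K * expR 1 := le_trans ler01 Ke1.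
  apply: (ler_pM E0 (exprn_ge0 _ Ke0)); first by rewrite lerDr.
  apply: lerXn2r; rewrite ?nnegrE; [exact: Ke0|exact: J0|].
  by rewrite /J ler_peMl// ler1n.
have tg : 0 <= t * g x by rewrite mulr_ge0.
apply: (le_trans (lerD (lexx _) (le_trans b2 (ler_wpM2l tg b3)))).
rewrite /c1 [X in X <= _](_ : _ = t * g x * (B0 + E) * J ^+ n * (K + 1)); last by ring.
rewrite exprS [X in _ <= X](_ : _ = t * g x * (B0 + E) * J ^+ n * J); last by ring.
by rewrite ler_wpM2l// !mulr_ge0// exprn_ge0.
Qed.

Lemma iterate_series_bound x (l : R) : rh + 1 <= normv x ->
  \sum_(n < N) iter n (vconv leb m) u x / n`!%:R @[N --> \oo] --> l ->
  l <= t * ((B0 + E) * expR J) * g x.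
Proof.
move=> hx hl; apply: (cvg_le hl) => N.
have hrx : rh < normv x by lra.
have gx := g0 hrx.
have Q0 : 0 <= Q by apply: le_trans uQ; apply: RI_ge0 => y; case/andP: (u0 y).
have E0 : 0 <= E by rewrite /E !mulr_ge0 ?expR_ge0.
have J0 : 0 <= J by rewrite /J !mulr_ge0 ?expR_ge0//; exact: le_trans ler01 K1.
have c0 : 0 <= t * g x * (B0 + E) by rewrite !mulr_ge0// addr_ge0.
apply: (@le_trans _ _ (t * g x * (B0 + E) * \sum_(n < N) J ^+ n / n`!%:R)).
  rewrite mulr_sumr; apply: ler_sum => n _; rewrite mulrA ler_wpM2r ?invr_ge0//.
  rewrite [X in _ <= X](_ : _ = t * (J ^+ n * (B0 + E)) * g x); last by ring.
  by apply: iterate_bound; apply: lt_le_trans hx; rewrite ltrBlDr ltrDl invr_gt0.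
rewrite [X in _ <= X](_ : _ = t * g x * (B0 + E) * expR J); last by ring.
by rewrite ler_wpM2l// sum_pow_fact_le.
Qed.

End iterate_bound.

(** As z >= 2 r + 1, what the rate 4 l / h leaves after paying for exp(4 l r / h) is at least l z +
    1/h. The part exp(-1/h) turns h^-N into at most (N + 2)! h^2, and h^2 <= C t is the source of
    the factor t. *)
Lemma tail_arith (R : realType) (N : nat) (l h K r z t C : R) : 1 <= l -> 0 < h -> h <= 1 -> 0 <= K ->
  2 * r + 1 <= z -> 0 <= z -> h ^+ 2 <= C * t ->
  K * (h^-1 ^+ N * expR (4 * l * r / h)) * expR (- (4 * l / h * z)) <=
  t * (K * ((N + 2)`!%:R * C)) * expR (- (l * z)).
Proof.
move=> l1 h0 h1 K0 hz z0 ht.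
have hi1 : 1 <= h^-1 by rewrite invf_ge1.
have hi0 : 0 < h^-1 by rewrite invr_gt0.
rewrite [X in _ <= X](_ : _ = K * (t * ((N + 2)`!%:R * C) * expR (- (l * z)))); last by ring.
rewrite -!mulrA ler_wpM2l// -expRD.
have s2 : 4 * (l * (r / h)) - 4 * (l * (h^-1 * z)) <= - h^-1 - l * z.
  have w1 : z / 2 + 1 / 2 <= z - r by lra.
  have lh : 0 <= 4 * l * h^-1 by rewrite !mulr_ge0 ?(ltW hi0)//; lra.
  have w2 := ler_wpM2l lh w1.
  have ln0 : 0 <= l * z by rewrite mulr_ge0//; lra.
  have w4 := ler_peMr ln0 hi1; have w5 := ler_peMl (ltW hi0) l1.
  have w3 : 4 * l * h^-1 * (z / 2 + 1 / 2) = 2 * (l * z * h^-1) + 2 * (l * h^-1) by field; exact: lt0r_neq0.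
  have w6 : 4 * (l * (r / h)) - 4 * (l * (h^-1 * z)) = - (4 * l * h^-1 * (z - r)) by ring.
  by rewrite w3 in w2; rewrite w6; lra.
apply: (@le_trans _ _ (h^-1 ^+ N * expR (- h^-1 - l * z))).
  by rewrite ler_wpM2l ?exprn_ge0 ?(ltW hi0)// ler_expR.
rewrite expRD !mulrA ler_wpM2r ?expR_ge0//.
have s3 := exp_ge_pow (N + 2) (ltW hi0).
have s4 : h^-1 ^+ N * expR (- h^-1) <= (N + 2)`!%:R * h ^+ 2.
  rewrite expRN ler_pdivrMr ?expR_gt0// mulrAC.
  rewrite exprD in s3; have := ler_wpM2r (sqr_ge0 h) s3.
  rewrite [X in X <= _](_ : _ = h^-1 ^+ N)//.
  by rewrite -mulrA -exprMn mulVf ?expr1n ?mulr1// lt0r_neq0.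
apply: (le_trans s4).
rewrite [X in _ <= X](_ : _ = (N + 2)`!%:R * (C * t)); last by ring.
by rewrite ler_wpM2l.
Qed.

Lemma absorb_one (R : realType) (a c e1 e2 e3 H : R) : 1 <= H * (e2 * e3) ->
  1 + 2 * (a * (e1 * e2)) * (c * H) * e3 <= (1 + 2 * (a * e1) * c) * (H * (e2 * e3)).
Proof.
move=> h; rewrite [X in _ <= X](_ : _ = H * (e2 * e3) + 2 * (a * (e1 * e2)) * (c * H) * e3); last by ring.
by rewrite lerD2r.
Qed.

(** * The density with jumps below the scale h *)

Section small_jumps.
Context (R : realType) (d : nat).
Local Notation V := (d.-tuple R).
Variable leb : {sigma_finite_measure set V -> \bar R}.
Hypothesis Hleb : is_lebesgue leb.
Hypothesis d0 : (0 < d)%N.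
Variables (b : V) (A : 'M[R]_d) (nu : V -> R).
Hypothesis sA : A^T = A.
Hypothesis pA : forall x, 0 <= quadA A x.
Hypothesis Hnu : levy_density leb nu.
Variables (T : set R) (M C : R).
Hypothesis T0 : forall t, T t -> 0 < t.
Hypothesis TM : forall t, T t -> t <= M.
Hypothesis C_gt0 : 0 < C.
Hypothesis irF : forall t, T t -> Itg leb (fun xi => rhoF leb A nu t xi * normv xi).

Local Notation UR := (UR leb b A nu).
Local Notation intensity := (intensity leb A nu).

Lemma outb_minh (h : R) (y : V) : 0 < h -> outb h y <= minh h y.
Proof.
move=> h0; rewrite /outb; case: (ltP h (normv y)) => hy; last exact: minh_ge0.
rewrite /minh le_min lexx/= ler_pdivlMr ?exprn_gt0// mul1r.
by apply: lerXn2r; rewrite ?nnegrE ?normv_ge0 ?(ltW h0)// ltW.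
Qed.

Lemma intensity_out t h : T t -> intensity t h C -> t * RI leb (fun y => outb h y * nu y) <= C.
Proof.
move=> Tt [/andP[h0 h1] _ hm _ _]; apply: le_trans hm; rewrite ler_wpM2l ?(ltW (T0 Tt))//.
apply: (RI_le (Itg_outnu Hnu h0) (Itg_minh Hnu h0)) => y.
by rewrite ler_wpM2r ?(nu_ge0 Hnu)// outb_minh.
Qed.

(** At rate l/h the jumps of size at most h contribute a bounded amount through [minh]. The drift
    and the compensator of the jumps between h and 1 only obey a bound of order 1/h, and for this
    reason the tail estimate starts at a fixed distance instead of a multiple of h. *)
Lemma LR_scaled_le (t h l : R) (a : V) : T t -> intensity t h C -> 0 <= l -> normv a = l / h ->
  t * LR leb b A nu h a <= C * (l + l ^+ 2) * expR l + C * l ^+ 2 + l * (C + M * normv b) / h.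
Proof.
move=> Tt It l0 al; case: (It) => /andP[h0 h1] _ hm hA _; have t0 := T0 Tt.
have lh0 : 0 <= l / h by rewrite divr_ge0// ltW.
pose k := (l + l ^+ 2) * expR l + l / h.
have k0 : 0 <= (l + l ^+ 2) * expR l by rewrite mulr_ge0 ?expR_ge0// addr_ge0// sqr_ge0.
have mb := @minb R d h.
have bd y : `|inb h y * (expR (dotv a y) - 1) - dotv a y * indB1 y| <= k * minh h y.
  have ny := normv_ge0 y.
  have cs := cauchy_schwarz a y; rewrite al in cs.
  rewrite /inb; have [hy|hy] := leP (normv y) h; last first.
    rewrite mul0r sub0r normrN.
    have -> : minh h y = 1.
      rewrite /minh min_l// ler_pdivlMr ?exprn_gt0// mul1r.
      by apply: lerXn2r; rewrite ?nnegrE ?(ltW h0)// ltW.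
    rewrite mulr1 /k indB1E; case: (ltP (normv y) 1) => y1; last by rewrite mulr0 normr0; lra.
    rewrite mulr1; apply: (le_trans cs); apply: (@le_trans _ _ (l / h)); last by lra.
    by rewrite ler_piMr// ltW.
  rewrite mul1r.
  have e : minh h y = (normv y / h) ^+ 2.
    rewrite /minh exprMn exprVn min_r// ler_pdivrMr ?exprn_gt0// mul1r.
    by apply: lerXn2r; rewrite ?nnegrE ?(ltW h0).
  have yh : normv y / h <= 1 by rewrite ler_pdivrMr// mul1r.
  have yh0 : 0 <= normv y / h by rewrite divr_ge0// ltW.
  have cs' : `|dotv a y| <= l * (normv y / h) by apply: (le_trans cs); rewrite le_eqVlt; apply/orP; left; apply/eqP; ring.
  have cl : `|dotv a y| <= l by apply: (le_trans cs'); rewrite ler_piMr.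
  have el : expR `|dotv a y| <= expR l by rewrite ler_expR.
  apply: (@le_trans _ _ ((l + l ^+ 2) * expR l * minh h y)); last first.
    by rewrite ler_wpM2r ?minh_ge0// /k lerDl.
  rewrite indB1E; case: (ltP (normv y) 1) => y1.
    rewrite mulr1; apply: (le_trans (exp_sub2_le _)).
    rewrite [X in _ <= X]mulrAC; apply: ler_pM; rewrite ?exprn_ge0 ?expR_ge0//.
    apply: (@le_trans _ _ ((l * (normv y / h)) ^+ 2)); first by apply: lerXn2r; rewrite ?nnegrE//; exact: mulr_ge0.
    by rewrite exprMn e ler_wpM2r ?exprn_ge0// lerDr.
  have -> : minh h y = 1.
    by rewrite /minh min_l// ler_pdivlMr ?exprn_gt0// mul1r; apply: lerXn2r; rewrite ?nnegrE ?(ltW h0)//; lra.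
  rewrite mulr0 subr0 mulr1; apply: (le_trans (exp_sub1_le _)).
  apply: ler_pM; rewrite ?expR_ge0//; have := sqr_ge0 l; lra.
have mF : measurable_fun setT (fun y => inb h y * (expR (dotv a y) - 1) - dotv a y * indB1 y) by mfun.
have mn := mnu Hnu.
have im := Itg_minh Hnu h0.
have r1 : RI leb (fun y => (inb h y * (expR (dotv a y) - 1) - dotv a y * indB1 y) * nu y) <= k * RI leb (fun y => minh h y * nu y).
  rewrite -(RIZ k im); apply: (le_trans (ler_norm _)); apply: RI_abs_le (ItgZ k im); first by mfun.
  by move=> y; rewrite normrM (ger0_norm (nu_ge0 Hnu y)) mulrA ler_wpM2r ?(nu_ge0 Hnu).
have kk : 0 <= k by rewrite addr_ge0.
have r2 := ler_wpM2l (ltW t0) r1; rewrite (mulrCA t k) in r2.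
have r3 := le_trans r2 (ler_wpM2l kk hm).
have r4 : t * dotv a b <= M * normv b * (l / h).
  apply: (@le_trans _ _ (t * (l / h * normv b))); first by rewrite ler_wpM2l ?(ltW t0)// -al dotv_le.
  rewrite [X in X <= _](_ : _ = t * (normv b * (l / h))); last by ring.
  by rewrite -mulrA ler_wpM2r ?TM// mulr_ge0 ?normv_ge0.
have r5 : t * quadA A a <= C * l ^+ 2.
  apply: (le_trans (hA a)); rewrite al [X in X <= _](_ : _ = C * l ^+ 2)//.
  by field; exact: lt0r_neq0.
rewrite /LR !mulrDr [X in _ <= X](_ : _ = M * normv b * (l / h) + C * l ^+ 2 + k * C); last by rewrite /k; field; exact: lt0r_neq0.
by rewrite lerD// lerD.
Qed.

(** Moments of rate 4 l N / h, with N = d (d + 1), give pointwise decay at rate 4 l / h. All terms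
    of order 1/h in the exponent add up to 4 l r1 / h with r1 independent of l, and [tail_arith]
    absorbs them beyond the radius 2 r1 + 1. *)
Lemma small_jumps_tail : exists rho : R, 1 <= rho /\ forall l : R, 1 <= l -> exists B : R, 0 <= B /\
  forall t h x, T t -> intensity t h C -> rho <= normv x -> UR t h x <= t * B * expR (- (l * normv x)).
Proof.
have [[t' Tt']|nT] := pselect (exists t, T t); last first.
  exists 1; split=> // l _; exists 0; split=> // t h x Tt; exfalso; apply: nT; by exists t.
have M0 : 0 <= M := le_trans (ltW (T0 Tt')) (TM Tt').
pose N := (d * d.+1)%N; have N0 : 0 < N%:R :> R by rewrite ltr0n muln_gt0 d0.
have nb := normv_ge0 b; have Mb := mulr_ge0 M0 nb.
pose r1 := N%:R * (1 + C + M * normv b).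
have cgt0 := C_gt0; have r10 : 0 < r1 by rewrite mulr_gt0//; lra.
exists (2 * r1 + 1); split; first by lra.
move=> l l1; pose q := 4 * l; have q0 : 0 < q by rewrite /q; lra.
pose lN := q * N%:R; have lN0 : 0 < lN by rewrite mulr_gt0.
pose CE := RI leb (fun xi : V => expR (1 - normv xi)).
have CE0 : 0 <= CE by apply: RI_ge0 => xi; exact: expR_ge0.
pose L0 := expR (2 * C) * (CE + C) + 1.
have L00 : 0 < L0 by rewrite ltr_wpDl// mulr_ge0 ?expR_ge0// addr_ge0// ltW.
pose K1 := C * (lN + lN ^+ 2) * expR lN + C * lN ^+ 2.
have Kd0 := Kd_gt0 Hleb.
pose K3 := 1 + 2 * (Kd leb * expR K1) * (d%:R * L0) ^+ d.
have dL0 : 0 <= (d%:R * L0) ^+ d by rewrite exprn_ge0// mulr_ge0// ltW.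
have KK0 : 0 <= 2 * (Kd leb * expR K1) by rewrite mulr_ge0// mulr_ge0 ?expR_ge0// ltW.
have K30 : 0 <= K3 by rewrite addr_ge0// mulr_ge0.
exists (K3 * ((N + 2)`!%:R * C)); split; first by rewrite mulr_ge0// mulr_ge0// ltW.
move=> t h x Tt It hx; case: (It) => /andP[h0 h1] hF _ _ ht; have t0 := T0 Tt.
have hi1 : 1 <= h^-1 by rewrite invf_ge1.
have hi0 : 0 < h^-1 by rewrite invr_gt0.
have H1 : 1 <= h^-1 ^+ d.+1 by rewrite exprn_ege1.
have iF := irF Tt.
have [i1 [i2 [e1 e2]]] := Itg_rhoR Hleb d0 b sA pA Hnu (ltW t0) iF h0.
have [_ eF] := Itg_rhoF Hleb pA Hnu (ltW t0) iF.
have ho : expR (2 * (t * RI leb (fun y => outb h y * nu y))) <= expR (2 * C).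
  by rewrite ler_expR ler_wpM2l// intensity_out.
(* A common bound for height and Lipschitz constant; its power d, from the volume in
   [pointwise_exp_bound], becomes the factor h^-N. *)
pose L := L0 * h^-1 ^+ d.+1.
have L_gt0 : 0 < L by apply: mulr_gt0 => //; exact: lt_le_trans ltr01 H1.
have LC : expR (2 * C) * (CE + C * h^-1 ^+ d.+1) <= L.
  rewrite (_ : L = expR (2 * C) * (CE * h^-1 ^+ d.+1 + C * h^-1 ^+ d.+1) + h^-1 ^+ d.+1); last by rewrite /L /L0; ring.
  apply: (@le_trans _ _ (expR (2 * C) * (CE * h^-1 ^+ d.+1 + C * h^-1 ^+ d.+1))); last first.
    by rewrite lerDl; exact: le_trans ler01 H1.
  by rewrite ler_wpM2l ?expR_ge0// lerD2r ler_peMr.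
have rn0 : 0 <= RI leb (fun xi => rhoF leb A nu t xi * normv xi).
  by apply: RI_ge0 => xi; rewrite mulr_ge0 ?expR_ge0 ?normv_ge0.
have rF0 : 0 <= RI leb (rhoF leb A nu t) by apply: RI_ge0 => xi; exact: expR_ge0.
have Lr : RI leb (rhoR leb A nu t h) <= L.
  apply: (le_trans e1); apply: le_trans LC; apply: ler_pM; rewrite ?expR_ge0//.
  by apply: (le_trans eF); rewrite lerD2l.
have Ln : RI leb (fun xi => rhoR leb A nu t h xi * normv xi) <= L.
  apply: (le_trans e2); apply: le_trans LC; apply: ler_pM; rewrite ?expR_ge0//.
  by apply: (le_trans hF); rewrite lerDr.
have G := good_cutoff Hleb d0 b sA pA Hnu h0 (ltW t0).
pose K2 := lN * (C + M * normv b).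
have qh0 : 0 <= q / h by rewrite divr_ge0// ltW.
have := @pointwise_exp_bound _ _ leb Hleb (UR t h) L (Kd leb * expR (K1 + K2 / h)) (q / h) d0 L_gt0 qh0.
have B0 : 0 <= Kd leb * expR (K1 + K2 / h) := mulr_ge0 (ltW Kd0) (expR_ge0 _).
move=> /(_ B0).
have c1 y : 0 <= UR t h y <= 2 * L.
  have /andP[p1 p2] := UR_le Hleb d0 b sA pA Hnu (ltW t0) iF h0 y.
  by rewrite p1/=; apply: (le_trans p2); apply: (le_trans Lr); rewrite ler_peMl ?(ltW L_gt0)// ler1n.
move=> /(_ c1).
have c2 y z : `|UR t h y - UR t h z| <= L * normv (vsub y z).
  apply: (le_trans (U_lip y z i1 _ (good_th G) i2)); first by move=> xi; exact: expR_ge0.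
  by rewrite ler_wpM2r ?normv_ge0.
move=> /(_ c2).
have c3 a : normv a = q / h * (d * d.+1)%:R -> Itg leb (fun y => expR (dotv a y) * UR t h y) /\
    RI leb (fun y => expR (dotv a y) * UR t h y) <= Kd leb * expR (K1 + K2 / h).
  move=> al; have [_ /(_ a) [j1 ->]] := UR_mgf Hleb d0 b sA pA Hnu (ltW t0) iF h0.
  split=> //; rewrite ler_wpM2l ?(ltW Kd0)// ler_expR; apply: (LR_scaled_le Tt It (ltW lN0)).
  by rewrite al /lN /N mulrAC.
move=> /(_ c3 x) /le_trans; apply.
have hd : (d%:R * L) ^+ d = (d%:R * L0) ^+ d * h^-1 ^+ N by rewrite /L mulrA exprMn -exprM mulnC.
rewrite hd -/N.
have s1 : 1 + 2 * (Kd leb * expR (K1 + K2 / h)) * ((d%:R * L0) ^+ d * h^-1 ^+ N) * expR (q / h * N%:R) <=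
   K3 * (h^-1 ^+ N * expR (q * r1 / h)).
  have qr : q * r1 / h = K2 / h + q / h * N%:R by rewrite /r1 /K2 /lN; field; exact: lt0r_neq0.
  have hN : 1 <= h^-1 ^+ N * (expR (K2 / h) * expR (q / h * N%:R)).
    apply: mulr_ege1; first by rewrite exprn_ege1.
    rewrite -expRD -qr -[X in X <= _]expR0 ler_expR; apply: divr_ge0; last exact: ltW.
    exact: mulr_ge0 (ltW q0) (ltW r10).
  rewrite qr (expRD (K2 / h)) (expRD K1); exact: absorb_one hN.
apply: (le_trans (ler_wpM2r (expR_ge0 _) s1)).
exact: (tail_arith N l1 h0 h1 K30 hx (normv_ge0 x) ht).
Qed.

End small_jumps.

(** * Tail bounds for the full density and for a fixed cutoff *)

Section tails.
Context (R : realType) (d : nat).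
Local Notation V := (d.-tuple R).
Variable leb : {sigma_finite_measure set V -> \bar R}.
Hypothesis Hleb : is_lebesgue leb.
Hypothesis d0 : (0 < d)%N.
Variables (b : V) (A : 'M[R]_d) (nu : V -> R).
Hypothesis sA : A^T = A.
Hypothesis pA : forall x, 0 <= quadA A x.
Hypothesis Hnu : levy_density leb nu.
Variables (T : set R) (M C : R).
Hypothesis T0 : forall t, T t -> 0 < t.
Hypothesis TM : forall t, T t -> t <= M.
Hypothesis C_gt0 : 0 < C.
Hypothesis irF : forall t, T t -> Itg leb (fun xi => rhoF leb A nu t xi * normv xi).
Hypothesis HI : forall t, T t -> exists h, intensity leb A nu t h C.
Variables (f : R -> R) (C0 : R).
Hypothesis f0 : forall r, 0 < r -> 0 < f r.
Hypothesis fd : forall r s, 0 < r -> r <= s -> f s <= f r.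
Hypothesis f_low : exists c : R, exists delta : R, 0 < c /\ 0 < delta /\
     forall r, 0 < r -> r < delta ->
       ((c * f r * r ^+ d)%:E <= \int[leb]_(x in [set x | (r < normv x)%R]) (nu x)%:E)%E.
Hypothesis K0 : Kfun leb f r @[r --> +oo] --> (0%R)%:E.
Hypothesis C00 : 0 < C0.
Hypothesis nuf : forall x, x <> vzero -> nu x <= C0 * f (normv x).

Local Notation UR := (UR leb b A nu).
Local Notation UF := (UF leb b A nu).

Lemma nz_of_normv (x : V) : 0 < normv x -> x <> vzero.
Proof. by move=> h e; rewrite e normv0 ltxx in h. Qed.

Lemma RI_mX_le t h (X : V -> R) : T t -> intensity leb A nu t h C -> measurable_fun setT X ->
  (forall y, 0 <= X y <= 1) -> RI leb (mX_ nu h X t) <= C.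
Proof.
move=> Tt It mX X01; have t0 := T0 Tt; case: (It) => /andP[h0 _] _ _ _ _.
apply: le_trans (intensity_out Hnu T0 Tt It).
have io := Itg_outnu Hnu h0.
rewrite -(RIZ t io); apply: (RI_le (ImX_ Hnu h0 mX X01 t) (ItgZ t io)) => y.
rewrite /mX_ ler_wpM2l ?(ltW t0)// ler_wpM2r ?(nu_ge0 Hnu)// ler_piMr//; by case/andP: (X01 y).
Qed.

Lemma mX_le t h (X : V -> R) y : T t -> (forall y, 0 <= X y <= 1) -> mX_ nu h X t y <= t * nu y.
Proof.
move=> Tt X01; rewrite /mX_ ler_wpM2l ?(ltW (T0 Tt))// ler_piMl ?(nu_ge0 Hnu)//.
by rewrite mulr_ile1//; [case/andP: (X01 y)|case/andP: (outb_le h y)|case/andP: (X01 y)].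
Qed.

Lemma one01 (y : V) : 0 <= (1 : R) <= 1. Proof. by rewrite ler01 lexx. Qed.

Lemma le_or_lt (x y : R) : x <= y \/ y < x. Proof. by have [] := leP x y; [left|right]. Qed.

(** [iterate_series_bound] with g = f, starting from the small-jump density and adding the jumps
    longer than h. Two long legs are controlled by [K], a moderate jump by [f_shift], and a short
    jump landing inside by the singularity bound [f_small], which is where the exponent d + 2 comes
    from. *)
Lemma tail_f : exists rho B : R, [/\ 1 <= rho, 0 <= B &
  forall t x, T t -> rho <= normv x -> UF t x <= t * B * f (normv x)].
Proof.
have [[t' Tt']|nT] := pselect (exists t, T t); last first.
  by exists 1, 0; split=> // t x Tt; exfalso; apply: nT; exists t.
have M0 : 0 <= M := le_trans (ltW (T0 Tt')) (TM Tt').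
have [r0 [r01 hsj]] := small_jumps_tail Hleb d0 b sA pA Hnu T0 TM C_gt0 irF.
have [Cf [L [Cf1 L0 [fsh fexp]]]] := f_shift Hleb d0 f0 fd K0.
have [Cs [Cs0 fs]] := f_small Hnu fd f_low.
have [r1 hr1] := K_eventually_le K0 ltr01.
pose rh := Order.max r0 r1 + 1.
have rhr1 : r1 < rh.
  have : r1 <= Order.max r0 r1 by rewrite le_max lexx orbT.
  rewrite /rh; lra.
have rhr0 : r0 <= rh.
  have : r0 <= Order.max r0 r1 by rewrite le_max lexx.
  rewrite /rh; lra.
have rh1 : 1 <= rh := le_trans r01 rhr0.
clearbody rh; have rhp : 0 < rh by lra.
(* The rate L + 1 is admissible in [small_jumps_tail], and exponential decay of that rate is
   dominated by f. *)
have L11 : 1 <= L + 1 by lra.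
have Cfp : 0 <= Cf := le_trans ler01 Cf1.
have [B [B0 hB]] := hsj (L + 1) L11.
(* A jump shorter than 1 that lands within rh + 1 starts within rh + 2, where f is at least f (rh +
   2). *)
have f2 : 0 < f (rh + 2) by apply: f0; lra.
have cgt := C_gt0; have c0gt := C00.
pose K := 1 + C + (Cf * expR (L * rh) * C + M * C0).
have e1 : 0 <= Cf * expR (L * rh) by rewrite mulr_ge0 ?expR_ge0//; lra.
have e2 : 0 <= M * C0 by rewrite mulr_ge0// ltW.
have e3 := mulr_ge0 e1 (ltW cgt).
have K1 : 1 <= K by rewrite /K; lra.
have KC : C <= K by rewrite /K; lra.
have Ksum : Cf * expR (L * rh) * C + M * C0 <= K by rewrite /K; lra.
clearbody K.
pose Cl := C0 * (Cf * expR (L * (rh + 1)) + Cs / f (rh + 2)).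
have cl1 : 0 <= Cf * expR (L * (rh + 1)) by rewrite mulr_ge0 ?expR_ge0//; lra.
have cl2 : 0 <= Cs / f (rh + 2) by rewrite divr_ge0// ltW.
have Cl0 : 0 <= Cl by rewrite mulr_ge0 ?(ltW C00)// addr_ge0.
have BCf : 0 <= B * Cf by rewrite mulr_ge0//; lra.
pose J : R := 2 * (K * expR 1).
pose EE : R := Cl * Kd leb * ((2 * (d + 2))`!%:R * expR 2).
exists (rh + 1), ((B * Cf + EE) * expR J); split; first by lra.
  have EE0 : 0 <= EE.
    apply: mulr_ge0; first by apply: mulr_ge0 => //; exact: (ltW (Kd_gt0 Hleb)).
    by apply: mulr_ge0; rewrite ?expR_ge0.
  by rewrite mulr_ge0 ?expR_ge0// addr_ge0.
move=> t x Tt hx; have [h It] := HI Tt; have t0 := T0 Tt; case: (It) => /andP[h0 h1] _ _ _ _.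
pose m := mX_ nu h (fun=> 1) t.
have m0 y : 0 <= m y := mX_ge0 Hnu h one01 y (ltW t0).
have im : Itg leb m := ImX_ Hnu h0 (measurable_cst _) one01 t.
have mle y : m y <= t * nu y := mX_le h y Tt one01.
have mC : RI leb m <= C := RI_mX_le Tt It (measurable_cst _) one01.
have S := @UF_series R d leb Hleb d0 b A nu sA pA Hnu t (ltW t0) (irF Tt) h h0 x.
rewrite -/m in S; clearbody m; clear hsj.
have g0 (y : V) : rh < normv y -> 0 <= f (normv y) by move=> hy; exact: ltW (f0 (lt_trans rhp hy)).
have H0 y : rh < normv y -> UR t h y <= t * (B * Cf) * f (normv y).
  move=> hy; have y0 : r0 <= normv y := le_trans rhr0 (ltW hy).
  apply: (le_trans (hB t h y Tt It y0)); rewrite -!mulrA !ler_wpM2l ?(ltW t0)//.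
  apply: le_trans (fexp _ (le_trans rh1 (ltW hy))).
  by rewrite ler_expR lerN2 mulrDl mul1r lerDl normv_ge0.
have HL y z (dl : R) : rh < normv y -> 0 < dl -> dl <= 1 -> dl <= normv z ->
  normv (vsub y z) <= rh + 1 -> m z <= t * Cl * dl^-1 ^+ (d + 2) * f (normv y).
  move=> hy dl0 dl1 hz hyz; have z0 : 0 < normv z := lt_le_trans dl0 hz.
  have fy : 0 < f (normv y) := f0 (lt_trans rhp hy).
  have fz : 0 < f (normv z) := f0 z0.
  have D1 : 1 <= dl^-1 ^+ (d + 2) by rewrite exprn_ege1// invf_ge1.
  have ynz : y <> vzero := nz_of_normv (lt_trans rhp hy).
  apply: (le_trans (mle z)); rewrite -!mulrA ler_wpM2l ?(ltW t0)//.
  apply: (le_trans (nuf (nz_of_normv z0))); rewrite ler_wpM2l ?(ltW C00)//.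
  have DF : f (normv y) <= dl^-1 ^+ (d + 2) * f (normv y) by rewrite ler_peMl// ltW.
  have DF0 : 0 <= dl^-1 ^+ (d + 2) * f (normv y) by apply: le_trans DF; exact: ltW.
  case: (le_or_lt 1 (normv z)) => z1.
    have k : f (normv z) <= Cf * expR (L * normv (vsub y z)) * f (normv y).
      by have := fsh y (vsub y z) ynz; rewrite vsub_vsub; apply.
    apply: (le_trans k); apply: (@le_trans _ _ (Cf * expR (L * (rh + 1)) * f (normv y))).
      apply: (ler_wpM2r (ltW fy)); apply: (ler_wpM2l Cfp).
      by rewrite ler_expR; apply: (ler_wpM2l L0).
    apply: ler_pM => //; [exact: ltW|by rewrite lerDl].
  have k : f (normv z) <= Cs * dl^-1 ^+ (d + 2) := le_trans (fd dl0 hz) (fs _ dl0 dl1).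
  have nyz : normv y <= rh + 2.
    by have := normvB_ge y z; lra.
  have fyy : 1 <= f (normv y) / f (rh + 2).
    by rewrite (ler_pdivlMr _ _ f2) mul1r; exact: fd (lt_trans rhp hy) nyz.
  apply: (@le_trans _ _ (Cs / f (rh + 2) * (dl^-1 ^+ (d + 2) * f (normv y)))); last first.
    by rewrite ler_wpM2r// lerDr.
  apply: (le_trans k); rewrite [X in _ <= X](_ : _ = Cs * dl^-1 ^+ (d + 2) * (f (normv y) / f (rh + 2))); last by ring.
  by apply: (ler_peMr _ fyy); apply: (mulr_ge0 (ltW Cs0)); exact: le_trans ler01 D1.
clear hB; have mm := Itg_meas im.
have mo := @moutb R d rh; have mf := @mfn R d f fd.
have HK y : rh < normv y ->
  Itg leb (fun z => m z * (outb rh (vsub y z) * f (normv (vsub y z)))) /\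
  RI leb (fun z => m z * (outb rh (vsub y z) * f (normv (vsub y z)))) <= K * f (normv y).
  move=> hy; have y1 : 1 < normv y := le_lt_trans rh1 hy.
  have fy : 0 < f (normv y) := f0 (lt_trans rhp hy).
  have ynz : y <> vzero := nz_of_normv (lt_trans rhp hy).
  have [iK bK] := Kfun_real f0 fd rhp (hr1 _ rhr1) y1; rewrite mul1r in bK.
  have myz : measurable_fun setT (fun z : V => vsub y z) by mfun.
  have mf2 := mf_comp2 mf myz; have mo2 := mf_comp2 mo myz.
  pose c1 := Cf * expR (L * rh) * f (normv y).
  have c10 : 0 <= c1 by rewrite mulr_ge0// ltW.
  have oz z : 0 <= outb rh (vsub y z) * f (normv (vsub y z)).
    rewrite /outb; case: (boolP (rh < normv (vsub y z))) => hz; last by rewrite mul0r lexx.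
    by rewrite mul1r; exact: g0.
  (* Jumps up to rh shift the argument of f at bounded cost; longer ones have density at most t C0 f
     and leave the convolution of f with itself. *)
  have pw z : m z * (outb rh (vsub y z) * f (normv (vsub y z))) <=
     c1 * m z + t * C0 * (outb rh (vsub y z) * outb rh z * (f (normv (vsub y z)) * f (normv z))).
    case: (le_or_lt (normv z) rh) => hz.
      have -> : outb rh z = 0 by rewrite /outb ltNge hz.
      rewrite mulr0 mul0r mulr0 addr0 mulrC ler_wpM2r//.
      rewrite /outb; case: (boolP (rh < normv (vsub y z))) => hyz; last by rewrite mul0r; exact: c10.
      rewrite mul1r; have yz1 : 1 <= normv (vsub y z) := le_trans rh1 (ltW hyz).
      apply: (le_trans (fsh y z ynz yz1)); apply: (ler_wpM2r (ltW fy)); apply: (ler_wpM2l Cfp).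
      by rewrite ler_expR; apply: (ler_wpM2l L0).
    have -> : outb rh z = 1 by rewrite /outb hz.
    rewrite mulr1.
    have zn : z <> vzero := nz_of_normv (lt_trans rhp hz).
    have fz : 0 < f (normv z) := f0 (lt_trans rhp hz).
    apply: (@le_trans _ _ (t * C0 * (outb rh (vsub y z) * (f (normv (vsub y z)) * f (normv z))))); last first.
      by rewrite lerDr mulr_ge0.
    rewrite [X in _ <= X](_ : _ = t * (C0 * f (normv z)) * (outb rh (vsub y z) * f (normv (vsub y z)))); last by ring.
    rewrite ler_wpM2r//; apply: (le_trans (mle z)); rewrite ler_wpM2l ?(ltW t0)//; exact: nuf.
  have is_ := ItgD (ItgZ c1 im) (ItgZ (t * C0) iK).
  have i1 : Itg leb (fun z => m z * (outb rh (vsub y z) * f (normv (vsub y z)))).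
    apply: Itg_dom is_; first by mfun.
    by move=> z; rewrite ger0_norm ?pw// mulr_ge0.
  split=> //; apply: (le_trans (RI_le i1 is_ pw)).
  rewrite (RID (ItgZ c1 im) (ItgZ (t * C0) iK)) (RIZ c1 im) (RIZ (t * C0) iK).
  apply: (@le_trans _ _ (c1 * C + M * C0 * f (normv y))).
    apply: lerD; first by rewrite ler_wpM2l.
    apply: ler_pM => //; [by rewrite mulr_ge0 ?(ltW t0)// ltW|apply: RI_ge0 => z| ].
      case: (le_or_lt (normv z) rh) => hz.
        have -> : outb rh z = 0 by rewrite /outb ltNge hz.
        by rewrite mulr0 mul0r.
      have -> : outb rh z = 1 by rewrite /outb hz.
      by rewrite mulr1 mulrA mulr_ge0// g0.
    by rewrite ler_wpM2r ?(ltW C00)// TM.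
  rewrite /c1 [X in X <= _](_ : _ = (Cf * expR (L * rh) * C + M * C0) * f (normv y)); last by ring.
  by rewrite ler_wpM2r// ltW.
have [iu eu] := UR_mass Hleb d0 b sA pA Hnu (ltW t0) (irF Tt) h0.
have u0 := UR_le Hleb d0 b sA pA Hnu (ltW t0) (irF Tt) h0.
have mn0 : 0 <= RI leb m := RI_ge0 leb m0.
have uQ : RI leb (UR t h) <= Kd leb by rewrite eu.
have := iterate_series_bound (g := fun y => f (normv y)) Hleb m0 im u0 iu (ltW t0) BCf Cl0 K1 (le_trans mC KC) uQ g0 H0 HK HL hx S.
have [UF0 _] := UF_mass Hleb d0 b sA pA Hnu (ltW t0) (irF Tt) ltr01.
apply: le_trans; rewrite ler_peMl ?UF0// -[X in X <= _]expR0 ler_expR//.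
Qed.

(** Same scheme with the profile exp(-l |x|): jumps are bounded by s, so one of them changes the
    profile by at most the factor exp(l s). *)
Lemma tail_exp (s l : R) : 1 <= s -> 1 <= l -> exists rho B : R, [/\ 1 <= rho, 0 <= B &
  forall t x, T t -> rho <= normv x -> UR t s x <= t * B * expR (- (l * normv x))].
Proof.
move=> s1 l1.
have [r0 [r01 hsj]] := small_jumps_tail Hleb d0 b sA pA Hnu T0 TM C_gt0 irF.
have [Cs [Cs0 fs]] := f_small Hnu fd f_low.
have [B [B0 hB]] := hsj l l1.
have cgt := C_gt0; have l0 : 0 <= l by lra.
pose K := 1 + C + expR (l * s) * C.
have e3 : 0 <= expR (l * s) * C by rewrite mulr_ge0 ?expR_ge0// ltW.
have K1 : 1 <= K by rewrite /K; lra.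
have KC : C <= K by rewrite /K; lra.
have Ksum : expR (l * s) * C <= K by rewrite /K; lra.
clearbody K.
pose Cl := C0 * Cs * expR (l * (r0 + 1 + s)).
have Cl0 : 0 <= Cl by rewrite !mulr_ge0 ?expR_ge0 ?(ltW C00) ?(ltW Cs0).
pose J : R := 2 * (K * expR 1).
pose EE : R := Cl * Kd leb * ((2 * (d + 2))`!%:R * expR 2).
exists (r0 + 1), ((B + EE) * expR J); split; first by lra.
  have EE0 : 0 <= EE.
    apply: mulr_ge0; first by apply: mulr_ge0 => //; exact: (ltW (Kd_gt0 Hleb)).
    by apply: mulr_ge0; rewrite ?expR_ge0.
  by rewrite mulr_ge0 ?expR_ge0// addr_ge0.
move=> t x Tt hx; have [h It] := HI Tt; have t0 := T0 Tt; case: (It) => /andP[h0 h1] _ _ _ _.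
have hs : h <= s := le_trans h1 s1.
pose m := mX_ nu h (inb s) t.
have m0 y : 0 <= m y := mX_ge0 Hnu h (inb_le s) y (ltW t0).
have im : Itg leb m := ImX_ Hnu h0 (minb s) (inb_le s) t.
have mle y : m y <= t * nu y := mX_le h y Tt (inb_le s).
have mz y : s < normv y -> m y = 0 by move=> hy; rewrite /m /mX_ /inb leNgt hy /= mulr0 mul0r mulr0.
pose g (y : V) := expR (- (l * normv y)).
have g0 y : r0 < normv y -> 0 <= g y by move=> _; exact: expR_ge0.
have H0 y : r0 < normv y -> UR t h y <= t * B * g y by move=> hy; apply: hB => //; exact: ltW.
have HL y z (dl : R) : r0 < normv y -> 0 < dl -> dl <= 1 -> dl <= normv z ->
  normv (vsub y z) <= r0 + 1 -> m z <= t * Cl * dl^-1 ^+ (d + 2) * g y.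
  move=> hy dl0 dl1 hz hyz; have z0 : 0 < normv z := lt_le_trans dl0 hz.
  have D0 : 0 <= dl^-1 ^+ (d + 2) by rewrite exprn_ge0// invr_ge0 ltW.
  have [zs|zs] := leP (normv z) s; last by rewrite (mz _ zs) !mulr_ge0 ?expR_ge0// ltW.
  apply: (le_trans (mle z)); rewrite -!mulrA ler_wpM2l ?(ltW t0)//.
  apply: (le_trans (nuf (nz_of_normv z0))); rewrite ler_wpM2l ?(ltW C00)//.
  apply: (le_trans (le_trans (fd dl0 hz) (fs _ dl0 dl1))); rewrite ler_wpM2l ?(ltW Cs0)//.
  rewrite mulrCA ler_peMr// /g -expRD -[X in X <= _]expR0 ler_expR.
  have k : normv y <= r0 + 1 + s by have := normvB_ge y z; lra.
  by have := ler_wpM2l l0 k; lra.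
have mm := Itg_meas im; have mo := @moutb R d r0.
have HK y : r0 < normv y ->
  Itg leb (fun z => m z * (outb r0 (vsub y z) * g (vsub y z))) /\
  RI leb (fun z => m z * (outb r0 (vsub y z) * g (vsub y z))) <= K * g y.
  move=> hy.
  have myz : measurable_fun setT (fun z : V => vsub y z) by mfun.
  have mo2 := mf_comp2 mo myz.
  have pw z : `|m z * (outb r0 (vsub y z) * g (vsub y z))| <= expR (l * s) * g y * m z.
    have /andP[w0 w1] := outb_le r0 (vsub y z).
    rewrite ger0_norm; last by apply: mulr_ge0 => //; apply: mulr_ge0 => //; exact: expR_ge0.
    rewrite [X in X <= _]mulrC.
    have [hz|hz] := leP (normv z) s; last by rewrite (mz _ hz) !mulr0.
    rewrite ler_wpM2r//; apply: (@le_trans _ _ (g (vsub y z))); first by rewrite ler_piMl ?expR_ge0.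
    rewrite /g -expRD ler_expR.
    have k : normv y - s <= normv (vsub y z) by have := normvB_ge y z; lra.
    by have := ler_wpM2l l0 k; rewrite mulrBr; lra.
  have iZ := ItgZ (expR (l * s) * g y) im.
  split; first by apply: (Itg_dom _ pw iZ); rewrite /g; mfun.
  apply: (le_trans (ler_norm _)); apply: (@le_trans _ _ (RI leb (fun z => expR (l * s) * g y * m z))).
    by apply: (RI_abs_le _ pw iZ); rewrite /g; mfun.
  have mC : RI leb m <= C := RI_mX_le Tt It (minb s) (inb_le s).
  rewrite (RIZ _ im) mulrAC ler_wpM2r ?expR_ge0//; apply: le_trans Ksum.
  by rewrite ler_wpM2l ?expR_ge0.
have [iu eu] := UR_mass Hleb d0 b sA pA Hnu (ltW t0) (irF Tt) h0.
have u0 := UR_le Hleb d0 b sA pA Hnu (ltW t0) (irF Tt) h0.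
have mC : RI leb m <= C := RI_mX_le Tt It (minb s) (inb_le s).
have mn0 : 0 <= RI leb m := RI_ge0 leb m0.
have S := @UR_series R d leb Hleb d0 b A nu sA pA Hnu t (ltW t0) (irF Tt) h h0 s x hs.
have uQ : RI leb (UR t h) <= Kd leb by rewrite eu.
have := iterate_series_bound Hleb m0 im u0 iu (ltW t0) B0 Cl0 K1 (le_trans mC KC) uQ g0 H0 HK HL hx S.
apply: le_trans; rewrite ler_peMl//; last by rewrite -[X in X <= _]expR0 ler_expR.
by apply: (UR_ge0 Hleb d0 b sA pA Hnu (ltW t0) (irF Tt)); lra.
Qed.

End tails.

(** * Separating zero, one and several large jumps *)

Section series_remainder.
Context (R : realType) (d : nat).
Local Notation V := (d.-tuple R).
Variable leb : {sigma_finite_measure set V -> \bar R}.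
Hypothesis Hleb : is_lebesgue leb.
Variables (m u l : V -> R) (D : R).
Hypothesis m0 : forall y, 0 <= m y.
Hypothesis im : Itg leb m.
Hypothesis u0 : forall x, 0 <= u x <= D.
Hypothesis iu : Itg leb u.
Hypothesis hl : forall x, \sum_(n < N) iter n (vconv leb m) u x / n`!%:R @[N --> \oo] --> l x.

Local Notation q n := (iter n (vconv leb m) u).

Lemma series_ge_partial N x : \sum_(n < N) q n x / n`!%:R <= l x.
Proof.
apply: (@cvg_ge _ (fun K => \sum_(n < (K + N)%N) q n x / n`!%:R)).
  have := @hl x; rewrite -(cvg_shiftn N); exact.
move=> K; rewrite -(big_mkord xpredT (fun n => q n x / n`!%:R)) -(big_mkord xpredT (fun n => q n x / n`!%:R)).
rewrite [X in _ <= X](@big_cat_nat _ _ _ N)//=; last exact: leq_addl.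
by rewrite lerDl sumr_ge0// => n _; rewrite mulr_ge0 ?invr_ge0//; exact: iter_vconv_ge0 u0 iu n x.
Qed.

Lemma series_le x : 0 <= l x <= expR (RI leb m) * D.
Proof.
have D0 : 0 <= D by case/andP: (u0 vzero); exact: le_trans.
have M0 : 0 <= RI leb m by exact: RI_ge0.
apply/andP; split; first by have := series_ge_partial 0 x; rewrite big_ord0.
apply: (cvg_le (@hl x)) => N; apply: (@le_trans _ _ ((\sum_(n < N) RI leb m ^+ n / n`!%:R) * D)).
  rewrite mulr_suml; apply: ler_sum => n _; rewrite mulrAC ler_wpM2r ?invr_ge0//.
  by have [h _ _] := iter_vconv_mass Hleb m0 im u0 iu n; case/andP: (h x).
by rewrite ler_wpM2r// sum_pow_fact_le.
Qed.

(** The term with n + 2 jumps is m convolved with the term with n + 1 jumps, up to 1/(n+2)! against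
    1/(n+1)!. Giving up this difference bounds everything from two jumps on by m convolved with l -
    u. *)
Lemma series_remainder x :
  Itg leb (fun z => m z * (l (vsub x z) - u (vsub x z))) /\
  0 <= l x - u x - vconv leb m u x <= RI leb (fun z => m z * (l (vsub x z) - u (vsub x z))).
Proof.
have [il el] := vconv_series_mass Hleb m0 im u0 iu hl.
have ml := Itg_meas il; have mu := Itg_meas iu; have mm := Itg_meas im.
have mxz : measurable_fun setT (fun z : V => vsub x z) by mfun.
have ml2 := mf_comp2 ml mxz; have mu2 := mf_comp2 mu mxz.
have q00 y : u y <= l y.
  by have := series_ge_partial 1 y; rewrite big_ord1 /= divr1.
have q01 y : u y + vconv leb m u y <= l y.
  by have := series_ge_partial 2 y; rewrite !big_ord_recl big_ord0 /= !divr1 addr0.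
have iM : Itg leb (fun z => m z * (l (vsub x z) - u (vsub x z))).
  apply: (@Itg_dom _ _ _ _ _ (fun z => expR (RI leb m) * D * m z)); [by mfun| |exact: ItgZ].
  move=> z; rewrite normrM (ger0_norm (m0 z)) mulrC ler_wpM2r//.
  rewrite ger0_norm ?subr_ge0//; have /andP[_ h] := series_le (vsub x z).
  by apply: le_trans h; rewrite gerBl; case/andP: (u0 (vsub x z)).
split=> //; apply/andP; split; first by have := q01 x; lra.
rewrite lerBlDr lerBlDr; apply: (@cvg_le _ (fun K => \sum_(n < (K + 2)%N) q n x / n`!%:R)).
  have := @hl x; rewrite -(cvg_shiftn 2); exact.
move=> K; rewrite addn2 !big_ord_recl /= !divr1 addrA.
rewrite [X in X <= _]addrC -addrA [vconv leb m u x + u x]addrC lerD2r.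
have ir n : Itg leb (fun z => m z * q n (vsub x z)).
  have [h1 h2 _] := iter_vconv_mass Hleb m0 im u0 iu n.
  have mq := mf_comp2 (Itg_meas h2) mxz.
  apply: (@Itg_dom _ _ _ _ _ (fun z => RI leb m ^+ n * D * m z)); [by mfun| |exact: ItgZ].
  move=> z; rewrite normrM (ger0_norm (m0 z)) mulrC ler_wpM2r//.
  by case/andP: (h1 (vsub x z)) => k1 k2; rewrite ger0_norm.
have f0 n : 0 <= (n`!%:R : R)^-1 by rewrite invr_ge0.
have S k : Itg leb (fun z => m z * \sum_(n < k) q n.+1 (vsub x z) / n.+1`!%:R) /\
   RI leb (fun z => m z * \sum_(n < k) q n.+1 (vsub x z) / n.+1`!%:R) = \sum_(n < k) q n.+2 x / n.+1`!%:R.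
  elim: k => [|k [I1 E1]].
    split; first by apply: (Itg_ext (u := fun=> 0)) => [z|]; [rewrite big_ord0 mulr0|exact: Itg0].
    by rewrite big_ord0 (RI_ext leb (v := fun=> 0)) ?RI0// => z; rewrite big_ord0 mulr0.
  have e z : m z * \sum_(n < k) q n.+1 (vsub x z) / n.+1`!%:R + (k.+1`!%:R)^-1 * (m z * q k.+1 (vsub x z)) =
     m z * \sum_(n < k.+1) q n.+1 (vsub x z) / n.+1`!%:R.
    by rewrite [in RHS]big_ord_recr /=; ring.
  have iz := ItgZ (k.+1`!%:R)^-1 (ir k.+1).
  split; first by apply: (Itg_ext e); exact: ItgD.
  by rewrite -(RI_ext leb e) (RID I1 iz) (RIZ _ (ir k.+1)) E1 big_ord_recr /= [_^-1 * _]mulrC.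
have [I1 E1] := S K.
apply: (@le_trans _ _ (\sum_(n < K) q n.+2 x / n.+1`!%:R)).
  apply: ler_sum => n _; rewrite /bump /= !add1n ler_wpM2l//.
    exact: (iter_vconv_ge0 Hleb m0 im u0 iu n.+2 x).
  rewrite lef_pV2 ?posrE ?ltr0n ?fact_gt0// ler_nat.
  by rewrite [X in (_ <= X)%N]factS leq_pmull.
rewrite -E1; apply: (RI_le I1 iM) => z; rewrite ler_wpM2l// lerBrDl.
have := series_ge_partial K.+1 (vsub x z); rewrite big_ord_recl /= divr1.
by under eq_bigr do rewrite /bump /= add1n.
Qed.

Lemma series_remainder_refl x :
  [/\ forall w, 0 <= l w - u w, Itg leb (fun w => l w - u w),
      RI leb (fun w => l w - u w) = RI leb u * (expR (RI leb m) - 1),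
      Itg leb (fun w => m (vsub x w) * (l w - u w)) &
      0 <= l x - u x - vconv leb m u x <= RI leb (fun w => m (vsub x w) * (l w - u w))].
Proof.
have [il el] := vconv_series_mass Hleb m0 im u0 iu hl.
have [j1 j2] := series_remainder x.
have e : RI leb (fun w => m (vsub x w) * (l w - u w)) = RI leb (fun z => m z * (l (vsub x z) - u (vsub x z))).
  by rewrite -(RI_refl Hleb x j1); apply: RI_ext => w; rewrite vsub_vsub.
split.
- by move=> w; rewrite subr_ge0; have := series_ge_partial 1 w; rewrite big_ord1 /= divr1.
- exact: ItgB.
- by rewrite (RIB il iu) el; ring.
- by apply: (Itg_ext _ (Itg_refl Hleb x j1)) => w; rewrite vsub_vsub.
- by rewrite e.
Qed.

End series_remainder.

(** * Exponential moments of nu at kappa theta *)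

Section tilt.
Context (R : realType) (d : nat).
Local Notation V := (d.-tuple R).
Variable leb : {sigma_finite_measure set V -> \bar R}.
Variables (b : V) (A : 'M[R]_d) (nu : V -> R).
Hypothesis Hnu : levy_density leb nu.
Variables (f : R -> R) (C0 C1 kappa : R) (E : set V).
Hypothesis f0 : forall r, 0 < r -> 0 < f r.
Hypothesis fd : forall r s, 0 < r -> r <= s -> f s <= f r.
Hypothesis K0 : Kfun leb f r @[r --> +oo] --> (0%R)%:E.
Hypothesis C00 : 0 < C0.
Hypothesis nuf : forall x, x <> vzero -> nu x <= C0 * f (normv x).
Hypothesis E1 : forall theta, E theta -> normv theta = 1.
Hypothesis k0 : 0 <= kappa.
Hypothesis Hratio : forall theta y, E theta ->
     nu (vsub (vscale r theta) y) / nu (vscale r theta) @[r --> +oo] --> expR (kappa * dotv theta y).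
Hypothesis C10 : 0 < C1.
Hypothesis nuE : forall x, x <> vzero -> E (vscale (normv x)^-1 x) -> C1 * f (normv x) <= nu x.

Definition nuratio (r : R) (theta z : V) : R := nu (vsub (vscale r theta) z) / nu (vscale r theta).

Lemma normv_ray (r : R) theta : 0 <= r -> E theta -> normv (vscale r theta) = r.
Proof. by move=> r0 /E1 e; rewrite normvZ e mulr1 ger0_norm. Qed.

Lemma nu_ray (r : R) theta : 0 < r -> E theta -> C1 * f r <= nu (vscale r theta).
Proof.
move=> r0 Et; have n := normv_ray (ltW r0) Et; rewrite -{1}n; apply: nuE.
  by apply: nz_of_normv; rewrite n.
rewrite n (_ : vscale r^-1 (vscale r theta) = theta)//.
by apply: eq_from_tnth => i; rewrite !tnthE mulKf// lt0r_neq0.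
Qed.

Lemma nu_ray_gt0 (r : R) theta : 0 < r -> E theta -> 0 < nu (vscale r theta).
Proof. by move=> r0 Et; apply: lt_le_trans (nu_ray r0 Et); rewrite mulr_gt0// f0. Qed.

Lemma nuratio_ge0 (r : R) theta z : 0 <= nuratio r theta z.
Proof. by rewrite divr_ge0 ?(nu_ge0 Hnu). Qed.

Lemma mnuratio (r : R) theta (g : V -> V) : measurable_fun setT g -> measurable_fun setT (fun w => nuratio r theta (g w)).
Proof.
move=> mg; have mn := mnu Hnu; rewrite /nuratio; apply: mf_mul; last exact: mf_cst.
by apply: (mf_comp2 mn); mfun.
Qed.

(** Fatou along the ray. The integral defining [K] at n theta, divided by f(n), dominates up to C0 /
    C1 the integral of f(|w|) nu(n theta - w) / nu(n theta), and this ratio tends to exp(kappa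
    theta.w). Thus the ratio limit in (C) and the bound on [K] already force the exponential moment,
    and it inherits the smallness of [K]. *)
Lemma profile_tilt (theta : V) (r k : R) : E theta -> 0 < r -> (Kfun leb f r <= k%:E)%E ->
  Itg leb (fun w => outb r w * (f (normv w) * expR (kappa * dotv theta w))) /\
  RI leb (fun w => outb r w * (f (normv w) * expR (kappa * dotv theta w))) <= C0 / C1 * k.
Proof.
(* The shift by 2 keeps |x n| > 1, the range of the supremum in [Kfun]. *)
move=> Et r0 Kk; pose x n := vscale n.+2%:R theta.
have nx n : normv (x n) = n.+2%:R by apply: normv_ray.
have mf := @mfn R d f fd; have mo := @moutb R d r.
pose g n (w : V) := outb r (vsub (x n) w) * outb r w * (f (normv (vsub (x n) w)) * f (normv w)).
pose u n (w : V) := outb r (vsub (x n) w) * (outb r w * (nuratio n.+2%:R theta w * f (normv w))).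
have fg (y : V) : r < normv y -> 0 < f (normv y) by move=> h; apply: f0; exact: lt_trans h.
have u0 n w : 0 <= u n w.
  rewrite /u /outb; case: (ltP r (normv (vsub (x n) w))) => h; last by rewrite mul0r.
  case: (ltP r (normv w)) => h'; last by rewrite mul0r mulr0.
  by rewrite !mul1r mulr_ge0 ?nuratio_ge0// ltW// fg.
have ug n w : u n w <= C0 / C1 / f n.+2%:R * g n w.
  rewrite /u /g /outb; case: (ltP r (normv (vsub (x n) w))) => h; last by rewrite !mul0r mulr0.
  case: (ltP r (normv w)) => h'; last by rewrite !mul0r !mulr0 ?mul0r ?mulr0.
  rewrite !mul1r mulrA ler_wpM2r ?(ltW (fg _ h'))// /nuratio -/(x n).
  have fn : 0 < f n.+2%:R by apply: f0.
  have h1 : nu (vsub (x n) w) <= C0 * f (normv (vsub (x n) w)) by apply: nuf; apply: nz_of_normv; exact: lt_trans h.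
  have h2 : C1 * f n.+2%:R <= nu (x n) by apply: nu_ray.
  have p2 : 0 < C1 * f n.+2%:R by rewrite mulr_gt0.
  rewrite ler_pdivrMr; last exact: lt_le_trans h2.
  apply: (le_trans h1); rewrite [X in _ <= X](_ : _ = C0 * f (normv (vsub (x n) w)) * (nu (x n) / (C1 * f n.+2%:R))); last first.
    by field; rewrite ?lt0r_neq0.
  rewrite ler_peMr//; first by rewrite mulr_ge0 ?(ltW C00)// ltW// fg.
  by rewrite ler_pdivlMr// mul1r.
have B n : Itg leb (g n) /\ RI leb (g n) <= k * f n.+2%:R.
  have x1 : 1 < normv (x n) by rewrite nx ltr1n.
  by have := Kfun_real f0 fd r0 Kk x1; rewrite nx.
have mu n : measurable_fun setT (u n).
  have mxw : measurable_fun setT (fun w : V => vsub (x n) w) by mfun.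
  have mo2 := mf_comp2 mo mxw; have mr := @mnuratio n.+2%:R theta id (@measurable_id _ _ setT).
  by apply: mf_mul => //; apply: mf_mul => //; exact: mf_mul.
have iu n : Itg leb (u n).
  apply: Itg_dom (ItgZ (C0 / C1 / f n.+2%:R) (proj1 (B n))) => //.
  by move=> w; rewrite ger0_norm.
apply: (@RI_fatou _ _ _ _ u) => //.
- move=> n; have [i1 b1] := B n; have fn : 0 < f n.+2%:R by apply: f0.
  have c : 0 <= C0 / C1 / f n.+2%:R by rewrite !divr_ge0// ltW.
  apply: (le_trans (RI_le (iu n) (ItgZ _ i1) (ug n))); rewrite (RIZ _ i1).
  apply: (le_trans (ler_wpM2l c b1)); rewrite le_eqVlt; apply/orP; left; apply/eqP.
  by field; rewrite ?lt0r_neq0.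
- move=> w; have -> : outb r w * (f (normv w) * expR (kappa * dotv theta w)) =
     1 * (outb r w * (expR (kappa * dotv theta w) * f (normv w))) by rewrite mul1r [_ * f _]mulrC.
  apply: cvgM.
    apply: (@cvg_near_cst _ _ _ _ _ _).
    exists (Num.truncn (r + normv w)).+1 => // n /= hn.
    have s0 : 0 <= r + normv w by rewrite addr_ge0 ?normv_ge0// ltW.
    have /andP[_ h2] := truncn_itv s0.
    have h3 : (Num.truncn (r + normv w)).+1%:R <= n.+2%:R :> R by rewrite ler_nat (leq_trans hn)// leqW.
    have h4 := normvB_ge (x n) w; rewrite nx in h4.
    by rewrite /outb (_ : r < normv (vsub (x n) w))//; lra.
  apply: cvgM; first exact: cvg_cst.
  apply: cvgM; last exact: cvg_cst.
  have /cvg_pinftyP/(_ (fun n => n.+2%:R)) := @Hratio theta w Et; apply.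
  have := @cvgr_idn R; rewrite -(cvg_shiftn 2) => h; apply: cvg_trans h; apply: near_eq_cvg.
  by apply: nearW => n /=; rewrite addn2.
Qed.

Lemma levy_tilt (theta : V) (r k : R) : E theta -> 0 < r -> (Kfun leb f r <= k%:E)%E ->
  Itg leb (fun w => outb r w * expR (kappa * dotv theta w) * nu w) /\
  RI leb (fun w => outb r w * expR (kappa * dotv theta w) * nu w) <= C0 * (C0 / C1 * k).
Proof.
move=> Et r0 Kk; have [i1 b1] := profile_tilt Et r0 Kk; have mn := mnu Hnu; have mo := @moutb R d r.
have le w : outb r w * expR (kappa * dotv theta w) * nu w <= C0 * (outb r w * (f (normv w) * expR (kappa * dotv theta w))).
  rewrite /outb; case: (ltP r (normv w)) => h; last by rewrite !mul0r mulr0.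
  rewrite !mul1r mulrA mulrC ler_wpM2r ?expR_ge0//; apply: nuf; apply: nz_of_normv; exact: lt_trans h.
have i2 : Itg leb (fun w => outb r w * expR (kappa * dotv theta w) * nu w).
  apply: Itg_dom (ItgZ C0 i1); first by mfun.
  by move=> w; rewrite ger0_norm// !mulr_ge0 ?expR_ge0 ?(nu_ge0 Hnu).
split=> //; apply: (le_trans (RI_le i2 (ItgZ C0 i1) le)).
by rewrite (RIZ C0 i1) ler_wpM2l// ltW.
Qed.

Lemma Itg_levy_tilt (theta : V) (r : R) : E theta -> 0 < r ->
  Itg leb (fun w => outb r w * expR (kappa * dotv theta w) * nu w).
Proof.
move=> Et r0; have mn := mnu Hnu; have mo := @moutb R d r.
have [r1 h1] := K_eventually_le K0 ltr01.
pose s := Order.max r1 r + 1.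
have sr1 : r1 < s by have : r1 <= Order.max r1 r by [rewrite le_max lexx]; rewrite /s; lra.
have sr : r < s by have : r <= Order.max r1 r by [rewrite le_max lexx orbT]; rewrite /s; lra.
have s0 : 0 < s := lt_trans r0 sr.
have [i1 _] := levy_tilt Et s0 (h1 _ sr1).
have ms := @minb R d s; have mos := @moutb R d s.
have i2 := @Itg_out _ _ leb nu Hnu r (fun w => inb s w * expR (kappa * dotv theta w)) (expR (kappa * s)) r0 ltac:(mfun).
have {}i2 : Itg leb (fun y => outb r y * (inb s y * expR (kappa * dotv theta y)) * nu y).
  apply: i2 => w; rewrite /inb; have [h|h] := leP (normv w) s; last by rewrite mul0r normr0 expR_ge0.
  rewrite mul1r ger0_norm ?expR_ge0// ler_expR ler_wpM2l// (le_trans (dotv_le _ _))//.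
  by rewrite (E1 Et) mul1r.
apply: (Itg_ext _ (ItgD i2 i1)) => w; rewrite /inb /outb.
have [h|h] := leP (normv w) s; first by rewrite mul1r mul0r mul0r addr0.
by rewrite (lt_trans sr h) mul0r mulr0 mul0r add0r.
Qed.

(** Matches the product of the two factors met in the limit: the moment of the cutoff density and
    the probability of no jump beyond s. The tilted mass beyond s is the error between them and the
    true exponent. *)
Lemma psitilde_split (theta : V) (s : R) : E theta -> 0 < s ->
  - psitilde leb b A nu (vscale kappa theta) =
  LR leb b A nu s (vscale kappa theta) - RI leb (fun w => outb s w * nu w) +
  RI leb (fun w => outb s w * expR (kappa * dotv theta w) * nu w).
Proof.
move=> Et s0; set a := vscale kappa theta; have mb := @minb R d s.
have aE w : kappa * dotv theta w = dotv a w by rewrite dotvZl.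
have i1 : Itg leb (fun y => (inb s y * (expR (dotv a y) - 1) - dotv a y * indB1 y) * nu y).
  by apply: (proj1 (Itg_levy Hnu _ (exp_dom s0 a))); mfun.
have i2 := Itg_outnu Hnu s0; have i3 := Itg_levy_tilt Et s0.
have i23 := ItgB i3 i2.
have e y : (inb s y * (expR (dotv a y) - 1) - dotv a y * indB1 y) * nu y +
   (outb s y * expR (kappa * dotv theta y) * nu y - outb s y * nu y) =
   - 1 * ((1 - expR (dotv a y) + dotv a y * indB1 y) * nu y).
  have := outb_inb s y; rewrite aE => h.
  rewrite [LHS](_ : _ = ((inb s y + outb s y) * (expR (dotv a y) - 1) - dotv a y * indB1 y) * nu y); last by ring.
  by rewrite h; ring.
have i4 := Itg_ext e (ItgD i1 i23).
have i5 : Itg leb (fun y => (1 - expR (dotv a y) + dotv a y * indB1 y) * nu y).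
  by apply: (Itg_ext _ (ItgN i4)) => y; rewrite mulN1r opprK.
rewrite /psitilde /LR.
have := RI_ext leb e; rewrite (RID i1 i23) (RIB i3 i2) (RIZ (-1) i5) => h; lra.
Qed.

End tilt.

(** In the application q, v and w are the terms with no, one and several large jumps, m is the limit
    of v, and e is the exponential of minus the large-jump mass. *)
Lemma combine_limits (R : realType) (p q v w m g e e1 e2 e3 e4 : R) : 0 <= e -> e <= 1 ->
  p = e * (q + v + w) -> `|q| <= e1 -> `|v - m| <= e2 -> `|w| <= e3 -> `|e * m - g| <= e4 ->
  `|p - g| <= e1 + e2 + e3 + e4.
Proof.
move=> e0 le1 -> h1 h2 h3 h4.
have -> : e * (q + v + w) - g = e * (q + (v - m) + w) + (e * m - g) by ring.
apply: (le_trans (ler_normD _ _)); apply: lerD => //.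
rewrite normrM (ger0_norm e0); apply: (@le_trans _ _ `|q + (v - m) + w|); first by rewrite ler_piMl.
by apply: (le_trans (ler_normD _ _)); apply: lerD => //; apply: (le_trans (ler_normD _ _)); apply: lerD.
Qed.

Lemma exists_small (R : realType) (c e : R) : 0 <= c -> 0 < e -> exists k : R, 0 < k /\ c * k <= e.
Proof.
move=> c0 e0; have c1 : 0 < c + 1 by lra.
exists (e / (c + 1)); split; first by rewrite divr_gt0.
by rewrite mulrA ler_pdivrMr// mulrC ler_wpM2l ?(ltW e0)//; lra.
Qed.

Lemma exists_exp_small (R : realType) (c e : R) : 0 <= c -> 0 < e -> exists r0 : R, forall r, r0 <= r -> c * expR (- r) <= e.
Proof.
move=> c0 e0; exists (c / e) => r hr.
rewrite expRN ler_pdivrMr ?expR_gt0//; have := expR_ge1Dx r.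
have h : c <= e * r by rewrite mulrC -ler_pdivrMr.
by move=> k; have := ler_wpM2l (ltW e0) k; rewrite mulrDr mulr1; lra.
Qed.

Lemma far_pointwise (R : realType) (a m g u c v M B k n : R) : 0 <= a ->
  0 <= m <= a * (c * expR (k * n)) -> 0 <= g <= v * expR (k * n) ->
  0 <= u -> u <= M * B * expR (- ((k + 1) * n)) ->
  `|m * u - a * (g * u)| <= a * (M * B * (c + v)) * expR (- n).
Proof.
move=> a0 /andP[m0 mc] /andP[g0 gv] u0 uM.
rewrite mulrA -mulrBl normrM (ger0_norm u0).
apply: (@le_trans _ _ (a * (c + v) * expR (k * n) * (M * B * expR (- ((k + 1) * n))))).
  apply: ler_pM => //; rewrite [X in _ <= X](_ : _ = a * (c * expR (k * n)) + a * (v * expR (k * n))); last by ring.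
  apply: (le_trans (ler_normB _ _)); rewrite (ger0_norm m0) (ger0_norm (mulr_ge0 a0 g0)).
  by apply: lerD => //; rewrite ler_wpM2l.
have -> : expR (- n) = expR (k * n) * expR (- ((k + 1) * n)) by rewrite -expRD; congr expR; ring.
by rewrite le_eqVlt; apply/orP; left; apply/eqP; ring.
Qed.

(** * The density along rays *)

Section limit.
Context (R : realType) (d : nat).
Local Notation V := (d.-tuple R).
Variable leb : {sigma_finite_measure set V -> \bar R}.
Hypothesis Hleb : is_lebesgue leb.
Hypothesis d0 : (0 < d)%N.
Variables (b : V) (A : 'M[R]_d) (nu : V -> R).
Hypothesis sA : A^T = A.
Hypothesis pA : forall x, 0 <= quadA A x.
Hypothesis Hnu : levy_density leb nu.
Variables (T : set R) (M C : R).
Hypothesis T0 : forall t, T t -> 0 < t.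
Hypothesis M0 : 0 <= M.
Hypothesis TM : forall t, T t -> t <= M.
Hypothesis C_gt0 : 0 < C.
Hypothesis irF : forall t, T t -> Itg leb (fun xi => rhoF leb A nu t xi * normv xi).
Hypothesis HI : forall t, T t -> exists h, intensity leb A nu t h C.
Variables (f : R -> R) (C0 C1 kappa : R) (E : set V).
Hypothesis f0 : forall r, 0 < r -> 0 < f r.
Hypothesis fd : forall r s, 0 < r -> r <= s -> f s <= f r.
Hypothesis f_low : exists c : R, exists delta : R, 0 < c /\ 0 < delta /\
     forall r, 0 < r -> r < delta ->
       ((c * f r * r ^+ d)%:E <= \int[leb]_(x in [set x | (r < normv x)%R]) (nu x)%:E)%E.
Hypothesis K0 : Kfun leb f r @[r --> +oo] --> (0%R)%:E.
Hypothesis C00 : 0 < C0.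
Hypothesis nuf : forall x, x <> vzero -> nu x <= C0 * f (normv x).
Hypothesis E1 : forall theta, E theta -> normv theta = 1.
Hypothesis k0 : 0 <= kappa.
Hypothesis Hratio : forall theta y, E theta ->
     nu (vsub (vscale r theta) y) / nu (vscale r theta) @[r --> +oo] --> expR (kappa * dotv theta y).
Hypothesis C10 : 0 < C1.
Hypothesis nuE : forall x, x <> vzero -> E (vscale (normv x)^-1 x) -> C1 * f (normv x) <= nu x.

Local Notation UR := (UR leb b A nu).
Local Notation UF := (UF leb b A nu).

Definition nuS (s : R) : R := RI leb (fun y => outb s y * nu y).

Lemma nuS_ge0 s : 0 <= nuS s.
Proof. by apply: RI_ge0 => y; rewrite mulr_ge0 ?(nu_ge0 Hnu). Qed.

Lemma nuS_mono (r s : R) : 0 < r -> r <= s -> nuS s <= nuS r.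
Proof.
move=> r0 rs; have s0 : 0 < s := lt_le_trans r0 rs.
apply: (RI_le (Itg_outnu Hnu s0) (Itg_outnu Hnu r0)) => y.
rewrite ler_wpM2r ?(nu_ge0 Hnu)// /outb; case: (ltP s (normv y)) => h; last by rewrite mulrn_wge0.
by rewrite (le_lt_trans rs h).
Qed.

Lemma nuS_small (e : R) : 0 < e -> exists s1 : R, 1 <= s1 /\ forall s, s1 <= s -> nuS s <= e.
Proof.
move=> e0; have mn := mnu Hnu.
have [||||_ h] // := @RI_dct _ _ _ leb (fun n y => outb n.+1%:R y * nu y) (fun=> 0) (fun y => outb 1 y * nu y).
- by move=> n; have mo := @moutb R d n.+1%:R; mfun.
- move=> n y; rewrite ger0_norm; last by rewrite mulr_ge0 ?(nu_ge0 Hnu).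
  rewrite ler_wpM2r ?(nu_ge0 Hnu)// /outb; case: (ltP n.+1%:R (normv y)) => h; last by rewrite mulrn_wge0.
  by rewrite (le_lt_trans _ h)// ler1n.
- exact: Itg_outnu.
- move=> y; apply: (@cvg_near_cst _ _ _ _ _ _).
  exists (Num.truncn (normv y)).+1 => // n /= hn.
  have /andP[_ h2] := truncn_itv (normv_ge0 y).
  have h3 : normv y <= n.+1%:R.
    by apply: (le_trans (ltW h2)); rewrite ler_nat (leq_trans hn).
  by rewrite /outb ltNge h3 mul0r.
rewrite RI0 in h.
have [N _ hN] := cvgr0_norm_lt (fun n => nuS n.+1%:R) h _ e0.
exists N.+1%:R; split; first by rewrite ler1n.
move=> s hs; have p : 0 < N.+1%:R :> R by [].
apply: (le_trans (nuS_mono p hs)); apply: (le_trans (ler_norm _)); apply: ltW; exact: (hN N (leqnn N)).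
Qed.

(** * Estimates over a set S of triples (t, theta, y), to be one triple or a product set *)

Section uniform.
Variables (S : R -> V -> V -> Prop) (vr : R).
Hypothesis vr0 : 0 <= vr.
Hypothesis ST : forall t theta y, S t theta y -> T t.
Hypothesis SE : forall t theta y, S t theta y -> E theta.
Hypothesis Sy : forall t theta y, S t theta y -> normv y <= vr.

(** Replaces f by nu(r theta) as unit of size, through nu >= C1 f on the cone and the slowness of f.
    The constants serve all theta, all y of the ball and all large r. *)
Lemma ray_bounds : exists L c : R, [/\ 0 <= L, 0 <= c &
  forall r theta y, E theta -> normv y <= vr -> vr + 1 < r ->
   [/\ 0 < nu (vscale r theta), f (normv (vsub (vscale r theta) y)) <= c * nu (vscale r theta),
     (forall w, 1 <= normv (vsub (vsub (vscale r theta) y) w) ->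
        nu (vsub (vsub (vscale r theta) y) w) <= c * expR (L * normv w) * nu (vscale r theta)) &
     expR (- (L * r)) <= c * nu (vscale r theta)]].
Proof.
have [Cf [L [Cf1 L0 [fsh fexp]]]] := f_shift Hleb d0 f0 fd K0.
pose a1 := Cf * expR (L * vr) / C1; pose a2 := C0 * Cf * a1; pose a3 := Cf / C1.
have Cf0 : 0 <= Cf by lra.
have a10 : 0 <= a1 by rewrite !mulr_ge0 ?expR_ge0// invr_ge0 ltW.
have a20 : 0 <= a2 := mulr_ge0 (mulr_ge0 (ltW C00) Cf0) a10.
have a30 : 0 <= a3 by rewrite mulr_ge0// invr_ge0 ltW.
exists L, (a1 + a2 + a3); split=> //; first by rewrite !addr_ge0.
move=> r theta y Et hy hr; have v0 := vr0.
have r0 : 0 < r by lra.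
have N0 := nu_ray_gt0 f0 E1 C10 nuE r0 Et; have N1 := nu_ray E1 nuE r0 Et.
have nr := normv_ray E1 (ltW r0) Et.
set N := nu _ in N0 N1 *; set x := vsub _ y.
have nx : 1 < normv x by have := normvB_ge (vscale r theta) y; rewrite nr -/x; lra.
have fr : f r <= N / C1 by rewrite ler_pdivlMr// mulrC.
have xr : vscale r theta <> vzero by apply: nz_of_normv; rewrite nr.
have fx : f (normv x) <= a1 * N.
  apply: (le_trans (fsh _ _ xr (ltW nx))); rewrite nr (_ : a1 * N = Cf * expR (L * vr) * (N / C1)); last by rewrite /a1; ring.
  apply: ler_pM => //; [by rewrite mulr_ge0 ?expR_ge0|exact: ltW (f0 r0)|].
  by rewrite ler_wpM2l// ler_expR ler_wpM2l.
have n1 : 0 <= a1 * N by rewrite mulr_ge0// ltW.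
have n2 : 0 <= a2 * N by rewrite mulr_ge0// ltW.
have n3 : 0 <= a3 * N by rewrite mulr_ge0// ltW.
have xz : x <> vzero by apply: nz_of_normv; lra.
split=> //.
- by rewrite !mulrDl; lra.
- move=> w hw; have w0 : 0 < normv (vsub x w) by lra.
  apply: (le_trans (nuf (nz_of_normv w0))).
  apply: (@le_trans _ _ (C0 * (Cf * expR (L * normv w) * (a1 * N)))).
    rewrite ler_wpM2l ?(ltW C00)//; apply: (le_trans (fsh x w xz hw)).
    by rewrite ler_wpM2l// mulr_ge0 ?expR_ge0.
  rewrite [X in X <= _](_ : _ = a2 * expR (L * normv w) * N); last by rewrite /a2; ring.
  by rewrite ler_wpM2r ?(ltW N0)// ler_wpM2r ?expR_ge0//; lra.
- apply: (le_trans (fexp r _)); first by lra.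
  apply: (@le_trans _ _ (a3 * N)); last by rewrite !mulrDl; lra.
  by rewrite (_ : a3 * N = Cf * (N / C1)) ?ler_wpM2l//; rewrite /a3; ring.
Qed.

Local Notation mu s t := (mX_ nu s (fun=> 1) t).

Lemma mu_ge0 s t y : T t -> 0 <= mu s t y.
Proof. by move=> /T0 t0; exact: (mX_ge0 (X := fun=> 1) Hnu s (@one01 R d) y (ltW t0)). Qed.
Lemma Itg_mu s t : 0 < s -> Itg leb (mu s t).
Proof. by move=> s0; exact: (ImX_ (X := fun=> 1) Hnu s0 (measurable_cst _) (@one01 R d) t). Qed.
Lemma muE s t y : mu s t y = t * (outb s y * nu y).
Proof. by rewrite /mX_ mulr1. Qed.
Lemma RI_mu s t : 0 < s -> RI leb (mu s t) = t * nuS s.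
Proof.
move=> s0; rewrite -(RIZ t (Itg_outnu Hnu s0)); apply: RI_ext => y; exact: muE.
Qed.

(** The part of the series with at least one jump longer than s; [rest] is the part with at least
    two. *)
Definition excess (s t : R) (w : V) : R := expR (RI leb (mu s t)) * UF t w - UR t s w.
Definition rest (s t : R) (x : V) : R := excess s t x - vconv leb (mu s t) (UR t s) x.

Lemma rest_bound (s t : R) x : T t -> 0 < s ->
  [/\ forall w, 0 <= excess s t w, Itg leb (excess s t),
      RI leb (excess s t) = Kd leb * (expR (RI leb (mu s t)) - 1),
      Itg leb (fun w => mu s t (vsub x w) * excess s t w) &
      0 <= rest s t x <= RI leb (fun w => mu s t (vsub x w) * excess s t w)].
Proof.
move=> Tt s0; have t0 := T0 Tt.
have [iu eu] := UR_mass Hleb d0 b sA pA Hnu (ltW t0) (irF Tt) s0.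
have u0 := UR_le Hleb d0 b sA pA Hnu (ltW t0) (irF Tt) s0.
have ser w := @UF_series R d leb Hleb d0 b A nu sA pA Hnu t (ltW t0) (irF Tt) s s0 w.
have := series_remainder_refl Hleb (fun y => mu_ge0 s y Tt) (Itg_mu t s0) u0 iu ser x.
by rewrite eu.
Qed.

(** If the position before the last jump is within rh, the excess has small mass there because few
    jumps exceed s; otherwise both legs are longer than rh and [K] is small. The first bound
    contains exp(L rh), so rh is fixed before s. *)
Lemma rest_small (e : R) : 0 < e -> exists s1 : R, 1 <= s1 /\ forall s, s1 <= s ->
  forall r t theta y, S t theta y -> vr + 1 < r ->
  0 <= rest s t (vsub (vscale r theta) y) <= e * (t * nu (vscale r theta)).
Proof.
move=> e0; have [L [c [L0 c0 rb]]] := ray_bounds.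
have [rf [Bf [rf1 Bf0 tf]]] := tail_f Hleb d0 b sA pA Hnu T0 TM C_gt0 irF HI f0 fd f_low K0 C00 nuf.
pose eM := expR (M * nuS 1).
have eM0 : 0 <= eM by exact: expR_ge0.
have e2 : 0 < e / 2 by rewrite divr_gt0.
have q0 : 0 <= eM * Bf * M * C0 * c by rewrite !mulr_ge0// ltW.
have [k [kp hk]] := exists_small q0 e2.
have [r1 hr1] := K_eventually_le K0 kp.
have [rh [rh1 rhf]] : exists rh, r1 < rh /\ rf <= rh.
  exists (Order.max r1 rf + 1); have h1 : r1 <= Order.max r1 rf by rewrite le_max lexx.
  have h2 : rf <= Order.max r1 rf by rewrite le_max lexx orbT.
  by split; lra.
have rhp : 0 < rh by lra.
have Kr := hr1 _ rh1.
have Kd0 := Kd_gt0 Hleb.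
have ce : 0 <= c * expR (L * rh) := mulr_ge0 c0 (expR_ge0 _).
have q1 : 0 <= c * expR (L * rh) * Kd leb * M * eM := mulr_ge0 (mulr_ge0 (mulr_ge0 ce (ltW Kd0)) M0) eM0.
have [v [vp hv]] := exists_small q1 e2.
have [s1 [s11 hs1]] := nuS_small vp.
exists (Order.max s1 rh); split; first by rewrite le_max s11.
move=> s; rewrite ge_max => /andP[ss1 srh] r t theta y Sy_ hr.
have Tt := ST Sy_; have Et := SE Sy_; have hy := Sy Sy_; have t0 := T0 Tt.
have s1' : 1 <= s := le_trans s11 ss1.
have s0 : 0 < s by lra.
have [N0 fx nux _] := rb r theta y Et hy hr.
set N := nu (vscale r theta) in N0 fx nux *; set x := vsub (vscale r theta) y in fx nux *.
have nx : 1 < normv x.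
  have r0 : 0 <= r by have := vr0; lra.
  have := normvB_ge (vscale r theta) y; rewrite (normv_ray E1 r0 Et) -/x; lra.
have [p0 pi pm pj /andP[rest0 rest1]] := rest_bound x Tt s0.
rewrite rest0 /=; apply: (le_trans rest1).
have [iK bK] := Kfun_real f0 fd rhp Kr nx.
have [F0 _] := UF_mass Hleb d0 b sA pA Hnu (ltW t0) (irF Tt) s0.
have LM : RI leb (mu s t) <= M * nuS 1.
  rewrite (RI_mu _ s0); apply: ler_pM; rewrite ?nuS_ge0 ?(ltW t0)//; [exact: TM|exact: nuS_mono].
have L0' : 0 <= RI leb (mu s t) by rewrite (RI_mu _ s0) mulr_ge0 ?nuS_ge0// ltW.
have eLM : expR (RI leb (mu s t)) <= eM by rewrite ler_expR.
pose g w := outb rh (vsub x w) * outb rh w * (f (normv (vsub x w)) * f (normv w)).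
pose ca := t * c * expR (L * rh) * N; pose cb := t * C0 * (eM * t * Bf).
have ca0 : 0 <= ca by rewrite !mulr_ge0 ?expR_ge0// ltW.
have cb0 : 0 <= cb by rewrite !mulr_ge0// ltW.
have g0 w : 0 <= g w.
  rewrite /g /outb; case: (ltP rh (normv (vsub x w))) => h; last by rewrite !mul0r.
  case: (ltP rh (normv w)) => h'; last by rewrite mulr0 mul0r.
  by rewrite !mul1r mulr_ge0// ltW// f0// (lt_trans rhp).
have pw w : mu s t (vsub x w) * excess s t w <= ca * excess s t w + cb * g w.
  rewrite muE; case: (ltP s (normv (vsub x w))) => hsw; last first.
    have -> : outb s (vsub x w) = 0 by rewrite /outb ltNge hsw.
    by rewrite mul0r mulr0 mul0r addr_ge0// mulr_ge0.
  have -> : outb s (vsub x w) = 1 by rewrite /outb hsw.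
  rewrite mul1r; have [hw|hw] := leP (normv w) rh.
    apply: (@le_trans _ _ (ca * excess s t w)); last by rewrite lerDl mulr_ge0.
    rewrite ler_wpM2r//; have sw1 : 1 <= normv (vsub x w) by exact: le_trans s1' (ltW hsw).
    rewrite /ca -!mulrA ler_wpM2l ?(ltW t0)//; apply: (le_trans (nux w sw1)).
    rewrite -mulrA ler_wpM2l// ler_wpM2r ?(ltW N0)// ler_expR ler_wpM2l//.
  apply: (@le_trans _ _ (cb * g w)); last by rewrite lerDr mulr_ge0.
  have hsr : rh < normv (vsub x w) := le_lt_trans srh hsw.
  have xw0 : 0 < normv (vsub x w) := lt_trans rhp hsr.
  have fw : 0 <= f (normv w) by apply: ltW; apply: f0; exact: lt_trans hw.
  have u1 : excess s t w <= eM * (t * Bf * f (normv w)).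
    apply: (@le_trans _ _ (expR (RI leb (mu s t)) * UF t w)).
      by rewrite gerBl; case/andP: (UR_le Hleb d0 b sA pA Hnu (ltW t0) (irF Tt) s0 w).
    apply: ler_pM => //; apply: tf => //; exact: le_trans rhf (ltW hw).
  have u2 := nuf (nz_of_normv xw0).
  apply: (@le_trans _ _ (t * (C0 * f (normv (vsub x w))) * (eM * (t * Bf * f (normv w))))).
    apply: ler_pM => //; first by rewrite mulr_ge0 ?(ltW t0) ?(nu_ge0 Hnu).
    by rewrite ler_wpM2l ?(ltW t0).
  have -> : g w = f (normv (vsub x w)) * f (normv w) by rewrite /g /outb hsr hw !mul1r.
  by rewrite le_eqVlt; apply/orP; left; apply/eqP; rewrite /cb; ring.
have isum := ItgD (ItgZ ca pi) (ItgZ cb iK).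
apply: (le_trans (RI_le pj isum pw)); rewrite (RID (ItgZ ca pi) (ItgZ cb iK)) (RIZ ca pi) (RIZ cb iK) pm.
have tN : 0 <= t * N := mulr_ge0 (ltW t0) (ltW N0).
have -> : e * (t * N) = t * N * (e / 2) + t * N * (e / 2) by field.
apply: lerD.
  rewrite [X in X <= _](_ : _ = t * N * (c * expR (L * rh) * Kd leb * (expR (RI leb (mu s t)) - 1))); last first.
    by rewrite /ca; ring.
  rewrite ler_wpM2l//; apply: le_trans hv.
  have ns : nuS s <= v by exact: hs1.
  have ex : expR (RI leb (mu s t)) - 1 <= M * v * eM.
    apply: (le_trans (ler_norm _)); apply: (le_trans (exp_sub1_le _)); rewrite (ger0_norm L0').
    apply: ler_pM => //.
    by rewrite (RI_mu _ s0); apply: ler_pM; rewrite ?nuS_ge0 ?(ltW t0)//; exact: TM.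
  rewrite [X in _ <= X](_ : _ = c * expR (L * rh) * Kd leb * (M * v * eM)); last by ring.
  by rewrite ler_wpM2l//; exact: mulr_ge0 ce (ltW Kd0).
apply: (@le_trans _ _ (cb * (k * (c * N)))).
  by rewrite ler_wpM2l//; apply: (le_trans bK); rewrite ler_wpM2l ?(ltW kp).
rewrite [X in X <= _](_ : _ = t * N * (eM * Bf * t * C0 * c * k)); last by rewrite /cb; ring.
rewrite ler_wpM2l//; apply: le_trans hk.
rewrite ler_wpM2r ?(ltW kp)// ler_wpM2r// ler_wpM2r ?(ltW C00)// ler_wpM2l ?mulr_ge0//; exact: TM.
Qed.

(** Limit of the one-jump term divided by t nu(r theta): the exponential moment at kappa theta of
    the density cut at s, times exp(kappa theta.y). *)
Definition tilted (s t : R) (theta y : V) : R :=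
  Kd leb * expR (kappa * dotv theta y + t * LR leb b A nu s (vscale kappa theta)).
(** [limit_val] without the distinction between kappa = 0 and kappa > 0. *)
Definition target (t : R) (theta y : V) : R :=
  expR (- (t * psitilde leb b A nu (vscale kappa theta)) + kappa * dotv theta y).

Lemma target_bound : exists B : R, 0 <= B /\ forall t theta y, S t theta y -> target t theta y <= B.
Proof.
have [r1 h1] := K_eventually_le K0 ltr01.
have [s [sr1 sp]] : exists s, r1 < s /\ 0 < s.
  exists (Order.max r1 0 + 1); have q1 : r1 <= Order.max r1 0 by rewrite le_max lexx.
  have q2 : 0 <= Order.max r1 0 by rewrite le_max lexx orbT.
  by split; lra.
have [B hB] := LR_bound b sA pA Hnu sp kappa.
pose P := `|B| + C0 * (C0 / C1 * 1).
have P0 : 0 <= P by rewrite addr_ge0// !mulr_ge0// ?invr_ge0 ltW.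
exists (expR (M * P + kappa * vr)); split; first exact: expR_ge0.
move=> t theta y H; have Tt := ST H; have Et := SE H; have hy := Sy H; have t0 := T0 Tt.
rewrite /target ler_expR; apply: lerD; last first.
  by rewrite ler_wpM2l// (le_trans (dotv_le _ _))// (E1 Et) mul1r.
rewrite -mulrN (psitilde_split b A Hnu f0 fd K0 C00 nuf E1 k0 Hratio C10 nuE Et sp).
have [_ b2] := levy_tilt Hnu f0 fd C00 nuf E1 Hratio C10 nuE Et sp (h1 _ sr1).
have nk : normv (vscale kappa theta) = kappa by rewrite normvZ (E1 Et) mulr1 ger0_norm.
have b1 := hB _ nk; have b3 := nuS_ge0 s.
apply: (@le_trans _ _ (t * P)); last by rewrite ler_wpM2r// TM.
rewrite ler_wpM2l ?(ltW t0)// /P; apply: lerD => //.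
by rewrite lerBlDr (le_trans b1)// (le_trans (ler_norm B))// lerDl.
Qed.

(** The two quantities differ by the factor exp(-t I), I being the tilted mass of nu beyond s, which
    [levy_tilt] bounds by [K]. [target_bound] makes this relative error an absolute one. *)
Lemma tilted_small (e : R) : 0 < e -> exists s1 : R, 1 <= s1 /\ forall s, s1 <= s ->
  forall t theta y, S t theta y ->
  `|expR (- RI leb (mu s t)) * tilted s t theta y - Kd leb * target t theta y| <= e.
Proof.
move=> e0; have [B [B0 hB]] := target_bound; have Kd0 := Kd_gt0 Hleb.
have q0 : 0 <= Kd leb * B * (M * (C0 * (C0 / C1))).
  have cc : 0 <= C0 / C1 := divr_ge0 (ltW C00) (ltW C10).
  exact: mulr_ge0 (mulr_ge0 (ltW Kd0) B0) (mulr_ge0 M0 (mulr_ge0 (ltW C00) cc)).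
have [k [kp hk]] := exists_small q0 e0.
have [r1 h1] := K_eventually_le K0 kp.
exists (Order.max r1 0 + 1); have q1 : r1 <= Order.max r1 0 by rewrite le_max lexx.
have q2 : 0 <= Order.max r1 0 by rewrite le_max lexx orbT.
split; first by lra.
move=> s hs t theta y H; have Tt := ST H; have Et := SE H; have t0 := T0 Tt.
have sp : 0 < s by lra.
have sr1 : r1 < s by lra.
have [i2 b2] := levy_tilt Hnu f0 fd C00 nuf E1 Hratio C10 nuE Et sp (h1 _ sr1).
have ps := psitilde_split b A Hnu f0 fd K0 C00 nuf E1 k0 Hratio C10 nuE Et sp.
set I := RI leb _ in b2 ps.
have I0 : 0 <= I by apply: RI_ge0 => w; rewrite !mulr_ge0 ?expR_ge0 ?(nu_ge0 Hnu).
have e1 : expR (- RI leb (mu s t)) * tilted s t theta y = Kd leb * target t theta y * expR (- (t * I)).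
  rewrite /tilted /target mulrCA -[RHS]mulrA -!expRD; congr (_ * expR _).
  have -> : psitilde leb b A nu (vscale kappa theta) = - (LR leb b A nu s (vscale kappa theta) - nuS s + I).
    by rewrite -ps opprK.
  by rewrite (RI_mu _ sp); ring.
rewrite e1 -{2}[Kd leb * target t theta y]mulr1 -mulrBr normrM.
have tg0 : 0 <= Kd leb * target t theta y by rewrite mulr_ge0 ?expR_ge0// ltW.
rewrite (ger0_norm tg0); apply: le_trans hk; rewrite -mulrA; apply: ler_pM => //.
  by rewrite ler_wpM2l ?(ltW Kd0)//; exact: hB H.
have tI : 0 <= t * I by rewrite mulr_ge0// ltW.
have /andP[w1 w2] := one_sub_expN_le tI.
rewrite distrC ger0_norm//; apply: (le_trans w2); apply: (@le_trans _ _ (t * I)); first by rewrite ge_min lexx orbT.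
rewrite [X in _ <= X](_ : _ = M * (C0 * (C0 / C1 * k))); last by ring.
by apply: ler_pM; rewrite ?(ltW t0)//; exact: TM.
Qed.

(** Without large jumps the density decays at rate L + 1, while nu(r theta) decays at rate at most
    L. *)
Lemma UR_far_small (s e : R) : 1 <= s -> 0 < e -> exists r0 : R, forall r, r0 < r ->
  forall t theta y, S t theta y ->
  0 <= UR t s (vsub (vscale r theta) y) <= e * (t * nu (vscale r theta)).
Proof.
move=> s1 e0; have [L [c [L0 c0 rb]]] := ray_bounds.
have l1 : 1 <= L + 1 by lra.
have [rs [Bs [rs1 Bs0 ts]]] := tail_exp Hleb d0 b sA pA Hnu T0 TM C_gt0 irF HI fd f_low C00 nuf s1 l1.
have q0 : 0 <= Bs * expR ((L + 1) * vr) * c by rewrite !mulr_ge0 ?expR_ge0.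
have [r0 hr0] := exists_exp_small q0 e0.
exists (Order.max r0 (vr + 1 + rs)) => r; rewrite gt_max => /andP[rr0 rrs] t theta y H.
have Tt := ST H; have Et := SE H; have hy := Sy H; have t0 := T0 Tt.
have v0 := vr0; have r_ge0 : 0 <= r by lra.
have hr : vr + 1 < r by lra.
have [N0 _ _ ex] := rb r theta y Et hy hr.
have nx : r - vr <= normv (vsub (vscale r theta) y).
  by have := normvB_ge (vscale r theta) y; rewrite (normv_ray E1 r_ge0 Et); lra.
have nrs : rs <= normv (vsub (vscale r theta) y) by lra.
have sp : 0 < s by lra.
rewrite (UR_ge0 Hleb d0 b sA pA Hnu (ltW t0) (irF Tt) sp)/=.
apply: (le_trans (ts t _ Tt nrs)); rewrite [X in _ <= X]mulrCA -mulrA ler_wpM2l ?(ltW t0)//.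
apply: (@le_trans _ _ (Bs * (expR ((L + 1) * vr) * expR (- r) * expR (- (L * r))))).
  rewrite ler_wpM2l// -!expRD ler_expR.
  by have := ler_wpM2l (le_trans ler01 l1) nx; rewrite mulrBr; lra.
apply: (@le_trans _ _ (Bs * (expR ((L + 1) * vr) * expR (- r) * (c * nu (vscale r theta))))).
  by rewrite ler_wpM2l// ler_wpM2l// mulr_ge0 ?expR_ge0.
rewrite [X in X <= _](_ : _ = Bs * expR ((L + 1) * vr) * c * expR (- r) * nu (vscale r theta)); last by ring.
by rewrite ler_wpM2r ?(ltW N0)// hr0// ltW.
Qed.

Lemma outb_exp_small (c e : R) : 0 <= c -> 0 < e -> exists r0 : R, forall r, r0 <= r ->
  Itg leb (fun w : V => outb r w * expR (- normv w)) /\ c * RI leb (fun w : V => outb r w * expR (- normv w)) <= e.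
Proof.
move=> c0 e0; have h2 : 0 < 1 / 2 :> R by lra.
have i1 := Itg_exp_norm Hleb h2.
pose I := RI leb (fun w : V => expR (- (1 / 2 * normv w))).
have I0 : 0 <= I by apply: RI_ge0 => w; exact: expR_ge0.
have [r1 hr1] := exists_exp_small (mulr_ge0 c0 I0) e0.
exists (2 * r1) => r hr; have mo := @moutb R d r.
have pw (w : V) : `|outb r w * expR (- normv w)| <= expR (- (r / 2)) * expR (- (1 / 2 * normv w)).
  case: (ltP r (normv w)) => h; last first.
    by rewrite /outb ltNge h mul0r normr0 mulr_ge0 ?expR_ge0.
  rewrite (_ : outb r w = 1); last by rewrite /outb h.
  by rewrite [1 * expR _]mul1r ger0_norm ?expR_ge0// -expRD ler_expR; lra.
have iZ := ItgZ (expR (- (r / 2))) i1.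
have mE : measurable_fun setT (fun w : V => outb r w * expR (- normv w)) by mfun.
split; first exact: (Itg_dom mE pw iZ).
have h := le_trans (ler_norm _) (RI_abs_le mE pw iZ); rewrite (RIZ _ i1) -/I in h.
apply: (le_trans (ler_wpM2l c0 h)); rewrite mulrCA mulrC; apply: hr1; lra.
Qed.

(** Convergence of the ratios of nu, averaged over a ball with the cutoff density. Here alone the
    two conclusions differ: for one triple it follows by dominated convergence, for all triples at
    once from uniform convergence on compact sets. *)
Hypothesis HS : forall s rh e : R, 1 <= s -> 0 < rh -> 0 < e -> exists r0 : R, forall r, r0 < r ->
  forall t theta y, S t theta y ->
  Itg leb (fun w => inb rh w * (UR t s w * `|nuratio nu r theta (vadd y w) - expR (kappa * dotv theta (vadd y w))|)) /\
  RI leb (fun w => inb rh w * (UR t s w * `|nuratio nu r theta (vadd y w) - expR (kappa * dotv theta (vadd y w))|)) <= e.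

(** In the variable w = x - z the jump density divided by nu(r theta) is t times the ratio at y + w.
    For |w| <= rh its error is [HS]; beyond, the cutoff density decays at rate L + kappa + 1, faster
    than both the ratio, of growth exp(L |w|), and its limit, of growth exp(kappa |w|), can
    increase. *)
Lemma one_jump_small (s e : R) : 1 <= s -> 0 < e -> exists r0 : R, forall r, r0 < r ->
  forall t theta y, S t theta y ->
  `|vconv leb (mu s t) (UR t s) (vsub (vscale r theta) y) - t * nu (vscale r theta) * tilted s t theta y|
    <= e * (t * nu (vscale r theta)).
Proof.
move=> s1 e0; have [L [c [L0 c0 rb]]] := ray_bounds.
have sp : 0 < s by lra.
have kk := k0; have v0 := vr0.
pose l := L + kappa + 1; have l1 : 1 <= l by rewrite /l; lra.
have [rs [Bs [rs1 Bs0 ts]]] := tail_exp Hleb d0 b sA pA Hnu T0 TM C_gt0 irF HI fd f_low C00 nuf s1 l1.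
have e2 : 0 < e / 2 by rewrite divr_gt0.
pose D := M * Bs * (c + expR (kappa * vr)).
have D0 : 0 <= D by rewrite !mulr_ge0// addr_ge0 ?expR_ge0.
have [r1 hr1] := outb_exp_small D0 e2.
have [rh [rhr1 rhrs]] : exists rh, r1 <= rh /\ rs <= rh.
  by exists (Order.max r1 rs); rewrite !le_max !lexx orbT.
have rhp : 0 < rh by lra.
have [r2 hr2] := HS s1 rhp e2.
exists (Order.max r2 (vr + 1 + s + rh)) => r; rewrite gt_max => /andP[rr2 rrs] t theta y H.
have Tt := ST H; have Et := SE H; have hy := Sy H; have t0 := T0 Tt.
have r_ge0 : 0 <= r by lra.
have hr : vr + 1 < r by lra.
have [N0 _ nux _] := rb r theta y Et hy hr.
set N := nu (vscale r theta) in N0 nux *; set x := vsub (vscale r theta) y in nux *.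
have nx : r - vr <= normv x.
  by have := normvB_ge (vscale r theta) y; rewrite (normv_ray E1 r_ge0 Et) -/x; lra.
have Nn : N != 0 := lt0r_neq0 N0.
have hxs w : normv w <= rh -> s < normv (vsub x w) by have := normvB_ge x w; lra.
have hk w : kappa * dotv theta (vadd y w) <= kappa * vr + (L * normv w + kappa * normv w).
  have n0 := normv_ge0 w.
  have : kappa * dotv theta (vadd y w) <= kappa * (vr + normv w).
    by rewrite ler_wpM2l// (le_trans (dotv_le _ _))// (E1 Et) mul1r (le_trans (normvD _ _))// lerD2r.
  have := mulr_ge0 L0 n0; rewrite mulrDr; lra.
have tN : 0 < t * N := mulr_gt0 t0 N0.
have k1 w : 0 <= mu s t (vsub x w) <= t * N * (c * expR ((L + kappa) * normv w)).
  rewrite (mu_ge0 s _ Tt) /= muE; case: (ltP s (normv (vsub x w))) => h; last first.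
    have -> : outb s (vsub x w) = 0 by rewrite /outb ltNge h.
    by rewrite mul0r mulr0 mulr_ge0 ?(ltW tN)// mulr_ge0 ?expR_ge0.
  have -> : outb s (vsub x w) = 1 by rewrite /outb h.
  rewrite mul1r -mulrA ler_wpM2l ?(ltW t0)//.
  apply: (le_trans (nux w (le_trans s1 (ltW h)))); rewrite mulrC ler_wpM2l ?(ltW N0)// ler_wpM2l//.
  by rewrite ler_expR mulrDl lerDl mulr_ge0 ?normv_ge0.
have k2 w : 0 <= expR (kappa * dotv theta (vadd y w)) <= expR (kappa * vr) * expR ((L + kappa) * normv w).
  by rewrite expR_ge0 /= -expRD ler_expR mulrDl hk.
have Uw w : rh < normv w -> UR t s w <= M * Bs * expR (- ((L + kappa + 1) * normv w)).
  move=> hw; apply: (le_trans (ts t w Tt (le_trans rhrs (ltW hw)))).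
  apply: (ler_wpM2r (expR_ge0 _)); apply: (ler_wpM2r Bs0); exact: TM.
have [io bo] := hr1 _ rhr1.
have [iS bS] := hr2 r rr2 t theta y H.
have [U0 mgf] := UR_mgf Hleb d0 b sA pA Hnu (ltW t0) (irF Tt) sp.
have [iu eu] := UR_mass Hleb d0 b sA pA Hnu (ltW t0) (irF Tt) sp.
have u0 := UR_le Hleb d0 b sA pA Hnu (ltW t0) (irF Tt) sp.
have mU := Itg_meas iu.
have im := Itg_mu t sp; have m0 y' := mu_ge0 s y' Tt; have mm := Itg_meas im.
have [ig eg] := mgf (vscale kappa theta).
pose ey := expR (kappa * dotv theta y).
have gE w : expR (kappa * dotv theta (vadd y w)) * UR t s w = ey * (expR (dotv (vscale kappa theta) w) * UR t s w).
  by rewrite dotvDr mulrDr expRD dotvZl /ey mulrA.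
have ig2 : Itg leb (fun w => expR (kappa * dotv theta (vadd y w)) * UR t s w).
  by rewrite (funext gE); exact: ItgZ.
have eg2 : RI leb (fun w => expR (kappa * dotv theta (vadd y w)) * UR t s w) = tilted s t theta y.
  by rewrite (RI_ext leb gE) (RIZ _ ig) eg /tilted expRD /ey; ring.
have mxz : measurable_fun setT (fun z : V => vsub x z) by mfun.
have mu2 := mf_comp2 mm mxz; have mU2 := mf_comp2 mU mxz.
have ic : Itg leb (fun z => mu s t z * UR t s (vsub x z)).
  apply: (@Itg_dom _ _ _ _ _ (fun z => RI leb (rhoR leb A nu t s) * mu s t z)); [by apply: mf_mul| |exact: ItgZ].
  move=> z; rewrite normrM (ger0_norm (m0 z)) (ger0_norm (U0 _)) mulrC ler_wpM2r//.
  by case/andP: (u0 (vsub x z)).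
have ic2 : Itg leb (fun w => mu s t (vsub x w) * UR t s w).
  by apply: (Itg_ext _ (Itg_refl Hleb x ic)) => w; rewrite vsub_vsub.
have ec : vconv leb (mu s t) (UR t s) x = RI leb (fun w => mu s t (vsub x w) * UR t s w).
  by rewrite /vconv -(RI_refl Hleb x ic); apply: RI_ext => w; rewrite vsub_vsub.
have itn := ItgZ (t * N) ig2.
rewrite ec -eg2 -(RIZ _ ig2) -(RIB ic2 itn).
have nuw w : nu (vsub x w) = N * nuratio nu r theta (vadd y w).
  by rewrite /nuratio -vsubA mulrCA (mulfV Nn) mulr1.
pose G w := inb rh w * (UR t s w * `|nuratio nu r theta (vadd y w) - expR (kappa * dotv theta (vadd y w))|).
have pw w : `|mu s t (vsub x w) * UR t s w - t * N * (expR (kappa * dotv theta (vadd y w)) * UR t s w)| <=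
   t * N * G w + t * N * D * (outb rh w * expR (- normv w)).
  have [hw|hw] := leP (normv w) rh.
    have -> : outb rh w = 0 by rewrite /outb ltNge hw.
    rewrite mul0r mulr0 addr0 /G (_ : inb rh w = 1); last by rewrite /inb hw.
    rewrite mul1r muE.
    have -> : outb s (vsub x w) = 1 by rewrite /outb hxs.
    rewrite mul1r nuw [X in `|X|](_ : _ = t * N * (UR t s w * (nuratio nu r theta (vadd y w) - expR (kappa * dotv theta (vadd y w))))); last by ring.
    by rewrite normrM (ger0_norm (ltW tN)) normrM (ger0_norm (U0 w)).
  have -> : outb rh w = 1 by rewrite /outb hw.
  rewrite /G (_ : inb rh w = 0); last by rewrite /inb leNgt hw.
  rewrite mul0r mulr0 add0r mul1r.
  exact: (far_pointwise (ltW tN) (k1 w) (k2 w) (U0 w) (Uw w hw)).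
have iR := ItgD (ItgZ (t * N) iS) (ItgZ (t * N * D) io).
have mD := Itg_meas (ItgB ic2 itn).
apply: (le_trans (RI_abs_le mD pw iR)).
rewrite (RID (ItgZ (t * N) iS) (ItgZ (t * N * D) io)) (RIZ _ iS) (RIZ _ io).
have -> : e * (t * N) = t * N * (e / 2) + t * N * (e / 2) by field.
rewrite -(mulrA (t * N) D).
by apply: lerD; apply: (ler_wpM2l (ltW tN)); [exact: bS|exact: bo].
Qed.

Lemma uniform_limit (e : R) : 0 < e -> exists r0 : R, forall r, r0 < r -> forall t theta y, S t theta y ->
  `|UF t (vsub (vscale r theta) y) / (t * nu (vscale r theta)) - Kd leb * target t theta y| <= e.
Proof.
move=> e0; have e4 : 0 < e / 4 by rewrite divr_gt0.
have [s1 [s11 h1]] := rest_small e4; have [s2 [s21 h2]] := tilted_small e4.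
pose s := Order.max s1 s2.
have ss1 : s1 <= s by rewrite le_max lexx.
have ss2 : s2 <= s by rewrite le_max lexx orbT.
have s_1 : 1 <= s := le_trans s11 ss1.
have sp : 0 < s by lra.
have [r1 hr1] := UR_far_small s_1 e4; have [r2 hr2] := one_jump_small s_1 e4.
exists (Order.max (vr + 1) (Order.max r1 r2)) => r; rewrite !gt_max => /and3P[k1 k2 k3] t theta y H.
have Tt := ST H; have Et := SE H; have t0 := T0 Tt.
have /andP[q0 q1] := hr1 r k2 t theta y H; have q2 := hr2 r k3 t theta y H.
have /andP[q3 q4] := h1 s ss1 r t theta y H k1; have q5 := h2 s ss2 t theta y H.
have v0 := vr0; have r0 : 0 < r by lra.
have N0 := nu_ray_gt0 f0 E1 C10 nuE r0 Et.
set N := nu _ in q1 q2 q4 N0 *; set x := vsub _ y in q0 q1 q2 q3 q4 *.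
have tN : 0 < t * N by rewrite mulr_gt0.
have tN0 : t * N != 0 by rewrite lt0r_neq0.
have L0 : 0 <= RI leb (mu s t) by rewrite (RI_mu _ sp) mulr_ge0 ?nuS_ge0// ltW.
have -> : e = e / 4 + e / 4 + e / 4 + e / 4 by field.
apply: (@combine_limits _ _ (UR t s x / (t * N)) (vconv leb (mu s t) (UR t s) x / (t * N)) (rest s t x / (t * N))
   (tilted s t theta y) _ (expR (- RI leb (mu s t)))).
- exact: expR_ge0.
- by rewrite -[X in _ <= X]expR0 ler_expR oppr_le0.
- have E2 : UR t s x + vconv leb (mu s t) (UR t s) x + rest s t x = expR (RI leb (mu s t)) * UF t x.
    by rewrite /rest /excess; ring.
  by rewrite -!mulrDl E2 !mulrA -expRD addNr expR0 mul1r.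
- by rewrite ger0_norm ?divr_ge0// ?(ltW tN)// ler_pdivrMr.
- have -> : vconv leb (mu s t) (UR t s) x / (t * N) - tilted s t theta y =
     (vconv leb (mu s t) (UR t s) x - t * N * tilted s t theta y) / (t * N).
    by rewrite [RHS]mulrBl [t * N * _]mulrC mulfK.
  by rewrite normrM (gtr0_norm (_ : 0 < (t * N)^-1)) ?invr_gt0// ler_pdivrMr.
- by rewrite ger0_norm ?divr_ge0// ?(ltW tN)// ler_pdivrMr.
- exact: q5.
Qed.

End uniform.
End limit.

(** * Pointwise and uniform limits, and the densities of the semigroup *)

Section conclusion.
Context (R : realType) (d : nat).
Local Notation V := (d.-tuple R).
Variable leb : {sigma_finite_measure set V -> \bar R}.
Hypothesis Hleb : is_lebesgue leb.
Hypothesis d0 : (0 < d)%N.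
Variables (b : V) (A : 'M[R]_d) (nu : V -> R).
Hypothesis sA : A^T = A.
Hypothesis pA : forall x, 0 <= quadA A x.
Hypothesis Hnu : levy_density leb nu.
Variables (T : set R) (M C : R).
Hypothesis T0 : forall t, T t -> 0 < t.
Hypothesis M0 : 0 <= M.
Hypothesis TM : forall t, T t -> t <= M.
Hypothesis C_gt0 : 0 < C.
Hypothesis irF : forall t, T t -> Itg leb (fun xi => rhoF leb A nu t xi * normv xi).
Hypothesis HI : forall t, T t -> exists h, intensity leb A nu t h C.
Variables (f : R -> R) (C0 C1 kappa : R) (E : set V).
Hypothesis f0 : forall r, 0 < r -> 0 < f r.
Hypothesis fd : forall r s, 0 < r -> r <= s -> f s <= f r.
Hypothesis f_low : exists c : R, exists delta : R, 0 < c /\ 0 < delta /\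
     forall r, 0 < r -> r < delta ->
       ((c * f r * r ^+ d)%:E <= \int[leb]_(x in [set x | (r < normv x)%R]) (nu x)%:E)%E.
Hypothesis K0 : Kfun leb f r @[r --> +oo] --> (0%R)%:E.
Hypothesis C00 : 0 < C0.
Hypothesis nuf : forall x, x <> vzero -> nu x <= C0 * f (normv x).
Hypothesis E1 : forall theta, E theta -> normv theta = 1.
Hypothesis k0 : 0 <= kappa.
Hypothesis Hratio : forall theta y, E theta ->
     nu (vsub (vscale r theta) y) / nu (vscale r theta) @[r --> +oo] --> expR (kappa * dotv theta y).
Hypothesis C10 : 0 < C1.
Hypothesis nuE : forall x, x <> vzero -> E (vscale (normv x)^-1 x) -> C1 * f (normv x) <= nu x.

Local Notation UR := (UR leb b A nu).
Local Notation UF := (UF leb b A nu).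
Local Notation discrepancy t s rh r theta y := (fun w =>
  inb rh w * (UR t s w * `|nuratio nu r theta (vadd y w) - expR (kappa * dotv theta (vadd y w))|)).

Lemma meas_discrepancy t s rh r theta y : T t -> 0 < s -> measurable_fun setT (discrepancy t s rh r theta y).
Proof.
move=> Tt sp; have t0 := T0 Tt; have mb := @minb R d rh.
have mU := mUR Hleb d0 b sA pA Hnu (ltW t0) sp.
have mr := @mnuratio _ _ leb nu Hnu r theta (fun w => vadd y w) ltac:(mfun).
by apply: mf_mul => //; apply: mf_mul => //; apply: mf_abs; apply: mf_add => //; mfun.
Qed.

Lemma discrepancy_ge0 t s rh r theta y w : T t -> 0 < s -> 0 <= discrepancy t s rh r theta y w.
Proof.
move=> Tt sp; have U0 := UR_ge0 Hleb d0 b sA pA Hnu (ltW (T0 Tt)) (irF Tt) sp w.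
by apply: mulr_ge0 => //; exact: mulr_ge0.
Qed.

(** Dominated convergence is available along sequences, the radius r is real: a failure would give
    radii tending to infinity along which the integrals stay above e. *)
Lemma discrepancy_pointwise t theta y (s rh e : R) : T t -> E theta -> 1 <= s -> 0 < rh -> 0 < e ->
  exists r0 : R, forall r, r0 < r ->
  Itg leb (discrepancy t s rh r theta y) /\ RI leb (discrepancy t s rh r theta y) <= e.
Proof.
move=> Tt Et s1 rhp e0; have t0 := T0 Tt; have sp : 0 < s := lt_le_trans ltr01 s1.
pose vr := normv y; have vr0 : 0 <= vr := normv_ge0 y.
have [L [c [L0 c0 rb]]] := ray_bounds Hleb d0 f0 fd K0 C00 nuf E1 C10 nuE vr0.
pose rr := vr + rh + 2.
pose D := c * expR (L * rh) + expR (kappa * (vr + rh)).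
have [iu _] := UR_mass Hleb d0 b sA pA Hnu (ltW t0) (irF Tt) sp.
have dom r w : rr < r -> discrepancy t s rh r theta y w <= D * UR t s w.
  move=> hr; have U0 := UR_ge0 Hleb d0 b sA pA Hnu (ltW t0) (irF Tt) sp w.
  have D0 : 0 <= D by rewrite addr_ge0 ?mulr_ge0 ?expR_ge0.
  rewrite /inb; have [hw|hw] := leP (normv w) rh; last by rewrite mul0r mulr_ge0.
  rewrite mul1r mulrC ler_wpM2r//.
  have hr' : vr + 1 < r by rewrite /rr in hr; lra.
  have [N0 _ nux _] := rb r theta y Et (lexx _) hr'.
  have r0 : 0 <= r by lra.
  have n1 : 1 <= normv (vsub (vsub (vscale r theta) y) w).
    have := normvB_ge (vscale r theta) y; rewrite (normv_ray E1 r0 Et) -/vr.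
    by have := normvB_ge (vsub (vscale r theta) y) w; rewrite /rr in hr; lra.
  apply: (le_trans (ler_normB _ _)); apply: lerD.
    rewrite ger0_norm; last exact: (nuratio_ge0 Hnu).
    rewrite /nuratio -vsubA ler_pdivrMr//; apply: (le_trans (nux w n1)).
    by rewrite ler_wpM2r ?(ltW N0)// ler_wpM2l// ler_expR ler_wpM2l.
  rewrite ger0_norm ?expR_ge0// ler_expR ler_wpM2l// (le_trans (dotv_le _ _))// (E1 Et) mul1r.
  by rewrite (le_trans (normvD _ _))// lerD2l.
have iD r : rr < r -> Itg leb (discrepancy t s rh r theta y).
  move=> hr; apply: (Itg_dom (meas_discrepancy rh r theta y Tt sp) _ (ItgZ D iu)) => w.
  by rewrite ger0_norm ?dom//; exact: discrepancy_ge0.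
apply: contrapT => /forallNP nH.
(* Beyond rr integrability is already known, so a failure concerns the value of the integral. *)
have ex n : exists r : R, Order.max rr n%:R < r /\ e < RI leb (discrepancy t s rh r theta y).
  have /existsNP[r /not_implyP[hr /not_andP h]] := nH (Order.max rr n%:R); exists r; split=> //.
  case: h => [h|/negP]; last by rewrite -ltNge.
  by exfalso; apply: h; apply: iD; move: hr; rewrite gt_max => /andP[].
have [u hu] := choice ex.
have hr n : rr < u n by have [+ _] := hu n; rewrite gt_max => /andP[].
have hn n : n%:R < u n by have [+ _] := hu n; rewrite gt_max => /andP[].
have cu : u n @[n --> \oo] --> +oo.
  apply/cvgryPge => a; have := @cvgr_idn R => /cvgryPge/(_ a); apply: filterS => n /le_trans; apply.
  exact: ltW.
have [||||_ h] // := @RI_dct _ _ _ leb (fun n => discrepancy t s rh (u n) theta y) (fun=> 0) (fun w => D * UR t s w).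
- by move=> n; exact: meas_discrepancy.
- by move=> n w; rewrite ger0_norm ?dom//; exact: discrepancy_ge0.
- exact: ItgZ.
- move=> w; rewrite -[X in _ --> X](mulr0 (inb rh w)) -[X in inb rh w * X](mulr0 (UR t s w)).
  apply: cvgM; first exact: cvg_cst.
  apply: cvgM; first exact: cvg_cst.
  have -> : nbhs (0 : R) = nbhs `|expR (kappa * dotv theta (vadd y w)) - expR (kappa * dotv theta (vadd y w))|.
    by rewrite subrr normr0.
  apply: cvg_norm; apply: cvgB; last exact: cvg_cst.
  by have /cvg_pinftyP/(_ u cu) := @Hratio theta (vadd y w) Et.
rewrite RI0 in h.
have [N _ hN] := cvgr0_norm_lt (fun n => RI leb (discrepancy t s rh (u n) theta y)) h _ e0.
have := hN N (leqnn N); rewrite /= ltNge => /negP; apply.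
by apply: ltW; apply: lt_le_trans (ler_norm _); case: (hu N).
Qed.

Lemma limit_point (t : R) (theta y : V) (e : R) : T t -> E theta -> 0 < e ->
  exists r0 : R, forall r, r0 < r ->
  `|UF t (vsub (vscale r theta) y) / (t * nu (vscale r theta)) - Kd leb * target leb b A nu kappa t theta y| <= e.
Proof.
move=> Tt Et e0.
pose S t' theta' y' := [/\ t' = t, theta' = theta & y' = y].
have [||||r0 hr0] := @uniform_limit _ _ leb Hleb d0 b A nu sA pA Hnu T M C T0 M0 TM C_gt0 irF HI f C0 C1 kappa E
   f0 fd f_low K0 C00 nuf E1 k0 Hratio C10 nuE S (normv y) (normv_ge0 y) _ _ _ _ e e0.
- by move=> t' theta' y' [-> _ _].
- by move=> t' theta' y' [_ -> _].
- by move=> t' theta' y' [_ _ ->].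
- move=> s rh e' s1 rhp e'0; have [r0 hr0] := discrepancy_pointwise y Tt Et s1 rhp e'0.
  by exists r0 => r hr t' theta' y' [-> -> ->]; exact: hr0.
by exists r0 => r hr; apply: hr0.
Qed.

Lemma compactV_box (K : R) : compactV [set z : V | forall i, - K <= tnth z i <= K].
Proof.
rewrite /compactV (_ : _ @` _ = [set v : 'rV[R]_d | forall i, `[- K, K]%classic (v ord0 i)]).
  by apply: (@rV_compact R d (fun=> `[- K, K]%classic)) => i; exact: segment_compact.
apply/seteqP; split => [v [z hz <-] i|v hv] /=; first by rewrite mxE in_itv; exact: hz.
exists (tuple_of_rv v); last by apply/rowP => i; rewrite mxE tnth_mktuple.
by move=> i; rewrite tnth_mktuple; have := hv i; rewrite /= in_itv.
Qed.

Lemma limit_uniform (vr : R) : 0 <= vr ->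
  (forall D, compactV D -> forall eps : R, 0 < eps -> exists M : R,
       forall r, M < r -> forall theta y, E theta -> D y ->
         `| nu (vsub (vscale r theta) y) / nu (vscale r theta) - expR (kappa * dotv theta y) | < eps) ->
  forall e : R, 0 < e -> exists r0 : R, forall r, r0 < r -> forall t theta y, T t -> E theta -> normv y <= vr ->
  `|UF t (vsub (vscale r theta) y) / (t * nu (vscale r theta)) - Kd leb * target leb b A nu kappa t theta y| <= e.
Proof.
move=> vr0 HU e e0.
pose S t theta (y : V) := [/\ T t, E theta & normv y <= vr].
have [||||r0 hr0] := @uniform_limit _ _ leb Hleb d0 b A nu sA pA Hnu T M C T0 M0 TM C_gt0 irF HI f C0 C1 kappa E
   f0 fd f_low K0 C00 nuf E1 k0 Hratio C10 nuE S vr vr0 _ _ _ _ e e0.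
- by move=> t' theta' y' [].
- by move=> t' theta' y' [].
- by move=> t' theta' y' [].
- move=> s rh e' s1 rhp e'0; have sp : 0 < s := lt_le_trans ltr01 s1.
  have [k [kp hk]] := exists_small (ltW (Kd_gt0 Hleb)) e'0.
  (* With |y| <= vr and |w| <= rh, the argument y + w stays in this cube. *)
  have [r0 hr0] := HU _ (@compactV_box (vr + rh)) k kp.
  exists r0 => r hr t theta y [Tt Et hy]; have t0 := T0 Tt.
  have [iu eu] := UR_mass Hleb d0 b sA pA Hnu (ltW t0) (irF Tt) sp.
  have dom w : discrepancy t s rh r theta y w <= k * UR t s w.
    have U0 := UR_ge0 Hleb d0 b sA pA Hnu (ltW t0) (irF Tt) sp w.
    rewrite /inb; have [hw|hw] := leP (normv w) rh; last by rewrite mul0r mulr_ge0// ltW.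
    rewrite mul1r mulrC ler_wpM2r//; apply: ltW; apply: hr0 => // i.
    have h : `|tnth (vadd y w) i| <= vr + rh.
      by apply: (le_trans (coord_le_normv _ _)); apply: (le_trans (normvD _ _)); exact: lerD.
    by move: h; rewrite ler_norml.
  have iD : Itg leb (discrepancy t s rh r theta y).
    apply: (Itg_dom (meas_discrepancy rh r theta y Tt sp) _ (ItgZ k iu)) => w.
    by rewrite ger0_norm ?dom//; exact: discrepancy_ge0.
  split=> //; apply: (le_trans (RI_le iD (ItgZ k iu) dom)).
  by rewrite (RIZ k iu) eu mulrC.
by exists r0 => r hr t theta y Tt Et hy; apply: hr0.
Qed.

(** For kappa = 0 the exponent vanishes, as psi~ (0) = 0. *)
Lemma limit_valE t theta y : limit_val leb b A nu kappa t theta y = target leb b A nu kappa t theta y.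
Proof.
rewrite /limit_val /target; have [->|//] := eqVneq kappa 0.
have z : vscale 0 theta = vzero by apply: eq_from_tnth => i; rewrite !tnthE mul0r.
rewrite z mul0r addr0 (_ : psitilde leb b A nu vzero = 0) ?mulr0 ?oppr0 ?expR0//.
rewrite /psitilde dotv0l (_ : quadA A vzero = 0); last first.
  by rewrite /quadA big1// => i _; rewrite big1// => j _; rewrite tnthE !mul0r.
rewrite (RI_ext leb (v := fun=> 0)) ?RI0 ?oppr0 ?addr0//.
by move=> w; rewrite dotv0l expR0 subrr mul0r addr0 mul0r.
Qed.

Variable P : R -> probability V R.
Hypothesis HP : forall t, 0 <= t -> has_charfun (P t) t leb b A nu.

Lemma exists_density t : T t -> cont_density leb (P t) (fun x => UF t x / Kd leb).
Proof.
move=> Tt; have t0 := T0 Tt; have hc := HP (ltW t0).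
have [i1 _] := Itg_rhoF Hleb pA Hnu (ltW t0) (irF Tt).
have [F0 [iF _]] := UF_mass Hleb d0 b sA pA Hnu (ltW t0) (irF Tt) ltr01.
apply: (density_of_charfun Hleb d0 (mthF b Hnu t) _ i1 (irF Tt)) => //.
- by move=> xi; exact: expR_ge0.
- by move=> xi; have [-> _] := hc xi; rewrite /thF cosN.
- by move=> xi; have [_ ->] := hc xi; rewrite /thF sinN mulrN.
Qed.

Lemma scaled_dist (p q g e : R) : `|p / q - Kd leb * g| <= Kd leb * e -> `|p / Kd leb / q - g| <= e.
Proof.
have Kp := Kd_gt0 Hleb; have Kn := lt0r_neq0 Kp.
have -> : p / Kd leb / q - g = (p / q - Kd leb * g) / Kd leb.
  by rewrite mulrBl mulrAC [Kd leb * g]mulrC mulfK.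
by rewrite normrM (gtr0_norm (_ : 0 < (Kd leb)^-1)) ?invr_gt0// ler_pdivrMr// [e * _]mulrC.
Qed.

Lemma spatial_asymptotics :
  ((forall t, T t -> exists p, cont_density leb (P t) p) /\
   (0 < kappa -> forall theta, E theta ->
      (\int[leb]_(y in [set y | (1 < normv y)%R]) (expR (kappa * dotv theta y) * nu y)%:E
         < +oo)%E) /\
   (forall t theta y p, T t -> E theta -> cont_density leb (P t) p ->
      p (vsub (vscale r theta) y) / (t * nu (vscale r theta)) @[r --> +oo]
        --> limit_val leb b A nu kappa t theta y))
  /\
  ((forall D, compactV D -> forall eps : R, 0 < eps -> exists M : R,
       forall r, M < r -> forall theta y, E theta -> D y ->
         `| nu (vsub (vscale r theta) y) / nu (vscale r theta)
            - expR (kappa * dotv theta y) | < eps) ->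
   forall p : R -> d.-tuple R -> R,
     (forall t, T t -> cont_density leb (P t) (p t)) ->
     forall rho : R, 0 < rho -> forall eps : R, 0 < eps -> exists M : R,
       forall r, M < r -> forall t theta y, T t -> E theta -> normv y < rho ->
         `| p t (vsub (vscale r theta) y) / (t * nu (vscale r theta))
            - limit_val leb b A nu kappa t theta y | < eps).
Proof.
have Kp := Kd_gt0 Hleb.
(* The limits are asserted for any continuous density; this reduces them to the Fourier integral. *)
have uniq t p : T t -> cont_density leb (P t) p -> p = (fun x => UF t x / Kd leb).
  by move=> Tt hp; apply: (cont_density_unique Hleb hp (exists_density Tt)).
split; [split; [|split]|].
- by move=> t Tt; exists (fun x => UF t x / Kd leb); exact: exists_density.
- move=> _ theta Et.
  have i := Itg_levy_tilt Hnu f0 fd K0 C00 nuf E1 k0 Hratio C10 nuE Et ltr01.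
  rewrite [X in (X < _)%E](_ : _ = (RI leb (fun w => outb 1 w * expR (kappa * dotv theta w) * nu w))%:E) ?ltry//.
  rewrite -(RI_E i) [LHS]integral_mkcond; apply: eq_integral => w _; rewrite patchE /outb.
  case: (boolP (w \in _)) => [/set_mem/= ->|/negP hw]; first by rewrite mul1r.
  by have [h1|h1] := ltP 1 (normv w); [exfalso; apply: hw; apply/mem_set|rewrite !mul0r].
- move=> t theta y p Tt Et /(uniq t p Tt) ->; rewrite limit_valE.
  apply/cvgrPdist_le => e e0.
  have [r0 hr0] := limit_point y Tt Et (mulr_gt0 Kp e0).
  exists r0; split; first exact: num_real.
  by move=> r /= hr; rewrite distrC; apply: scaled_dist; exact: hr0.
- move=> HU p hp rho rho0 e e0.
  have e2 : 0 < e / 2 by rewrite divr_gt0.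
  have [r0 hr0] := limit_uniform (ltW rho0) HU (mulr_gt0 Kp e2).
  exists r0 => r hr t theta y Tt Et hy; rewrite limit_valE (uniq t (p t) Tt (hp t Tt)).
  apply: (@le_lt_trans _ _ (e / 2)); last by lra.
  by apply: scaled_dist; apply: hr0 => //; exact: ltW.
Qed.

End conclusion.

Theorem theorem1 (R : realType) (d : nat)
    (leb : {measure set (d.-tuple R) -> \bar R})
    (b : d.-tuple R) (A : 'M[R]_d) (nu : d.-tuple R -> R)
    (P : R -> probability (d.-tuple R) R)
    (f : R -> R) (C0 : R) (E : set (d.-tuple R)) (kappa : R)
    (T : set R) (C2 : R) :
  (0 < d)%N ->
  is_lebesgue leb ->
  (* Levy triplet (b, A, nu) and the convolution semigroup P *)
  A^T = A -> (forall xi, 0 <= quadA A xi) ->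
  levy_density leb nu ->
  (forall t, 0 <= t -> has_charfun (P t) t leb b A nu) ->
  (* (A) *)
  (A = 0 \/ exists c : R, 0 < c /\ forall xi, normv xi = 1 -> c <= quadA A xi) ->
  (* (B) *)
  (forall r, 0 < r -> 0 < f r) ->
  (forall r s, 0 < r -> r <= s -> f s <= f r) ->
  0 < C0 ->
  (forall x, x <> vzero -> nu x <= C0 * f (normv x)) ->
  (exists c : R, exists delta : R, 0 < c /\ 0 < delta /\
     forall r, 0 < r -> r < delta ->
       ((c * f r * r ^+ d)%:E <= \int[leb]_(x in [set x | (r < normv x)%R]) (nu x)%:E)%E) ->
  (forall r s, 0 < r -> r <= s -> (Kfun leb f s <= Kfun leb f r)%E) ->
  Kfun leb f r @[r --> +oo] --> (0%R)%:E ->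
  (* (C) *)
  (forall theta, E theta -> normv theta = 1) ->
  0 <= kappa ->
  (forall theta y, E theta ->
     nu (vsub (vscale r theta) y) / nu (vscale r theta) @[r --> +oo]
       --> expR (kappa * dotv theta y)) ->
  (exists C1 : R, 0 < C1 /\ forall x, x <> vzero -> E (vscale (normv x)^-1 x) ->
       C1 * f (normv x) <= nu x) ->
  (* (D) *)
  (T `<=` [set t | 0 < t]) -> (exists t, T t) -> (exists M : R, forall t, T t -> t <= M) ->
  0 < C2 ->
  (forall t, T t ->
     ((t^-1)%:E < Psi_inf leb nu)%E /\
     (\int[leb]_xi (expR (- (t * RePhi leb nu xi)) * normv xi)%:E
        <= (C2 * Psi_minus leb nu t^-1 ^+ d.+1)%:E)%E) ->
  (* conclusion (a) *)
  ((forall t, T t -> exists p, cont_density leb (P t) p) /\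
   (0 < kappa -> forall theta, E theta ->
      (\int[leb]_(y in [set y | (1 < normv y)%R]) (expR (kappa * dotv theta y) * nu y)%:E
         < +oo)%E) /\
   (forall t theta y p, T t -> E theta -> cont_density leb (P t) p ->
      p (vsub (vscale r theta) y) / (t * nu (vscale r theta)) @[r --> +oo]
        --> limit_val leb b A nu kappa t theta y))
  /\
  (* conclusion (b) *)
  ((forall D, compactV D -> forall eps : R, 0 < eps -> exists M : R,
       forall r, M < r -> forall theta y, E theta -> D y ->
         `| nu (vsub (vscale r theta) y) / nu (vscale r theta)
            - expR (kappa * dotv theta y) | < eps) ->
   forall p : R -> d.-tuple R -> R,
     (forall t, T t -> cont_density leb (P t) (p t)) ->
     forall rho : R, 0 < rho -> forall eps : R, 0 < eps -> exists M : R,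
       forall r, M < r -> forall t theta y, T t -> E theta -> normv y < rho ->
         `| p t (vsub (vscale r theta) y) / (t * nu (vscale r theta))
            - limit_val leb b A nu kappa t theta y | < eps).
Proof.
(* From here on the measure carries its sigma-finite structure, as the sections above require. *)
move=> d0 Hleb; have [leb' e] := exists_sigma_finite Hleb; subst leb.
move=> sA pA Hnu HP HA f0 fd C00 nuf f_low _ K0 E1 k0 Hr [C1 [C10 nuE]] T0 [t1 Tt1] [M TM] C20 TD.
have M0 : 0 <= M := le_trans (ltW (T0 _ Tt1)) (TM _ Tt1).
have TD' t : T t -> (\int[leb']_xi (expR (- (t * RePhi leb' nu xi)) * normv xi)%:E
        <= (C2 * Psi_minus leb' nu t^-1 ^+ d.+1)%:E)%E by move=> /TD[].
have irF t (Tt : T t) := proj1 (Itg_rhoF_normv pA Hnu T0 TD' Tt).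
have [C [C_gt0 HI]] : exists C : R, 0 < C /\ forall t, T t -> exists h, intensity leb' A nu t h C.
  (* The dichotomy (A) decides the length scale: that of the jumps when there is no Gaussian part,
     the diffusive one otherwise. *)
  case: HA => [A0|[c [c0 hc]]].
    apply: (exists_scale_jump Hleb d0 pA Hnu T0 TM C20 TD') => x.
    by rewrite A0 /quadA big1// => i _; rewrite big1// => j _; rewrite mxE mulr0 mul0r.
  exact: (exists_scale_gauss Hleb sA pA Hnu T0 TM TD' c0 hc).
exact: (@spatial_asymptotics R d leb' Hleb d0 b A nu sA pA Hnu T M C T0 M0 TM C_gt0 irF HI
  f C0 C1 kappa E f0 fd f_low K0 C00 nuf E1 k0 Hr C10 nuE P HP).
Qed.
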